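(* Let $\Bbbk$ be an algebraically closed field of characteristic $0$, let $\mathcal{M}=[H/G]$ be a quotient stack over $\Bbbk$, where $H$ is a scheme of finite type over $\Bbbk$ and $G$ is a linear algebraic $\Bbbk$-group acting on $H$, and let $\mathcal{Z}^+$ be a higher $\Theta$-stratum in $\mathcal{M}$ of type $\tau$, where $\tau\subset N\otimes\mathbb{R}$ is a regular rational polyhedral cone; regard $\mathcal{Z}^+$ as a closed substack of $\mathcal{M}$ via evaluation at the identity. Let $f\colon \mathrm{Spec}\,\Bbbk[[t]]\to\mathcal{M}$ be any $\Bbbk$-morphism which maps the closed point into $\mathcal{Z}^+$ and the generic point outside $\mathcal{Z}^+$, and let $f^o$ be the restriction of $f$ to $\mathrm{Spec}\,\Bbbk((t))$. Then there exist $d\in\mathbb{Z}_{>0}$ and a $\Bbbk$-morphism $$f_{\rm new}\colon \mathrm{Spec}\,\Bbbk[[t^{1/d}]]\to\mathcal{M}$$ which extends the base change of $f^o$ to $\Bbbk((t^{1/d}))$ and which sends the closed point of $\mathrm{Spec}\,\Bbbk[[t^{1/d}]]$ outside $\mathcal{Z}^+$.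
   Context: Let $N$ be a free abelian group of finite rank $r$, $M=\mathrm{Hom}(N,\mathbb{Z})$, and $T=\mathbb{G}_m\otimes_{\mathbb{Z}}N=\mathrm{Spec}\,\Bbbk[M]$. Let $\tau\subset N_{\mathbb{R}}=N\otimes\mathbb{R}$ be a strictly convex, full-dimensional, regular rational polyhedral cone (regular: generated by a $\mathbb{Z}$-basis of $N$; regularity of cones is assumed throughout). Let $U_\tau=\mathrm{Spec}\,\Bbbk[\tau^\vee\cap M]\supset T$ be the associated affine toric variety, and $\Theta_\tau:=[U_\tau/T]$. Higher $\Theta$-stratum: for an algebraic stack $\mathcal{M}$ over $\Bbbk$, let $\mathrm{Map}(\Theta_\tau,\mathcal{M})$ be the mapping stack. A higher $\Theta$-stratum of type $\tau$ and rank $r$ in $\mathcal{M}$ is a union of connected components $\mathcal{Z}^+\subset\mathrm{Map}(\Theta_\tau,\mathcal{M})$ such that the evaluation morphism $\mathrm{ev}_{(1,\dots,1)}\colon\mathcal{Z}^+\to\mathcal{M}$ at the identity $(1,\dots,1)\in T\subset U_\tau$ is a closed embedding. One identifies $\mathcal{Z}^+$ with its image in $\mathcal{M}$; ''in/outside $\mathcal{Z}^+$'' refers to this closed substack. The rank $r$ need not be the rank of $G$. *)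

(* Defs.v *)
From Stdlib Require List.
From HB Require Import structures.
From mathcomp Require Import all_boot all_order all_algebra.
From mathcomp Require Import boolp classical_sets reals.
From mathcomp Require Import topology.

Set Implicit Arguments.
Unset Strict Implicit.
Unset Printing Implicit Defensive.
Import GRing.Theory Num.Theory.
Local Open Scope ring_scope.
Local Open Scope classical_set_scope.

(* Commutative algebras. The zero ring has to be allowed (Spec 0 is empty), so
   MathComp's comAlgType, whose elements are nontrivial rings, is unsuitable. *)
Record alg (k : comPzRingType) := Alg {
  alg_car :> comPzRingType;
  alg_str : {rmorphism k -> alg_car}
}.

Record hom (k : comPzRingType) (A B : alg k) := Hom {
  hom_fun :> {rmorphism A -> B};
  homE : forall c, hom_fun (alg_str A c) = alg_str B c
}.

Lemma rmorph_ext (A B : pzRingType) (f g : {rmorphism A -> B}) :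
  f =1 g -> f = g.
Proof.
case: f g => [f cf] [g cg] /= /funext fg; subst g.
suff -> : cf = cg by [].
case: cf cg => [[a] [b]] [[c] [d]].
by rewrite (Prop_irrelevance a c) (Prop_irrelevance b d).
Qed.

Lemma hom_ext (k : comPzRingType) (A B : alg k) (f g : hom A B) :
  f =1 g -> f = g.
Proof.
case: f g => [f ef] [g eg] /= /rmorph_ext fg; subst g.
by rewrite (Prop_irrelevance ef eg).
Qed.

Section HomOps.
Variable k : comPzRingType.

Definition hid (A : alg k) : hom A A := @Hom k A A idfun (fun=> erefl).

Lemma hcomp_subproof (A B C : alg k) (g : hom B C) (f : hom A B) c :
  (g \o f) (alg_str A c) = alg_str C c.
Proof. by rewrite /= !homE. Qed.

Definition hcomp (A B C : alg k) (g : hom B C) (f : hom A B) : hom A C :=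
  @Hom k A C (g \o f) (hcomp_subproof g f).

Lemma hcompA (A B C D : alg k) (h : hom C D) (g : hom B C) (f : hom A B) :
  hcomp h (hcomp g f) = hcomp (hcomp h g) f.
Proof. exact: hom_ext. Qed.

Lemma hcomp1f (A B : alg k) (f : hom A B) : hcomp (hid B) f = f.
Proof. exact: hom_ext. Qed.

Lemma hcompf1 (A B : alg k) (f : hom A B) : hcomp f (hid A) = f.
Proof. exact: hom_ext. Qed.

Definition self_alg : alg k := @Alg k k idfun.

Definition restr (A : alg k) (B : alg A) : alg k :=
  @Alg k B (alg_str B \o alg_str A).

Lemma restr_str_subproof (A : alg k) (B : alg A) c :
  alg_str B (alg_str A c) = alg_str (restr B) c.
Proof. by []. Qed.

Definition restr_str (A : alg k) (B : alg A) : hom A (restr B) :=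
  @Hom k A (restr B) (alg_str B) (@restr_str_subproof A B).

Definition along (A C : alg k) (f : hom A C) : alg A := @Alg A C f.

Lemma restr_hom_subproof (A C : alg k) (f : hom A C) (B : alg A)
  (h : hom B (along f)) c : h (alg_str (restr B) c) = alg_str C c.
Proof. by rewrite /= homE /= homE. Qed.

Definition restr_hom (A C : alg k) (f : hom A C) (B : alg A)
    (h : hom B (along f)) : hom (restr B) C :=
  @Hom k (restr B) C h (restr_hom_subproof h).

End HomOps.

(* The R-algebra with generators X and relations rel: terms modulo equality in
   all R-algebras that satisfy the relations. *)
Inductive term (R X : Type) :=
  | tvar of X
  | tcst of R
  | tadd of term R X & term R X
  | tmul of term R X & term R X.
Arguments tvar {R X}.
Arguments tcst {R X}.

Fixpoint teval (R : comPzRingType) (X : Type) (C : alg R) (x : X -> C)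
    (t : term R X) : C :=
  match t with
  | tvar i => x i
  | tcst c => alg_str C c
  | tadd t1 t2 => teval x t1 + teval x t2
  | tmul t1 t2 => teval x t1 * teval x t2
  end.

Definition satisfies (R : comPzRingType) (X : Type)
    (rel : term R X -> term R X -> Prop) (C : alg R) (x : X -> C) :=
  forall t t', rel t t' -> teval x t = teval x t'.

Section Presented.
Variables (R : comPzRingType) (X : Type) (rel : term R X -> term R X -> Prop).

Definition tequiv (t t' : term R X) : Prop :=
  forall (C : alg R) (x : X -> C), satisfies rel x -> teval x t = teval x t'.

Definition pres_car : Type := {P : term R X -> Prop | exists t, P = tequiv t}.
HB.instance Definition _ := gen_eqMixin pres_car.
HB.instance Definition _ := gen_choiceMixin pres_car.

Definition pres_pi (t : term R X) : pres_car :=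
  exist _ (tequiv t) (ex_intro _ t erefl).

Definition pres_repr (p : pres_car) : term R X := projT1 (cid (projT2 p)).

Definition pres_ev (C : alg R) (x : X -> C) (p : pres_car) : C :=
  teval x (pres_repr p).

Lemma pres_reprK p : pres_pi (pres_repr p) = p.
Proof.
case: p => P HP; rewrite /pres_pi /pres_repr /=.
by case: cid => t /= e; apply: eq_exist; rewrite e.
Qed.

Lemma pres_piP t t' : pres_pi t = pres_pi t' <-> tequiv t t'.
Proof.
split=> [/(congr1 sval) /= e|tt'].
  have : tequiv t' t' by [].
  by rewrite -e.
apply: eq_exist; apply/funext => s; apply/propext; split=> H C x sx.
  by rewrite -(tt' C x sx) (H C x sx).
by rewrite (tt' C x sx) (H C x sx).
Qed.

Lemma pres_ev_pi (C : alg R) (x : X -> C) t :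
  satisfies rel x -> pres_ev x (pres_pi t) = teval x t.
Proof. by move=> sx; have /pres_piP := pres_reprK (pres_pi t); apply. Qed.

Lemma pres_sep p q :
  (forall (C : alg R) (x : X -> C), satisfies rel x ->
     pres_ev x p = pres_ev x q) -> p = q.
Proof.
by move=> H; rewrite -(pres_reprK p) -(pres_reprK q); apply/pres_piP.
Qed.

Definition pres_zero := pres_pi (tcst 0).
Definition pres_one := pres_pi (tcst 1).
Definition pres_add p q := pres_pi (tadd (pres_repr p) (pres_repr q)).
Definition pres_mul p q := pres_pi (tmul (pres_repr p) (pres_repr q)).
Definition pres_opp p := pres_pi (tmul (tcst (-1)) (pres_repr p)).

Section Ev.
Variables (C : alg R) (x : X -> C) (sx : satisfies rel x).
Lemma pres_ev0 : pres_ev x pres_zero = 0.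
Proof. by rewrite pres_ev_pi //= rmorph0. Qed.
Lemma pres_ev1 : pres_ev x pres_one = 1.
Proof. by rewrite pres_ev_pi //= rmorph1. Qed.
Lemma pres_evD p q : pres_ev x (pres_add p q) = pres_ev x p + pres_ev x q.
Proof. by rewrite pres_ev_pi. Qed.
Lemma pres_evM p q : pres_ev x (pres_mul p q) = pres_ev x p * pres_ev x q.
Proof. by rewrite pres_ev_pi. Qed.
Lemma pres_evN p : pres_ev x (pres_opp p) = - pres_ev x p.
Proof. by rewrite pres_ev_pi //= rmorphN1 mulN1r. Qed.
End Ev.

Lemma pres_addA : associative pres_add.
Proof.
move=> p q s; apply: pres_sep => C x sx.
by rewrite !pres_evD // addrA.
Qed.
Lemma pres_addC : commutative pres_add.
Proof.
move=> p q; apply: pres_sep => C x sx.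
by rewrite !pres_evD // addrC.
Qed.
Lemma pres_add0 : left_id pres_zero pres_add.
Proof.
move=> p; apply: pres_sep => C x sx.
by rewrite pres_evD // pres_ev0 // add0r.
Qed.
Lemma pres_addN : left_inverse pres_zero pres_opp pres_add.
Proof.
move=> p; apply: pres_sep => C x sx.
by rewrite pres_evD // pres_ev0 // pres_evN // addNr.
Qed.
Lemma pres_mulA : associative pres_mul.
Proof.
move=> p q s; apply: pres_sep => C x sx.
by rewrite !pres_evM // mulrA.
Qed.
Lemma pres_mulC : commutative pres_mul.
Proof.
move=> p q; apply: pres_sep => C x sx.
by rewrite !pres_evM // mulrC.
Qed.
Lemma pres_mul1 : left_id pres_one pres_mul.
Proof.
move=> p; apply: pres_sep => C x sx.
by rewrite pres_evM // pres_ev1 // mul1r.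
Qed.
Lemma pres_mulD : left_distributive pres_mul pres_add.
Proof.
move=> p q s; apply: pres_sep => C x sx.
by rewrite !(pres_evM, pres_evD) // mulrDl.
Qed.

HB.instance Definition _ :=
  GRing.isZmodule.Build pres_car pres_addA pres_addC pres_add0 pres_addN.
HB.instance Definition _ :=
  GRing.Zmodule_isComPzRing.Build pres_car pres_mulA pres_mulC
    pres_mul1 pres_mulD.

Definition pres_str (c : R) : pres_car := pres_pi (tcst c).

Lemma pres_str_nmod : nmod_morphism pres_str.
Proof.
split=> // c d; apply: pres_sep => C x sx.
by rewrite pres_evD // !pres_ev_pi //= rmorphD.
Qed.
Lemma pres_str_monoid : monoid_morphism pres_str.
Proof.
split=> // c d; apply: pres_sep => C x sx.
by rewrite pres_evM // !pres_ev_pi //= rmorphM.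
Qed.
HB.instance Definition _ :=
  GRing.isNmodMorphism.Build R pres_car pres_str pres_str_nmod.
HB.instance Definition _ :=
  GRing.isMonoidMorphism.Build R pres_car pres_str pres_str_monoid.

Definition pres : alg R := @Alg R pres_car pres_str.

Definition pres_gen (i : X) : pres := pres_pi (tvar i).

Lemma teval_gen t : teval pres_gen t = pres_pi t.
Proof.
elim: t => [i|c|t IHt s IHs|t IHt s IHs] //=; rewrite IHt IHs;
    apply: pres_sep => C x sx.
  by rewrite (pres_evD sx) !pres_ev_pi.
by rewrite (pres_evM sx) !pres_ev_pi.
Qed.

Lemma pres_gen_sat : satisfies rel pres_gen.
Proof.
move=> t t' tt'; rewrite !teval_gen.
by apply/pres_piP => C x; apply.
Qed.

Section Lift.
Variables (C : alg R) (x : X -> C) (sx : satisfies rel x).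

Lemma pres_lift_nmod : nmod_morphism (pres_ev x : pres -> C).
Proof. by split=> [|p q]; [exact: pres_ev0 | exact: pres_evD]. Qed.
Lemma pres_lift_monoid : monoid_morphism (pres_ev x : pres -> C).
Proof. by split=> [|p q]; [exact: pres_ev1 | exact: pres_evM]. Qed.

Definition pres_lift_rmorph : {rmorphism pres -> C} :=
  GRing.RMorphism.Pack (GRing.RMorphism.Class
    (GRing.isNmodMorphism.Build pres C (pres_ev x) pres_lift_nmod)
    (GRing.isMonoidMorphism.Build pres C (pres_ev x) pres_lift_monoid)).

Lemma pres_lift_subproof c : pres_lift_rmorph (alg_str pres c) = alg_str C c.
Proof. exact: pres_ev_pi. Qed.

Definition pres_lift : hom pres C := Hom pres_lift_subproof.

Lemma pres_lift_gen i : pres_lift (pres_gen i) = x i.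
Proof. exact: pres_ev_pi. Qed.
End Lift.

Lemma pres_ext (C : alg R) (f g : hom pres C) :
  (forall i, f (pres_gen i) = g (pres_gen i)) -> f = g.
Proof.
move=> fg; apply: hom_ext => p; rewrite -(pres_reprK p) -teval_gen.
elim: (pres_repr p) => [i|c|t IHt s IHs|t IHt s IHs] //=.
- by rewrite !homE.
- by rewrite !rmorphD IHt IHs.
- by rewrite !rmorphM IHt IHs.
Qed.

End Presented.

Section Finiteness.
Variable A : comPzRingType.

Definition finitely_generated (B : alg A) : Prop :=
  exists n (b : 'I_n -> B), forall y : B, exists t, teval b t = y.

Definition finitely_presented (B : alg A) : Prop :=
  exists n (rels : seq (term A 'I_n * term A 'I_n)),
  exists f : hom (pres (fun t t' => List.In (t, t') rels)) B, bijective f.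

Definition formally_etale (B : alg A) : Prop :=
  forall (C C0 : alg A) (q : hom C C0),
    (forall y, exists x, q x = y) ->
    (forall x y, q x = 0 -> q y = 0 -> x * y = 0) ->
  forall h0 : hom B C0, exists! h : hom B C, forall b, q (h b) = h0 b.

Definition etale (B : alg A) : Prop :=
  formally_etale B /\ finitely_presented B.

End Finiteness.

Definition is_field (A : comPzRingType) : Prop :=
  1 != 0 :> A /\ forall x : A, x != 0 -> exists y, x * y = 1.

(* Spec B -> Spec A is surjective. *)
Definition spec_surjective (A : comPzRingType) (B : alg A) : Prop :=
  forall K : alg A, is_field K ->
  exists L : alg A, [/\ is_field L, inhabited (hom K L) & inhabited (hom B L)].

Definition etale_cover (A : comPzRingType) (B : alg A) : Prop :=
  etale B /\ spec_surjective B.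

Lemma etale_cover_self (A : comPzRingType) : etale_cover (self_alg A).
Proof.
split; last first.
  move=> K fK; exists K; split => //; first exact: (inhabits (hid K)).
  exact: (inhabits (@Hom A (self_alg A) K (alg_str K) (fun=> erefl))).
split.
  move=> C C0 q _ _ h0.
  exists (@Hom A (self_alg A) C (alg_str C) (fun=> erefl)); split => /=.
    by move=> b; rewrite homE -(homE h0).
  by move=> h' _; apply: hom_ext => b /=; rewrite -(homE h').
exists 0%N, [::].
have sx : satisfies (fun t t' => List.In (t, t') [::])
    (fun i : 'I_0 => 0 : self_alg A) by [].
exists (pres_lift sx).
exists (alg_str (pres (fun t t' : term A 'I_0 => List.In (t, t') [::]))) => y.
  have -> : y = hid _ y by [].
  rewrite -[LHS]/(hcomp (@Hom A (self_alg A) _ (alg_str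
    (pres (fun t t' : term A 'I_0 => List.In (t, t') [::]))) (fun=> erefl))
    (pres_lift sx) y).
  by congr (hom_fun _ y); apply: pres_ext; case.
exact: (homE (pres_lift sx) y).
Qed.

Section Tensor.
Variables (k : comPzRingType) (A B : alg k).

Inductive tensor_rel : term A B -> term A B -> Prop :=
  | tensor_relD b b' : tensor_rel (tvar (b + b')) (tadd (tvar b) (tvar b'))
  | tensor_relM b b' : tensor_rel (tvar (b * b')) (tmul (tvar b) (tvar b'))
  | tensor_relC c : tensor_rel (tvar (alg_str B c)) (tcst (alg_str A c)).

(* The tensor product of A and B over k, as an A-algebra and as a k-algebra. *)
Definition tensorA : alg A := pres tensor_rel.
Definition tensor : alg k := restr tensorA.

Definition tensl : hom A tensor := restr_str tensorA.

Definition tensr_fun : B -> tensor := pres_gen tensor_rel.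

Lemma tensr_nmod : nmod_morphism tensr_fun.
Proof.
split=> [|b b'].
  have := pres_gen_sat (tensor_relC 0); rewrite /= !rmorph0 => H.
  by rewrite /tensr_fun H.
exact: (pres_gen_sat (tensor_relD b b')).
Qed.

Lemma tensr_monoid : monoid_morphism tensr_fun.
Proof.
split=> [|b b'].
  have := pres_gen_sat (tensor_relC 1); rewrite /= !rmorph1 => H.
  by rewrite /tensr_fun H.
exact: (pres_gen_sat (tensor_relM b b')).
Qed.

Definition tensr_rmorph : {rmorphism B -> tensor} :=
  GRing.RMorphism.Pack (GRing.RMorphism.Class
    (GRing.isNmodMorphism.Build B tensor tensr_fun tensr_nmod)
    (GRing.isMonoidMorphism.Build B tensor tensr_fun tensr_monoid)).

Lemma tensr_subproof c : tensr_rmorph (alg_str B c) = alg_str tensor c.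
Proof. exact: (pres_gen_sat (tensor_relC c)). Qed.

Definition tensr : hom B tensor := Hom tensr_subproof.

Lemma tens_sat (C : alg k) (f : hom A C) (g : hom B C) :
  satisfies (C := along f) tensor_rel g.
Proof.
move=> _ _ [b b'|b b'|c] /=; [exact: rmorphD | exact: rmorphM |].
by rewrite !homE.
Qed.

Definition tens_lift (C : alg k) (f : hom A C) (g : hom B C) : hom tensor C :=
  restr_hom (pres_lift (tens_sat f g)).

Lemma tens_liftl (C : alg k) (f : hom A C) (g : hom B C) :
  hcomp (tens_lift f g) tensl = f.
Proof. by apply: hom_ext => a; exact: (homE (pres_lift (tens_sat f g))). Qed.

Lemma tens_liftr (C : alg k) (f : hom A C) (g : hom B C) :
  hcomp (tens_lift f g) tensr = g.
Proof. by apply: hom_ext => b; exact: (pres_lift_gen (tens_sat f g)). Qed.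

Lemma tens_ext (C : alg k) (f g : hom tensor C) :
  hcomp f tensl = hcomp g tensl -> hcomp f tensr = hcomp g tensr -> f = g.
Proof.
move=> efg er.
have el c : f (alg_str tensorA c) = g (alg_str tensorA c).
  exact: (congr1 (fun h : hom A C => h c) efg).
pose f' := @Hom A tensorA (along (hcomp f tensl)) f (fun=> erefl).
pose g' := @Hom A tensorA (along (hcomp f tensl)) g (fun c => esym (el c)).
suff fg : f' = g'.
  by apply: hom_ext => x; exact: (congr1 (fun h : hom tensorA _ => h x) fg).
by apply: pres_ext => b; exact: (congr1 (fun h : hom B C => h b) er).
Qed.

End Tensor.

(* Schemes are described by their functors of points on k-algebras. *)
Section Functors.
Variable k : comPzRingType.

Record kfun := KFun {
  kpts :> alg k -> Type;
  kmap : forall A B : alg k, hom A B -> kpts A -> kpts B;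
  kmap_id : forall A x, kmap (hid A) x = x;
  kmap_comp : forall (A B C : alg k) (g : hom B C) (f : hom A B) x,
    kmap (hcomp g f) x = kmap g (kmap f x)
}.

Definition Spec (B : alg k) : kfun :=
  @KFun (hom B) (fun A C f p => hcomp f p)
    (fun A x => hcomp1f x) (fun A C D g f x => esym (hcompA g f x)).

Definition is_localization (A L : alg k) (a : A) (f : hom A L) : Prop :=
  (exists u, f a * u = 1) /\
  forall (C : alg k) (g : hom A C), (exists u, g a * u = 1) ->
    exists! h : hom L C, hcomp h f = g.

Definition zariski_sheaf (X : kfun) : Prop :=
  forall (A : alg k) n (a : 'I_n -> A) (L : 'I_n -> alg k)
    (f : forall i, hom A (L i)),
    (exists c : 'I_n -> A, \sum_(i < n) c i * a i = 1) ->
    (forall i, is_localization (a i) (f i)) ->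
  forall x : forall i, X (L i),
    (forall i j (C : alg k) (g : hom (L i) C) (h : hom (L j) C),
       hcomp g (f i) = hcomp h (f j) -> kmap g (x i) = kmap h (x j)) ->
    exists! y : X A, forall i, kmap (f i) y = x i.

(* u : X(B), seen by Yoneda as a morphism Spec B -> X, is an open immersion:
   an isomorphism onto an open subfunctor; the ideal generated by E cuts out
   the complement of the pullback of this open subfunctor to Spec A. *)
Definition open_immersion (X : kfun) (B : alg k) (u : X B) : Prop :=
  (forall (C : alg k) (f g : hom B C), kmap f u = kmap g u -> f = g) /\
  forall (A : alg k) (x : X A), exists E : set A,
  forall (C : alg k) (f : hom A C),
    (exists g : hom B C, kmap g u = kmap f x) <->
    (exists n (e : 'I_n -> A) (c : 'I_n -> C),
       (forall i, E (e i)) /\ \sum_(i < n) c i * f (e i) = 1).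

Definition scheme_of_finite_type (X : kfun) : Prop :=
  zariski_sheaf X /\
  exists n (B : 'I_n -> alg k) (u : forall i, X (B i)),
    (forall i, finitely_generated (B i) /\ open_immersion (u i)) /\
    forall (K : alg k) (x : X K), is_field K ->
      exists i (g : hom (B i) K), kmap g (u i) = x.

(* An affine group scheme: a group structure on Spec of an algebra. *)
Record grp := Grp {
  gring : alg k;
  gmul : forall C : alg k, hom gring C -> hom gring C -> hom gring C;
  gone : forall C : alg k, hom gring C;
  ginv : forall C : alg k, hom gring C -> hom gring C;
  gmulA : forall C (g h l : hom gring C), gmul g (gmul h l) = gmul (gmul g h) l;
  gmul1 : forall C (g : hom gring C), gmul (gone C) g = g;
  gmulV : forall C (g : hom gring C), gmul (ginv g) g = gone C;
  gmul_nat : forall (C D : alg k) (f : hom C D) (g h : hom gring C),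
    hcomp f (gmul g h) = gmul (hcomp f g) (hcomp f h)
}.

(* Reducedness is not imposed: it is automatic in characteristic 0. *)
Definition linear_algebraic (G : grp) : Prop := finitely_generated (gring G).

Record gaction (G : grp) (X : kfun) := GAction {
  gact :> forall C : alg k, hom (gring G) C -> X C -> X C;
  act1 : forall C (x : X C), gact (gone G C) x = x;
  actM : forall C (g h : hom (gring G) C) (x : X C),
    gact (gmul g h) x = gact g (gact h x);
  act_nat : forall (C D : alg k) (f : hom C D) g (x : X C),
    kmap f (gact g x) = gact (hcomp f g) (kmap f x)
}.

(* Categories over the category of affine k-schemes: mor x' x is the type of
   morphisms from x' (over Spec A') to x (over Spec A), and mor_base f is the
   underlying morphism Spec A' -> Spec A. By the 2-Yoneda lemma, an object over
   Spec A of a stack M is a morphism Spec A -> M. *)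
Record aff_cat := AffCat {
  ob : alg k -> Type;
  mor : forall A A' : alg k, ob A' -> ob A -> Type;
  mor_base : forall (A A' : alg k) (x' : ob A') (x : ob A),
    mor x' x -> hom A A';
  idm : forall (A : alg k) (x : ob A), mor x x;
  mcomp : forall (A A' A'' : alg k) (x'' : ob A'') (x' : ob A') (x : ob A),
    mor x' x -> mor x'' x' -> mor x'' x;
  mor_base_id : forall A (x : ob A), mor_base (idm x) = hid A;
  mor_base_comp : forall (A A' A'' : alg k) (x'' : ob A'') (x' : ob A')
    (x : ob A) (f : mor x' x) (g : mor x'' x'),
    mor_base (mcomp f g) = hcomp (mor_base g) (mor_base f);
  mcomp1m : forall (A A' : alg k) (x' : ob A') (x : ob A) (f : mor x' x),
    mcomp (idm x) f = f;
  mcompm1 : forall (A A' : alg k) (x' : ob A') (x : ob A) (f : mor x' x),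
    mcomp f (idm x') = f;
  mcompA : forall (A A' A'' A''' : alg k) (x''' : ob A''') (x'' : ob A'')
    (x' : ob A') (x : ob A) (f : mor x' x) (g : mor x'' x') (h : mor x''' x''),
    mcomp f (mcomp g h) = mcomp (mcomp f g) h
}.

Record functor (X Y : aff_cat) := Functor {
  fob :> forall A : alg k, ob X A -> ob Y A;
  fmor : forall (A A' : alg k) (x' : ob X A') (x : ob X A),
    mor x' x -> mor (fob x') (fob x);
  fover : forall (A A' : alg k) (x' : ob X A') (x : ob X A) (f : mor x' x),
    mor_base (fmor f) = mor_base f;
  fmor_id : forall A (x : ob X A), fmor (idm x) = idm (fob x);
  fmor_comp : forall (A A' A'' : alg k) (x'' : ob X A'') (x' : ob X A')
    (x : ob X A) (f : mor x' x) (g : mor x'' x'),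
    fmor (mcomp f g) = mcomp (fmor f) (fmor g)
}.

Lemma fcomp_over (X Y Z : aff_cat) (G : functor Y Z) (F : functor X Y)
  (A A' : alg k) (x' : ob X A') (x : ob X A) (f : mor x' x) :
  mor_base (fmor G (fmor F f)) = mor_base f.
Proof. by rewrite !fover. Qed.

Lemma fcomp_id (X Y Z : aff_cat) (G : functor Y Z) (F : functor X Y)
  A (x : ob X A) : fmor G (fmor F (idm x)) = idm (G _ (F _ x)).
Proof. by rewrite !fmor_id. Qed.

Lemma fcomp_comp (X Y Z : aff_cat) (G : functor Y Z) (F : functor X Y)
    (A A' A'' : alg k) (x'' : ob X A'') (x' : ob X A') (x : ob X A)
    (f : mor x' x) (g : mor x'' x') :
  fmor G (fmor F (mcomp f g)) = mcomp (fmor G (fmor F f)) (fmor G (fmor F g)).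
Proof. by rewrite !fmor_comp. Qed.

Definition fcomp (X Y Z : aff_cat) (G : functor Y Z) (F : functor X Y) :
    functor X Z :=
  @Functor X Z (fun A x => G A (F A x))
    (fun A A' x' x f => fmor G (fmor F f))
    (fcomp_over G F) (fcomp_id G F) (fcomp_comp G F).

(* The terminal category over affine k-schemes, i.e. Spec k. *)
Definition Spec_base : aff_cat.
Proof.
refine (@AffCat (fun=> unit) (fun A A' _ _ => hom A A') (fun A A' _ _ f => f)
  (fun A _ => hid A) (fun A A' A'' _ _ _ f g => hcomp g f) _ _ _ _ _) => //.
- by move=> A A' _ _ f; rewrite hcompf1.
- by move=> A A' _ _ f; rewrite hcomp1f.
- by move=> A A' A'' A''' _ _ _ _ f g h; rewrite hcompA.
Defined.

(* X x Spec A *)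
Section Product.
Variables (X : aff_cat) (A : alg k).

Definition prod_ob (C : alg k) : Type := (ob X C * hom A C)%type.

Definition prod_mor (C C' : alg k) (x' : prod_ob C') (x : prod_ob C) : Type :=
  {f : mor x'.1 x.1 | x'.2 = hcomp (mor_base f) x.2}.

Lemma prod_id_subproof C (x : prod_ob C) : x.2 = hcomp (mor_base (idm x.1)) x.2.
Proof. by rewrite mor_base_id hcomp1f. Qed.

Lemma prod_comp_subproof (C C' C'' : alg k) (x'' : prod_ob C'')
    (x' : prod_ob C') (x : prod_ob C) (f : prod_mor x' x)
    (g : prod_mor x'' x') :
  x''.2 = hcomp (mor_base (mcomp (sval f) (sval g))) x.2.
Proof. by rewrite mor_base_comp -hcompA -(svalP f) -(svalP g). Qed.

Definition prod_stack : aff_cat.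
Proof.
refine (@AffCat prod_ob prod_mor (fun C C' x' x f => mor_base (sval f))
  (fun C x => exist _ (idm x.1) (prod_id_subproof x))
  (fun C C' C'' x'' x' x f g =>
     exist _ (mcomp (sval f) (sval g)) (prod_comp_subproof f g)) _ _ _ _ _).
- by move=> C x; exact: mor_base_id.
- by move=> C C' C'' x'' x' x f g; exact: mor_base_comp.
- by move=> C C' x' x [f ?]; apply: eq_exist; exact: mcomp1m.
- by move=> C C' x' x [f ?]; apply: eq_exist; exact: mcompm1.
- by move=> C C' C'' C''' ? ? ? ? f g h; apply: eq_exist; exact: mcompA.
Defined.

End Product.

(* The mapping stack Map(X, M): its objects over Spec A are the morphisms
   X x Spec A -> M, and its morphisms from F' to F over phi : A -> A' are the
   base-preserving natural transformations from F' to the pullback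
   F o (id x Spec phi) of F. In nt_at, the hypothesis a = a' o phi stands for
   the definition of a, which avoids transporting along equalities. *)
Section Mapping.
Variables (X M : aff_cat).

Definition map_ob (A : alg k) : Type := functor (prod_stack X A) M.

Definition pmor (A C C' : alg k) (x' : ob X C') (x : ob X C) (f : mor x' x)
    (a' : hom A C') (a : hom A C) (e : a' = hcomp (mor_base f) a) :
    @mor (prod_stack X A) C C' (x', a') (x, a) := exist _ f e.

Record map_mor (A A' : alg k) (F' : map_ob A') (F : map_ob A) := MapMor {
  nt_base : hom A A';
  nt_at : forall (C : alg k) (x : ob X C) (a' : hom A' C) (a : hom A C),
    a = hcomp a' nt_base -> mor (F' C (x, a')) (F C (x, a));
  nt_over : forall C (x : ob X C) a' a (e : a = hcomp a' nt_base),
    mor_base (nt_at x e) = hid C;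
  nt_nat : forall (C C' : alg k) (x' : ob X C') (x : ob X C) (f : mor x' x)
    (a1' : hom A' C') (a2' : hom A' C) (a1 : hom A C') (a2 : hom A C)
    (e1 : a1 = hcomp a1' nt_base) (e2 : a2 = hcomp a2' nt_base)
    (e' : a1' = hcomp (mor_base f) a2') (e : a1 = hcomp (mor_base f) a2),
    mcomp (fmor F (pmor e)) (nt_at x' e1) =
    mcomp (nt_at x e2) (fmor F' (pmor e'))
}.
Arguments nt_at {A A' F' F} _ {C} x {a' a} e.
Arguments nt_over {A A' F' F} _ {C} x {a' a} e.
Arguments nt_nat {A A' F' F} _ {C C' x' x f a1' a2' a1 a2} e1 e2 e' e.

Lemma map_mor_ext (A A' : alg k) (F' : map_ob A') (F : map_ob A)
    (s t : map_mor F' F) :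
  nt_base s = nt_base t ->
  (forall C (x : ob X C) a' a (e : a = hcomp a' (nt_base s))
     (e' : a = hcomp a' (nt_base t)), nt_at s x e = nt_at t x e') ->
  s = t.
Proof.
case: s t => [b s so sn] [c t to tn] /= e; subst c => st.
have {}st : s = t.
  apply: functional_extensionality_dep => C.
  apply: functional_extensionality_dep => x.
  apply: functional_extensionality_dep => a'.
  apply: functional_extensionality_dep => a.
  by apply: functional_extensionality_dep => e; exact: st.
subst t.
by rewrite (Prop_irrelevance so to) (Prop_irrelevance sn tn).
Qed.

Lemma map_id_subproof (A C : alg k) (x : ob X C) (a' a : hom A C) :
  a = hcomp a' (hid A) -> a' = hcomp (mor_base (idm x)) a.
Proof. by move=> ->; rewrite mor_base_id hcomp1f hcompf1. Qed.

Lemma fmor_pmor_comp (A : alg k) (F : map_ob A) (C C' C'' : alg k)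
    (x'' : ob X C'') (x' : ob X C') (x : ob X C) (f : mor x' x)
    (g : mor x'' x') (h : mor x'' x) a'' a' a
    (ef : a' = hcomp (mor_base f) a) (eg : a'' = hcomp (mor_base g) a')
    (eh : a'' = hcomp (mor_base h) a) :
  mcomp f g = h ->
  mcomp (fmor F (pmor ef)) (fmor F (pmor eg)) = fmor F (pmor eh).
Proof.
move=> E; rewrite -fmor_comp; congr (fmor F _).
by apply: eq_exist; exact: E.
Qed.

Definition map_id (A : alg k) (F : map_ob A) : map_mor F F.
Proof.
refine (@MapMor A A F F (hid A)
  (fun C x a' a e => fmor F (pmor (map_id_subproof x e))) _ _).
- by move=> C x a' a e; rewrite fover /= mor_base_id.
- move=> C C' x' x f a1' a2' a1 a2 e1 e2 e' e.
  have ef : a1' = hcomp (mor_base f) a2.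
    by rewrite e' e2 hcompf1.
  rewrite (fmor_pmor_comp F e (map_id_subproof x' e1) ef); last exact: mcompm1.
  by rewrite (fmor_pmor_comp F (map_id_subproof x e2) e' ef) // mcomp1m.
Defined.

Lemma map_comp_subproof (A A' A'' C : alg k) (b : hom A A') (c : hom A' A'')
    (a'' : hom A'' C) (a : hom A C) :
  a = hcomp a'' (hcomp c b) -> a = hcomp (hcomp a'' c) b.
Proof. by rewrite hcompA. Qed.

Definition map_comp (A A' A'' : alg k) (F'' : map_ob A'') (F' : map_ob A')
    (F : map_ob A) (s : map_mor F' F) (t : map_mor F'' F') : map_mor F'' F.
Proof.
refine (@MapMor A A'' F'' F (hcomp (nt_base t) (nt_base s))
  (fun C x a'' a e =>
     mcomp (nt_at s x (map_comp_subproof e))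
          (nt_at t x (erefl (hcomp a'' (nt_base t))))) _ _).
- by move=> C x a'' a e; rewrite mor_base_comp !nt_over hcomp1f.
- move=> C C' x' x f a1'' a2'' a1 a2 e1 e2 e'' e.
  have e' : hcomp a1'' (nt_base t) =
      hcomp (mor_base f) (hcomp a2'' (nt_base t)).
    by rewrite e'' hcompA.
  rewrite mcompA (nt_nat s _ (map_comp_subproof e2) e' e).
  rewrite -mcompA (nt_nat t _ (erefl (hcomp a2'' (nt_base t))) e'' e').
  by rewrite mcompA.
Defined.

Lemma nt_irr (A A' A'' : alg k) (F'' : map_ob A'') (F' : map_ob A')
    (F : map_ob A) (s : map_mor F' F) (t : map_mor F'' F') (C : alg k)
    (x : ob X C) a'' (a1' a2' : hom A' C) a
    (e1 : a = hcomp a1' (nt_base s)) (f1 : a1' = hcomp a'' (nt_base t))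
    (e2 : a = hcomp a2' (nt_base s)) (f2 : a2' = hcomp a'' (nt_base t)) :
  mcomp (nt_at s x e1) (nt_at t x f1) = mcomp (nt_at s x e2) (nt_at t x f2).
Proof.
have E : a1' = a2' by rewrite f1 f2.
case: _ / E e2 f2 => e2 f2.
by rewrite (Prop_irrelevance e1 e2) (Prop_irrelevance f1 f2).
Qed.

Lemma nt_pmor_id (A A' : alg k) (F' : map_ob A') (F : map_ob A)
    (s : map_mor F' F) (C : alg k) (x : ob X C) a' a1 a2
    (e : a1 = hcomp (mor_base (idm x)) a2) (e1 : a1 = hcomp a' (nt_base s))
    (e2 : a2 = hcomp a' (nt_base s)) :
  mcomp (fmor F (pmor e)) (nt_at s x e1) = nt_at s x e2.
Proof.
have e' : a' = hcomp (mor_base (idm x)) a' by rewrite mor_base_id hcomp1f.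
rewrite (nt_nat s e1 e2 e' e).
have -> : pmor e' = idm ((x, a') : ob (prod_stack X A') C) by exact: eq_exist.
by rewrite fmor_id mcompm1.
Qed.

Lemma nt_pmor_idr (A A' : alg k) (F' : map_ob A') (F : map_ob A)
    (s : map_mor F' F) (C : alg k) (x : ob X C) a1' a2' a
    (e : a1' = hcomp (mor_base (idm x)) a2') (e1 : a = hcomp a1' (nt_base s))
    (e2 : a = hcomp a2' (nt_base s)) :
  mcomp (nt_at s x e2) (fmor F' (pmor e)) = nt_at s x e1.
Proof.
have e' : a = hcomp (mor_base (idm x)) a by rewrite mor_base_id hcomp1f.
rewrite -(nt_nat s e1 e2 e e').
have -> : pmor e' = idm ((x, a) : ob (prod_stack X A) C) by exact: eq_exist.
by rewrite fmor_id mcomp1m.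
Qed.

Definition Map_stack : aff_cat.
Proof.
refine (@AffCat map_ob map_mor (fun A A' F' F s => nt_base s) map_id map_comp
  _ _ _ _ _) => //.
- move=> A A' F' F s; apply: map_mor_ext => [|C x a' a e e'] /=.
    by rewrite hcompf1.
  exact: nt_pmor_id.
- move=> A A' F' F s; apply: map_mor_ext => [|C x a' a e e'] /=.
    by rewrite hcomp1f.
  exact: nt_pmor_idr.
- move=> A A' A'' A''' F''' F'' F' F s t u.
  apply: map_mor_ext => [|C x a' a e e'] /=; first by rewrite hcompA.
  rewrite mcompA; congr (mcomp _ _); exact: nt_irr.
Defined.

(* Evaluation of a family of morphisms X -> M at a k-point p of X. *)
Variable p : functor Spec_base X.

Let pt_ (A : alg k) : ob X A := p A tt.

Let ptm (A A' : alg k) (f : hom A A') : mor (pt_ A') (pt_ A) :=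
  @fmor _ _ p A A' tt tt f.

Lemma ev_subproof (A A' : alg k) (f : hom A A') :
  f = hcomp (mor_base (ptm f)) (hid A).
Proof. by rewrite fover hcompf1. Qed.

Lemma ev_subproof2 (A A' : alg k) (f : hom A A') : f = hcomp (hid A') f.
Proof. by rewrite hcomp1f. Qed.

Definition ev_mor (A A' : alg k) (F' : map_ob A') (F : map_ob A)
    (s : map_mor F' F) :
    mor (F' A' (pt_ A', hid A')) (F A (pt_ A, hid A)) :=
  mcomp (fmor F (pmor (ev_subproof (nt_base s))))
       (nt_at s (pt_ A') (ev_subproof2 (nt_base s))).

Definition ev : functor Map_stack M.
Proof.
refine (@Functor Map_stack M (fun A (F : map_ob A) => F A (pt_ A, hid A))
  ev_mor _ _ _).
- move=> A A' F' F s.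
  by rewrite mor_base_comp nt_over hcomp1f fover /= /ptm fover.
- move=> A F; rewrite /ev_mor /= -fmor_id -fmor_comp; congr (fmor F _).
  by apply: eq_exist; rewrite /= /ptm mcompm1; exact: (fmor_id p).
- move=> A A' A'' F'' F' F s t; rewrite /ev_mor /=.
  have e2 : hcomp (nt_base t) (nt_base s) =
      hcomp (mor_base (ptm (nt_base t))) (nt_base s) by rewrite fover.
  rewrite -mcompA [X in _ = mcomp _ X]mcompA.
  rewrite -(nt_nat s (erefl _) (ev_subproof2 _) (ev_subproof (nt_base t)) e2).
  rewrite -[X in _ = mcomp _ X]mcompA [RHS]mcompA (fmor_pmor_comp F _ _
    (ev_subproof (hcomp (nt_base t) (nt_base s)))); last first.
    by rewrite /ptm -(fmor_comp p).
  congr (mcomp _ _); exact: nt_irr.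
Defined.

End Mapping.

End Functors.

(* The quotient stack [X/G]: objects over Spec A are G-torsors P = Spec B
   over Spec A (P is affine because G is) with an equivariant morphism P -> X,
   given by Yoneda as an element of X(B); morphisms are cartesian squares. *)
Section Quotient.
Variables (k : comPzRingType) (G : grp k) (X : kfun k) (aX : gaction G X).

Lemma gmul_rV C (g : hom (gring G) C) : gmul g (ginv g) = gone G C.
Proof.
rewrite -[LHS]gmul1 -{1}(gmulV (ginv g)) -gmulA [X in gmul _ X]gmulA gmulV.
by rewrite gmul1 gmulV.
Qed.

Lemma gmul_r1 C (g : hom (gring G) C) : gmul g (gone G C) = g.
Proof. by rewrite -(gmulV g) gmulA gmul_rV gmul1. Qed.

Lemma gone_nat (C D : alg k) (f : hom C D) : hcomp f (gone G C) = gone G D.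
Proof.
have : gmul (hcomp f (gone G C)) (hcomp f (gone G C)) = hcomp f (gone G C).
  by rewrite -gmul_nat gmul1.
move=> /(congr1 (gmul (ginv (hcomp f (gone G C))))).
by rewrite gmulA !gmulV gmul1.
Qed.

Definition etale_locally_trivial (A B : alg k) (pi : hom A B)
    (aB : gaction G (Spec B)) : Prop :=
  exists A' : alg A, etale_cover A' /\
  exists s : hom B (restr A'),
    hcomp s pi = restr_str A' /\
    forall (C : alg k) (a : hom (restr A') C) (p : hom B C),
      hcomp p pi = hcomp a (restr_str A') ->
      exists! g : hom (gring G) C, aB C g (hcomp a s) = p.

Record quot_ob (A : alg k) := QuotOb {
  tors_ring : alg k;
  tors_proj : hom A tors_ring;
  tors_act : gaction G (Spec tors_ring);
  tors_inv : forall C (g : hom (gring G) C) (p : hom tors_ring C),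
    hcomp (tors_act C g p) tors_proj = hcomp p tors_proj;
  tors_loc : etale_locally_trivial tors_proj tors_act;
  tors_map : X tors_ring;
  tors_equiv : forall C (g : hom (gring G) C) (p : hom tors_ring C),
    kmap (tors_act C g p) tors_map = aX C g (kmap p tors_map)
}.

Record quot_mor (A A' : alg k) (x' : quot_ob A') (x : quot_ob A) := QuotMor {
  qm_base : hom A A';
  qm_fun : hom (tors_ring x) (tors_ring x');
  qm_proj : hcomp qm_fun (tors_proj x) = hcomp (tors_proj x') qm_base;
  qm_equiv : forall C (g : hom (gring G) C) (p : hom (tors_ring x') C),
    hcomp (tors_act x' C g p) qm_fun = tors_act x C g (hcomp p qm_fun);
  qm_cart : forall C (p : hom (tors_ring x) C) (a : hom A' C),
    hcomp p (tors_proj x) = hcomp a qm_base ->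
    exists! p' : hom (tors_ring x') C,
      hcomp p' qm_fun = p /\ hcomp p' (tors_proj x') = a;
  qm_map : kmap qm_fun (tors_map x) = tors_map x'
}.

Lemma quot_mor_ext (A A' : alg k) (x' : quot_ob A') (x : quot_ob A)
    (f g : quot_mor x' x) :
  qm_base f = qm_base g -> qm_fun f = qm_fun g -> f = g.
Proof.
case: f g => [b f p1 e1 c1 m1] [b' f' p2 e2 c2 m2] /= eb ef; subst b' f'.
by rewrite (Prop_irrelevance p1 p2) (Prop_irrelevance e1 e2)
  (Prop_irrelevance c1 c2) (Prop_irrelevance m1 m2).
Qed.

Definition quot_id (A : alg k) (x : quot_ob A) : quot_mor x x.
Proof.
refine (@QuotMor A A x x (hid A) (hid _) _ _ _ _).
- by rewrite hcomp1f hcompf1.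
- by move=> C g p; rewrite !hcompf1.
- move=> C p a; rewrite hcompf1 => e; exists p; split.
    by rewrite hcompf1.
  by move=> p' [<- _]; rewrite hcompf1.
- exact: kmap_id.
Defined.

Definition quot_comp (A A' A'' : alg k) (x'' : quot_ob A'') (x' : quot_ob A')
  (x : quot_ob A) (f : quot_mor x' x) (g : quot_mor x'' x') : quot_mor x'' x.
Proof.
refine (@QuotMor A A'' x'' x (hcomp (qm_base g) (qm_base f))
  (hcomp (qm_fun g) (qm_fun f)) _ _ _ _).
- by rewrite -hcompA qm_proj hcompA qm_proj hcompA.
- by move=> C h p; rewrite hcompA !qm_equiv hcompA.
- move=> C p a; rewrite hcompA => e.
  have [p' [[e1 e2] u1]] := qm_cart e.
  have [p'' [[e3 e4] u2]] := qm_cart e2.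
  exists p''; split; first by rewrite hcompA e3.
  move=> q [q1 q2]; apply: u2; split=> //; apply/esym/u1; split.
    by rewrite -hcompA.
  by rewrite -hcompA qm_proj hcompA q2.
- by rewrite kmap_comp !qm_map.
Defined.

Definition quot_stack : aff_cat k.
Proof.
refine (@AffCat k quot_ob quot_mor (fun A A' x' x f => qm_base f)
  quot_id quot_comp _ _ _ _ _) => //.
- by move=> *; apply: quot_mor_ext; rewrite /= hcompf1.
- by move=> *; apply: quot_mor_ext; rewrite /= hcomp1f.
- by move=> *; apply: quot_mor_ext; rewrite /= hcompA.
Defined.

(* The trivial torsor G x Spec A with the orbit map g |-> g x of x in X(A). *)
Section Trivial.
Variables (A : alg k) (x : X A).
Let B := tensor A (gring G).

Definition triv_fun (C : alg k) (g : hom (gring G) C) (p : hom B C) : hom B C :=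
  tens_lift (hcomp p (tensl A (gring G)))
    (gmul g (hcomp p (tensr A (gring G)))).

Definition triv_act : gaction G (Spec B).
Proof.
refine (@GAction k G (Spec B) triv_fun _ _ _).
- by move=> C p; apply: tens_ext; rewrite ?tens_liftl ?tens_liftr ?gmul1.
- by move=> C g h p; apply: tens_ext;
    rewrite ?tens_liftl ?tens_liftr ?tens_liftl ?gmulA.
- move=> C D f g p; apply: tens_ext => /=.
    by rewrite -hcompA !tens_liftl hcompA.
  by rewrite -hcompA !tens_liftr gmul_nat hcompA.
Defined.

Lemma triv_loc : etale_locally_trivial (tensl A (gring G)) triv_act.
Proof.
exists (self_alg A); split; first exact: etale_cover_self.
exists (tens_lift (restr_str (self_alg A)) (gone G _)); split.
  exact: tens_liftl.
move=> C a p e; exists (hcomp p (tensr A (gring G))); split.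
  apply: tens_ext => /=; rewrite ?tens_liftl ?tens_liftr.
    by rewrite -hcompA tens_liftl -e.
  by rewrite -hcompA tens_liftr gone_nat gmul_r1.
move=> g /(congr1 (fun q => hcomp q (tensr A (gring G)))) /=.
by rewrite tens_liftr -hcompA tens_liftr gone_nat gmul_r1 => <-.
Qed.

Lemma triv_equiv C (g : hom (gring G) C) (p : hom B C) :
  kmap (triv_act C g p) (aX B (tensr A (gring G)) (kmap (tensl A (gring G)) x))
  = aX C g (kmap p (aX B (tensr A (gring G)) (kmap (tensl A (gring G)) x))).
Proof.
rewrite !act_nat -!kmap_comp /= tens_liftl tens_liftr.
by rewrite actM.
Qed.

Definition triv_ob : quot_ob A :=
  @QuotOb A B (tensl A (gring G)) triv_act
    (fun C g p => tens_liftl _ _) triv_loc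
    (aX B (tensr A (gring G)) (kmap (tensl A (gring G)) x)) triv_equiv.

End Trivial.

(* A k-point of X, given as a compatible family of points x_ A of X(A), and
   the induced k-point Spec k -> X -> [X/G] of the quotient stack. *)
Variable x_ : forall A : alg k, X A.
Hypothesis x_nat : forall (A A' : alg k) (f : hom A A'), kmap f (x_ A) = x_ A'.

Definition triv_mor (A A' : alg k) (f : hom A A') :
  quot_mor (triv_ob (x_ A')) (triv_ob (x_ A)).
Proof.
refine (@QuotMor A A' (triv_ob (x_ A')) (triv_ob (x_ A)) f
  (tens_lift (hcomp (tensl A' (gring G)) f) (tensr A' (gring G))) _ _ _ _).
- exact: tens_liftl.
- move=> C g p; apply: tens_ext; rewrite -?hcompA /= ?tens_liftl ?tens_liftr.
    by rewrite hcompA tens_liftl -!hcompA tens_liftl.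
  by rewrite -hcompA tens_liftr.
- move=> C p a /= e; exists (tens_lift a (hcomp p (tensr A (gring G)))); split.
    split; last exact: tens_liftl.
    apply: tens_ext; rewrite -hcompA ?tens_liftl ?tens_liftr.
      by rewrite hcompA tens_liftl.
    by [].
  move=> q [<- <-]; apply: tens_ext; rewrite ?tens_liftl //.
  by rewrite tens_liftr -hcompA tens_liftr.
- by rewrite /= act_nat tens_liftr -kmap_comp tens_liftl kmap_comp x_nat.
Defined.

Definition quot_point : functor (Spec_base k) quot_stack.
Proof.
refine (@Functor k (Spec_base k) quot_stack (fun A _ => triv_ob (x_ A))
  (fun A A' _ _ f => triv_mor f) _ _ _) => //.
- move=> A []; apply: quot_mor_ext => //=.
  by apply: tens_ext; rewrite ?tens_liftl ?tens_liftr ?hcomp1f ?hcompf1.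
- move=> A A' A'' [] [] [] f g; apply: quot_mor_ext => //=.
  apply: tens_ext.
    by rewrite tens_liftl -[RHS]hcompA tens_liftl [RHS]hcompA tens_liftl hcompA.
  by rewrite tens_liftr -[RHS]hcompA !tens_liftr.
Defined.

End Quotient.

(* The topological space |X| of equivalence classes of field-valued points. It
   lives in a larger universe than the carriers of MathComp's structures, so it
   cannot be made a topologicalType, and its subsets are plain predicates. *)
Section Points.
Variables (k : comPzRingType) (X : aff_cat k).

Record fpoint := FPoint {
  fp_ring : alg k;
  fp_field : is_field fp_ring;
  fp_ob : ob X fp_ring
}.

(* p and q become isomorphic over a common field extension. *)
Definition fp_equiv (p q : fpoint) : Prop :=
  exists r : fpoint, inhabited (mor (fp_ob r) (fp_ob p)) /\
                     inhabited (mor (fp_ob r) (fp_ob q)).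

Definition stack_space : Type :=
  {S : fpoint -> Prop | exists p, S = fp_equiv p}.

Definition pt_class (p : fpoint) : stack_space :=
  exist _ (fp_equiv p) (ex_intro _ p erefl).

(* U is open iff its preimage under every Spec A -> X is Zariski open: it
   consists of the points where some element of E does not vanish. *)
Definition space_open (U : stack_space -> Prop) : Prop :=
  forall (A : alg k) (x : ob X A), exists E : set A,
  forall (p : fpoint) (f : mor (fp_ob p) x),
    U (pt_class p) <-> exists a, E a /\ mor_base f a != 0.

Definition space_connected (C : stack_space -> Prop) : Prop :=
  forall U V : stack_space -> Prop, space_open U -> space_open V ->
    (forall p, C p -> U p \/ V p) ->
    (forall p, C p -> U p -> V p -> False) ->
    (forall p, C p -> U p) \/ (forall p, C p -> V p).

Definition component (p q : stack_space) : Prop :=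
  exists C : stack_space -> Prop, [/\ space_connected C, C p & C q].

Definition union_of_components (S : stack_space -> Prop) : Prop :=
  exists F : stack_space -> Prop,
    forall q, S q <-> exists p, F p /\ component p q.

(* The full substack of X whose points all lie in S. *)
Section Substack.
Variable S : stack_space -> Prop.

Definition sub_ob (A : alg k) : Type :=
  {x : ob X A | forall (p : fpoint) (f : mor (fp_ob p) x), S (pt_class p)}.

Definition substack : aff_cat k.
Proof.
refine (@AffCat k sub_ob (fun A A' x' x => mor (sval x') (sval x))
  (fun A A' x' x f => mor_base f) (fun A x => idm (sval x))
  (fun A A' A'' x'' x' x f g => mcomp f g) _ _ _ _ _).
- by move=> *; exact: mor_base_id.
- by move=> *; exact: mor_base_comp.
- by move=> *; exact: mcomp1m.
- by move=> *; exact: mcompm1.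
- by move=> *; exact: mcompA.
Defined.

Definition sub_incl : functor substack X :=
  @Functor k substack X (fun A x => sval x) (fun A A' x' x f => f)
    (fun _ _ _ _ _ => erefl) (fun _ _ => erefl) (fun _ _ _ _ _ _ _ _ => erefl).

End Substack.
End Points.

Section Embeddings.
Variables (k : comPzRingType) (Z M : aff_cat k) (E : functor Z M).

(* E is a closed embedding: for each x : Spec A -> M the fibre product
   Z x_M Spec A, whose objects over A' are triples (f : A -> A', z, E z -> x
   over f), is the closed subscheme of Spec A defined by some ideal. *)
Definition closed_embedding : Prop :=
  forall (A : alg k) (x : ob M A), exists I : set A,
  forall (A' : alg k) (f : hom A A'),
    ((exists (z : ob Z A') (m : mor (E A' z) x), mor_base m = f) <->
     (forall a, I a -> f a = 0)) /\
    (forall (z z' : ob Z A') (m : mor (E A' z) x) (m' : mor (E A' z') x),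
       mor_base m = f -> mor_base m' = f ->
       exists! h : mor z z', mor_base h = hid A' /\ mcomp m' (fmor E h) = m).

(* The composite of Spec A' -> Spec A with x : Spec A -> M factors through E. *)
Definition factors_through (A A' : alg k) (f : hom A A') (x : ob M A) : Prop :=
  exists (z : ob Z A') (m : mor (E A' z) x), mor_base m = f.

End Embeddings.

Section Localization.
Variables (k : comPzRingType) (A : alg k) (a : A).

Inductive loc_rel : term A unit -> term A unit -> Prop :=
  | loc_rel1 : loc_rel (tmul (tcst a) (tvar tt)) (tcst 1).

Definition loc : alg k := restr (pres loc_rel).

Definition loc_map : hom A loc := restr_str (pres loc_rel).

Definition loc_inv : loc := pres_gen loc_rel tt.

Lemma loc_invP : loc_map a * loc_inv = 1.
Proof. by have := pres_gen_sat loc_rel1; rewrite /= rmorph1. Qed.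

Variables (C : alg k) (f : hom A C) (u : C).
Hypothesis fu : f a * u = 1.

Lemma loc_sat : satisfies (C := along f) loc_rel (fun=> u).
Proof. by move=> _ _ [] /=; rewrite rmorph1. Qed.

Definition loc_lift : hom loc C := restr_hom (pres_lift loc_sat).

End Localization.

(* For a submonoid P of M, the algebra k[P] generated by symbols chi^m, m in P,
   with chi^0 = 1 and chi^(m1 + m2) = chi^m1 chi^m2. *)
Section MonoidAlgebra.
Variables (k : comPzRingType) (M : zmodType) (P : set M).

Inductive mon_rel : term k {m | P m} -> term k {m | P m} -> Prop :=
  | mon_rel0 m : sval m = 0 -> mon_rel (tvar m) (tcst 1)
  | mon_relD m m1 m2 : sval m = sval m1 + sval m2 ->
      mon_rel (tvar m) (tmul (tvar m1) (tvar m2)).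

Definition mon_alg : alg k := pres mon_rel.

Definition chi (m : {m | P m}) : mon_alg := pres_gen mon_rel m.

Variable C : alg k.

Definition is_character (h : {m | P m} -> C) : Prop :=
  (forall m, sval m = 0 -> h m = 1) /\
  (forall m m1 m2, sval m = sval m1 + sval m2 -> h m = h m1 * h m2).

Lemma character_sat (h : {m | P m} -> C) :
  is_character h -> satisfies mon_rel h.
Proof.
by case=> h0 hD _ _ [m m0|m m1 m2 e] /=; [rewrite rmorph1 h0 | exact: hD].
Qed.

Definition of_character (h : {m | P m} -> C) (hP : is_character h) :
    hom mon_alg C := pres_lift (character_sat hP).

Lemma of_characterE h (hP : is_character h) m : of_character hP (chi m) = h m.
Proof. exact: (pres_lift_gen (character_sat hP)). Qed.

Lemma character_of (p : hom mon_alg C) : is_character (fun m => p (chi m)).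
Proof.
split=> [m m0|m m1 m2 e].
  by have /(congr1 p) := pres_gen_sat (mon_rel0 m0); rewrite /= !rmorph1.
by have /(congr1 p) := pres_gen_sat (mon_relD e); rewrite /= rmorphM.
Qed.

Lemma mon_ext (p q : hom mon_alg C) :
  (forall m, p (chi m) = q (chi m)) -> p = q.
Proof. exact: pres_ext. Qed.

Lemma character1 : is_character (fun=> 1 : C).
Proof. by split=> // m m1 m2 _; rewrite mulr1. Qed.

End MonoidAlgebra.

(* The torus T = Spec k[M], acting on Spec k[P] for P a submonoid of M: on
   points, (g p)(m) = g(m) p(m). *)
Section Torus.
Variables (k : comPzRingType) (M : zmodType).

Definition incl_setT (P : set M) (m : {m | P m}) : {m : M | setT m} :=
  exist _ (sval m) Logic.I.

Section Act.
Variables (P : set M) (C : alg k).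

Lemma torus_act_subproof (g : hom (mon_alg k [set: M]) C)
    (p : hom (mon_alg k P) C) :
  is_character (fun m => g (chi k (incl_setT m)) * p (chi k m)).
Proof.
have [g0 gD] := character_of g; have [p0 pD] := character_of p.
split=> [m m0|m m1 m2 e]; first by rewrite g0 // p0 // mulr1.
by rewrite (gD _ (incl_setT m1) (incl_setT m2)) // (pD _ m1 m2) // mulrACA.
Qed.

Definition torus_act_fun (g : hom (mon_alg k [set: M]) C)
    (p : hom (mon_alg k P) C) : hom (mon_alg k P) C :=
  of_character (torus_act_subproof g p).

Lemma torus_act_funE g p (m : {m | P m}) :
  torus_act_fun g p (chi k m) = g (chi k (incl_setT m)) * p (chi k m).
Proof. exact: of_characterE. Qed.

End Act.

Definition opp_setT (m : {m : M | setT m}) : {m : M | setT m} :=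
  exist _ (- sval m) Logic.I.

Lemma torus_inv_subproof C (g : hom (mon_alg k [set: M]) C) :
  is_character (fun m => g (chi k (opp_setT m))).
Proof.
have [g0 gD] := character_of g.
split=> [m m0|m m1 m2 e]; first by rewrite g0 //= m0 oppr0.
by apply: gD; rewrite /= e opprD.
Qed.

Lemma incl_setTT (m : {m : M | setT m}) : incl_setT m = m.
Proof. by case: m => m []. Qed.

Definition torus : grp k.
Proof.
refine (@Grp k (mon_alg k [set: M]) (@torus_act_fun [set: M])
  (fun C => of_character (character1 [set: M] C))
  (fun C g => of_character (torus_inv_subproof g)) _ _ _ _).
- move=> C g h l; apply: mon_ext => m.
  by rewrite !torus_act_funE !incl_setTT mulrA.
- move=> C g; apply: mon_ext => m.
  by rewrite torus_act_funE of_characterE mul1r.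
- move=> C g; apply: mon_ext => m.
  rewrite torus_act_funE !of_characterE incl_setTT.
  have [g0 gD] := character_of g.
  have m0 : setT (0 : M) by [].
  rewrite -(gD (exist _ 0 m0)); first by rewrite g0.
  by rewrite /= addNr.
- move=> C D f g h; apply: mon_ext => m.
  rewrite torus_act_funE -[LHS]/(f (torus_act_fun g h (chi k m))).
  by rewrite torus_act_funE rmorphM.
Defined.

Definition torus_act (P : set M) : gaction torus (Spec (mon_alg k P)).
Proof.
refine (@GAction k torus (Spec (mon_alg k P)) (@torus_act_fun P) _ _ _).
- move=> C p; apply: mon_ext => m; rewrite torus_act_funE.
  set u := (X in X * _ = _); have -> : u = 1; last by rewrite mul1r.
  exact: (of_characterE (character1 [set: M] C)).
- move=> C g h p; apply: mon_ext => m; rewrite !torus_act_funE.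
  by rewrite mulrA incl_setTT.
- move=> C D f g p; apply: mon_ext => m.
  rewrite torus_act_funE -[LHS]/(f (torus_act_fun g p (chi k m))).
  by rewrite torus_act_funE rmorphM.
Defined.

(* The identity of T, as a k-point of Spec k[P]. *)
Definition torus_one (P : set M) (A : alg k) : Spec (mon_alg k P) A :=
  of_character (character1 P A).

Lemma torus_one_nat (P : set M) (A A' : alg k) (f : hom A A') :
  kmap f (torus_one P A) = torus_one P A'.
Proof.
apply: mon_ext => m.
rewrite of_characterE -[LHS]/(f (torus_one P A (chi k m))).
by rewrite of_characterE rmorph1.
Qed.

End Torus.

(* N = Z^r consists of row vectors and M = Hom(N, Z) of column vectors, with
   the pairing given by the matrix product; N (x) R consists of real row
   vectors. *)
Section Toric.
Variables (R : realType) (r : nat).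

Definition Zbasis (b : 'I_r -> 'rV[int]_r) : Prop :=
  forall n : 'rV[int]_r, exists! c : 'rV[int]_r, n = \sum_i c 0 i *: b i.

Definition regular_cone (tau : set 'rV[R]_r) : Prop :=
  exists b : 'I_r -> 'rV[int]_r, Zbasis b /\
  tau = [set v | exists c : 'rV[R]_r, (forall i, 0 <= c 0 i) /\
                   v = \sum_i c 0 i *: map_mx intr (b i)].

Variable tau : set 'rV[R]_r.

Definition dual_lattice : set 'cV[int]_r :=
  [set m | forall v, tau v -> 0 <= (v *m map_mx intr m) 0 0].

Variable k : comPzRingType.

(* The stack Theta_tau = [U_tau / T], and its k-point (1, ..., 1). *)
Definition Theta : aff_cat k := quot_stack (torus_act k dual_lattice).

Definition Theta_one : functor (Spec_base k) Theta :=
  quot_point (torus_act k dual_lattice) (@torus_one_nat k _ dual_lattice).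

Section Stratum.
Variables (Mst : aff_cat k) (S : stack_space (Map_stack Theta Mst) -> Prop).

(* Z^+ -> Map(Theta_tau, M) -> M, where Z^+ is the part of Map(Theta_tau, M)
   supported on S. *)
Definition stratum_ev : functor (substack S) Mst :=
  fcomp (ev Mst Theta_one) (sub_incl S).

Definition higher_Theta_stratum : Prop :=
  union_of_components S /\ closed_embedding stratum_ev.

End Stratum.
End Toric.

Section PowerSeries.
Variable k : comNzRingType.

Record fps := Fps { fcoef : nat -> k }.
HB.instance Definition _ := gen_eqMixin fps.
HB.instance Definition _ := gen_choiceMixin fps.

Lemma fps_ext (f g : fps) : fcoef f =1 fcoef g -> f = g.
Proof. by case: f g => [f] [g] /= /funext ->. Qed.

Definition fps_zero := Fps (fun=> 0).
Definition fps_opp f := Fps (fun n => - fcoef f n).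
Definition fps_add f g := Fps (fun n => fcoef f n + fcoef g n).

Lemma fps_addA : associative fps_add.
Proof. by move=> f g h; apply: fps_ext => n /=; rewrite addrA. Qed.
Lemma fps_addC : commutative fps_add.
Proof. by move=> f g; apply: fps_ext => n /=; rewrite addrC. Qed.
Lemma fps_add0 : left_id fps_zero fps_add.
Proof. by move=> f; apply: fps_ext => n /=; rewrite add0r. Qed.
Lemma fps_addN : left_inverse fps_zero fps_opp fps_add.
Proof. by move=> f; apply: fps_ext => n /=; rewrite addNr. Qed.

HB.instance Definition _ :=
  GRing.isZmodule.Build fps fps_addA fps_addC fps_add0 fps_addN.

Definition fps_of_poly (p : {poly k}) : fps := Fps (fun n => p`_n).

Definition fps_mul f g :=
  Fps (fun n => \sum_(i < n.+1) fcoef f i * fcoef g (n - i)).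

Definition fps_trunc n (f : fps) : {poly k} := \poly_(i < n) fcoef f i.

Lemma trunc_mul (f g : fps) m n : (n < m)%N ->
  (fps_trunc m f * fps_trunc m g)`_n = fcoef (fps_mul f g) n.
Proof.
move=> nm; rewrite coefM; apply: eq_bigr => i _; rewrite !coef_poly.
by rewrite (leq_ltn_trans (leq_subr _ _) nm) (leq_ltn_trans _ nm) // -ltnS.
Qed.

Lemma fps_mulA : associative fps_mul.
Proof.
move=> f g h; apply: fps_ext => n; pose t := fps_trunc n.+1.
transitivity ((t f * (t g * t h))`_n).
  rewrite coefM; apply: eq_bigr => i _; rewrite coef_poly ltn_ord.
  congr (_ * _); by rewrite trunc_mul // ltnS leq_subr.
rewrite mulrA coefM; apply: eq_bigr => i _.
by rewrite coef_poly ltnS leq_subr trunc_mul.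
Qed.

Lemma fps_mulC : commutative fps_mul.
Proof.
by move=> f g; apply: fps_ext => n; rewrite -!(@trunc_mul _ _ n.+1) // mulrC.
Qed.

Lemma fps_mul1 : left_id (fps_of_poly 1) fps_mul.
Proof.
move=> f; apply: fps_ext => n /=.
rewrite big_ord_recl coef1 /= mul1r subn0 big1 ?addr0 // => i _.
by rewrite coef1 mul0r.
Qed.

Lemma fps_mulD : left_distributive fps_mul fps_add.
Proof.
move=> f g h; apply: fps_ext => n /=; rewrite -big_split /=.
by apply: eq_bigr => i _; rewrite mulrDl.
Qed.

HB.instance Definition _ := GRing.Zmodule_isComPzRing.Build fps
  fps_mulA fps_mulC fps_mul1 fps_mulD.

Definition fps_const (c : k) : fps := fps_of_poly c%:P.

Lemma fps_const_nmod : nmod_morphism fps_const.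
Proof.
split=> [|c d]; first by apply: fps_ext => n /=; rewrite coef0.
by apply: fps_ext => n; rewrite /= polyCD coefD.
Qed.
Lemma fps_const_monoid : monoid_morphism fps_const.
Proof. by split=> // c d; apply: fps_ext => n; rewrite /= polyCM coefM. Qed.
HB.instance Definition _ :=
  GRing.isNmodMorphism.Build k fps fps_const fps_const_nmod.
HB.instance Definition _ :=
  GRing.isMonoidMorphism.Build k fps fps_const fps_const_monoid.

(* k[[t]], and its closed point. *)
Definition pser : alg k := @Alg k fps fps_const.

Definition fcoef0 (f : fps) : k := fcoef f 0.

Lemma fcoef0_nmod : nmod_morphism fcoef0.
Proof. by []. Qed.
Lemma fcoef0_monoid : monoid_morphism fcoef0.
Proof.
split=> [|f g]; first by rewrite /fcoef0 /= coef1.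
by rewrite /fcoef0 /= big_ord1.
Qed.
HB.instance Definition _ := GRing.isNmodMorphism.Build fps k fcoef0 fcoef0_nmod.
HB.instance Definition _ :=
  GRing.isMonoidMorphism.Build fps k fcoef0 fcoef0_monoid.

Lemma closed_point_subproof c :
  fcoef0 (alg_str pser c) = alg_str (self_alg k) c.
Proof. by rewrite /fcoef0 /= coefC. Qed.

Definition closed_point : hom pser (self_alg k) :=
  @Hom k pser (self_alg k) fcoef0 closed_point_subproof.

Definition fps_t : pser := fps_of_poly 'X.

(* k((t)) = k[[t]][1/t], and the generic point of Spec k[[t]]. *)
Definition laurent : alg k := loc fps_t.

Definition generic_point : hom pser laurent := loc_map fps_t.

(* k[[t^(1/d)]] is k[[s]], as an extension of k[[t]] by t = s^d. *)
Section Ramification.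
Variables (d : nat) (d_gt0 : (0 < d)%N).

Definition fps_subst (f : fps) : fps :=
  Fps (fun n => if (d %| n)%N then fcoef f (n %/ d) else 0).

Lemma fps_subst_poly p : fps_subst (fps_of_poly p) = fps_of_poly (p \Po 'X^d).
Proof. by apply: fps_ext => n /=; rewrite coef_comp_poly_Xn. Qed.

Lemma fps_subst_nmod : nmod_morphism fps_subst.
Proof.
split=> [|f g]; apply: fps_ext => n /=; first by rewrite if_same.
by case: ifP => //; rewrite addr0.
Qed.

Lemma fps_subst_trunc f n i : (i <= n)%N ->
  fcoef (fps_subst f) i = (fps_trunc n.+1 f \Po 'X^d)`_i.
Proof.
move=> le_in; rewrite coef_comp_poly_Xn //= coef_poly.
by rewrite ltnS (leq_trans (leq_div _ _) le_in).
Qed.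

Lemma fps_subst_monoid : monoid_morphism fps_subst.
Proof.
split=> [|f g].
  by rewrite -[1]/(fps_of_poly 1) fps_subst_poly comp_polyC.
apply: fps_ext => n.
transitivity (((fps_trunc n.+1 f * fps_trunc n.+1 g) \Po 'X^d)`_n).
  rewrite coef_comp_poly_Xn //=; case: ifP => // _.
  by rewrite trunc_mul // ltnS leq_div.
rewrite comp_polyM coefM; apply: eq_bigr => i _.
have le_in : (i <= n)%N by rewrite -ltnS.
by rewrite (fps_subst_trunc f le_in) (fps_subst_trunc g (leq_subr i n)).
Qed.
HB.instance Definition _ :=
  GRing.isNmodMorphism.Build fps fps fps_subst fps_subst_nmod.
HB.instance Definition _ :=
  GRing.isMonoidMorphism.Build fps fps fps_subst fps_subst_monoid.

Lemma ramify_subproof c : fps_subst (alg_str pser c) = alg_str pser c.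
Proof. by rewrite /= /fps_const fps_subst_poly comp_polyC. Qed.

Definition ramify : hom pser pser := @Hom k pser pser fps_subst ramify_subproof.

Lemma ramify_t : ramify fps_t = fps_t ^+ d.
Proof.
rewrite /= /fps_t fps_subst_poly comp_polyX.
elim: d => [|n IHn] //; rewrite !exprS -IHn.
by apply: fps_ext => m; rewrite /= coefM.
Qed.

Lemma laurent_ramify_subproof :
  hcomp generic_point ramify fps_t * loc_inv fps_t ^+ d = 1.
Proof.
rewrite -[hcomp _ _ _]/(generic_point (ramify fps_t)) ramify_t rmorphXn.
by rewrite -exprMn loc_invP expr1n.
Qed.

(* The inclusion of k((t)) in k((t^(1/d))) = k((s)). *)
Definition laurent_ramify : hom laurent laurent :=
  loc_lift laurent_ramify_subproof.

End Ramification.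
End PowerSeries.

(* Main.v *)
(* After trivializing torsors, [f] is a point [fh] of [H] over k[[t]]. Moving it
   by a Laurent point of [G] and ramifying, its limit becomes a point [z] through
   which the limit [F0] of the corresponding map from Theta_tau factors over [BT];
   hence a homomorphism [lam : T -> G] fixing [z]. Write the orbit [lam(x) f], in
   a chart at [z], as a power series in [t] with coefficients in k[M]. If all
   weights up to order [n] lie in the dual cone, then [f] modulo t^(n+1) lies in
   the stratum (extend the equivariant family to U_tau by descent); so some order
   contains a weight [m] negative on a ray [b_l]. Consider the greatest slope
   -<b_l, m> q / i = p of such weights. The edge part of order [j] is a tangent
   vector [zeta] at [z]. If a weight component of [zeta] is tangent to the orbit of
   [G], it is killed by acting with the exponential of a weight vector of Lie G.
   Otherwise lam_(b_l)(s^q) f(s^p) has a limit, and this limit is outside the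
   stratum: were it inside, then so would be [zeta], and a tangent vector of the
   stratum whose weights are negative on [b_l] is tangent to the orbit. As the
   tangent weights are finite in number, the slope cannot decrease forever. *)

Require Import Defs.
From HB Require Import structures.
From mathcomp Require Import all_boot all_order all_algebra.
From mathcomp Require Import boolp classical_sets reals.
From mathcomp Require Import zify ring.
Import Defs.

Set Implicit Arguments.
Unset Strict Implicit.
Unset Printing Implicit Defensive.
Import GRing.Theory Num.Theory.
Local Open Scope ring_scope.
Local Open Scope classical_set_scope.

(** * Homomorphisms, square-zero extensions, monoid algebras *)

(** As [H] is an arbitrary scheme of finite type, [z] need not have an affine neighbourhood stable
    under [lam]. Weights are therefore read off only on formal thickenings of [z], over which any
    open chart at [z] contains the whole orbit. A coefficient of the orbit has an intrinsic weight
    only if products of terms of lower order do not reach it; [admissible] and [extremal] keep track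
    of this. A map out of Theta_tau must be defined on all torsors, which are only étale-locally
    trivial. Descent rests on purity of étale covers, obtained from formal étaleness and
    surjectivity by a Krull intersection argument instead of flatness. Points of torsors play the
    role of local trivializations. The slopes could decrease forever if their denominators grew. The
    denominator is fixed in advance, as a factorial depending on two bounds: the order to which the
    curve can agree with the stratum, which no change by G(k[[t]]) affects, and the most negative
    pairing of a ray with a tangent weight at [z]. The argument runs by contradiction, under the
    hypothesis that no modification leaves the stratum. *)

Section HomBuild.
Variable k : comPzRingType.

Section HomOf.
Variables (A B : alg k) (f : A -> B).
Hypothesis fD : forall x y, f (x + y) = f x + f y.
Hypothesis fM : forall x y, f (x * y) = f x * f y.
Hypothesis fk : forall c, f (alg_str A c) = alg_str B c.

Lemma hom_of_nmod : nmod_morphism f.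
Proof.
split=> [|x y]; last exact: fD.
by rewrite -(rmorph0 (alg_str A)) fk rmorph0.
Qed.

Lemma hom_of_monoid : monoid_morphism f.
Proof.
split=> [|x y]; last exact: fM.
by rewrite -(rmorph1 (alg_str A)) fk rmorph1.
Qed.

Definition hom_of_rmorph : {rmorphism A -> B} :=
  GRing.RMorphism.Pack (GRing.RMorphism.Class
    (GRing.isNmodMorphism.Build A B f hom_of_nmod)
    (GRing.isMonoidMorphism.Build A B f hom_of_monoid)).

Definition hom_of : hom A B := @Hom k A B hom_of_rmorph fk.

Lemma hom_ofE x : hom_of x = f x. Proof. by []. Qed.
End HomOf.

Definition kin (A : alg k) : hom (self_alg k) A :=
  @Hom k (self_alg k) A (alg_str A) (fun=> erefl).

Lemma kin_uniq (A : alg k) (f g : hom (self_alg k) A) : f = g.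
Proof. by apply: hom_ext => c; rewrite (homE f c) (homE g c). Qed.

Lemma hcompE (A B C : alg k) (g : hom B C) (f : hom A B) x :
  hcomp g f x = g (f x).
Proof. by []. Qed.

Lemma hom_factor (C B D : alg k) (i : hom B D) (c : hom C D) :
  injective i -> (forall x, exists b, i b = c x) ->
  exists c' : hom C B, hcomp i c' = c.
Proof.
move=> inj ex; pose f x := projT1 (cid (ex x)).
have fE x : i (f x) = c x by rewrite /f; case: cid.
have fD x y : f (x + y) = f x + f y by apply: inj; rewrite rmorphD !fE rmorphD.
have fM x y : f (x * y) = f x * f y by apply: inj; rewrite rmorphM !fE rmorphM.
have fk a : f (alg_str C a) = alg_str B a by apply: inj; rewrite fE !homE.
by exists (hom_of fD fM fk); apply: hom_ext => x; rewrite hcompE hom_ofE fE.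
Qed.

End HomBuild.

(* Square-zero extension [B + eps D]. *)
Section SquareZero.
Variables (k : comPzRingType) (B : alg k) (D : alg B).

Record sqz_car := Sqz { sq0 : B; sq1 : D }.
HB.instance Definition _ := gen_eqMixin sqz_car.
HB.instance Definition _ := gen_choiceMixin sqz_car.

Lemma sqz_ext (x y : sqz_car) : sq0 x = sq0 y -> sq1 x = sq1 y -> x = y.
Proof. by case: x y => [a b] [c d] /= -> ->. Qed.

Definition sqz_zero := Sqz 0 0.
Definition sqz_opp x := Sqz (- sq0 x) (- sq1 x).
Definition sqz_add x y := Sqz (sq0 x + sq0 y) (sq1 x + sq1 y).
Definition sqz_one := Sqz 1 0.
Definition sqz_mul x y := Sqz (sq0 x * sq0 y)
  (alg_str D (sq0 x) * sq1 y + alg_str D (sq0 y) * sq1 x).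

Lemma sqz_addA : associative sqz_add.
Proof. by move=> x y z; apply: sqz_ext; rewrite /= addrA. Qed.
Lemma sqz_addC : commutative sqz_add.
Proof. by move=> x y; apply: sqz_ext; rewrite /= addrC. Qed.
Lemma sqz_add0 : left_id sqz_zero sqz_add.
Proof. by move=> x; apply: sqz_ext; rewrite /= add0r. Qed.
Lemma sqz_addN : left_inverse sqz_zero sqz_opp sqz_add.
Proof. by move=> x; apply: sqz_ext; rewrite /= addNr. Qed.
HB.instance Definition _ :=
  GRing.isZmodule.Build sqz_car sqz_addA sqz_addC sqz_add0 sqz_addN.

Lemma sqz_mulA : associative sqz_mul.
Proof.
move=> x y z; apply: sqz_ext => /=; first exact: mulrA.
by rewrite !rmorphM !mulrDr !mulrA addrA; congr (_ + _ + _); rewrite mulrAC mulrC ?mulrA.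
Qed.
Lemma sqz_mulC : commutative sqz_mul.
Proof. by move=> x y; apply: sqz_ext => /=; [exact: mulrC | exact: addrC]. Qed.
Lemma sqz_mul1 : left_id sqz_one sqz_mul.
Proof. by move=> x; apply: sqz_ext; rewrite /= ?mul1r // rmorph1 !mul1r mulr0 addr0. Qed.
Lemma sqz_mulD : left_distributive sqz_mul sqz_add.
Proof.
move=> x y z; apply: sqz_ext; rewrite /= ?mulrDl // rmorphD mulrDl mulrDr.
by rewrite !addrA; congr (_ + _); rewrite addrAC.
Qed.
HB.instance Definition _ := GRing.Zmodule_isComPzRing.Build sqz_car
  sqz_mulA sqz_mulC sqz_mul1 sqz_mulD.

Definition sqz_in (b : B) : sqz_car := Sqz b 0.
Lemma sqz_in_nmod : nmod_morphism sqz_in.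
Proof. by split=> // b c; apply: sqz_ext; rewrite /= ?addr0. Qed.
Lemma sqz_in_monoid : monoid_morphism sqz_in.
Proof. by split=> // b c; apply: sqz_ext; rewrite /= ?mulr0 ?addr0. Qed.
HB.instance Definition _ :=
  GRing.isNmodMorphism.Build B sqz_car sqz_in sqz_in_nmod.
HB.instance Definition _ :=
  GRing.isMonoidMorphism.Build B sqz_car sqz_in sqz_in_monoid.

Definition sqz : alg k := @Alg k sqz_car (sqz_in \o alg_str B).

Definition sqz_inh : hom B sqz := @Hom k B sqz sqz_in (fun=> erefl).

Definition sqz_pr : hom sqz B :=
  @hom_of k sqz B sq0 (fun x y => erefl) (fun x y => erefl) (fun c => erefl).

End SquareZero.
Arguments Sqz {k B D}.

Section SquareZeroMap.
Variables (k : comPzRingType) (B B' : alg k) (D : alg B) (D' : alg B').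
Variables (f : hom B B') (g : D -> D').
Hypothesis gD : forall x y, g (x + y) = g x + g y.
Hypothesis gM : forall b d, g (alg_str D b * d) = alg_str D' (f b) * g d.

(** The infinitesimal part is mapped by a semilinear [g]. Coefficient extractions, which are linear
    but not multiplicative, thus induce ring maps of square-zero extensions; weight components are
    projected in this way. *)
Definition sqz_map : hom (sqz D) (sqz D').
Proof.
refine (@hom_of k (sqz D) (sqz D')
  (fun x => Sqz (f (sq0 x)) (g (sq1 x)) : sqz_car D') _ _ _).
- by move=> x y; apply: sqz_ext; rewrite /= ?rmorphD // gD.
- by move=> x y; apply: sqz_ext; rewrite /= ?rmorphM // gD !gM.
- move=> c; apply: sqz_ext; rewrite /= ?homE //.
  by have := gD 0 0; rewrite addr0 -{1}[g 0]addr0 => /addrI <-.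
Defined.

End SquareZeroMap.

(* The monoid algebra [R[M]], as finitely supported functions. *)
Section MonAlg.
Variables (R : comPzRingType) (M : nmodType).

Definition finsup (f : M -> R) := exists s : seq M, forall m, f m != 0 -> m \in s.

Record monalg := MonAlg { mc :> M -> R; mcP : finsup mc }.
HB.instance Definition _ := gen_eqMixin monalg.
HB.instance Definition _ := gen_choiceMixin monalg.

Lemma monalg_ext (f g : monalg) : f =1 g -> f = g.
Proof.
case: f g => [f hf] [g hg] /= /funext e; subst g.
by rewrite (Prop_irrelevance hf hg).
Qed.

Definition supp (f : monalg) : seq M := undup (projT1 (cid (mcP f))).

Lemma supp_uniq f : uniq (supp f). Proof. exact: undup_uniq. Qed.

Lemma suppP (f : monalg) m : f m != 0 -> m \in supp f.
Proof. by rewrite /supp; case: cid => s /= H /H; rewrite mem_undup. Qed.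

(** Coefficients, products, evaluations and twists in R[M] are all of this form. The list [supp f]
    is an arbitrary choice; by [prE] any duplicate-free list containing the support gives the same
    sum. *)
Definition pr (V : nmodType) (F : M -> R -> V) (f : monalg) : V :=
  \sum_(m <- supp f) F m (f m).

Lemma prE (V : nmodType) (F : M -> R -> V) (f : monalg) (s : seq M) :
  (forall m, F m 0 = 0) -> uniq s -> (forall m, f m != 0 -> m \in s) ->
  pr F f = \sum_(m <- s) F m (f m).
Proof.
move=> F0 us hs; rewrite /pr.
have red (t : seq M) : \sum_(m <- t) F m (f m) =
    \sum_(m <- [seq m <- t | f m != 0]) F m (f m).
  rewrite big_filter [RHS]big_mkcond /=; apply: eq_bigr => m _.
  by case: eqP => //= ->; rewrite F0.
rewrite red [RHS]red; apply: perm_big; apply: uniq_perm.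
- exact/filter_uniq/supp_uniq.
- exact: filter_uniq.
- move=> m; rewrite !mem_filter; case: (boolP (f m != 0)) => //= h.
  by rewrite suppP // hs.
Qed.

Definition ma_zero : monalg.
Proof. by exists (fun=> 0); exists [::] => m; rewrite eqxx. Defined.
Definition ma_opp (f : monalg) : monalg.
Proof.
by exists (fun m => - f m); exists (supp f) => m; rewrite oppr_eq0; exact: suppP.
Defined.
Definition ma_add (f g : monalg) : monalg.
Proof.
exists (fun m => f m + g m); exists (supp f ++ supp g) => m h.
rewrite mem_cat; case: (eqVneq (f m) 0) h => [->|/suppP -> //].
by rewrite add0r => /suppP ->; rewrite orbT.
Defined.
Definition ma_d (m : M) (a : R) : monalg.
Proof.
exists (fun i => if i == m then a else 0); exists [:: m] => i.
by rewrite inE; case: (i == m); rewrite ?eqxx.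
Defined.

Lemma ma_addA : associative ma_add.
Proof. by move=> x y z; apply: monalg_ext => m; rewrite /= addrA. Qed.
Lemma ma_addC : commutative ma_add.
Proof. by move=> x y; apply: monalg_ext => m; rewrite /= addrC. Qed.
Lemma ma_add0 : left_id ma_zero ma_add.
Proof. by move=> x; apply: monalg_ext => m; rewrite /= add0r. Qed.
Lemma ma_addN : left_inverse ma_zero ma_opp ma_add.
Proof. by move=> x; apply: monalg_ext => m; rewrite /= addNr. Qed.
HB.instance Definition _ :=
  GRing.isZmodule.Build monalg ma_addA ma_addC ma_add0 ma_addN.

Lemma prD (V : nmodType) (F : M -> R -> V) (f g : monalg) :
  (forall m, F m 0 = 0) -> (forall m a b, F m (a + b) = F m a + F m b) ->
  pr F (f + g) = pr F f + pr F g.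
Proof.
move=> F0 FD; pose s := undup (supp f ++ supp g).
have us : uniq s by exact: undup_uniq.
rewrite !(@prE _ _ _ s) //.
- by rewrite -big_split; apply: eq_bigr => m _; rewrite /= FD.
- by move=> m /suppP h; rewrite mem_undup mem_cat h orbT.
- by move=> m /suppP h; rewrite mem_undup mem_cat h.
- move=> m h; rewrite mem_undup mem_cat.
  by case: (eqVneq (f m) 0) h => [e|/suppP -> //]; rewrite /= e add0r => /suppP ->;
    rewrite orbT.
Qed.

Lemma pr_d (V : nmodType) (F : M -> R -> V) m a :
  (forall m, F m 0 = 0) -> pr F (ma_d m a) = F m a.
Proof.
move=> F0; rewrite (@prE _ _ _ [:: m]) //= ?big_seq1 /= ?eqxx // => i.
by rewrite inE; case: (i == m); rewrite ?eqxx.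
Qed.

Lemma coefE (f : monalg) m : f m = pr (fun i a => if i == m then a else 0) f.
Proof.
rewrite /pr -big_mkcond /=; case: (boolP (m \in supp f)) => h.
  rewrite -big_filter (_ : [seq _ <- _ | _] = [:: m]) ?big_seq1 //.
  apply: perm_small_eq => //; apply: uniq_perm => //.
    exact/filter_uniq/supp_uniq.
  by move=> i; rewrite mem_filter inE; case: eqP => //= ->.
rewrite big_seq_cond big_pred0 => [|i]; last first.
  by case: eqP => [->|]; rewrite ?andbF // (negbTE h).
by apply/eqP; apply: contraNT h => /suppP.
Qed.

Definition ma_mulf (f g : monalg) (m : M) : R :=
  pr (fun i a => pr (fun j b => if i + j == m then a * b else 0) g) f.

Lemma ma_mulf_fin f g : finsup (ma_mulf f g).
Proof.
exists [seq i + j | i <- supp f, j <- supp g] => m; apply: contraNT => h.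
rewrite /ma_mulf /pr big_seq big1 // => i hi; rewrite big_seq big1 // => j hj.
by case: eqP => // e; case/negP: h; rewrite -e; apply: allpairs_f.
Qed.

Definition ma_mul f g := MonAlg (ma_mulf_fin f g).

Lemma prM (V : nmodType) (F : M -> R -> V) (f g : monalg) :
  (forall m, F m 0 = 0) -> (forall m a b, F m (a + b) = F m a + F m b) ->
  pr F (ma_mul f g) = pr (fun i a => pr (fun j b => F (i + j) (a * b)) g) f.
Proof.
move=> F0 FD; pose s := undup [seq i + j | i <- supp f, j <- supp g].
have Fs (I : Type) (r : seq I) m (h : I -> R) :
    F m (\sum_(i <- r) h i) = \sum_(i <- r) F m (h i).
  by elim: r => [|x r IH]; rewrite ?big_nil // !big_cons FD IH.
rewrite (@prE _ _ _ s) //; last 2 first.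
- exact: undup_uniq.
- move=> m; apply: contraNT; rewrite mem_undup => h.
  rewrite /= /ma_mulf /pr big_seq big1 // => i hi; rewrite big_seq big1 // => j hj.
  by case: eqP => // e; case/negP: h; rewrite -e; apply: allpairs_f.
rewrite /= /ma_mulf /pr; under eq_bigr do rewrite Fs.
rewrite exchange_big /=; rewrite big_seq [RHS]big_seq; apply: eq_bigr => i hi.
under eq_bigr do rewrite Fs.
rewrite exchange_big /=; rewrite big_seq [RHS]big_seq; apply: eq_bigr => j hj.
rewrite (bigD1_seq (i + j)) /= ?undup_uniq ?mem_undup ?allpairs_f //.
rewrite eqxx big1 ?addr0 // => m; rewrite eq_sym => /negbTE ->.
exact: F0.
Qed.

Lemma eq_pr (V : nmodType) (F G : M -> R -> V) (f : monalg) :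
  (forall m a, F m a = G m a) -> pr F f = pr G f.
Proof. by move=> e; apply: eq_bigr => m _. Qed.

Lemma pr_exch (V : nmodType) (F : M -> R -> M -> R -> V) (f g : monalg) :
  pr (fun i a => pr (fun j b => F i a j b) g) f =
  pr (fun j b => pr (fun i a => F i a j b) f) g.
Proof. exact: exchange_big. Qed.

Lemma pr0 (V : nmodType) (F : M -> R -> V) (f : monalg) :
  (forall m, F m (f m) = 0) -> pr F f = 0.
Proof. by move=> h; rewrite /pr big1. Qed.

Lemma ma_mulC : commutative ma_mul.
Proof.
move=> f g; apply: monalg_ext => m; rewrite /= /ma_mulf pr_exch.
by apply: eq_pr => i a; apply: eq_pr => j b; rewrite addrC mulrC.
Qed.

(** A coefficient is itself of the form [pr] ([coefE]), so [prM] unfolds both sides into the same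
    triple sum. *)
Lemma ma_mulA : associative ma_mul.
Proof.
move=> f g h; apply: monalg_ext => m; rewrite [LHS]coefE [RHS]coefE.
have D0 i : (if i == m then 0 else 0) = 0 :> R by case: eqP.
have DD i (a b : R) : (if i == m then a + b else 0) =
  (if i == m then a else 0) + (if i == m then b else 0).
  by case: eqP; rewrite ?addr0.
have H i (c : R) : (if i == m then c * 0 else 0) = 0 by rewrite mulr0.
have H' i (c : R) : (if i == m then 0 * c else 0) = 0 by rewrite mul0r.
rewrite !prM //.
transitivity (pr (fun i a => pr (fun j b => pr (fun l c =>
   if i + (j + l) == m then a * (b * c) else 0) h) g) f).
  apply: eq_pr => i a; rewrite prM // => j x y.
  by rewrite mulrDr; case: eqP; rewrite ?addr0.
- apply: eq_pr => i a; apply: eq_pr => j b; apply: eq_pr => l c.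
  by rewrite addrA mulrA.
- by move=> i; apply: pr0 => j; rewrite mul0r if_same.
- move=> i a b; rewrite /pr -big_split; apply: eq_bigr => j _ /=.
  by rewrite mulrDl; case: eqP; rewrite ?addr0.
Qed.

Lemma ma_mul1 : left_id (ma_d 0 1) ma_mul.
Proof.
move=> f; apply: monalg_ext => m; rewrite /= /ma_mulf pr_d => [|i]; last first.
  by apply: pr0 => j; rewrite mul0r if_same.
by rewrite [RHS]coefE; apply: eq_pr => i a; rewrite add0r mul1r.
Qed.

Lemma ma_mulD : left_distributive ma_mul ma_add.
Proof.
move=> f g h; apply: monalg_ext => m; rewrite /= /ma_mulf -[ma_add f g]/(f + g).
apply: prD => [i|i a b]; first by apply: pr0 => j; rewrite mul0r if_same.
rewrite /pr -big_split; apply: eq_bigr => j _ /=.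
by rewrite mulrDl; case: eqP; rewrite ?addr0.
Qed.

HB.instance Definition _ := GRing.Zmodule_isComPzRing.Build monalg
  ma_mulA ma_mulC ma_mul1 ma_mulD.

Lemma ma_dD m a b : ma_d m (a + b) = ma_d m a + ma_d m b.
Proof. by apply: monalg_ext => i /=; case: eqP; rewrite ?addr0. Qed.

Lemma ma_dM m n a b : ma_d m a * ma_d n b = ma_d (m + n) (a * b).
Proof.
apply: monalg_ext => i /=; rewrite -[LHS]/(ma_mulf _ _ i) /ma_mulf pr_d => [|j].
  by rewrite pr_d => [|j]; rewrite ?mulr0 ?if_same // eq_sym.
by apply: pr0 => l; rewrite mul0r if_same.
Qed.

Definition ma_c (a : R) : monalg := ma_d 0 a.
Lemma ma_c_nmod : nmod_morphism ma_c.
Proof.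
split=> [|a b]; last exact: ma_dD.
by apply: monalg_ext => i /=; rewrite if_same.
Qed.
Lemma ma_c_monoid : monoid_morphism ma_c.
Proof. by split=> // a b; rewrite /ma_c ma_dM addr0. Qed.
HB.instance Definition _ := GRing.isNmodMorphism.Build R monalg ma_c ma_c_nmod.
HB.instance Definition _ :=
  GRing.isMonoidMorphism.Build R monalg ma_c ma_c_monoid.

Definition mona : alg R := @Alg R monalg ma_c.

Lemma monaMd (a : R) (f : monalg) m : (ma_c a * f) m = a * f m.
Proof.
rewrite -[LHS]/(ma_mulf _ _ m) /ma_mulf pr_d => [|i]; last first.
  by apply: pr0 => l; rewrite mul0r if_same.
rewrite [in RHS]coefE /pr mulr_sumr; apply: eq_bigr => i _.
by rewrite add0r; case: eqP; rewrite ?mulr0.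
Qed.

Lemma monalg_sum (f : monalg) : f = \sum_(m <- supp f) ma_d m (f m).
Proof.
apply: monalg_ext => i; rewrite [LHS]coefE /pr.
elim: (supp f) => [|m s IH]; rewrite ?big_nil // !big_cons IH /=.
by rewrite [m == i]eq_sym.
Qed.

Section Ev.
Variables (D : alg R) (chi : M -> D).
Hypothesis chi0 : chi 0 = 1.
Hypothesis chiD : forall m n, chi (m + n) = chi m * chi n.

Definition mona_ev_fun (f : mona) : D := pr (fun m a => alg_str D a * chi m) f.

Definition mona_ev : hom mona D.
Proof.
refine (@hom_of R mona D mona_ev_fun _ _ _).
- move=> f g; apply: prD => [m|m a b]; first by rewrite rmorph0 mul0r.
  by rewrite rmorphD mulrDl.
- move=> f g; rewrite -[f * g]/(ma_mul f g) /mona_ev_fun prM => [|m|m a b].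
  + rewrite /pr mulr_suml; apply: eq_bigr => i _.
    rewrite mulr_sumr; apply: eq_bigr => j _.
    by rewrite rmorphM chiD mulrACA.
  + by rewrite rmorph0 mul0r.
  + by rewrite rmorphD mulrDl.
- by move=> c; rewrite /mona_ev_fun pr_d => [|m]; rewrite ?chi0 ?mulr1 // rmorph0 mul0r.
Defined.

Lemma mona_ev_d m a : mona_ev (ma_d m a) = alg_str D a * chi m.
Proof. by rewrite hom_ofE /mona_ev_fun pr_d // => i; rewrite rmorph0 mul0r. Qed.
End Ev.

End MonAlg.
Arguments mona_ev {R M D chi}.

(** * Subalgebras, quotients and finitely generated ideals *)

Section SubAlg.
Variables (k : comPzRingType) (B : alg k) (S : set B).

Definition subalg_closed : Prop :=
  [/\ forall c, S (alg_str B c), forall x y, S x -> S y -> S (x + y)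
    & forall x y, S x -> S y -> S (x * y)].

Hypothesis hS : subalg_closed.

Definition sub_car of subalg_closed := {x : B | S x}.
Local Notation T := (sub_car hS).
HB.instance Definition _ := gen_eqMixin T.
HB.instance Definition _ := gen_choiceMixin T.

Lemma sub_ext (x y : T) : sval x = sval y -> x = y.
Proof. by case: x y => [x hx] [y hy] /= e; apply: eq_exist. Qed.

Let Sk c : S (alg_str B c). Proof. by case: hS. Qed.
Let SD x y : S x -> S y -> S (x + y). Proof. by case: hS => _ + _; exact. Qed.
Let SM x y : S x -> S y -> S (x * y). Proof. by case: hS => _ _; exact. Qed.
Let S0 : S 0. Proof. by rewrite -(rmorph0 (alg_str B)). Qed.
Let S1 : S 1. Proof. by rewrite -(rmorph1 (alg_str B)). Qed.
Let SN x : S x -> S (- x).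
Proof. by move=> Sx; rewrite -mulN1r -(rmorphN1 (alg_str B)); exact: SM. Qed.

Definition sub_zero : T := exist _ 0 S0.
Definition sub_one : T := exist _ 1 S1.
Definition sub_opp (x : T) : T := exist _ _ (SN (svalP x)).
Definition sub_add (x y : T) : T := exist _ _ (SD (svalP x) (svalP y)).
Definition sub_mul (x y : T) : T := exist _ _ (SM (svalP x) (svalP y)).

Lemma sub_addA : associative sub_add.
Proof. by move=> x y z; apply: sub_ext; rewrite /= addrA. Qed.
Lemma sub_addC : commutative sub_add.
Proof. by move=> x y; apply: sub_ext; rewrite /= addrC. Qed.
Lemma sub_add0 : left_id sub_zero sub_add.
Proof. by move=> x; apply: sub_ext; rewrite /= add0r. Qed.
Lemma sub_addN : left_inverse sub_zero sub_opp sub_add.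
Proof. by move=> x; apply: sub_ext; rewrite /= addNr. Qed.
HB.instance Definition _ :=
  GRing.isZmodule.Build T sub_addA sub_addC sub_add0 sub_addN.
Lemma sub_mulA : associative sub_mul.
Proof. by move=> x y z; apply: sub_ext; rewrite /= mulrA. Qed.
Lemma sub_mulC : commutative sub_mul.
Proof. by move=> x y; apply: sub_ext; rewrite /= mulrC. Qed.
Lemma sub_mul1 : left_id sub_one sub_mul.
Proof. by move=> x; apply: sub_ext; rewrite /= mul1r. Qed.
Lemma sub_mulD : left_distributive sub_mul sub_add.
Proof. by move=> x y z; apply: sub_ext; rewrite /= mulrDl. Qed.
HB.instance Definition _ := GRing.Zmodule_isComPzRing.Build T
  sub_mulA sub_mulC sub_mul1 sub_mulD.

Definition sub_str (c : k) : T := exist _ _ (Sk c).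
Lemma sub_str_nmod : nmod_morphism sub_str.
Proof.
by split=> [|b c]; apply: sub_ext; rewrite /= ?rmorph0 ?rmorphD.
Qed.
Lemma sub_str_monoid : monoid_morphism sub_str.
Proof. by split=> [|b c]; apply: sub_ext; rewrite /= ?rmorph1 ?rmorphM. Qed.
HB.instance Definition _ := GRing.isNmodMorphism.Build k T sub_str sub_str_nmod.
HB.instance Definition _ :=
  GRing.isMonoidMorphism.Build k T sub_str sub_str_monoid.

Definition subalg : alg k := @Alg k T sub_str.

Definition sub_inc : hom subalg B :=
  @hom_of k subalg B (fun x => sval x) (fun x y => erefl) (fun x y => erefl)
    (fun c => erefl).

Lemma sub_inc_inj : injective sub_inc.
Proof. by move=> x y /sub_ext. Qed.

End SubAlg.

Section Quot.
Variables (k : comPzRingType) (A : alg k) (I : set A).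

Definition is_ideal : Prop :=
  [/\ I 0, forall x y, I x -> I y -> I (x + y) & forall x y, I y -> I (x * y)].

Hypothesis hI : is_ideal.

Definition quot_car of is_ideal :=
  {P : A -> Prop | exists a, P = (fun b => I (b - a))}.
Local Notation T := (quot_car hI).
HB.instance Definition _ := gen_eqMixin T.
HB.instance Definition _ := gen_choiceMixin T.

Definition qpi_fun (a : A) : T := exist _ _ (ex_intro _ a erefl).
Definition qrepr (p : T) : A := projT1 (cid (projT2 p)).

Let IN x : I x -> I (- x).
Proof. by case: hI => _ _ H /(H (-1)); rewrite mulN1r. Qed.
Let ID x y : I x -> I y -> I (x + y). Proof. by case: hI => _ + _; exact. Qed.

Lemma qpiP a b : qpi_fun a = qpi_fun b <-> I (a - b).
Proof.
split=> [/(congr1 sval) /= e|h].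
  by move: (congr1 (fun P => P a) e) => /= <-; rewrite subrr; case: hI.
apply: eq_exist; apply/funext => c; apply/propext; split=> hc.
  by have := ID hc h; rewrite addrA subrK.
by have := ID hc (IN h); rewrite opprB addrA subrK.
Qed.

Lemma qreprK p : qpi_fun (qrepr p) = p.
Proof. by case: p => P HP; apply: eq_exist; rewrite /qrepr /=; case: cid. Qed.

Lemma qrepr_pi a : I (qrepr (qpi_fun a) - a).
Proof. by apply/qpiP; rewrite qreprK. Qed.

Definition q_add p q := qpi_fun (qrepr p + qrepr q).
Definition q_mul p q := qpi_fun (qrepr p * qrepr q).
Definition q_opp p := qpi_fun (- qrepr p).

Lemma q_addE a b : q_add (qpi_fun a) (qpi_fun b) = qpi_fun (a + b).
Proof.
apply/qpiP; rewrite opprD addrACA; apply: ID; exact: qrepr_pi.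
Qed.
Lemma q_mulE a b : q_mul (qpi_fun a) (qpi_fun b) = qpi_fun (a * b).
Proof.
apply/qpiP; set x := qrepr _; set y := qrepr _.
have -> : x * y - a * b = x * (y - b) + b * (x - a) by ring.
by apply: ID; case: hI => _ _; apply; exact: qrepr_pi.
Qed.
Lemma q_oppE a : q_opp (qpi_fun a) = qpi_fun (- a).
Proof. by apply/qpiP; rewrite -opprD; apply: IN; exact: qrepr_pi. Qed.

Lemma q_ind (P : T -> Prop) : (forall a, P (qpi_fun a)) -> forall p, P p.
Proof. by move=> H p; rewrite -(qreprK p). Qed.

Lemma q_addA : associative q_add.
Proof.
by elim/q_ind => a; elim/q_ind => b; elim/q_ind => c; rewrite !q_addE addrA.
Qed.
Lemma q_addC : commutative q_add.
Proof. by elim/q_ind => a; elim/q_ind => b; rewrite !q_addE addrC. Qed.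
Lemma q_add0 : left_id (qpi_fun 0) q_add.
Proof. by elim/q_ind => a; rewrite !q_addE add0r. Qed.
Lemma q_addN : left_inverse (qpi_fun 0) q_opp q_add.
Proof. by elim/q_ind => a; rewrite q_oppE q_addE addNr. Qed.
HB.instance Definition _ := GRing.isZmodule.Build T q_addA q_addC q_add0 q_addN.
Lemma q_mulA : associative q_mul.
Proof.
by elim/q_ind => a; elim/q_ind => b; elim/q_ind => c; rewrite !q_mulE mulrA.
Qed.
Lemma q_mulC : commutative q_mul.
Proof. by elim/q_ind => a; elim/q_ind => b; rewrite !q_mulE mulrC. Qed.
Lemma q_mul1 : left_id (qpi_fun 1) q_mul.
Proof. by elim/q_ind => a; rewrite !q_mulE mul1r. Qed.
Lemma q_mulD : left_distributive q_mul q_add.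
Proof.
elim/q_ind => a; elim/q_ind => b; elim/q_ind => c.
by rewrite !(q_addE, q_mulE) mulrDl.
Qed.
HB.instance Definition _ := GRing.Zmodule_isComPzRing.Build T
  q_mulA q_mulC q_mul1 q_mulD.

Lemma qpi_nmod : nmod_morphism qpi_fun.
Proof. by split=> // a b; rewrite -q_addE. Qed.
Lemma qpi_monoid : monoid_morphism qpi_fun.
Proof. by split=> // a b; rewrite -q_mulE. Qed.
HB.instance Definition _ := GRing.isNmodMorphism.Build A T qpi_fun qpi_nmod.
HB.instance Definition _ := GRing.isMonoidMorphism.Build A T qpi_fun qpi_monoid.

(* As an A-algebra and as a k-algebra. *)
Definition quotA : alg A := @Alg A T qpi_fun.
Definition quot : alg k := restr quotA.
Definition qpi : hom A quot := restr_str quotA.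

Lemma qpi_surj (y : quot) : exists x, qpi x = y.
Proof. by exists (qrepr y); exact: qreprK. Qed.

Lemma qpi0 a : qpi a = 0 <-> I a.
Proof.
have -> : (0 : quot) = qpi 0 by rewrite rmorph0.
by split=> [/qpiP|h]; [rewrite subr0 | apply/qpiP; rewrite subr0].
Qed.

End Quot.

Lemma hom_quot (k : comPzRingType) (A B C : alg k) (p : hom A B) (f : hom A C) :
  (forall y, exists x, p x = y) -> (forall a, p a = 0 -> f a = 0) ->
  exists g : hom B C, hcomp g p = f.
Proof.
move=> surj ker; pose g y := f (projT1 (cid (surj y))).
have gE x : g (p x) = f x.
  rewrite /g; case: cid => x' /= e; apply/eqP; rewrite -subr_eq0 -rmorphB.
  by rewrite ker // rmorphB e subrr.
have gD x y : g (x + y) = g x + g y.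
  have [a <-] := surj x; have [b <-] := surj y.
  by rewrite -rmorphD !gE rmorphD.
have gM x y : g (x * y) = g x * g y.
  have [a <-] := surj x; have [b <-] := surj y.
  by rewrite -rmorphM !gE rmorphM.
have gk c : g (alg_str B c) = alg_str C c by rewrite -(homE p) gE homE.
by exists (hom_of gD gM gk); apply: hom_ext => x; exact: gE.
Qed.

Definition fam_ideal (A : comPzRingType) (J : finType) (f : J -> A) : set A :=
  [set a | exists c : J -> A, a = \sum_j c j * f j].

Lemma fam_idealP (k : comPzRingType) (A : alg k) (J : finType) (f : J -> A) :
  is_ideal (fam_ideal f).
Proof.
split.
- by exists (fun=> 0); rewrite big1 // => j _; rewrite mul0r.
- move=> x y [c ->] [d ->]; exists (fun j => c j + d j).
  by rewrite -big_split; apply: eq_bigr => j _; rewrite mulrDl.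
- move=> x y [c ->]; exists (fun j => x * c j).
  by rewrite mulr_sumr; apply: eq_bigr => j _; rewrite mulrA.
Qed.

Lemma fam_ideal_gen (A : comPzRingType) (J : finType) (f : J -> A) j :
  fam_ideal f (f j).
Proof.
exists (fun i => (i == j)%:R); rewrite (bigD1 j) //= eqxx mul1r big1 ?addr0 //.
by move=> i /negbTE ->; rewrite mul0r.
Qed.

(** * Localizations *)

Section LocTheory.
Variables (k : comPzRingType) (A : alg k) (a : A).

Lemma loc_ind_eq (y : loc a) :
  exists b n, y = loc_map a b * loc_inv a ^+ n.
Proof.
rewrite -[y]pres_reprK -teval_gen; elim: (pres_repr y) => [[]|c|t|t].
- by exists 1, 1%N; rewrite rmorph1 mul1r expr1.
- by exists c, 0%N; rewrite expr0 mulr1.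
- move=> [b [n IHb]] s [c [m IHc]] /=; rewrite IHb IHc.
  exists (b * a ^+ m + c * a ^+ n), (n + m)%N.
  rewrite rmorphD !rmorphM mulrDl !rmorphXn.
  have AI i : loc_map a a ^+ i * loc_inv a ^+ i = 1.
    by rewrite -exprMn loc_invP expr1n.
  rewrite exprD; congr (_ + _); first by rewrite mulrACA AI mulr1.
  by rewrite [_ ^+ n * _ ^+ m]mulrC mulrACA AI mulr1.
- move=> [b [n IHb]] s [c [m IHc]] /=; rewrite IHb IHc.
  by exists (b * c), (n + m)%N; rewrite rmorphM exprD mulrACA.
Qed.

Lemma loc_liftE (C : alg k) (f : hom A C) (u : C) (fu : f a * u = 1) :
  hcomp (loc_lift fu) (loc_map a) = f.
Proof. by apply: hom_ext => x; exact: (homE (pres_lift (loc_sat fu)) x). Qed.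

Lemma loc_lift_inv (C : alg k) (f : hom A C) (u : C) (fu : f a * u = 1) :
  loc_lift fu (loc_inv a) = u.
Proof. exact: (pres_lift_gen (loc_sat fu) tt). Qed.

Lemma inv_uniq (C : comPzRingType) (x u v : C) : x * u = 1 -> x * v = 1 -> u = v.
Proof. by move=> xu xv; rewrite -[u]mulr1 -xv mulrA [u * x]mulrC xu mul1r. Qed.

Lemma loc_ext (C : alg k) (f g : hom (loc a) C) :
  hcomp f (loc_map a) = hcomp g (loc_map a) -> f = g.
Proof.
move=> e; have ex x : f (loc_map a x) = g (loc_map a x).
  by rewrite -!hcompE e.
have ei : f (loc_inv a) = g (loc_inv a).
  apply: (@inv_uniq _ (f (loc_map a a))); first by rewrite -rmorphM loc_invP rmorph1.
  by rewrite ex -rmorphM loc_invP rmorph1.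
apply: hom_ext => y; have [b [n ->]] := loc_ind_eq y.
by rewrite !rmorphM !rmorphXn ex ei.
Qed.

Lemma loc_is_localization : is_localization a (loc_map a).
Proof.
split; first by exists (loc_inv a); exact: loc_invP.
move=> C g [u gu]; exists (loc_lift gu); split; first exact: loc_liftE.
by move=> h e; apply: loc_ext; rewrite loc_liftE e.
Qed.

Lemma ma_natX (g : mona A nat) (b : A) i :
  (ma_d 1%N b * g) i = (if i is j.+1 then b * g j else 0).
Proof.
rewrite -[LHS]/(ma_mulf _ _ i) /ma_mulf pr_d => [|j]; last first.
  by apply: pr0 => l; rewrite mul0r if_same.
case: i => [|i]; first by apply: pr0 => j.
rewrite [in RHS]coefE /pr mulr_sumr; apply: eq_bigr => j _.
by rewrite /GRing.add /= add1n eqSS; case: eqP; rewrite ?mulr0.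
Qed.

(** The presented ring [loc a] maps to A[u]/(au - 1). If b dies there, then b = (au - 1) g, and
    comparing coefficients forces g_i = - a^i b; as g has finite support, some power of a kills
    b. *)
Lemma loc_kernel b : loc_map a b = 0 -> exists n, a ^+ n * b = 0.
Proof.
pose P : alg k := restr (mona A nat).
pose r : P := ma_d 1%N a - 1.
pose I : set P := [set p | exists g, p = r * g].
have hI : is_ideal I.
  split; first by exists 0; rewrite mulr0.
    by move=> x y [g ->] [h ->]; exists (g + h); rewrite mulrDr.
  by move=> x y [g ->]; exists (x * g); rewrite mulrCA.
pose f : hom A (quot hI) := hcomp (qpi hI) (restr_str (mona A nat)).
have fu : f a * qpi hI (ma_d 1%N 1 : P) = 1.
  apply/eqP; rewrite /f hcompE -rmorphM -(rmorph1 (qpi hI)) -subr_eq0 -rmorphB.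
  apply/eqP/qpi0; exists 1; rewrite mulr1; congr (_ - _).
  by rewrite -[restr_str _ _]/(ma_c nat a) ma_dM mulr1.
move=> /(congr1 (loc_lift fu)); rewrite rmorph0 -hcompE loc_liftE hcompE.
move/qpi0 => [g]; rewrite -[restr_str _ _]/(ma_c nat b) => e.
have coef i : (if i == 0%N then b else 0) = (if i is j.+1 then a * g j else 0) - g i.
  have H : (ma_c nat b : monalg A nat) = ma_d 1%N a * g - g.
    by rewrite e /r mulrBl mul1r.
  have -> : (if i == 0%N then b else 0) = (ma_c nat b : monalg A nat) i by [].
  by rewrite H -(ma_natX g a i).
have gi i : g i = - (a ^+ i * b).
  elim: i => [|i IH]; first by have := coef 0%N => /= ->; rewrite sub0r expr0 mul1r opprK.
  have /eqP := coef i.+1; rewrite /= eq_sym subr_eq0 => /eqP <-.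
  by rewrite IH mulrN exprS mulrA.
case: (mcP g) => s hs; exists (\max_(m <- s) m).+1.
apply/eqP; rewrite -oppr_eq0 -gi; apply: contraT => /hs h.
by have := @leq_bigmax_seq nat s xpredT (fun m => m) _ h isT; rewrite ltnn.
Qed.

End LocTheory.

(** * Power series and Laurent series *)

Section FpsBase.
Variable A : comNzRingType.
Implicit Types (a b : fps A) (n i j : nat).

Lemma fps_coefD a b n : fcoef (a + b) n = fcoef a n + fcoef b n.
Proof. by []. Qed.
Lemma fps_coefM a b n : fcoef (a * b) n = \sum_(i < n.+1) fcoef a i * fcoef b (n - i).
Proof. by []. Qed.
Lemma fps_coef1 n : fcoef (1 : fps A) n = (n == 0%N)%:R.
Proof. by rewrite /= coef1. Qed.
Lemma fps_coefC (c : A) n : fcoef (fps_const c) n = (if n == 0%N then c else 0).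
Proof. by rewrite /= coefC. Qed.
Lemma fps_coefB a b n : fcoef (a - b) n = fcoef a n - fcoef b n.
Proof. by []. Qed.

Lemma fps_coefCM (c : A) a n : fcoef (fps_const c * a) n = c * fcoef a n.
Proof.
rewrite fps_coefM big_ord_recl fps_coefC /= subn0 big1 ?addr0 // => i _.
by rewrite coefC mul0r.
Qed.

Lemma fps_coefXnM m a n :
  fcoef ((fps_t A : fps A) ^+ m * a) n = if (m <= n)%N then fcoef a (n - m) else 0.
Proof.
elim: m n => [|m IH] n; first by rewrite expr0 mul1r subn0.
have XM b : forall n, fcoef ((fps_t A : fps A) * b) n =
    if n is p.+1 then fcoef b p else 0.
  case=> [|p]; first by rewrite fps_coefM big_ord1 /= coefX mul0r.
  rewrite fps_coefM (bigD1 (Ordinal (isT : (1 < p.+2)%N))) //= coefX mul1r.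
  rewrite subSS subn0 big1 ?addr0 // => i.
  by rewrite -val_eqE /= coefX => /negbTE ->; rewrite mul0r.
by rewrite exprS -mulrA XM; case: n => [|n] //; rewrite IH ltnS subSS.
Qed.

Lemma fps_divXn m a : (forall i, (i < m)%N -> fcoef a i = 0) ->
  exists b, a = (fps_t A : fps A) ^+ m * b.
Proof.
move=> h; exists (Fps (fun i => fcoef a (i + m))); apply: fps_ext => n.
rewrite fps_coefXnM; case: leqP => hn; last exact: h.
by rewrite /= subnK.
Qed.

(* Coefficients of the inverse of [a], where [c] is the inverse of [a(0)]. *)
Fixpoint inv_seq (c : A) a n : seq A :=
  if n is m.+1 then
    let s := inv_seq c a m in
    rcons s (c * ((m == 0%N)%:R - \sum_(i < m) s`_i * fcoef a (m - i)))
  else [::].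
Definition fps_inv (c : A) a : fps A := Fps (fun n => (inv_seq c a n.+1)`_n).

Lemma size_inv_seq c a n : size (inv_seq c a n) = n.
Proof. by elim: n => //= n IH; rewrite size_rcons IH. Qed.

Lemma inv_seq_nth c a n i : (i < n)%N -> (inv_seq c a n)`_i = fcoef (fps_inv c a) i.
Proof.
elim: n => // n IH; rewrite ltnS leq_eqVlt => /orP[/eqP ->|h] //.
by rewrite /= nth_rcons size_inv_seq h IH.
Qed.

Lemma fps_invE c a n : fcoef (fps_inv c a) n =
  c * ((n == 0%N)%:R - \sum_(i < n) fcoef (fps_inv c a) i * fcoef a (n - i)).
Proof.
rewrite {1}/fps_inv /= nth_rcons size_inv_seq ltnn eqxx; congr (_ * (_ - _)).
by apply: eq_bigr => i _; rewrite inv_seq_nth.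
Qed.

Lemma fps_mulV c a : fcoef a 0 * c = 1 -> fps_inv c a * a = 1.
Proof.
move=> ac; apply: fps_ext => n; rewrite fps_coefM fps_coef1 big_ord_recr.
have -> : nat_of_ord (@ord_max n) = n by [].
rewrite subnn [fcoef (fps_inv c a) n]fps_invE [c * _]mulrC -mulrA [c * _]mulrC ac mulr1.
set T := (X in _ - X); rewrite -[X in X + _ = _]/T addrC subrK //.
Qed.

Lemma fps_nilp_unit a : fcoef a 0 = 1 -> exists b, a * b = 1.
Proof. by move=> h; exists (fps_inv 1 a); rewrite mulrC fps_mulV // h mulr1. Qed.

End FpsBase.

Section FpsMaps.
Variables (A B : comNzRingType) (h : {rmorphism A -> B}).
Definition fps_cmap (a : fps A) : fps B := Fps (fun n => h (fcoef a n)).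
Lemma fps_cmapD a b : fps_cmap (a + b) = fps_cmap a + fps_cmap b.
Proof. by apply: fps_ext => n /=; rewrite rmorphD. Qed.
Lemma fps_cmapM a b : fps_cmap (a * b) = fps_cmap a * fps_cmap b.
Proof.
apply: fps_ext => n; rewrite /= rmorph_sum; apply: eq_bigr => i _.
by rewrite rmorphM.
Qed.
Lemma fps_cmapC c : fps_cmap (fps_const c) = fps_const (h c).
Proof.
apply: fps_ext => n; rewrite fps_coefC /= coefC.
by case: eqP => // _; rewrite rmorph0.
Qed.
End FpsMaps.

Section FpsScale.
Variables (A : comNzRingType) (c : A).
Definition fps_scale (a : fps A) : fps A := Fps (fun n => c ^+ n * fcoef a n).
Lemma fps_scaleD a b : fps_scale (a + b) = fps_scale a + fps_scale b.
Proof. by apply: fps_ext => n /=; rewrite mulrDr. Qed.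
Lemma fps_scaleM a b : fps_scale (a * b) = fps_scale a * fps_scale b.
Proof.
apply: fps_ext => n; rewrite /= mulr_sumr; apply: eq_bigr => i _.
rewrite mulrACA -exprD subnKC //; by case: i.
Qed.
Lemma fps_scaleC d : fps_scale (fps_const d) = fps_const d.
Proof.
apply: fps_ext => n; rewrite /= coefC.
by case: eqP => [->|_]; rewrite ?mulr0 // expr0 mul1r.
Qed.
End FpsScale.

(** [fps] is built over nontrivial rings, while [alg] admits the zero ring. For [L] of this type,
    [fpsA L] and [lauA L] are L[[t]] and L((t)) as k-algebras. *)
Record nzalg (k : comPzRingType) := NzAlg {
  nz_car :> comNzRingType;
  nz_str : {rmorphism k -> nz_car}
}.

Section NzAlgs.
Variable k : comPzRingType.
Definition nza (L : nzalg k) : alg k := @Alg k L (nz_str L).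
Definition fpsA (L : nzalg k) : alg k := @restr k (nza L) (pser L).
Definition lauA (L : nzalg k) : alg k := @restr k (nza L) (laurent L).

Definition rh (A : alg k) (B C : alg A) (f : hom B C) : hom (restr B) (restr C).
Proof.
refine (@hom_of k (restr B) (restr C) f (rmorphD f) (rmorphM f) _).
by move=> c; rewrite /= homE.
Defined.

Definition genA (L : nzalg k) : hom (fpsA L) (lauA L) := @rh (nza L) (pser L) (laurent L) (generic_point L).

Definition fcst (L : nzalg k) : hom (nza L) (fpsA L) := @restr_str k (nza L) (pser L).

Definition fps_at0 (L : nzalg k) : hom (fpsA L) (nza L).
Proof.
refine (@hom_of k (fpsA L) (nza L) (fun a => fcoef a 0) _ _ _) => //.
- by move=> x y; rewrite fps_coefM big_ord1.
- by move=> c; rewrite /= coefC.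
Defined.

Definition fpsA_map (L L' : nzalg k) (h : hom (nza L) (nza L')) :
    hom (fpsA L) (fpsA L').
Proof.
refine (@hom_of k (fpsA L) (fpsA L') (@fps_cmap L L' h) _ _ _).
- exact: fps_cmapD.
- exact: fps_cmapM.
- by move=> c /=; rewrite fps_cmapC -[nz_str L c]/(alg_str (nza L) c) homE.
Defined.

Definition fpsA_scale (L : nzalg k) (c : L) : hom (fpsA L) (fpsA L) :=
  @hom_of k (fpsA L) (fpsA L) (fps_scale c) (fps_scaleD c) (fps_scaleM c)
    (fun d => fps_scaleC c _).

Definition fpsA_ram (L : nzalg k) (d : nat) (d0 : (0 < d)%N) :
  hom (fpsA L) (fpsA L) := @rh (nza L) (pser L) (pser L) (ramify L d0).

(** The localization is universal among L-algebras; the restriction of [f] to constants makes the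
    target one. *)
Lemma fpsA_to (L : nzalg k) (C : alg k) (f : hom (fpsA L) C) (u : C) :
  f (fps_t L) * u = 1 -> exists g : hom (lauA L) C, hcomp g (genA L) = f.
Proof.
move=> fu; pose C' : alg L := @Alg L C (hcomp f (fcst L)).
pose f' : hom (pser L) C' := @Hom L (pser L) C' f (fun c => erefl).
have fu' : f' (fps_t L) * u = 1 by [].
have gk c : loc_lift fu' (alg_str (lauA L) c) = alg_str C c.
  by rewrite -[alg_str (lauA L) c]/(alg_str (laurent L) (nz_str L c)) homE /=
    -(homE f).
exists (@hom_of k (lauA L) C (loc_lift fu') (rmorphD _) (rmorphM _) gk).
apply: hom_ext => x; rewrite hcompE hom_ofE.
by rewrite -[genA L x]/(loc_map (fps_t L) x) -hcompE loc_liftE.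
Qed.
End NzAlgs.

Lemma lcoef_aux n q m : (q <= m)%N -> (n <= n + m - q)%N /\ (n + m - q - n)%N = (m - q)%N.
Proof. by move=> h; split; lia. Qed.
Lemma lcoef_aux2 n q m : (n < q)%N -> (q <= m)%N -> (m <= n + m - q)%N = false.
Proof. by move=> h h'; lia. Qed.

Section PserNz.
Variable k : comNzRingType.

Definition pser_map (L : nzalg k) : hom (pser k) (fpsA L).
Proof.
refine (@hom_of k (pser k) (fpsA L) (@fps_cmap k L (nz_str L)) _ _ _).
- exact: fps_cmapD.
- exact: fps_cmapM.
- by move=> c /=; rewrite fps_cmapC.
Defined.

Lemma generic_inj : injective (generic_point k).
Proof.
move=> x y e; apply/eqP; rewrite -subr_eq0; apply/eqP.
have /loc_kernel [n h] : generic_point k (x - y) = 0.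
  by rewrite rmorphB e subrr.
apply: fps_ext => i; have := congr1 (fun s : fps k => fcoef s (i + n)) h.
by rewrite fps_coefXnM leq_addl addnK.
Qed.

Definition lt_inv : laurent k := loc_inv (fps_t k).
Lemma lt_invP n : generic_point k (fps_t k ^+ n) * lt_inv ^+ n = 1.
Proof. by rewrite rmorphXn -exprMn loc_invP expr1n. Qed.

Lemma lau_rep (y : laurent k) : exists a n, y = generic_point k a * lt_inv ^+ n.
Proof. exact: loc_ind_eq. Qed.

Lemma lau_rep_eq (a b : pser k) n m :
  generic_point k a * lt_inv ^+ n = generic_point k b * lt_inv ^+ m ->
  fps_t k ^+ m * a = fps_t k ^+ n * b.
Proof.
move=> e; apply: generic_inj; rewrite !rmorphM.
have : generic_point k (fps_t k ^+ m) * generic_point k (fps_t k ^+ n) *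
   (generic_point k a * lt_inv ^+ n) = generic_point k (fps_t k ^+ m) *
   generic_point k (fps_t k ^+ n) * (generic_point k b * lt_inv ^+ m).
  by rewrite e.
rewrite mulrACA lt_invP mulr1 => ->; rewrite [X in X * _]mulrC mulrACA lt_invP.
by rewrite mulr1.
Qed.

(* The coefficient of [t ^ - q]. *)
Definition lcoef (q : nat) (y : laurent k) : k :=
  let a := projT1 (cid (lau_rep y)) in
  let n := projT1 (cid (projT2 (cid (lau_rep y)))) in
  if (q <= n)%N then fcoef a (n - q) else 0.

Lemma lcoefE q a n : lcoef q (generic_point k a * lt_inv ^+ n) =
  if (q <= n)%N then fcoef a (n - q) else 0.
Proof.
rewrite /lcoef; case: cid => b [m e0] /=; case: cid => m' /= /lau_rep_eq e.
have C i := congr1 (fun s : fps k => fcoef s i) e.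
have := C (n + m' - q)%N; rewrite !fps_coefXnM.
case: (leqP q m') => h1; case: (leqP q n) => h2 //.
- have [-> ->] := lcoef_aux n h1; rewrite [(n + m')%N]addnC.
  by have [-> ->] := lcoef_aux m' h2.
- by have [-> ->] := lcoef_aux n h1; rewrite lcoef_aux2.
- by rewrite [(n + m')%N]addnC; have [-> ->] := lcoef_aux m' h2; rewrite lcoef_aux2.
Qed.

Lemma lau_rep2 (x y : laurent k) : exists a b n,
  x = generic_point k a * lt_inv ^+ n /\ y = generic_point k b * lt_inv ^+ n.
Proof.
have [a [n ->]] := lau_rep x; have [b [m ->]] := lau_rep y.
exists (a * fps_t k ^+ m), (b * fps_t k ^+ n), (n + m)%N; split.
  by rewrite rmorphM exprD mulrACA lt_invP mulr1.
by rewrite rmorphM addnC exprD mulrACA lt_invP mulr1.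
Qed.

Lemma lcoefD q x y : lcoef q (x + y) = lcoef q x + lcoef q y.
Proof.
have [a [b [n [-> ->]]]] := lau_rep2 x y; rewrite -mulrDl -rmorphD !lcoefE.
by case: ifP; rewrite ?addr0.
Qed.

Lemma lcoefZ q c x : lcoef q (alg_str (laurent k) c * x) = c * lcoef q x.
Proof.
have [a [n ->]] := lau_rep x; rewrite -(homE (generic_point k)) mulrA -rmorphM !lcoefE.
by case: ifP; rewrite ?mulr0 // => _; exact: fps_coefCM.
Qed.

Lemma lcoef_gen q a : (0 < q)%N -> lcoef q (generic_point k a) = 0.
Proof.
move=> q0; have -> : generic_point k a = generic_point k a * lt_inv ^+ 0 by rewrite mulr1.
by rewrite lcoefE leqNgt q0.
Qed.

Lemma lcoef_inv q : lcoef q (lt_inv ^+ q) = 1.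
Proof. by rewrite -[_ ^+ q]mul1r -(rmorph1 (generic_point k)) lcoefE leqnn subnn fps_coef1. Qed.

End PserNz.

Section FieldFps.
Variable F : fieldType.

Lemma fps_val (a : pser F) : a != 0 -> exists n (u : pser F),
  a = fps_t F ^+ n * u /\ fcoef u 0 != 0.
Proof.
move=> a0; have ex : exists n, fcoef a n != 0.
  apply: contrapT => h; case/eqP: a0; apply: fps_ext => n; apply/eqP.
  by apply: contrapT => /negP hn; apply: h; exists n.
have [|u e] := @fps_divXn F (ex_minn ex) a; last first.
  exists (ex_minn ex), u; split=> //; case: ex_minnP e => n hn _ e.
  by move: hn; rewrite {1}e fps_coefXnM leqnn subnn.
move=> i; case: ex_minnP => n _ hmin lt; apply/eqP; apply: contraT => /hmin.
by rewrite leqNgt lt.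
Qed.

Lemma fps_unit (u : pser F) : fcoef u 0 != 0 -> exists v, u * v = 1.
Proof.
move=> u0; exists (fps_inv (fcoef u 0)^-1 u); rewrite mulrC.
by apply: fps_mulV; rewrite mulfV.
Qed.

Lemma lau_field : is_field (laurent F).
Proof.
split.
  apply/eqP => e; have := @generic_inj F 1 0; rewrite rmorph1 rmorph0 => /(_ e).
  by move/(congr1 (fun s : fps F => fcoef s 0)); rewrite fps_coef1 => /eqP; rewrite oner_eq0.
move=> x x0; have [a [n e]] := lau_rep x.
have /fps_val [m [u [ea /fps_unit [v uv]]]] : a != 0.
  by apply: contraNneq x0 => a0; rewrite e a0 rmorph0 mul0r.
exists (generic_point F (fps_t F ^+ n * v) * lt_inv F ^+ m).
rewrite e ea mulrACA -rmorphM mulrACA uv mulr1 -exprD rmorphXn -!exprD addnC.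
by rewrite -exprMn loc_invP expr1n.
Qed.

End FieldFps.

(** * Quotient stacks and affine charts *)

Section GroupPoints.
Variables (k : comPzRingType) (G : grp k).

Lemma gmulKV C (g h : hom (gring G) C) : gmul (ginv g) (gmul g h) = h.
Proof. by rewrite gmulA gmulV gmul1. Qed.

Lemma ginv_uniq C (g h : hom (gring G) C) : gmul h g = gone G C -> h = ginv g.
Proof.
by move=> e; rewrite -[h]gmul_r1 -(gmul_rV g) gmulA e gmul1.
Qed.

Lemma ginv_nat (C D : alg k) (f : hom C D) (g : hom (gring G) C) :
  hcomp f (ginv g) = ginv (hcomp f g).
Proof. by apply: ginv_uniq; rewrite -gmul_nat gmulV gone_nat. Qed.

Lemma ginvM C (g h : hom (gring G) C) : ginv (gmul g h) = gmul (ginv h) (ginv g).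
Proof. by apply/esym/ginv_uniq; rewrite -gmulA gmulKV gmulV. Qed.

Lemma ginvK C (g : hom (gring G) C) : ginv (ginv g) = g.
Proof. by apply/esym/ginv_uniq; exact: gmul_rV. Qed.

Lemma gmul_cancel C (g h h' : hom (gring G) C) : gmul g h = gmul g h' -> h = h'.
Proof. by move=> e; rewrite -[h](gmulKV g) e gmulKV. Qed.

End GroupPoints.

Section TrivialTorsors.
Variables (k : comPzRingType) (G : grp k) (X : kfun k) (aX : gaction G X).
Local Notation M := (quot_stack aX).
Local Notation GG := (gring G).

Lemma act_flip C (g : hom GG C) (x y : X C) : aX C g x = y -> x = aX C (ginv g) y.
Proof. by move=> <-; rewrite -actM gmulV act1. Qed.

Lemma act_natE (C D : alg k) (f : hom C D) g (x : X C) :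
  kmap f (aX C g x) = aX D (hcomp f g) (kmap f x).
Proof. exact: act_nat. Qed.

Lemma orbitE (A C : alg k) (y : X A) (a : hom A C) (h : hom GG C) :
  kmap (tens_lift a h) (tors_map (triv_ob aX y)) = aX C h (kmap a y).
Proof. by rewrite /= act_nat -kmap_comp tens_liftl tens_liftr. Qed.

Definition tunit (A : alg k) : hom (tensor A GG) A := tens_lift (hid A) (gone G A).

Lemma tens_liftE (A C D : alg k) (f : hom C D) (a : hom A C) (h : hom GG C) :
  hcomp f (tens_lift a h) = tens_lift (hcomp f a) (hcomp f h).
Proof.
by apply: tens_ext; rewrite -hcompA ?tens_liftl ?tens_liftr ?tens_liftl ?tens_liftr.
Qed.

Lemma tens_split (A C : alg k) (p : hom (tensor A GG) C) :
  p = tens_lift (hcomp p (tensl A GG)) (hcomp p (tensr A GG)).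
Proof. by apply: tens_ext; rewrite ?tens_liftl ?tens_liftr. Qed.

Section Gel.
Variables (A A' : alg k) (y : X A) (y' : X A').
Variable m : @mor _ M A A' (triv_ob aX y') (triv_ob aX y).

(** The value of the torsor map at the unit section. A morphism of trivial torsors is right
    translation by this element; [gelP], [triv_mor_ex] and [triv_mor_ext] identify morphisms over f
    with the elements g of G such that g f(y) = y'. *)
Definition gel : hom GG A' :=
  hcomp (tunit A') (hcomp (qm_fun m) (tensr A GG)).

Lemma qm_funE (C : alg k) (a : hom A' C) (h : hom GG C) :
  hcomp (tens_lift a h) (qm_fun m) =
  tens_lift (hcomp a (mor_base m)) (gmul h (hcomp a gel)).
Proof.
have -> : tens_lift a h = triv_fun h (hcomp a (tunit A')).
  rewrite /triv_fun /tunit tens_liftE tens_liftl tens_liftr gone_nat gmul_r1.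
  by rewrite hcompf1.
have -> : hcomp (triv_fun h (hcomp a (tunit A'))) (qm_fun m) =
    triv_fun h (hcomp (hcomp a (tunit A')) (qm_fun m)) by exact: (qm_equiv m).
have Pm : hcomp (qm_fun m) (tensl A GG) = hcomp (tensl A' GG) (mor_base m).
  exact: (qm_proj m).
rewrite /triv_fun; congr (tens_lift _ (gmul h _)).
  transitivity (hcomp (hcomp a (tunit A')) (hcomp (tensl A' GG) (mor_base m))).
    by rewrite -Pm; exact/esym/hcompA.
  by rewrite hcompA -(hcompA a) tens_liftl hcompf1.
by rewrite -!hcompA.
Qed.

Lemma gelP : y' = aX A' gel (kmap (mor_base m) y).
Proof.
have e1 : kmap (tunit A') (tors_map (triv_ob aX y')) = y'.
  by rewrite orbitE act1 kmap_id.
have e2 : kmap (qm_fun m) (tors_map (triv_ob aX y)) = tors_map (triv_ob aX y').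
  exact: (qm_map m).
transitivity (kmap (tunit A') (tors_map (triv_ob aX y'))); first by rewrite e1.
by rewrite -e2 -kmap_comp qm_funE gmul1 hcomp1f orbitE hcomp1f.
Qed.

End Gel.

Lemma triv_mor_ext (A A' : alg k) (y : X A) (y' : X A')
  (m m' : @mor _ M A A' (triv_ob aX y') (triv_ob aX y)) :
  mor_base m = mor_base m' -> gel m = gel m' -> m = m'.
Proof.
move=> eb eg; apply: quot_mor_ext => //.
rewrite -[qm_fun m]hcomp1f -[qm_fun m']hcomp1f [hid _]tens_split !qm_funE eb eg.
by [].
Qed.

Lemma triv_mor_ex (A A' : alg k) (y : X A) (y' : X A') (f : hom A A')
    (g : hom GG A') : aX A' g (kmap f y) = y' ->
  exists m : @mor _ M A A' (triv_ob aX y') (triv_ob aX y),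
    mor_base m = f /\ gel m = g.
Proof.
move=> e; pose q : hom (tensor A GG) (tensor A' GG) :=
  tens_lift (hcomp (tensl A' GG) f) (gmul (tensr A' GG) (hcomp (tensl A' GG) g)).
have qE (C : alg k) (p : hom (tensor A' GG) C) : hcomp p q =
    tens_lift (hcomp (hcomp p (tensl A' GG)) f)
     (gmul (hcomp p (tensr A' GG)) (hcomp (hcomp p (tensl A' GG)) g)).
  by rewrite /q tens_liftE gmul_nat !hcompA.
have p1 : hcomp q (tensl A GG) = hcomp (tensl A' GG) f by exact: tens_liftl.
have p2 C (h : hom GG C) (p : hom (tensor A' GG) C) :
    hcomp (triv_fun h p) q = triv_fun h (hcomp p q).
  rewrite qE [in RHS]qE /triv_fun !tens_liftl !tens_liftr.
  by congr (tens_lift _ _); rewrite gmulA.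
have p3 C (p : hom (tensor A GG) C) (a : hom A' C) :
    hcomp p (tensl A GG) = hcomp a f ->
    exists! p' : hom (tensor A' GG) C, hcomp p' q = p /\ hcomp p' (tensl A' GG) = a.
  move=> e1; exists (tens_lift a (gmul (hcomp p (tensr A GG)) (ginv (hcomp a g)))).
  split; first split.
  - rewrite qE tens_liftl tens_liftr -gmulA gmulV gmul_r1 -e1.
    by rewrite -tens_split.
  - exact: tens_liftl.
  - move=> p' [e2 e3]; rewrite [RHS]tens_split e3; congr (tens_lift _ _).
    by rewrite -e2 qE tens_liftr e3 -gmulA gmul_rV gmul_r1.
have p4 : kmap q (tors_map (triv_ob aX y)) = tors_map (triv_ob aX y').
  by rewrite /q orbitE /= -e act_nat -kmap_comp actM.
exists (@QuotMor k G X aX A A' (triv_ob aX y') (triv_ob aX y) f q p1 p2 p3 p4).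
split=> //; rewrite /gel /= tens_liftr gmul_nat /tunit tens_liftr gmul1.
by rewrite hcompA tens_liftl hcomp1f.
Qed.

Lemma gel_comp (A A' A'' : alg k) (y : X A) (y' : X A') (y'' : X A'')
  (m1 : @mor _ M A A' (triv_ob aX y') (triv_ob aX y))
  (m2 : @mor _ M A' A'' (triv_ob aX y'') (triv_ob aX y')) :
  gel (mcomp m1 m2) = gmul (gel m2) (hcomp (mor_base m2) (gel m1)).
Proof.
rewrite {1}/gel /= -[hcomp (hcomp _ _) (tensr _ _)]hcompA hcompA.
rewrite /tunit qm_funE gmul1 !hcomp1f hcompA qm_funE.
by rewrite tens_liftr.
Qed.

(** All morphisms of [X/G] are cartesian, the stack being fibred in groupoids. The torsor map comes
    from the universal property [qm_cart] of [m1], and its compatibilities are checked after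
    composition with [m1], where [uq] makes them detectable. *)
Lemma quot_cart (A A1 A' : alg k) (x : ob M A) (x1 : ob M A1) (x' : ob M A')
    (m1 : mor x1 x) (m : mor x' x) (f : hom A1 A') :
  mor_base m = hcomp f (mor_base m1) ->
  exists m2 : mor x' x1, mor_base m2 = f /\ mcomp m1 m2 = m.
Proof.
move=> e; have [p [[pq pp] pu]] :
    exists! p : hom (tors_ring x1) (tors_ring x'), hcomp p (qm_fun m1) = qm_fun m
       /\ hcomp p (tors_proj x1) = hcomp (tors_proj x') f.
  by apply: qm_cart; rewrite qm_proj -hcompA; congr hcomp.
have uq C (q q' : hom (tors_ring x1) C) :
    hcomp q (qm_fun m1) = hcomp q' (qm_fun m1) ->
    hcomp q (tors_proj x1) = hcomp q' (tors_proj x1) -> q = q'.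
  move=> e1 e2; have [|r [_ ru]] := @qm_cart _ _ _ _ _ _ _ _ m1 C
     (hcomp q (qm_fun m1)) (hcomp q (tors_proj x1)).
    by rewrite -!hcompA qm_proj.
  by rewrite -(ru q) // -(ru q').
have p2 C (g : hom GG C) (q : hom (tors_ring x') C) :
    hcomp (tors_act x' C g q) p = tors_act x1 C g (hcomp q p).
  apply: uq; first by rewrite -hcompA pq qm_equiv qm_equiv -hcompA pq.
  by rewrite tors_inv -!hcompA pp !hcompA tors_inv.
have p3 C (q : hom (tors_ring x1) C) (a : hom A' C) :
    hcomp q (tors_proj x1) = hcomp a f ->
    exists! p' : hom (tors_ring x') C, hcomp p' p = q /\ hcomp p' (tors_proj x') = a.
  move=> e1; have [|r [[r1 r2] ru]] := @qm_cart _ _ _ _ _ _ _ _ m C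
     (hcomp q (qm_fun m1)) a.
    rewrite -hcompA qm_proj hcompA e1 -hcompA; congr (hcomp a _).
    exact: esym.
  exists r; split.
    split=> //; apply: uq; first by rewrite -hcompA pq r1.
    by rewrite -hcompA pp hcompA r2 e1.
  by move=> r' [e2 e3]; apply: ru; split=> //; rewrite -pq hcompA e2.
have p4 : kmap p (tors_map x1) = tors_map x'.
  by rewrite -(qm_map m1) -kmap_comp pq qm_map.
exists (@QuotMor k G X aX A1 A' x' x1 f p pp p2 p3 p4); split=> //.
by apply: quot_mor_ext.
Qed.

Lemma quot_inv (A : alg k) (x x' : ob M A) (m : mor x' x) :
  mor_base m = hid A -> exists m' : mor x x', mor_base m' = hid A.
Proof.
move=> e; have [|m' [e' _]] := @quot_cart _ _ _ x x' x m (idm x) (hid A).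
  by rewrite mor_base_id e hcomp1f.
by exists m'.
Qed.

Definition simply_transitive (A : alg k) (x : ob M A) (s : hom (tors_ring x) A) :=
  hcomp s (tors_proj x) = hid A /\
  forall C (a : hom A C) (p : hom (tors_ring x) C), hcomp p (tors_proj x) = a ->
    exists! g : hom GG C, tors_act x C g (hcomp a s) = p.

Lemma section_triv (A : alg k) (x : ob M A) (s : hom (tors_ring x) A) :
  simply_transitive s ->
  exists m : @mor _ M A A (triv_ob aX (kmap s (tors_map x))) x, mor_base m = hid A.
Proof.
move=> [s1 s2]; set y := kmap s _.
have ac : act_nat (tors_act x) = act_nat (tors_act x) by [].
pose q : hom (tors_ring x) (tensor A GG) :=
  tors_act x _ (tensr A GG) (hcomp (tensl A GG) s).
have qE C (p : hom (tensor A GG) C) : hcomp p q =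
    tors_act x C (hcomp p (tensr A GG)) (hcomp (hcomp p (tensl A GG)) s).
  by rewrite /q -[LHS]/(kmap p (_ : Spec (tors_ring x) _)) act_nat /= hcompA.
have p1 : hcomp q (tors_proj x) = hcomp (tensl A GG) (hid A).
  by rewrite tors_inv -hcompA s1.
have p2 C (g : hom GG C) (p : hom (tensor A GG) C) :
    hcomp (triv_fun g p) q = tors_act x C g (hcomp p q).
  by rewrite qE [in RHS]qE /triv_fun tens_liftl tens_liftr actM.
have p3 C (p : hom (tors_ring x) C) (a : hom A C) :
    hcomp p (tors_proj x) = hcomp a (hid A) ->
    exists! p' : hom (tensor A GG) C, hcomp p' q = p /\ hcomp p' (tensl A GG) = a.
  rewrite hcompf1 => e; have [g [g1 g2]] := s2 C a p e.
  exists (tens_lift a g); split.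
    by split; [rewrite qE tens_liftl tens_liftr | exact: tens_liftl].
  move=> p' [e1 e2]; rewrite [RHS]tens_split e2; congr (tens_lift _ _).
  by apply: g2; rewrite -e1 qE e2.
have p4 : kmap q (tors_map x) = tors_map (triv_ob aX y).
  by rewrite /q tors_equiv /= /y kmap_comp.
by exists (@QuotMor k G X aX A A (triv_ob aX y) x (hid A) q p1 p2 p3 p4).
Qed.

Section Factors.
Variables (Z : aff_cat k) (E : functor Z M).

Lemma factors_comp (A A1 A' : alg k) (x : ob M A) (x1 : ob M A1) (m : mor x1 x)
    (g : hom A1 A') :
  factors_through E g x1 <-> factors_through E (hcomp g (mor_base m)) x.
Proof.
split=> [[z [n e]]|[z [n e]]].
  by exists z, (mcomp m n); rewrite mor_base_comp e.
have [n' [e' _]] := quot_cart e.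
by exists z, n'.
Qed.

End Factors.

End TrivialTorsors.

(** * Points in an open affine chart *)

Section Charts.
Variables (k : comPzRingType) (X : kfun k) (U : alg k) (u : X U).
Hypothesis hu : open_immersion u.

Definition in_chart (B : alg k) (y : X B) := exists c : hom U B, kmap c u = y.

Lemma chart_inj (B : alg k) (c c' : hom U B) : kmap c u = kmap c' u -> c = c'.
Proof. exact: hu.1. Qed.

Lemma in_chart_map (B B' : alg k) (f : hom B B') (y : X B) :
  in_chart y -> in_chart (kmap f y).
Proof. by move=> [c <-]; exists (hcomp f c); rewrite kmap_comp. Qed.

(** The complement of the chart is cut out by an ideal. A relation placing 1 in that ideal over [A0]
    lifts to an element with image 1, which is a unit. Hence charts do not distinguish a ring from
    its formal or nilpotent thickenings. *)
Lemma in_chart_local (A A0 : alg k) (r : hom A A0) (x : X A) :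
  (forall y, exists a, r a = y) -> (forall a, r a = 1 -> exists b, a * b = 1) ->
  in_chart (kmap r x) -> in_chart x.
Proof.
move=> surj un; have [E HE] := hu.2 A x.
move=> /HE [n [e [c [Ee ce]]]].
have [d dE] : exists d : 'I_n -> A, forall i, r (d i) = c i.
  by exists (fun i => projT1 (cid (surj (c i)))) => i; case: cid.
have [|b eb] := un (\sum_(i < n) d i * e i).
  by rewrite rmorph_sum -ce; apply: eq_bigr => i _; rewrite rmorphM dE.
have [|c' e'] := (HE A (hid A)).2; last by exists c'; rewrite e' kmap_id.
exists n, e, (fun i => b * d i); split=> //.
rewrite -eb [RHS]mulrC mulr_sumr; apply: eq_bigr => i _; by rewrite mulrA.
Qed.

Lemma chart_descend (B B' : alg k) (i : hom B B') (y : X B) (c : hom U B) :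
  injective i -> in_chart y -> kmap i y = kmap i (kmap c u) -> y = kmap c u.
Proof.
move=> inj [c' <-]; rewrite -!kmap_comp => /chart_inj e; congr (kmap _ u).
by apply: hom_ext => x; apply: inj; rewrite -!hcompE e.
Qed.

Lemma in_chart_loc (A K : alg k) (f : hom A K) (x : X A) :
  1 != 0 :> K -> in_chart (kmap f x) ->
  exists e : A, f e != 0 /\ in_chart (kmap (loc_map e) x).
Proof.
move=> K1; have [E HE] := hu.2 A x => /HE [n [e [c [Ee ce]]]].
have [i fi] : exists i, f (e i) != 0.
  apply: contrapT => h; case/eqP: K1; rewrite -ce big1 // => i _.
  apply/eqP; apply: contraT => h'; case: h; exists i.
  by apply: contraNneq h' => ->; rewrite mulr0.
exists (e i); split=> //; apply/HE; exists 1%N, (fun=> e i), (fun=> loc_inv (e i)).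
by split=> //; rewrite big_ord1 mulrC loc_invP.
Qed.

Lemma in_chart_inj (A K : alg k) (f : hom A K) (x : X A) :
  is_field A -> 1 != 0 :> K -> in_chart (kmap f x) -> in_chart x.
Proof.
move=> [A1 inv] K1 /(in_chart_loc K1) [e [fe [c hc]]].
have [v ev] : exists v, e * v = 1.
  by apply: inv; apply: contraNneq fe => ->; rewrite rmorph0.
have ev' : hid A e * v = 1 by [].
exists (hcomp (loc_lift ev') c).
by rewrite kmap_comp hc -kmap_comp loc_liftE kmap_id.
Qed.

End Charts.

Section SqzUnits.
Variables (k : comPzRingType) (B : alg k) (D : alg B).
Lemma sqz_pr_surj (y : B) : exists a, sqz_pr D a = y.
Proof. by exists (sqz_in D y). Qed.
Lemma sqz_pr_unit (a : sqz D) : sqz_pr D a = 1 -> exists b, a * b = 1.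
Proof.
case: a => [a d] e; have {}e : a = 1 by exact: e.
subst a.
exists (Sqz 1 (- d)); apply: sqz_ext => /=; first by rewrite mulr1.
by rewrite rmorph1 !mul1r addNr.
Qed.
End SqzUnits.

(** * Strictly henselian rings *)

Section FieldOf.
Variables (A : comPzRingType) (hA : is_field A).
Definition fld of is_field A : Type := A.
Local Notation F := (fld hA).
HB.instance Definition _ := GRing.ComPzRing.copy F A.
Lemma fld_neq0 : (1 : F) != 0. Proof. exact: hA.1. Qed.
HB.instance Definition _ := GRing.PzSemiRing_isNonZero.Build F fld_neq0.
Definition fld_inv (x : F) : F :=
  if pselect (x != 0) is left h then projT1 (cid (hA.2 x h)) else x.
Lemma fld_mulV (x : F) : x != 0 -> fld_inv x * x = 1.
Proof.
by move=> h; rewrite /fld_inv; case: pselect => // h'; case: cid => y /= <-; rewrite mulrC.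
Qed.
Lemma fld_inv0 : fld_inv 0 = 0.
Proof. by rewrite /fld_inv; case: pselect => // h; case/negP: (h). Qed.
HB.instance Definition _ := GRing.ComNzRing_isField.Build F fld_mulV fld_inv0.
Definition fld_field : fieldType := F.
End FieldOf.

Lemma pdiv_aux a b : (0 < b)%N -> (b <= a)%N ->
  (a.-1 < a - b)%N = false /\ (a.-1 - (a - b) = b.-1)%N.
Proof. by move=> h h'; split; lia. Qed.

Lemma pdiv_aux2 a b c : (c = (a + b).-1)%N -> (1 < b)%N -> (c <= a)%N -> False.
Proof. by move=> h h' h''; lia. Qed.

(** * A Nullstellensatz by specialization *)

Section Nullstellensatz.
Variables (K : closedFieldType) (L : fieldType) (io : {rmorphism K -> L}).

Definition subr (S : set L) : Prop :=
  [/\ forall c, S (io c), forall x y, S x -> S y -> S (x + y)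
    & forall x y, S x -> S y -> S (x * y)].

(** [th] is a function on all of L of which only the restriction to S is a ring map; the induction
    on generators then needs no separate carrier for each subring. *)
Definition special (S : set L) (th : L -> K) : Prop :=
  [/\ forall c, th (io c) = c,
      forall x y, S x -> S y -> th (x + y) = th x + th y
    & forall x y, S x -> S y -> th (x * y) = th x * th y].

(** The strengthening that makes the induction on generators work: a specialization can be asked to
    spare a given nonzero element, such as a leading coefficient. *)
Definition specializable (S : set L) : Prop :=
  forall b, S b -> b != 0 -> exists th, special S th /\ th b != 0.

Definition pS (S : set L) (p : {poly L}) := forall i, S p`_i.

Definition adjoin (S : set L) (x : L) : set L :=
  [set y | exists p, pS S p /\ y = p.[x]].

Section Step.
Variables (S : set L) (x : L).
Hypothesis hS : subr S.

Let Sk c : S (io c). Proof. by case: hS. Qed.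
Let SD a b : S a -> S b -> S (a + b). Proof. by case: hS => _ + _; exact. Qed.
Let SM a b : S a -> S b -> S (a * b). Proof. by case: hS => _ _; exact. Qed.
Let S0 : S 0. Proof. by rewrite -(rmorph0 io). Qed.
Let S1 : S 1. Proof. by rewrite -(rmorph1 io). Qed.
Let SN a : S a -> S (- a).
Proof. by move=> Sx; rewrite -mulN1r -(rmorphN1 io); exact: SM. Qed.
Let Ssum n (F : 'I_n -> L) : (forall i, S (F i)) -> S (\sum_(i < n) F i).
Proof. by move=> h; elim/big_ind: _ => // a b; exact: SD. Qed.

Lemma pSD p q : pS S p -> pS S q -> pS S (p + q).
Proof. by move=> hp hq i; rewrite coefD; exact: SD. Qed.
Lemma pSN p : pS S p -> pS S (- p).
Proof. by move=> hp i; rewrite coefN; exact: SN. Qed.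
Lemma pSM p q : pS S p -> pS S q -> pS S (p * q).
Proof. by move=> hp hq i; rewrite coefM; apply: Ssum => j; exact: SM. Qed.
Lemma pSC c : S c -> pS S c%:P.
Proof. by move=> hc i; rewrite coefC; case: ifP. Qed.
Lemma pSXn n : pS S 'X^n.
Proof. by move=> i; rewrite coefXn; case: eqP. Qed.

Lemma subr_adjoin : subr (adjoin S x).
Proof.
split.
- by move=> c; exists (io c)%:P; rewrite hornerC; split=> //; exact: pSC.
- by move=> a b [p [hp ->]] [q [hq ->]]; exists (p + q); rewrite hornerD; split=> //; exact: pSD.
- by move=> a b [p [hp ->]] [q [hq ->]]; exists (p * q); rewrite hornerM; split=> //; exact: pSM.
Qed.

Lemma adjoin_sub a : S a -> adjoin S x a.
Proof. by move=> ha; exists a%:P; rewrite hornerC; split=> //; exact: pSC. Qed.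
Lemma adjoin_x : adjoin S x x.
Proof. by exists 'X; rewrite hornerX; split=> //; exact: (pSXn 1). Qed.

(** Euclidean division inside S[X]: a power of the leading coefficient replaces its inverse, which
    may leave S. *)
Lemma pseudo_div p g : pS S p -> pS S g -> g != 0 ->
  exists N s r, [/\ (lead_coef g ^+ N)%:P * p = s * g + r, pS S s, pS S r
    & (size r < size g)%N].
Proof.
move=> + hg g0; have [n] := ubnP (size p); elim: n p => // n IH p hn hp.
have [lt|ge] := ltnP (size p) (size g).
  exists 0%N, 0, p; rewrite expr0 mul1r mul0r add0r; split=> //.
  by move=> i; rewrite coef0.
pose m := (size p - size g)%N.
pose p' := (lead_coef g)%:P * p - (lead_coef p)%:P * 'X^m * g.
have Sg : S (lead_coef g) by exact: hg.
have Sp : S (lead_coef p) by exact: hp.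
have sg : (0 < size g)%N by rewrite size_poly_gt0.
have sm : (size ('X^m * g)%R <= size p)%N.
  by apply: leq_trans (size_polyMleq _ _) _; rewrite size_polyXn /= /m subnK.
have lt : (size p' < size p)%N.
  have sp : (0 < size p)%N by exact: leq_trans ge.
  rewrite -(prednK sp) ltnS; apply/leq_sizeP => j hj.
  rewrite /p' -mulrA coefB !coefCM.
  have [e|ne] := eqVneq j (size p).-1.
    have [e1 e2] := pdiv_aux sg ge.
    rewrite e coefXnM ifF // e2.
    by rewrite -!/(lead_coef _) mulrC subrr.
  have hj' : (size p <= j)%N by rewrite -(prednK sp) ltn_neqAle eq_sym ne.
  by rewrite (leq_sizeP _ _ sm) // (leq_sizeP _ _ (leqnn _)) // !mulr0 subrr.
have [||N [s [r [e hs hr hlt]]]] := IH p'.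
- exact: leq_trans lt hn.
- apply: pSD; first by apply: pSM => //; exact: pSC.
  by apply: pSN; apply: pSM => //; apply: pSM; [exact: pSC | exact: pSXn].
exists N.+1, (s + (lead_coef g ^+ N)%:P * (lead_coef p)%:P * 'X^m), r; split=> //.
- rewrite exprSr polyCM mulrDl addrAC -e /p' mulrBr !mulrA.
  by rewrite subrK.
- apply: pSD => //; apply: pSM; last exact: pSXn.
  apply: pSM; apply: pSC => //; elim: {e}N => [|N IHN]; first by rewrite expr0.
  by rewrite exprS; exact: SM.
Qed.

Section Spec.
Variable th : L -> K.
Hypothesis hth : special S th.
Let thk c : th (io c) = c. Proof. by case: hth. Qed.
Let thD a b : S a -> S b -> th (a + b) = th a + th b.
Proof. by case: hth => _ + _; exact. Qed.
Let thM a b : S a -> S b -> th (a * b) = th a * th b.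
Proof. by case: hth => _ _; exact. Qed.
Let th0 : th 0 = 0. Proof. by rewrite -(rmorph0 io) thk. Qed.
Let th1 : th 1 = 1. Proof. by rewrite -(rmorph1 io) thk. Qed.
Let thX a n : S a -> S (a ^+ n) /\ th (a ^+ n) = th a ^+ n.
Proof.
move=> ha; elim: n => [|n [h1 h2]]; first by rewrite !expr0 th1.
by rewrite !exprS thM // h2; split=> //; exact: SM.
Qed.
Let thsum n (F : 'I_n -> L) : (forall i, S (F i)) ->
  th (\sum_(i < n) F i) = \sum_(i < n) th (F i).
Proof.
elim: n F => [|n IH] F h; first by rewrite !big_ord0.
by rewrite !big_ord_recr /= thD ?IH //; apply: Ssum.
Qed.

Definition thp (p : {poly L}) : {poly K} := \poly_(i < size p) th p`_i.
Lemma thpE p i : (thp p)`_i = th p`_i.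
Proof. by rewrite coef_poly; case: ltnP => // h; rewrite nth_default. Qed.
Lemma thpD p q : pS S p -> pS S q -> thp (p + q) = thp p + thp q.
Proof. by move=> hp hq; apply/polyP => i; rewrite coefD !thpE coefD thD. Qed.
Lemma thpM p q : pS S p -> pS S q -> thp (p * q) = thp p * thp q.
Proof.
move=> hp hq; apply/polyP => i; rewrite coefM !thpE coefM thsum => [|j]; last exact: SM.
by apply: eq_bigr => j _; rewrite !thpE thM.
Qed.
Lemma thpC c : thp c%:P = (th c)%:P.
Proof. by apply/polyP => i; rewrite thpE !coefC; case: eqP. Qed.

(** The extension sends p(x) to the value of the specialized p at [xi]; the first hypothesis says
    that this does not depend on the choice of p. *)
Lemma special_ext (xi : K) (pb : {poly L}) :
  (forall p, pS S p -> p.[x] = 0 -> (thp p).[xi] = 0) ->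
  pS S pb -> (thp pb).[xi] != 0 ->
  exists th', special (adjoin S x) th' /\ th' pb.[x] != 0.
Proof.
move=> H hpb hb.
pose th' y := if pselect (adjoin S x y) is left h then (thp (projT1 (cid h))).[xi] else 0.
have E p : pS S p -> th' p.[x] = (thp p).[xi].
  move=> hp; rewrite /th'; case: pselect => [h|[]]; last by exists p.
  case: cid => q [hq e] /=; apply/eqP; rewrite -subr_eq0 -hornerN -hornerD.
  have -> : thp q - thp p = thp (q - p).
    by apply/polyP => i; rewrite coefB !thpE coefB thD ?thE //; first
      (by congr (_ + _); rewrite -[- p`_i]mulN1r -(rmorphN1 io) thM ?thk ?mulN1r //);
      exact: SN.
  rewrite H //; first by apply: pSD => //; exact: pSN.
  by rewrite hornerD hornerN e subrr.
exists th'; split; last by rewrite E.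
split.
- by move=> c; rewrite -[io c](hornerC _ x) E ?thpC ?hornerC ?thk //; exact: pSC.
- move=> a b [p [hp ->]] [q [hq ->]]; rewrite -hornerD !E ?thpD ?hornerD //.
  exact: pSD.
- move=> a b [p [hp ->]] [q [hq ->]]; rewrite -hornerM !E ?thpM ?hornerM //.
  exact: pSM.
Qed.
End Spec.

(** If x is transcendental over S, a specialization sparing the leading coefficient of [pb] extends,
    x going to any non-root. Otherwise x has an equation q over S of minimal degree, and the ideal
    generated by [pb] and [q] contains a nonzero constant c. A specialization sparing c and the
    leading coefficient of q extends, x going to a root of the specialized q, and the relation c = U
    pb + V q keeps [pb] from vanishing there. *)
Lemma specializable_adjoin : specializable S -> specializable (adjoin S x).
Proof.
move=> good b [pb [hpb eb]] b0.
have pb0 : pb != 0 by apply: contraNneq b0 => e; rewrite eb e horner0.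
have [[q0 [hq0 q00 qx0]]|tr] :=
    pselect (exists q, [/\ pS S q, q != 0 & q.[x] = 0]); last first.
  have [th [hth tha]] := good (lead_coef pb) (hpb _) (eqbLR (esym (congr1 negb (lead_coef_eq0 pb))) pb0).
  have tp0 : thp th pb != 0.
    by apply: contraNneq tha => e; rewrite /lead_coef -(thpE hth) e coef0.
  have /closed_nonrootP [xi hxi] := tp0.
  rewrite eb; apply: (special_ext hth (xi := xi)) => // p hp px.
  have [->|p0] := eqVneq p 0; last by case: tr; exists p.
  by rewrite -[0 : {poly L}]polyC0 (thpC hth) hornerC -(rmorph0 io); case: hth => ->.
have exq : exists n q, [/\ pS S q, q != 0, q.[x] = 0 & size q = n] by exists (size q0), q0.
have exq' : exists n, `[< exists q, [/\ pS S q, q != 0, q.[x] = 0 & size q = n] >].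
  by case: exq => n h; exists n; apply/asboolP.
pose nq := ex_minn exq'.
have [q [hq q_n0 qx sq]] : exists q, [/\ pS S q, q != 0, q.[x] = 0 & size q = nq].
  by rewrite /nq; case: ex_minnP => n /asboolP.
have qmin p : pS S p -> p.[x] = 0 -> (size p < nq)%N -> p = 0.
  move=> hp px; apply: contraTeq => p0; rewrite -leqNgt /nq; case: ex_minnP => n _; apply.
  by apply/asboolP; exists p.
(* The constant is found as an element of this ideal of least degree that does not vanish at x. *)
pose inI g := exists U V, [/\ pS S U, pS S V & g = U * pb + V * q].
have inIS g : inI g -> pS S g.
  by move=> [U [V [hU hV ->]]]; apply: pSD; apply: pSM.
have exg' : exists n, `[< exists g, [/\ inI g, g.[x] != 0 & size g = n] >].
  exists (size pb); apply/asboolP; exists pb; rewrite -eb; split=> //.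
  exists 1, 0; rewrite mul1r mul0r addr0; split=> //; first exact: (pSXn 0).
  by move=> i; rewrite coef0.
pose ng := ex_minn exg'.
have [g [Ig gx sg]] : exists g, [/\ inI g, g.[x] != 0 & size g = ng].
  by rewrite /ng; case: ex_minnP => n /asboolP.
have gmin h : inI h -> h.[x] != 0 -> (ng <= size h)%N.
  move=> hI hx; rewrite /ng; case: ex_minnP => n _; apply.
  by apply/asboolP; exists h.
have g0 : g != 0 by apply: contraNneq gx => ->; rewrite horner0.
have lq0 : lead_coef q != 0 by rewrite lead_coef_eq0.
have lg0 : lead_coef g != 0 by rewrite lead_coef_eq0.
have SX a n : S a -> S (a ^+ n).
  by move=> ha; elim: n => [|n IHn]; rewrite ?expr0 // exprS; exact: SM.
have ltg : (size g < nq)%N.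
  have [N [s [r [e hs hr lt]]]] := pseudo_div (inIS _ Ig) hq q_n0.
  rewrite -sq; apply: leq_ltn_trans lt; rewrite sg; apply: gmin.
    case: Ig => U [V [hU hV eg]].
    exists ((lead_coef q ^+ N)%:P * U), ((lead_coef q ^+ N)%:P * V - s); split.
    - by apply: pSM => //; apply: pSC; apply: SX; exact: hq.
    - by apply: pSD; [apply: pSM => //; apply: pSC; apply: SX; exact: hq | exact: pSN].
    - have -> : r = (lead_coef q ^+ N)%:P * g - s * q by rewrite e addrAC subrr add0r.
      by rewrite eg; ring.
  have := congr1 (horner^~ x) e; rewrite !hornerE qx mulr0 add0r => <-.
  by rewrite mulf_neq0 // expf_neq0.
(* Dividing q by g leaves a remainder which minimality forces to vanish, first at x and then
   identically. So q equals s g up to a constant, with s(x) = 0; then s is not shorter than q, and g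
   is constant. *)
have sg1 : size g = 1%N.
  apply/eqP; rewrite eqn_leq size_poly_gt0 g0 andbT leqNgt; apply/negP => g2.
  have [N [s [r [e hs hr lt]]]] := pseudo_div hq (inIS _ Ig) g0.
  have rI : inI r.
    case: Ig => U [V [hU hV eg]].
    exists (- (s * U)), ((lead_coef g ^+ N)%:P - s * V); split.
    - by apply: pSN; exact: pSM.
    - apply: pSD; last by apply: pSN; exact: pSM.
      apply: pSC; apply: SX; exact: (inIS _ (ex_intro _ U (ex_intro _ V (And3 hU hV eg)))).
    - have -> : r = (lead_coef g ^+ N)%:P * q - s * g by rewrite e addrAC subrr add0r.
      by rewrite eg; ring.
  have rx : r.[x] = 0.
    by apply/eqP; apply: contraT => /(gmin _ rI); rewrite -sg leqNgt lt.
  have r0 : r = 0 by apply: qmin => //; exact: ltn_trans ltg.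
  have sx : s.[x] = 0.
    have := congr1 (horner^~ x) e; rewrite r0 addr0 !hornerE qx mulr0 => /esym/eqP.
    by rewrite mulf_eq0 (negbTE gx) orbF => /eqP.
  have /eqP := congr1 (fun p : {poly L} => size p) e.
  rewrite r0 addr0 size_Cmul ?expf_neq0 //.
  have s0 : s != 0.
    apply: contraNneq q_n0 => s0; move: e; rewrite s0 r0 mul0r addr0 => /eqP.
    by rewrite mulf_eq0 polyC_eq0 expf_eq0 (negbTE lg0) andbF /=.
  have : (nq <= size s)%N.
    by rewrite leqNgt; apply/negP => h; case/eqP: s0; apply: qmin.
  rewrite size_mul // -sq => hle.
  move: (size q) (size s) (size g) g2 hle => c1 a1 b1 g2 hle /eqP ec.
  exact: pdiv_aux2 ec g2 hle.
have [c eg] : exists c, g = c%:P by exists g`_0; apply: size1_polyC; rewrite sg1.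
have c0 : c != 0 by rewrite eg polyC_eq0 in g0.
have Sc : S c by have := inIS _ Ig 0%N; rewrite eg coefC.
have [th [hth thac]] := good (lead_coef q * c) (SM (hq _) Sc) (mulf_neq0 lq0 c0).
have thM a b' : S a -> S b' -> th (a * b') = th a * th b' by case: hth => _ _; exact.
move: thac; rewrite thM //; last exact: hq.
rewrite mulf_eq0 negb_or => /andP [tha thc].
have sq1 : (1 < size q)%N.
  rewrite ltnNge; apply/negP => /size1_polyC e; move: qx; rewrite e hornerC => e0.
  by move: q_n0; rewrite e e0 polyC0 eqxx.
have stq : size (thp th q) = size q.
  by apply: size_poly_eq.
have /closed_rootP [xi /rootP hxi] : size (thp th q) != 1%N by rewrite stq gtn_eqF.
have [U [V [hU hV eI]]] := Ig.
rewrite eb; apply: (special_ext hth (xi := xi)) => // [p hp px|].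
  have [N [s [r [e hs hr lt]]]] := pseudo_div hp hq q_n0.
  have r0 : r = 0.
    apply: qmin; rewrite -?sq //; have := congr1 (horner^~ x) e.
    by rewrite !hornerE px qx !mulr0 add0r.
  have := congr1 (fun p => (thp th p).[xi]) e; rewrite r0 addr0.
  have SN' : S (lead_coef q ^+ N) by apply: SX; exact: hq.
  rewrite !(thpM hth) //; last exact: pSC.
  rewrite !hornerM hxi mulr0 (thpC hth) hornerC => /eqP; rewrite mulf_eq0.
  case/orP => [|/eqP //]; have -> : th (lead_coef q ^+ N) = th (lead_coef q) ^+ N.
    elim: {SN' e} N => [|N IHN]; first by rewrite !expr0 -(rmorph1 io); case: hth => ->.
    by rewrite !exprS thM ?IHN //; [exact: hq | apply: SX; exact: hq].
  by rewrite expf_eq0 (negbTE tha) andbF.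
have := congr1 (fun p => (thp th p).[xi]) eI.
rewrite eg (thpC hth) hornerC (thpD hth); try exact: pSM.
rewrite !(thpM hth) // hornerD !hornerM hxi mulr0 addr0 => e.
by apply: contraNneq thc => e'; rewrite e e' mulr0.
Qed.

End Step.

Lemma nullst n (x : 'I_n -> L) : exists (S : set L) th,
  [/\ subr S, forall i, S (x i) & special S th].
Proof.
have [S [hS hx good]] : exists S, [/\ subr S, forall i : 'I_n, S (x i) & specializable S].
  elim: n x => [|n IH] x.
    exists (range io); split; [split| by case |].
    - by move=> c; exists c.
    - by move=> _ _ [a _ <-] [b _ <-]; exists (a + b); rewrite ?rmorphD.
    - by move=> _ _ [a _ <-] [b _ <-]; exists (a * b); rewrite ?rmorphM.
    move=> _ [a _ <-] a0; pose th y := if pselect (exists c, io c = y) is left h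
      then projT1 (cid h) else 0.
    have thE c : th (io c) = c.
      rewrite /th; case: pselect => [h|[]]; last by exists c.
      by case: cid => d /= /fmorph_inj.
    exists th; split; last by rewrite thE; apply: contraNneq a0 => ->; rewrite rmorph0.
    split=> // _ _ [b _ <-] [d _ <-]; first by rewrite -rmorphD !thE.
    by rewrite -rmorphM !thE.
  have [S [hS hx good]] := IH (fun i => x (lift ord_max i)).
  exists (adjoin S (x ord_max)); split.
  - exact: subr_adjoin.
  - move=> i; have [j ->|->] := unliftP ord_max i; last exact: adjoin_x.
    exact: adjoin_sub.
  - exact: specializable_adjoin.
have [||th [hth _]] := good 1; last by exists S, th.
  by case: hS => h _ _; rewrite -(rmorph1 io).
exact: oner_neq0.
Qed.

End Nullstellensatz.

(** * Sections of étale covers over strictly henselian rings *)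

Section Sections.
Variable k : closedFieldType.

(* Étale covers have sections over [B]; this is stable under change of the
   algebra [A] over which the cover is defined. *)
Definition strictly_henselian (B : alg k) : Prop :=
  forall (A : alg k) (r : hom A B) (A' : alg A), etale_cover A' ->
    inhabited (hom A' (along r)).

Lemma closedField_is_field : is_field k.
Proof.
by split=> [|x x0]; [exact: oner_neq0 | exists x^-1; rewrite mulfV].
Qed.

(** Surjectivity provides a point of the cover over some extension field L only. Its coordinates
    generate a finitely generated subring of L, which specializes to k by [nullst]. *)
Lemma henselian_k : strictly_henselian (self_alg k).
Proof.
move=> A r A' [[_ [n [rels [fi fib]]]] surj].
have [L [fL [h1] [h2]]] := surj (along r) closedField_is_field.
pose LF : fieldType := fld_field fL.
pose io : {rmorphism k -> LF} := hom_fun h1.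
pose gen (i : 'I_n) := fi (pres_gen (fun t t' => List.In (t, t') rels) i).
have [S [th [[S1 S2 S3] hx [th1 th2 th3]]]] :=
  @nullst k LF io n (fun i => h2 (gen i) : LF).
have Sk c : S (h2 (alg_str A' c)) /\ th (h2 (alg_str A' c)) = r c.
  by rewrite homE -(homE h1) /=; split; [exact: S1 | exact: th1].
have gens b : exists t, b = teval gen t.
  have [g fg gf] := fib; rewrite -[b]gf; exists (pres_repr (g b)).
  rewrite -[in LHS](pres_reprK (g b)) -teval_gen.
  elim: (pres_repr (g b)) => [i|c|t IHt s IHs|t IHt s IHs] //=.
  - exact: (homE fi c).
  - by rewrite rmorphD IHt IHs.
  - by rewrite rmorphM IHt IHs.
have SA b : S (h2 b).
  have [t ->] := gens b; elim: t => [i|c|t IHt s IHs|t IHt s IHs] /=.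
  - exact: hx.
  - exact: (Sk c).1.
  - by rewrite rmorphD; exact: S2.
  - by rewrite rmorphM; exact: S3.
constructor; apply: (@hom_of A A' (along r) (fun b => th (h2 b))).
- by move=> x y; rewrite rmorphD th2.
- by move=> x y; rewrite rmorphM th3.
- by move=> c; exact: (Sk c).2.
Qed.

(** Formal étaleness lifts a section over [B] across the square-zero kernel. *)
Lemma henselian_sqz (B : alg k) (D : alg B) :
  strictly_henselian B -> strictly_henselian (sqz D).
Proof.
move=> hB A r A' cA; have [h0] := hB A (hcomp (sqz_pr D) r) A' cA.
have [[fe _] _] := cA.
pose q := @Hom A (along r) (along (hcomp (sqz_pr D) r)) (sqz_pr D) (fun c => erefl).
have [h _] : exists! h : hom A' (along r), forall b, q (h b) = h0 b.
  apply: fe; first by move=> y; exact: (sqz_pr_surj D y).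
  move=> [x0 x1] [y0 y1] /= ex ey.
  have {}ex : x0 = 0 by exact: ex.
  have {}ey : y0 = 0 by exact: ey.
  by apply: sqz_ext; rewrite /= ex ey ?mulr0 // rmorph0 !mul0r addr0.
exact: inhabits h.
Qed.

Section Tower.
Let I n : set (pser k) := [set a | forall i, (i < n)%N -> fcoef a i = 0].

Let hI n : is_ideal (I n).
Proof.
split=> [i|x y hx hy i lt|x y hy i lt]; first by [].
  by rewrite fps_coefD hx // hy // addr0.
rewrite fps_coefM big1 // => j _; rewrite [fcoef y _]hy ?mulr0 //.
by apply: leq_ltn_trans lt; exact: leq_subr.
Qed.

Let Q n : alg k := quot (hI n).
Let q n : hom (pser k) (Q n) := qpi (hI n).

(** A section over k is lifted step by step to all quotients k[[t]]/t^n by formal étaleness, each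
    lift extending the previous one; completeness of k[[t]] assembles them. *)
Lemma henselian_pser : strictly_henselian (pser k).
Proof.
move=> A r A' cA; have [[fe _] _] := cA.
pose T n : alg A := along (hcomp (q n) r).
have red n : exists p : hom (T n.+1) (T n), forall x, p (q n.+1 x) = q n x.
  have [||g gE] := @hom_quot k (pser k) (Q n.+1) (Q n) (q n.+1) (q n).
  - exact: qpi_surj.
  - by move=> a /qpi0 h; apply/qpi0 => i lt; apply: h; exact: ltnW.
  have E x : g (q n.+1 x) = q n x by rewrite -gE.
  by exists (@Hom A (T n.+1) (T n) g (fun c => E (r c))).
have step n (h : hom A' (T n.+1)) : exists h' : hom A' (T n.+2),
    forall b x, h' b = q n.+2 x -> h b = q n.+1 x.
  have [p pE] := red n.+1.
  have [h' [e _]] : exists! h' : hom A' (T n.+2), forall b, p (h' b) = h b.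
    apply: fe => [y|x y].
      by have [x <-] := qpi_surj y; exists (q n.+2 x).
    have [a <-] := qpi_surj x; have [b <-] := qpi_surj y.
    rewrite -/(q _ _) -/(q _ _) !pE => /qpi0 ha /qpi0 hb; rewrite -rmorphM.
    apply/qpi0 => i lt; rewrite fps_coefM big1 // => j _.
    have [lj|gj] := ltnP j n.+1; first by rewrite ha ?mul0r.
    by rewrite hb ?mulr0 //; clear -lt gj; lia.
  by exists h' => b x hx; rewrite -e hx pE.
have [N] := henselian_k (hcomp (closed_point k) r) cA.
have h0 : hom A' (T 1%N).
  apply: (@hom_of A A' (T 1%N) (fun b => kin (Q 1%N) (N b))).
  - by move=> x y; rewrite !rmorphD.
  - by move=> x y; rewrite !rmorphM.
  - move=> c; rewrite homE /= -/(q 1%N _).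
    apply/eqP; rewrite -subr_eq0.
    rewrite -[X in X - _]/(q 1%N (fps_const (fcoef (r c) 0))) -rmorphB.
    apply/eqP/qpi0 => i; rewrite ltnS leqn0 => /eqP ->.
    by rewrite fps_coefB fps_coefC subrr.
pose hs := fix F n : hom A' (T n.+1) :=
  if n is m.+1 then projT1 (cid (step m (F m))) else h0.
have hsE n b x : hs n.+1 b = q n.+2 x -> hs n b = q n.+1 x.
  by move: b x; rewrite /=; case: cid.
have rep n b : exists x, hs n b = q n.+1 x.
  by have [x <-] := qpi_surj (hs n b); exists x.
(* The section modulo t^(n+1) determines the coefficient of t^n, whatever representative is
   chosen. *)
pose g (b : A') : pser k := Fps (fun n => fcoef (projT1 (cid (rep n b))) n).
have uq n x y : q n x = q n y -> forall i, (i < n)%N -> fcoef x i = fcoef y i.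
  move=> e i lt; apply/eqP; rewrite -subr_eq0 -fps_coefB; apply/eqP.
  suff : I n (x - y) by apply.
  by apply/qpi0; rewrite rmorphB; apply/eqP; rewrite subr_eq0; apply/eqP.
have hsE' n m b x : hs (n + m)%N b = q (n + m).+1 x -> hs n b = q n.+1 x.
  elim: m => [|m IH]; first by rewrite addn0.
  by rewrite addnS => /hsE; exact: IH.
have gE n b : hs n b = q n.+1 (g b).
  have [x hx] := rep n b; rewrite hx; apply/eqP; rewrite -subr_eq0 -rmorphB.
  apply/eqP/qpi0 => i lt; rewrite fps_coefB /g /=; case: cid => y /= hy.
  have : hs i b = q i.+1 x by apply: (@hsE' i (n - i)%N); rewrite subnKC.
  by rewrite hy => /uq -> //; rewrite subrr.
have gext x y : (forall n, q n.+1 x = q n.+1 y) -> x = y.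
  by move=> e; apply: fps_ext => n; exact: (uq _ _ _ (e n)).
constructor; apply: (@hom_of A A' (along r) g).
- by move=> x y; apply: gext => n; rewrite rmorphD -!gE rmorphD.
- by move=> x y; apply: gext => n; rewrite rmorphM -!gE rmorphM.
- by move=> c; apply: gext => n; rewrite -gE homE.
Qed.
End Tower.

Lemma henselian_triv (G : grp k) (X : kfun k) (aX : gaction G X) (A : alg k)
    (x : ob (quot_stack aX) A) : strictly_henselian A ->
  exists (y : X A) (m : @mor _ (quot_stack aX) A A (triv_ob aX y) x), mor_base m = hid A.
Proof.
move=> hA; have [A' [cA [s [s1 s2]]]] := tors_loc x.
have [e] := hA A (hid A) A' cA.
have eE c : e (alg_str A' c) = c by exact: homE.
pose e' : hom (restr A') A :=
  @hom_of k (restr A') A e (rmorphD e) (rmorphM e) (fun c => eE (alg_str A c)).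
have [|m em] := @section_triv k G X aX A x (hcomp e' s).
  split; first by rewrite -hcompA s1; apply: hom_ext => c; exact: eE.
  move=> C a p ea; rewrite hcompA; apply: s2.
  by rewrite ea -hcompA; apply: hom_ext => c; rewrite hcompE -[hcomp _ _ c]/(e (alg_str A' c)) eE.
by exists (kmap (hcomp e' s) (tors_map x)), m.
Qed.

End Sections.

(** * Étale descent *)

Section Noetherian.
Variable B : comNzRingType.

Definition subring_set (S : set B) : Prop :=
  [/\ S 0, S 1, forall x, S x -> S (- x), forall x y, S x -> S y -> S (x + y)
    & forall x y, S x -> S y -> S (x * y)].

(** The ascending chain condition for ideals of S, in terms of sequences of generators. Subrings are
    subsets of a fixed ring, so that generators can be adjoined without changing the type. *)
Definition noetherian (S : set B) : Prop :=
  forall h : nat -> B, (forall i, S (h i)) ->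
    exists N (c : 'I_N -> B), (forall i, S (c i)) /\ h N = \sum_(i < N) c i * h i.

Definition poly_over (S : set B) (p : {poly B}) := forall i, S p`_i.

Definition adjoin1 (S : set B) (x : B) : set B :=
  [set y | exists p, poly_over S p /\ y = p.[x]].

Section Adjoin.
Variables (S : set B) (x : B).
Hypothesis hS : subring_set S.

Let S0 : S 0. Proof. by case: hS. Qed.
Let S1 : S 1. Proof. by case: hS. Qed.
Let SN a : S a -> S (- a). Proof. by case: hS => _ _ + _ _; exact. Qed.
Let SD a b : S a -> S b -> S (a + b). Proof. by case: hS => _ _ _ + _; exact. Qed.
Let SM a b : S a -> S b -> S (a * b). Proof. by case: hS => _ _ _ _; exact. Qed.
Let Ssum n (F : 'I_n -> B) : (forall i, S (F i)) -> S (\sum_(i < n) F i).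
Proof. by move=> h; elim/big_ind: _ => // a b; exact: SD. Qed.

Lemma poD p q : poly_over S p -> poly_over S q -> poly_over S (p + q).
Proof. by move=> hp hq i; rewrite coefD; exact: SD. Qed.
Lemma poN p : poly_over S p -> poly_over S (- p).
Proof. by move=> hp i; rewrite coefN; exact: SN. Qed.
Lemma poM p q : poly_over S p -> poly_over S q -> poly_over S (p * q).
Proof. by move=> hp hq i; rewrite coefM; apply: Ssum => j; exact: SM. Qed.
Lemma poC c : S c -> poly_over S c%:P.
Proof. by move=> hc i; rewrite coefC; case: ifP. Qed.
Lemma poXn n : poly_over S 'X^n.
Proof. by move=> i; rewrite coefXn; case: eqP. Qed.

Lemma subring_adjoin : subring_set (adjoin1 S x).
Proof.
split.
- by exists 0%:P; rewrite hornerC; split=> //; exact: poC.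
- by exists 1%:P; rewrite hornerC; split=> //; exact: poC.
- by move=> _ [p [hp ->]]; exists (- p); rewrite hornerN; split=> //; exact: poN.
- by move=> _ _ [p [hp ->]] [q [hq ->]]; exists (p + q); rewrite hornerD; split=> //; exact: poD.
- by move=> _ _ [p [hp ->]] [q [hq ->]]; exists (p * q); rewrite hornerM; split=> //; exact: poM.
Qed.

Lemma adjoin1_sub a : S a -> adjoin1 S x a.
Proof. by move=> ha; exists a%:P; rewrite hornerC; split=> //; exact: poC. Qed.
Lemma adjoin1_x : adjoin1 S x x.
Proof. by exists 'X; rewrite hornerX; split=> //; exact: (poXn 1). Qed.

(** Hilbert's argument, with polynomials over S evaluated at x: P_n has minimal degree among those
    with value in the ideal [I] but outside the span of the earlier values. The leading coefficient
    of some P_N is a combination of the earlier ones, and subtracting the corresponding multiples of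
    the P_i lowers the degree. *)
Lemma noetherian_adjoin : noetherian S -> noetherian (adjoin1 S x).
Proof.
move=> nS h hh; apply: contrapT => bad.
set S' := adjoin1 S x in hh bad *.
have [S'0 S'1 S'N S'D S'M] := subring_adjoin; rewrite -/S' in S'0 S'1 S'N S'D S'M.
have S'sum n (F : 'I_n -> B) : (forall i, S' (F i)) -> S' (\sum_(i < n) F i).
  by move=> hF; elim/big_ind: _ => // a b; exact: S'D.
pose span n (y : nat -> B) z := exists c : 'I_n -> B,
  (forall i, S' (c i)) /\ z = \sum_(i < n) c i * y i.
have span_trans n m (y y' : nat -> B) z : span n y z ->
    (forall i, (i < n)%N -> span m y' (y i)) -> span m y' z.
  move=> [c [hc ->]] hy.
  have [d hd] : exists d : 'I_n -> 'I_m -> B, forall i,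
      (forall j, S' (d i j)) /\ y i = \sum_(j < m) d i j * y' j.
    by exists (fun i : 'I_n => projT1 (cid (hy i (ltn_ord i)))) => i; case: cid.
  exists (fun j => \sum_(i < n) c i * d i j); split.
    by move=> j; apply: S'sum => i; apply: S'M => //; exact: (hd i).1.
  under eq_bigr => i _ do rewrite (hd i).2 mulr_sumr.
  rewrite exchange_big; apply: eq_bigr => j _ /=.
  by rewrite mulr_suml; apply: eq_bigr => i _; rewrite mulrA.
have span_mono n m (y : nat -> B) z : (n <= m)%N -> span n y z -> span m y z.
  move=> le hz; apply: span_trans hz _ => i lt.
  pose i0 := Ordinal (leq_trans lt le).
  exists (fun j => (j == i0)%:R); split; first by move=> j; case: eqP.
  rewrite (bigD1 i0) //= eqxx mul1r big1 ?addr0 // => j /negbTE ->.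
  by rewrite mul0r.
(* The ideal generated by the whole sequence. If no term is in the span of its predecessors, no
   finite family of elements of [I] spans it, so a next candidate always exists. *)
pose I z := exists n, span n h z.
have ID a b : I a -> I b -> I (a + b).
  move=> [n ha] [m hb].
  have [c [hc ea]] := span_mono _ (maxn n m) _ _ (leq_maxl n m) ha.
  have [d [hd eb]] := span_mono _ (maxn n m) _ _ (leq_maxr n m) hb.
  exists (maxn n m), (fun i => c i + d i); split; first by move=> i; exact: S'D.
  by rewrite ea eb -big_split; apply: eq_bigr => i _; rewrite mulrDl.
have IM a b : S' a -> I b -> I (a * b).
  move=> ha [n [c [hc ->]]]; exists n, (fun i => a * c i); split.
    by move=> i; exact: S'M.
  by rewrite mulr_sumr; apply: eq_bigr => i _; rewrite mulrA.
pose cand n (y : nat -> B) p :=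
  [/\ poly_over S p, I p.[x] & ~ span n y p.[x]].
have cand_ex n y : (forall i, (i < n)%N -> I (y i)) -> exists p, cand n y p.
  move=> hy; apply: contrapT => no.
  have [N hN] : exists N, forall i, (i < n)%N -> span N h (y i).
    elim: n hy {no} => [|n IH] hy; first by exists 0%N.
    have [|N hN] := IH; first by move=> i lt; apply: hy; exact: ltnW.
    have [m hm] := hy n (ltnSn n); exists (maxn N m) => i.
    rewrite ltnS leq_eqVlt => /orP[/eqP ->|/hN hi].
      by apply: span_mono hm; exact: leq_maxr.
    by apply: span_mono hi; exact: leq_maxl.
  have [p [hp ep]] := hh N.
  have : span N h (h N).
    apply: (span_trans n); last exact: hN.
    apply: contrapT => hno; apply: no; exists p; split=> //; rewrite -ep //.
    exists N.+1, (fun i => (i == ord_max)%:R); split; first by move=> i; case: eqP.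
    rewrite (bigD1 ord_max) //= eqxx mul1r big1 ?addr0 // => j /negbTE ->.
    by rewrite mul0r.
  by move=> [c [hc ec]]; apply: bad; exists N, c.
have next n y : exists p, (forall i, (i < n)%N -> I (y i)) ->
    cand n y p /\ forall q, cand n y q -> (size p <= size q)%N.
  have [hy|no] := pselect (forall i, (i < n)%N -> I (y i)); last by exists 0.
  have ex : exists m, `[< exists p, cand n y p /\ size p = m >].
    by have [p hp] := cand_ex n y hy; exists (size p); apply/asboolP; exists p.
  case: (ex_minnP ex) => m /asboolP [p [hp sp]] hm; exists p => _; split=> // q hq.
  by rewrite sp; apply: hm; apply/asboolP; exists q.
pose nx n (s : seq {poly B}) := projT1 (cid (next n (fun i => (s`_i).[x]))).
(* Each choice depends on all the earlier ones, hence the recursion on lists of choices. *)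
pose L := fix L n : seq {poly B} := if n is m.+1 then rcons (L m) (nx m (L m)) else [::].
have sL n : size (L n) = n by elim: n => //= n IH; rewrite size_rcons IH.
pose P n := nx n (L n).
have LP n i : (i < n)%N -> (L n)`_i = P i.
  elim: n => // n IH; rewrite ltnS leq_eqVlt /= nth_rcons sL => /orP[/eqP ->|lt].
    by rewrite ltnn eqxx.
  by rewrite lt IH.
have PP n : cand n (fun i => (P i).[x]) (P n) /\
    forall q, cand n (fun i => (P i).[x]) q -> (size (P n) <= size q)%N.
  elim/ltn_ind: n => n IH.
  have IP i : (i < n)%N -> I ((L n)`_i).[x].
    by move=> lt; rewrite LP //; have [[]] := IH i lt.
  have sp y y' z : (forall i, (i < n)%N -> y i = y' i) -> span n y z -> span n y' z.
    move=> e [c [hc ->]]; exists c; split=> //; apply: eq_bigr => i _.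
    by rewrite e.
  have e i : (i < n)%N -> ((L n)`_i).[x] = (P i).[x] by move=> lt; rewrite LP.
  have ce q : cand n (fun i => (P i).[x]) q <-> cand n (fun i => ((L n)`_i).[x]) q.
    split=> -[h1 h2 h3]; split=> // h4; apply: h3; apply: sp h4 => i lt; rewrite e //.
  rewrite /P /nx; case: cid => p /= /(_ IP) [h1 h2].
  by split; [apply/ce | move=> q /ce; exact: h2].
have [N [c [hc ec]]] := nS (fun n => lead_coef (P n)) (fun n => (let: And3 a _ _ := (PP n).1 in a) _).
have szP i : (i < N)%N -> (size (P i) <= size (P N))%N.
  move=> lt; apply: (PP i).2; have [[h1 h2 h3] _] := PP N; split=> // h4.
  by apply: h3; apply: span_mono h4; exact: ltnW.
have [[PN1 PN2 PN3] PNmin] := PP N.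
pose T (i : 'I_N) : {poly B} := (c i)%:P * 'X^(size (P N) - size (P i)).
have poT i : poly_over S (T i) by apply: poM; [exact: poC | exact: poXn].
pose q := P N - \sum_(i < N) T i * P i.
have posum : poly_over S (\sum_(i < N) T i * P i).
  move=> l; rewrite coef_sum; apply: Ssum => i; apply: poM => //.
  by have [[]] := PP i.
have qx : q.[x] = (P N).[x] - \sum_(i < N) (T i).[x] * (P i).[x].
  by rewrite hornerD hornerN horner_sum; congr (_ - _); apply: eq_bigr => i _; rewrite hornerM.
have S'T i : S' (T i).[x] by exists (T i).
have spT : span N (fun i => (P i).[x]) (\sum_(i < N) (T i).[x] * (P i).[x]).
  by exists (fun i => (T i).[x]).
have PN0 : (0 < size (P N))%N.
  rewrite size_poly_gt0; apply/eqP => e; apply: PN3; rewrite e horner0.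
  exists (fun=> 0); split=> //; rewrite big1 // => i _; exact: mul0r.
have : (size (P N) <= size q)%N.
  apply: PNmin; split.
  - by apply: poD => //; exact: poN.
  - rewrite qx -mulN1r; apply: (ID) => //; apply: (IM); first exact: S'N.
    apply: (big_ind I) => [|a b|i _]; last by apply: (IM) => //; have [[]] := PP i.
      by exists 0%N, (fun=> 0); rewrite big_ord0.
    exact: ID.
  - rewrite qx => h1; apply: PN3; have [d [hd ed]] := h1.
    exists (fun i => d i + (T i).[x]); split; first by move=> i; exact: S'D.
    under eq_bigr => i _ do rewrite mulrDl.
    by rewrite big_split /= -ed subrK.
apply/negP; rewrite -ltnNge -(prednK PN0) ltnS; apply/leq_sizeP => j hj.
rewrite coefB coef_sum.
have [e|ne] := eqVneq j (size (P N)).-1; last first.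
  have hj' : (size (P N) <= j)%N by rewrite -(prednK PN0) ltn_neqAle eq_sym ne.
  rewrite nth_default // big1 ?subr0 // => i _.
  rewrite -mulrA coefCM coefXnM; case: ifP; rewrite ?mulr0 // => _.
  rewrite nth_default ?mulr0 // -(leq_add2r (size (P N) - size (P i))).
  rewrite subnKC ?szP // subnK //.
  by apply: leq_trans hj'; exact: leq_subr.
apply/eqP; rewrite subr_eq0 e -/(lead_coef _) ec; apply/eqP; apply: eq_bigr => i _.
rewrite -mulrA coefCM; congr (_ * _); rewrite coefXnM.
have [e0|] := posnP (size (P i)).
  rewrite e0 subn0 ltn_predL PN0 lead_coefE e0.
  by rewrite nth_default // e0.
move=> gt0; have le := szP i (ltn_ord i).
have [-> ->] := pdiv_aux gt0 le.
by [].
Qed.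

End Adjoin.
End Noetherian.

Lemma teval_hom (R : comPzRingType) (V : Type) (C D : alg R) (h : hom C D)
  (x : V -> C) t : h (teval x t) = teval (fun i => h (x i)) t.
Proof.
elim: t => [i|c|t IHt s IHs|t IHt s IHs] //=; first exact: homE.
  by rewrite rmorphD IHt IHs.
by rewrite rmorphM IHt IHs.
Qed.

Section NzOf.
Variables (A : comPzRingType) (hA : 1 != 0 :> A).
Definition nzof of (1 != 0 :> A) : Type := A.
HB.instance Definition _ := GRing.ComPzRing.copy (nzof hA) A.
HB.instance Definition _ := GRing.PzSemiRing_isNonZero.Build (nzof hA) hA.
Definition nzof_ring : comNzRingType := nzof hA.
End NzOf.

Section FreeAlg.
Variables (k : fieldType) (V : finType).

Definition no_rel (t t' : term k V) : Prop := False.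
Definition free : alg k := pres no_rel.
Definition fgen (v : V) : free := pres_gen no_rel v.

Lemma no_rel_sat (C : alg k) (x : V -> C) : satisfies no_rel x.
Proof. by []. Qed.
Definition free_lift (C : alg k) (x : V -> C) : hom free C := pres_lift (no_rel_sat x).
Lemma free_liftE (C : alg k) (x : V -> C) v : free_lift x (fgen v) = x v.
Proof. exact: pres_lift_gen. Qed.

Lemma free_ind (S : free -> Prop) : (forall c, S (alg_str free c)) ->
  (forall v, S (fgen v)) -> (forall x y, S x -> S y -> S (x + y)) ->
  (forall x y, S x -> S y -> S (x * y)) -> forall x, S x.
Proof.
move=> Sc Sv SD SM x; rewrite -[x]pres_reprK -teval_gen.
elim: (pres_repr x) => [i|c|t IHt s IHs|t IHt s IHs].
- exact: Sv.
- exact: Sc.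
- exact: SD.
- exact: SM.
Qed.

Lemma free_neq0 : 1 != 0 :> free.
Proof.
apply/eqP => /(congr1 (free_lift (C := self_alg k) (fun=> 0))).
by rewrite rmorph1 rmorph0 => /eqP; rewrite oner_eq0.
Qed.

Lemma free_noetherian (h : nat -> free) :
  exists N (c : 'I_N -> free), h N = \sum_(i < N) c i * h i.
Proof.
pose B : comNzRingType := nzof_ring free_neq0.
suff [S [nS hS hall]] : exists S : set B,
    [/\ noetherian S, subring_set S & forall x, S x].
  have [N [c [_ e]]] := nS h (fun i => hall _).
  by exists N, c.
have [S [nS hS [hc hv]]] : exists S : set B, [/\ noetherian S, subring_set S &
    (forall c, S (alg_str free c)) /\ forall v, v \in enum V -> S (fgen v)].
  elim: (enum V) => [|v s [S [nS hS [hc hv]]]].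
    exists (range (alg_str free)); split.
    - move=> h' hh; have [e0|ne] := pselect (h' 0%N = 0).
        by exists 0%N, (fun=> 0); split=> [i|]; [exists 0; rewrite ?rmorph0 | rewrite big_ord0].
      have [a _ ea] := hh 0%N; have [b _ eb] := hh 1%N.
      have a0 : a != 0 by apply/eqP => e; apply: ne; rewrite -ea e; exact: rmorph0.
      exists 1%N, (fun=> alg_str free (b / a)); split; first by move=> i; exists (b / a).
      rewrite big_ord1 -ea -eb.
      transitivity (alg_str free (b / a * a)); first by rewrite divfK.
      exact: rmorphM.
    - split.
      + by exists 0 => //; exact: rmorph0.
      + by exists 1 => //; exact: rmorph1.
      + by move=> _ [a _ <-]; exists (- a) => //; exact: rmorphN.
      + by move=> _ _ [a _ <-] [b _ <-]; exists (a + b) => //; exact: rmorphD.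
      + by move=> _ _ [a _ <-] [b _ <-]; exists (a * b) => //; exact: rmorphM.
    - by split=> // c; exists c.
  exists (adjoin1 S (fgen v : B)); split.
  - exact: noetherian_adjoin.
  - exact: subring_adjoin.
  - split=> [c|w]; first exact/adjoin1_sub/hc.
    rewrite inE => /orP[/eqP ->|/hv]; [exact: adjoin1_x | exact: adjoin1_sub].
exists S; split=> // x; case: hS => _ _ _ SD SM.
by apply: (@free_ind (S : free -> Prop)) => // v; apply: hv; rewrite mem_enum.
Qed.
End FreeAlg.

(** * Polynomials in n variables *)

Section PolyRing.
Variable n : nat.
Definition expo : nmodType := {ffun 'I_n -> nat}.
Definition ex (e : expo) (i : 'I_n) : nat := (e : {ffun 'I_n -> nat}) i.
Definition dl (i : 'I_n) : expo := [ffun j => (j == i : nat)].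
Lemma ex0 i : ex 0 i = 0%N. Proof. by rewrite /ex ffunE. Qed.
Lemma exD e f i : ex (e + f) i = (ex e i + ex f i)%N.
Proof. by rewrite /ex ffunE. Qed.
Lemma ex_dl i j : ex (dl i) j = (j == i). Proof. by rewrite /ex ffunE. Qed.
Lemma exMn e m i : ex (e *+ m) i = (m * ex e i)%N.
Proof. by elim: m => [|m IH]; rewrite ?mulr0n ?ex0 // mulrS exD IH mulSn. Qed.
Lemma ex_sum (I : Type) (r : seq I) (F : I -> expo) j :
  ex (\sum_(i <- r) F i) j = (\sum_(i <- r) ex (F i) j)%N.
Proof. by elim: r => [|i r IH]; rewrite ?big_nil ?ex0 // !big_cons exD IH. Qed.
Lemma expo_ext (e f : expo) : (forall i, ex e i = ex f i) -> e = f.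
Proof. by move=> h; apply/ffunP => i; exact: h. Qed.

Section PR.
Variable R : comPzRingType.
Definition PR : alg R := mona R expo.
Definition pX (i : 'I_n) : PR := ma_d (dl i) 1.

Section Peval.
Variables (D : alg R) (x : 'I_n -> D).
Lemma peval0 : \prod_i x i ^+ ex 0 i = 1.
Proof. by rewrite big1 // => i _; rewrite ex0 expr0. Qed.
Lemma pevalD (e f : expo) : \prod_i x i ^+ ex (e + f) i =
  (\prod_i x i ^+ ex e i) * \prod_i x i ^+ ex f i.
Proof. by rewrite -big_split; apply: eq_bigr => i _; rewrite exD exprD. Qed.
Definition peval : hom PR D :=
  @mona_ev R expo D (fun e : expo => \prod_i x i ^+ ex e i) peval0 pevalD.
Lemma pevalX i : peval (pX i) = x i.
Proof.
rewrite /peval mona_ev_d rmorph1 mul1r (bigD1 i) //= ex_dl eqxx expr1 big1 ?mulr1 //.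
by move=> j /negbTE ne; rewrite ex_dl ne expr0.
Qed.
End Peval.

Lemma ma_d_mon (e : expo) (a : R) : ma_d e a = ma_c _ a * \prod_i pX i ^+ ex e i :> PR.
Proof.
have dX m (s : nat) : (ma_d (m : expo) 1 : PR) ^+ s = ma_d (m *+ s) 1.
  elim: s => [|s IH]; first by rewrite expr0 mulr0n.
  by rewrite exprS IH ma_dM mulr1 mulrS.
have P (r : seq 'I_n) : \prod_(i <- r) pX i ^+ ex e i =
   ma_d (\sum_(i <- r) dl i *+ ex e i) 1 :> PR.
  elim: r => [|i r IH]; first by rewrite !big_nil.
  by rewrite !big_cons IH dX ma_dM mulr1.
rewrite P ma_dM mulr1 add0r; congr (ma_d _ _).
apply: expo_ext => j; rewrite ex_sum (bigD1 j) //= exMn ex_dl eqxx muln1.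
by rewrite big1 ?addn0 // => i ne; rewrite exMn ex_dl eq_sym (negbTE ne) muln0.
Qed.

Lemma PR_ind (S : PR -> Prop) : (forall c, S (ma_c _ c)) -> (forall i, S (pX i)) ->
  (forall x y, S x -> S y -> S (x + y)) -> (forall x y, S x -> S y -> S (x * y)) ->
  forall p : PR, S p.
Proof.
move=> Sc SX SD SM p; rewrite [p]monalg_sum.
apply: (@big_ind _ S _ _ _ SD) => [|e _].
  by rewrite -(rmorph0 (alg_str PR)); exact: Sc.
rewrite ma_d_mon; apply: (SM) => //.
have S1 : S 1 by rewrite -(rmorph1 (alg_str PR)); exact: Sc.
apply: (big_ind S) => // i _; elim: (ex e i) => [|m IH]; rewrite ?expr0 // exprS.
exact: SM.
Qed.

Lemma PR_ext (D : alg R) (f g : hom PR D) : (forall i, f (pX i) = g (pX i)) -> f = g.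
Proof.
move=> e; apply: hom_ext => p; apply: (@PR_ind (fun p => f p = g p)) => //.
- by move=> c; rewrite -[ma_c _ c]/(alg_str PR c) !homE.
- by move=> x y; rewrite !rmorphD => -> ->.
- by move=> x y; rewrite !rmorphM => -> ->.
Qed.
End PR.

Section MapCoef.
Variables (R R' : comPzRingType) (e : R -> R').
Hypothesis e0 : e 0 = 0.
(** Coefficients are also pushed along maps that are merely additive, such as the projection B' ->
    B'/B in [effective_core]; [pmapM] is the semilinearity that remains of multiplicativity. *)
Definition pmap (p : PR R) : PR R'.
Proof.
exists (fun m => e (mc p m)); exists (supp p) => m h; apply: suppP.
by apply: contraNneq h => ->; rewrite e0.
Defined.
End MapCoef.

Section MapCoefM.
Variables (R R' : comPzRingType) (e : R -> R') (d : {rmorphism R -> R'}).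
Variables (S : comPzRingType) (i : {rmorphism S -> R}) (io : {rmorphism S -> R'}).
Hypothesis eD : forall x y, e (x + y) = e x + e y.
Hypothesis eM : forall x b, e (x * i b) = e x * io b.
Lemma map0 : e 0 = 0.
Proof. by have := eD 0 0; rewrite addr0 -{1}[e 0]addr0 => /addrI <-. Qed.

Lemma pmapD (p q : PR R) : pmap map0 (p + q) = pmap map0 p + pmap map0 q.
Proof. by apply: monalg_ext => m; exact: eD. Qed.

Lemma pmapM (p : PR R) (q : PR S) :
  pmap map0 (p * pmap (rmorph0 i) q) = pmap map0 p * pmap (rmorph0 io) q.
Proof.
have esum (I : Type) (r : seq I) (h : I -> R) : e (\sum_(j <- r) h j) = \sum_(j <- r) e (h j).
  by elim: r => [|x r IH]; rewrite ?big_nil ?map0 // !big_cons eD IH.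
apply: monalg_ext => m.
rewrite -[LHS]/(e (ma_mulf p (pmap (rmorph0 i) q) m)).
rewrite -[RHS]/(ma_mulf (pmap map0 p) (pmap (rmorph0 io) q) m) /ma_mulf.
have F0 (T : comPzRingType) (g : PR T) (l : expo) :
    pr (fun j b => if l + j == m then 0 * b else 0) g = 0.
  by apply: pr0 => j; rewrite mul0r if_same.
rewrite [in RHS](@prE _ _ _ _ _ (supp p)); last 3 first.
- by move=> l; exact: F0.
- exact: supp_uniq.
- by move=> l h; apply: suppP; apply: contraNneq h => /= ->; rewrite map0.
have prU (T : comPzRingType) (V : nmodType) (F : expo -> T -> V) (f : PR T) :
  pr F f = \sum_(l <- supp f) F l (f l) by [].
rewrite [pr _ p]prU esum; apply: eq_bigr => l _.
have Q (T : comPzRingType) (t : {rmorphism S -> T}) (c : T) :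
  pr (fun j b => if l + j == m then c * b else 0) (pmap (rmorph0 t) q) =
  \sum_(j <- supp q) (if l + j == m then c * t (q j) else 0).
  rewrite (@prE _ _ _ _ _ (supp q)) //.
  - by move=> j; rewrite mulr0 if_same.
  - exact: supp_uniq.
  - by move=> j h; apply: suppP; apply: contraNneq h => /= ->; rewrite rmorph0.
rewrite !Q esum; apply: eq_bigr => j _.
by case: eqP => _; rewrite ?map0 // eM.
Qed.
End MapCoefM.

Definition bc (R R' : comPzRingType) (d : {rmorphism R -> R'}) (p : PR R) : PR R' :=
  pmap (rmorph0 d) p.

Lemma bcM (R R' : comPzRingType) (d : {rmorphism R -> R'}) p q :
  bc d (p * q) = bc d p * bc d q.
Proof.
have H := @pmapM R R' d R idfun d (rmorphD d) (rmorphM d) p q.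
have e1 : pmap (rmorph0 (idfun : {rmorphism R -> R})) q = q by apply: monalg_ext.
have e2 f : pmap (map0 (rmorphD d)) f = bc d f by apply: monalg_ext.
by rewrite e1 !e2 in H.
Qed.
Lemma bcD (R R' : comPzRingType) (d : {rmorphism R -> R'}) p q :
  bc d (p + q) = bc d p + bc d q.
Proof. by apply: monalg_ext => m; exact: rmorphD. Qed.
Lemma bcC (R R' : comPzRingType) (d : {rmorphism R -> R'}) c :
  bc d (ma_c _ c) = ma_c _ (d c).
Proof. by apply: monalg_ext => m /=; case: eqP => // _; rewrite rmorph0. Qed.
Lemma bcX (R R' : comPzRingType) (d : {rmorphism R -> R'}) i : bc d (pX R i) = pX R' i.
Proof. by apply: monalg_ext => m /=; case: eqP => // _; rewrite ?rmorph0 ?rmorph1. Qed.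

Definition bch (R : comPzRingType) (D : alg R) : hom (PR R)
   (@Alg R (PR D) (alg_str (PR D) \o alg_str D)) :=
  @hom_of R (PR R) (@Alg R (PR D) (alg_str (PR D) \o alg_str D)) (bc (alg_str D))
   (bcD _) (bcM _) (bcC _).

End PolyRing.

Lemma ma_natXn (A : comPzRingType) (g : mona A nat) m (b : A) i :
  (ma_d m b * g) i = (if (m <= i)%N then b * g (i - m)%N else 0).
Proof.
rewrite -[LHS]/(ma_mulf _ _ i) /ma_mulf pr_d => [|j]; last first.
  by apply: pr0 => l; rewrite mul0r if_same.
case: leqP => h; last first.
  apply: pr0 => j; rewrite ifF //; apply/eqP => e; move: h.
  by rewrite -e /GRing.add /= ltnNge leq_addr.
rewrite [in RHS]coefE /pr mulr_sumr; apply: eq_bigr => j _.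
have -> : ((m + j)%R == i) = (j == (i - m)%N).
  by rewrite /GRing.add /= -[X in _ == X](subnKC h) eqn_add2l.
by case: eqP; rewrite ?mulr0.
Qed.

(** * A Krull intersection argument for an ideal mapped into its square *)

Section Krull.
Variables (k : fieldType) (R : alg k) (n : nat) (J : finType).
Variables (f g : J -> PR n R) (xi : 'I_n -> PR n R) (h : J -> J * J -> PR n R).
Variable a : R.
Hypothesis sf : forall j,
  peval xi (f j) = \sum_(p : J * J) h j p * (f p.1 * f p.2).
Hypothesis ag : ma_c _ a = \sum_j g j * f j.

Let PRk : alg k := restr (PR n R).
Let s : hom PRk PRk := rh (peval xi).

(** Only finitely many coefficients occur in xi, h and g. They are replaced by variables Y which,
    together with variables X_i and one variable Z_j for each f_j, generate a polynomial ring [Q]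
    over k. Thus the noetherian argument takes place in [Q], while R is arbitrary. *)
Let ps : seq (PR n R) := [seq xi i | i <- enum 'I_n] ++
  [seq h q.1 q.2 | q <- enum {: J * (J * J)}] ++ [seq g j | j <- enum J].
Let cs : seq R := flatten [seq [seq mc p m | m <- supp p] | p <- ps].

Let V : finType := ('I_(size cs) + ('I_n + J))%type.
Let Q : alg k := free k V.
Let vY l : Q := fgen k (inl l : V).
Let vX i : Q := fgen k (inr (inl i) : V).
Let vZ j : Q := fgen k (inr (inr j) : V).

Let ev_gen (v : V) : PRk := match v with
  | inl l => ma_c _ cs`_l
  | inr (inl i) => pX R i
  | inr (inr j) => f j
  end.
Let ev : hom Q PRk := free_lift ev_gen.

Let Qu : alg k := restr (mona Q nat).
Let cst : hom Q Qu := restr_str (mona Q nat).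
(** The resulting map Q -> Q[u] records the degree in the variables Z as a power of u. *)
Let sg_gen (v : V) : Qu := match v with
  | inr (inr j) => ma_d 1%N (vZ j)
  | _ => ma_c _ (fgen k v)
  end.
Let sg : hom Q Qu := free_lift sg_gen.
Let evY l : ev (vY l) = ma_c _ cs`_l. Proof. exact: free_liftE. Qed.
Let evX i : ev (vX i) = pX R i. Proof. exact: free_liftE. Qed.
Let evZ j : ev (vZ j) = f j. Proof. exact: free_liftE. Qed.
Let sgY l : sg (vY l) = cst (vY l). Proof. exact: free_liftE. Qed.
Let sgX i : sg (vX i) = cst (vX i). Proof. exact: free_liftE. Qed.
Let sgZ j : sg (vZ j) = ma_d 1%N (vZ j). Proof. exact: free_liftE. Qed.
Let cstE q : cst q = ma_d 0%N q. Proof. by []. Qed.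

Let good (p : PR n R) := exists q : Q, ev q = p /\ sg q = cst q.

Let good_lift (p : PR n R) : (forall m, p m != 0 -> p m \in cs) -> good p.
Proof.
move=> hp; rewrite [p]monalg_sum big_seq.
have gD x y : good x -> good y -> good (x + y).
  by move=> [b [b1 b2]] [c [c1 c2]]; exists (b + c); rewrite !rmorphD b1 b2 c1 c2.
have gM x y : good x -> good y -> good (x * y).
  by move=> [b [b1 b2]] [c [c1 c2]]; exists (b * c); rewrite !rmorphM b1 b2 c1 c2.
have g0 : good 0 by exists 0; rewrite !rmorph0.
have g1 : good 1 by exists 1; rewrite !rmorph1.
apply: (big_ind good) => //= m hm.
have [->|ne] := eqVneq (p m) 0.
  have -> : ma_d m 0 = 0 :> PR n R by apply: monalg_ext => i /=; rewrite if_same.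
  by [].
rewrite ma_d_mon; apply: (gM); last first.
  apply: (big_ind good) => // i _; elim: (ex m i) => [|e IH]; rewrite ?expr0 // exprS.
  by apply: (gM) => //; exists (vX i); rewrite evX sgX.
have lt : (index (p m) cs < size cs)%N by rewrite index_mem hp.
exists (vY (Ordinal lt)); rewrite evY sgY; split=> //=.
by rewrite nth_index // hp.
Qed.

Let good_ps p : p \in ps -> good p.
Proof.
move=> hp; apply: good_lift => m ne; apply/flattenP.
exists [seq mc p m | m <- supp p]; first by apply: map_f.
by apply: map_f; exact: suppP.
Qed.

Let goodxi i : good (xi i).
Proof. by apply: good_ps; rewrite mem_cat map_f // mem_enum. Qed.
Let goodh j p : good (h j p).
Proof.
apply: good_ps; rewrite !mem_cat; apply/orP; right; apply/orP; left.
by apply/mapP; exists (j, p); rewrite ?mem_enum.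
Qed.
Let goodg j : good (g j).
Proof.
by apply: good_ps; rewrite !mem_cat; apply/orP; right; apply/orP; right;
  rewrite map_f // mem_enum.
Qed.

Let xi' i : Q := projT1 (cid (goodxi i)).
Let h' j p : Q := projT1 (cid (goodh j p)).
Let g' j : Q := projT1 (cid (goodg j)).
Let xi'P i : ev (xi' i) = xi i /\ sg (xi' i) = cst (xi' i).
Proof. by rewrite /xi'; case: cid. Qed.
Let h'P j p : ev (h' j p) = h j p /\ sg (h' j p) = cst (h' j p).
Proof. by rewrite /h'; case: cid. Qed.
Let g'P j : ev (g' j) = g j /\ sg (g' j) = cst (g' j).
Proof. by rewrite /g'; case: cid. Qed.

(** The lift to [Q] of the substitution X -> xi. It sends each Z_j to a form of degree two in Z and
    therefore doubles the degree in Z. *)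
Let st_gen (v : V) : Q := match v with
  | inl l => vY l
  | inr (inl i) => xi' i
  | inr (inr j) => \sum_(p : J * J) h' j p * (vZ p.1 * vZ p.2)
  end.
Let st : hom Q Q := free_lift st_gen.
Let stY l : st (vY l) = vY l. Proof. exact: free_liftE. Qed.
Let stX i : st (vX i) = xi' i. Proof. exact: free_liftE. Qed.
Let stZ j : st (vZ j) = \sum_(p : J * J) h' j p * (vZ p.1 * vZ p.2).
Proof. exact: free_liftE. Qed.

Let ev_st q : ev (st q) = s (ev q).
Proof.
have -> : ev (st q) = hcomp ev st q by [].
have -> : s (ev q) = hcomp s ev q by [].
congr (hom_fun _ q); apply: pres_ext => v.
case: v => [l|[i|j]].
- rewrite !hcompE -[pres_gen _ _]/(vY l) stY evY; exact/esym/(homE (peval xi)).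
- rewrite !hcompE -[pres_gen _ _]/(vX i) stX evX (xi'P i).1; exact: (esym (pevalX xi i)).
- rewrite !hcompE -[pres_gen _ _]/(vZ j) stZ evZ rmorph_sum -[RHS]/(peval xi (f j)) sf.
  by apply: eq_bigr => p _; rewrite !rmorphM (h'P j p).1 !evZ.
Qed.

Let dbl0 : (ma_d (0 *+ 2)%R 1 : Qu) = 1. Proof. by []. Qed.
Let dblD (m l : nat) : (ma_d ((m + l) *+ 2)%R 1 : Qu) = ma_d (m *+ 2)%R 1 * ma_d (l *+ 2)%R 1.
Proof. by rewrite ma_dM mulr1 mulrnDl. Qed.

Let su : hom Qu Qu := restr_hom
  (@mona_ev Q nat (along (hcomp cst st)) (fun m : nat => (ma_d (m *+ 2)%R 1 : Qu)) dbl0 dblD).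

Let su_d m q : su (ma_d m q) = cst (st q) * ma_d (m *+ 2)%R 1.
Proof. exact: (@mona_ev_d Q nat (along (hcomp cst st)) (fun m : nat => (ma_d (m *+ 2)%R 1 : Qu)) dbl0 dblD m q). Qed.

Let sg_st q : sg (st q) = su (sg q).
Proof.
have -> : sg (st q) = hcomp sg st q by [].
have -> : su (sg q) = hcomp su sg q by [].
congr (hom_fun _ q); apply: pres_ext => v.
case: v => [l|[i|j]].
- by rewrite !hcompE -[pres_gen _ _]/(vY l) stY sgY [cst _ in RHS]cstE su_d stY mulr1.
- by rewrite !hcompE -[pres_gen _ _]/(vX i) stX sgX (xi'P i).2 [cst _ in RHS]cstE su_d stX mulr1.
- rewrite !hcompE -[pres_gen _ _]/(vZ j) stZ sgZ su_d stZ !rmorph_sum mulr_suml.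
  apply: eq_bigr => p _; rewrite !rmorphM (h'P j p).2 -!mulrA; congr (_ * _).
  by rewrite !sgZ !cstE !ma_dM mulr1 !add0r.
Qed.

(** Witnesses, all in the noetherian ring [Q], that a lies in every power of (f): [H N] evaluates to
    a, which the substitution fixes, and is homogeneous of degree 2^N in Z. *)
Let H := fix H N : Q := if N is N'.+1 then st (H N') else \sum_j g' j * vZ j.

Let evH N : ev (H N) = ma_c _ a.
Proof.
elim: N => [|N IH]; last first.
  by rewrite -[H N.+1]/(st (H N)) ev_st IH; exact: (homE (peval xi)).
rewrite -[H 0%N]/(\sum_j g' j * vZ j) rmorph_sum ag; apply: eq_bigr => j _.
by rewrite rmorphM (g'P j).1 evZ.
Qed.

Let sgH N : sg (H N) = ma_d (2 ^ N)%N (H N).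
Proof.
elim: N => [|N IH].
  rewrite -[H 0%N]/(\sum_j g' j * vZ j) rmorph_sum expn0; transitivity (\sum_j (ma_d 1%N (g' j * vZ j) : Qu)).
    apply: eq_bigr => j _; rewrite rmorphM (g'P j).2 sgZ.
    by rewrite cstE ma_dM.
  elim/big_ind2: _ => // [|x1 x2 y1 y2 -> ->]; last by rewrite ma_dD.
  by apply: monalg_ext => i /=; rewrite if_same.
rewrite -[H N.+1]/(st (H N)) sg_st IH su_d cstE ma_dM mulr1 add0r.
by congr (ma_d _ _); rewrite expnS mul2n -addnn.
Qed.

Let If : set (PR n R) := fam_ideal f.
Let IfP : is_ideal If. Proof. exact: (fam_idealP (A := PRk)). Qed.
Let If0 : If 0. Proof. by case: IfP. Qed.
Let IfD x y : If x -> If y -> If (x + y). Proof. by case: IfP => _ + _; exact. Qed.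
Let IfM x y : If y -> If (x * y). Proof. by case: IfP => _ _; exact. Qed.

Let cst_pos q e : (cst q : mona Q nat) e.+1 = 0. Proof. by []. Qed.

Let sg_pos q e : (0 < e)%N -> If (ev ((sg q : mona Q nat) e)).
Proof.
move: e; elim/free_ind: q => [c|v|x y IHx IHy|x y IHx IHy] [//|e] _.
- have -> : sg (alg_str (free k V) c) = cst (alg_str Q c).
    by rewrite (homE sg c) (homE cst c).
  by rewrite cst_pos rmorph0.
- case: v => [l|[i|j]].
  + by rewrite -[fgen _ _]/(vY l) sgY cst_pos rmorph0.
  + by rewrite -[fgen _ _]/(vX i) sgX cst_pos rmorph0.
  + have -> : (sg (vZ j) : mona Q nat) e.+1 = (if e == 0%N then vZ j else 0).
      by rewrite sgZ.
    by case: eqP => _; rewrite ?rmorph0 // evZ; exact: fam_ideal_gen.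
- have -> : (sg (x + y) : mona Q nat) e.+1 =
      (sg x : mona Q nat) e.+1 + (sg y : mona Q nat) e.+1 by rewrite rmorphD.
  by rewrite rmorphD; apply: IfD; [exact: IHx | exact: IHy].
- have -> : (sg (x * y) : mona Q nat) e.+1 = ma_mulf (sg x) (sg y) e.+1.
    by rewrite rmorphM.
  rewrite /ma_mulf /pr.
  rewrite rmorph_sum; apply: (big_ind If) => // i _.
  rewrite rmorph_sum; apply: (big_ind If) => // j _.
  case: eqP => [eij|_]; last by rewrite rmorph0.
  rewrite rmorphM; case: i eij => [|i] eij.
    by apply: IfM; apply: IHy; move: eij; rewrite add0r => ->.
  by rewrite mulrC; apply: IfM; exact: IHx.
Qed.

(** Some [H N] is a combination of the earlier [H i]. In degree 2^N the coefficients have positive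
    degree 2^N - 2^i in Z, so they evaluate into the ideal (f), while all the [H i] evaluate to
    a. *)
Lemma krull : exists c : J -> PR n R, (1 - \sum_j c j * f j) * ma_c _ a = 0.
Proof.
have [N [d e]] := free_noetherian H.
have e1 : H N = \sum_(i < N) (sg (d i) : mona Q nat) (2 ^ N - 2 ^ i)%N * H i.
  have E : (sg (H N) : mona Q nat) (2 ^ N)%N = H N by rewrite sgH /= eqxx.
  rewrite -[LHS]E [in LHS]e rmorph_sum.
  have csum (r : seq 'I_N) (F : 'I_N -> Qu) :
    (\sum_(i <- r) F i : mona Q nat) (2 ^ N)%N = \sum_(i <- r) (F i : mona Q nat) (2 ^ N)%N.
    by elim: r => [|i r IH]; rewrite ?big_nil // !big_cons -IH.
  rewrite csum; apply: eq_bigr => i _; rewrite rmorphM sgH mulrC ma_natXn.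
  by rewrite leq_exp2l // ltnW // mulrC.
have [c ec] : If (\sum_(i < N) ev ((sg (d i) : mona Q nat) (2 ^ N - 2 ^ i)%N)).
  apply: (big_ind If) => // i _; apply: sg_pos.
  by rewrite subn_gt0 ltn_exp2l.
exists c; rewrite -ec mulrBl mul1r mulr_suml.
apply/eqP; rewrite subr_eq0; apply/eqP.
rewrite -[LHS](evH N) [in LHS]e1 rmorph_sum.
by apply: eq_bigr => i _; rewrite rmorphM evH.
Qed.

End Krull.

Lemma max_ideal (k : comPzRingType) (R : alg k) (I : set R) :
  is_ideal I -> ~ I 1 -> exists m : set R,
   [/\ is_ideal m, forall x, I x -> m x, ~ m 1 & forall x, ~ m x -> exists y, m (1 - x * y)].
Proof.
move=> hI I1.
pose proper (S : set R) := [/\ is_ideal S, forall x, I x -> S x & ~ S 1].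
pose P (S : set R) := S = set0 \/ proper S.
have cup (F : set (set R)) : (F `<=` P)%classic -> total_on F subset ->
    P (\bigcup_(X in F) X).
  move=> hF tot; have big S x : F S -> S x -> proper S.
    by move=> FS Sx; have [e|//] := hF _ FS; rewrite e in Sx.
  have [[S0 [x0 [FS0 Sx0]]]|no] := pselect (exists S x, F S /\ S x); last first.
    by left; apply/seteqP; split=> // x [S FS Sx]; apply: no; exists S, x.
  have [[S00 S0D S0M] S0I _] := big _ _ FS0 Sx0.
  right; split; [split | |].
  - by exists S0.
  - move=> x y [S FS Sx] [T FT Ty]; have [[_ SD _] _ _] := big _ _ FS Sx.
    have [[_ TD _] _ _] := big _ _ FT Ty.
    by have [h|h] := tot _ _ FS FT; [exists T => //; apply: TD => //; exact: h
       | exists S => //; apply: SD => //; exact: h].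
  - move=> x y [S FS Sx]; have [[_ _ SM] _ _] := big _ _ FS Sx.
    by exists S => //; exact: SM.
  - by move=> x Ix; exists S0 => //; exact: S0I.
  - by move=> [S FS S1]; have [_ _] := big _ _ FS S1.
have [m [Pm mmax]] := Zorn_bigcup cup.
have I0 : I 0 by case: hI.
have [[m0 mD mM] mI m1] : proper m.
  case: Pm => // e; exfalso; apply: (mmax I); last by right.
  by rewrite e; split=> [x //|/(_ 0 I0)].
exists m; split=> // x nx; apply: contrapT => no.
pose m' : set R := [set z | exists a b, m a /\ z = a + x * b].
apply: (mmax m'); last right; last split; [split|split|..].
- by move=> z mz; exists z, 0; rewrite mulr0 addr0.
- by move=> h; apply: nx; apply: h; exists 0, 1; rewrite mulr1 add0r.
- by exists 0, 0; rewrite mulr0 addr0.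
- move=> y z [a [b [ma ->]]] [c [d [mc ->]]]; exists (a + c), (b + d).
  by split; [exact: mD | rewrite mulrDr addrACA].
- move=> y z [a [b [ma ->]]]; exists (y * a), (y * b).
  by split; [exact: mM | rewrite mulrDr mulrCA].
- by move=> y /mI my; exists y, 0; rewrite mulr0 addr0.
- by move=> [a [b [ma e]]]; apply: no; exists b; rewrite e addrK.
Qed.

Lemma quot_field (k : comPzRingType) (R : alg k) (I : set R) : is_ideal I -> ~ I 1 ->
  exists (K : alg k) (p : hom R K), is_field K /\ forall x, I x -> p x = 0.
Proof.
move=> hI I1; have [m [hm mI m1 mx]] := max_ideal hI I1.
exists (quot hm), (qpi hm); split; last by move=> x /mI mx'; apply/(qpi0 hm).
split.
  by apply/eqP; rewrite -(rmorph1 (qpi hm)) => /qpi0.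
move=> y; have [x <-] := qpi_surj y => x0.
have [|z hz] := mx x; first by move=> mx'; case/eqP: x0; apply/qpi0.
exists (qpi hm z); rewrite -rmorphM; apply/eqP; rewrite eq_sym -subr_eq0.
by rewrite -(rmorph1 (qpi hm)) -rmorphB; apply/eqP/qpi0.
Qed.

Section Etale.
Variables (k : fieldType) (A : alg k) (A' : alg A).
Hypothesis cA : etale_cover A'.

(* A presentation [A' = A[X]/(f)] with an endomorphism [X |-> xi] of [A[X]]
   mapping (f) into (f)^2, which formal etaleness provides. *)
Lemma etale_data : exists n (J : finType) (f : J -> PR n A) (xi : 'I_n -> PR n A)
    (h : J -> J * J -> PR n A),
  [/\ forall j, peval xi (f j) = \sum_(p : J * J) h j p * (f p.1 * f p.2),
      forall (D : alg A) (x : 'I_n -> D), (forall j, peval x (f j) = 0) ->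
        inhabited (hom A' D)
    & forall K : alg A, is_field K -> exists (L : alg A) (x : 'I_n -> L),
       [/\ is_field L, inhabited (hom K L) & forall j, peval x (f j) = 0]].
Proof.
have [[fe [n [rels [fi fib]]]] surj] := cA.
pose rel (t t' : term A 'I_n) := List.In (t, t') rels.
pose J : finType := 'I_(size rels).
pose tt0 : term A 'I_n * term A 'I_n := (tcst 0, tcst 0).
pose f (j : J) : PR n A := teval (@pX n A) (nth tt0 rels j).1 - teval (@pX n A) (nth tt0 rels j).2.
have relP t t' : rel t t' -> exists j : J, nth tt0 rels j = (t, t').
  rewrite /rel /J; elim: rels {fi fib rel J f} => //= r rs IH [e|/IH [j hj]].
    by exists ord0; rewrite /= e.
  by exists (lift ord0 j).
have relJ (j : J) : rel (nth tt0 rels j).1 (nth tt0 rels j).2.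
  rewrite /rel -surjective_pairing; case: j => j /=.
  elim: rels j {fi fib rel J f relP} => //= r rs IH [|j] h /=; first by left.
  by right; exact: IH.
have ev_sat (D : alg A) (x : 'I_n -> D) : (forall j, peval x (f j) = 0) -> satisfies rel x.
  move=> hx t t' /relP [j ej]; have := hx j.
  rewrite /f ej rmorphB !teval_hom => /eqP; rewrite subr_eq0 => /eqP.
  by rewrite (_ : (fun i => _) = x) //; apply/funext => i; rewrite pevalX.
have sat_ev (D : alg A) (x : 'I_n -> D) : satisfies rel x -> forall j, peval x (f j) = 0.
  move=> hx j; rewrite /f rmorphB !teval_hom; apply/eqP; rewrite subr_eq0.
  rewrite (_ : (fun i => _) = x); first by rewrite (hx _ _ (relJ j)).
  by apply/funext => i; rewrite pevalX.
have [finv fvE] : exists g : hom A' (pres rel), hcomp g fi = hid _.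
  have [g' g1 g2] := fib; apply: (@hom_quot A (pres rel) A' (pres rel) fi (hid _)).
    by move=> y; exists (g' y); rewrite g2.
  by move=> a /(congr1 g'); rewrite g1 -(rmorph0 fi) g1.
have lift_ex (D : alg A) (x : 'I_n -> D) : satisfies rel x ->
    exists h : hom A' D, forall i, h (fi (pres_gen rel i)) = x i.
  move=> hx; exists (hcomp (pres_lift hx) finv) => i.
  rewrite hcompE -[finv _]/(hcomp finv fi _) fvE; exact: pres_lift_gen.
pose IJ : set (PR n A) := fam_ideal f.
pose IJ2 : set (PR n A) := fam_ideal (fun p : J * J => f p.1 * f p.2).
have hIJ : is_ideal IJ by exact: fam_idealP.
have hIJ2 : is_ideal IJ2 by exact: fam_idealP.
have sub21 p : IJ2 p -> IJ p.
  case: hIJ => i0 iD iM [c ->]; apply: (big_ind IJ) => // q _.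
  by apply: (iM); apply: (iM); exact: fam_ideal_gen.
have mul12 p q : IJ p -> IJ q -> IJ2 (p * q).
  move=> [c ->] [d ->]; exists (fun r => c r.1 * d r.2).
  rewrite mulr_suml -(pair_bigA _ (fun i j => c i * d j * (f i * f j))) /=.
  apply: eq_bigr => i _; rewrite mulr_sumr; apply: eq_bigr => j _.
  by rewrite mulrACA.
pose C : alg A := quot hIJ2.
pose C0 : alg A := quot hIJ.
have [q qE] : exists q : hom C C0, hcomp q (qpi hIJ2) = qpi hIJ.
  apply: hom_quot; first exact: qpi_surj.
  by move=> a /qpi0 /sub21 ha; apply/(qpi0 hIJ).
have qE' x : q (qpi hIJ2 x) = qpi hIJ x by rewrite -qE.
have [h0 h0E] : exists h : hom A' C0, forall i, h (fi (pres_gen rel i)) = qpi hIJ (pX A i).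
  apply: lift_ex; apply: ev_sat => j.
  have -> : peval (fun i => qpi hIJ (pX A i)) (f j) = qpi hIJ (f j).
    by congr (hom_fun _ _); apply: PR_ext => i; rewrite pevalX.
  by apply/(qpi0 hIJ); exact: fam_ideal_gen.
(* Formal étaleness lifts the tautological map A' -> A[X]/(f) to A[X]/(f)^2. Polynomials
   representing the images of the variables form [xi], so that the substitution maps (f) into its
   square. *)
have [h [hq _]] : exists! h : hom A' C, forall b, q (h b) = h0 b.
  apply: fe => [y|x y].
    by have [x <-] := qpi_surj y; exists (qpi hIJ2 x).
  have [a <-] := qpi_surj x; have [b <-] := qpi_surj y.
  rewrite !qE' -rmorphM => /qpi0 ha /qpi0 hb; apply/(qpi0 hIJ2); exact: mul12.
have [xi xiE] : exists xi : 'I_n -> PR n A, forall i,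
    qpi hIJ2 (xi i) = h (fi (pres_gen rel i)).
  exists (fun i => projT1 (cid (qpi_surj (h (fi (pres_gen rel i)))))) => i.
  by case: cid.
have sJ2 j : IJ2 (peval xi (f j)).
  apply/(qpi0 hIJ2).
  have -> : qpi hIJ2 (peval xi (f j)) = peval (fun i => h (fi (pres_gen rel i))) (f j).
    rewrite -[LHS]/(hcomp (qpi hIJ2) (peval xi) (f j)).
    by congr (hom_fun _ _); apply: PR_ext => i; rewrite hcompE !pevalX xiE.
  apply: sat_ev => t t' tt'.
  rewrite -[X in teval X](_ : (fun i => hcomp h fi (pres_gen rel i)) = _) //.
  by rewrite -!(teval_hom (hcomp h fi)) (pres_gen_sat tt').
exists n, J, f, xi, (fun j => projT1 (cid (sJ2 j))); split.
- by move=> j; case: cid => c /= ->.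
- by move=> D x /ev_sat /lift_ex [g _].
- move=> K /surj [L [fL h1 [h2]]]; exists L, (fun i => h2 (fi (pres_gen rel i))).
  split=> //; apply: sat_ev => t t' tt'.
  rewrite -[X in teval X](_ : (fun i => hcomp h2 fi (pres_gen rel i)) = _) //.
  by rewrite -!(teval_hom (hcomp h2 fi)) (pres_gen_sat tt').
Qed.

End Etale.

Section BaseChange.
Variables (A : comPzRingType) (n : nat).

Lemma bc_comp (D D' : alg A) (g : hom D D') (p : PR n A) :
  bc g (bc (alg_str D) p) = bc (alg_str D') p.
Proof. by apply: monalg_ext => m /=; exact: homE. Qed.

Definition bcA (D D' : alg A) (g : hom D D') :
  hom (@restr A D (PR n D)) (@restr A D' (PR n D')).
Proof.
refine (@hom_of A (@restr A D (PR n D)) (@restr A D' (PR n D')) (bc g) (bcD g) (bcM g) _).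
by move=> c; rewrite /= bcC homE.
Defined.

Lemma peval_bc (D L : alg A) (g : hom D L) (x : 'I_n -> L) (p : PR n A) :
  peval (D := @Alg D L g) x (bc (alg_str D) p) = peval x p.
Proof.
pose LD : alg D := @Alg D L g.
have F1k c : peval (D := LD) x (bc (alg_str D) (alg_str (PR n A) c)) = alg_str L c.
  rewrite -[alg_str (PR n A) c]/(ma_c _ c) bcC.
  exact: (etrans (homE (peval (D := LD) x) (alg_str D c)) (homE g c)).
have F1D p1 p2 : peval (D := LD) x (bc (alg_str D) (p1 + p2)) =
   peval (D := LD) x (bc (alg_str D) p1) + peval (D := LD) x (bc (alg_str D) p2).
  by rewrite bcD rmorphD.
have F1M p1 p2 : peval (D := LD) x (bc (alg_str D) (p1 * p2)) =
   peval (D := LD) x (bc (alg_str D) p1) * peval (D := LD) x (bc (alg_str D) p2).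
  by rewrite bcM rmorphM.
rewrite -[LHS]/(@hom_of A (PR n A) L _ F1D F1M F1k p).
by congr (hom_fun _ p); apply: PR_ext => i; rewrite hom_ofE bcX !pevalX.
Qed.
End BaseChange.

(** * Purity of étale covers *)

Section Purity.
Variables (k : fieldType) (A : alg k) (A' : alg A).
Hypothesis cA : etale_cover A'.
Variables (n : nat) (J : finType) (f : J -> PR n A) (xi : 'I_n -> PR n A)
  (h : J -> J * J -> PR n A).
Hypothesis sf : forall j, peval xi (f j) = \sum_(p : J * J) h j p * (f p.1 * f p.2).
Hypothesis univ : forall (D : alg A) (x : 'I_n -> D), (forall j, peval x (f j) = 0) ->
        inhabited (hom A' D).
Hypothesis surj : forall K : alg A, is_field K -> exists (L : alg A) (x : 'I_n -> L),
       [/\ is_field L, inhabited (hom K L) & forall j, peval x (f j) = 0].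

Definition fD (D : alg A) (j : J) : PR n D := bc (alg_str D) (f j).

(** By [krull] an element congruent to 1 modulo (f) kills a. If a were nonzero, some field over D
    would kill the annihilator of a, and by surjectivity f would have a solution in an extension of
    it. At this solution the element takes the value 1, although all its coefficients annihilate
    a. *)
Lemma pure_core (D : alg A) (a : D) : fam_ideal (fD D) (ma_c _ a) -> a = 0.
Proof.
move=> [g ag]; pose Dk : alg k := restr D.
have [|c ec] := @krull k Dk n J (fD D) g (fun i => bc (alg_str D) (xi i))
  (fun j p => bc (alg_str D) (h j p)) a _ ag.
  move=> j; transitivity (bc (alg_str D) (peval xi (f j))).
    rewrite /fD -[RHS]/(hcomp (bch n D) (peval xi) (f j)).
    pose g1 : hom D (@restr A D (PR n D)) := restr_str (PR n D).
    apply: (etrans (@peval_bc A n D (@restr A D (PR n D)) g1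
      (fun i => bc (alg_str D) (xi i)) (f j))).
    congr (hom_fun _ (f j)); apply: PR_ext => i.
    by rewrite hcompE !pevalX.
  rewrite sf -[LHS]/(bch n D _) rmorph_sum; apply: eq_bigr => p _.
  by rewrite !rmorphM.
apply: contrapT => a0.
pose I : set Dk := [set b | b * a = 0].
have hI : is_ideal I.
  split; first by rewrite /I /= mul0r.
    by move=> x y; rewrite /I /= mulrDl => -> ->; rewrite addr0.
  by move=> x y; rewrite /I /= -mulrA => ->; rewrite mulr0.
have [|K [p [fK pI]]] := quot_field hI; first by rewrite /I /= mul1r.
pose KA : alg A := @Alg A K (p \o alg_str D).
have [L [x [fL [u] hx]]] := surj (K := KA) fK.
have uk c0 : u (p (alg_str D c0)) = alg_str L c0 by exact: (homE u).
pose v : hom D L := @hom_of A D L (fun y => u (p y))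
  (fun y z => etrans (congr1 u (rmorphD p y z)) (rmorphD u _ _))
  (fun y z => etrans (congr1 u (rmorphM p y z)) (rmorphM u _ _)) uk.
pose LD : alg D := @Alg D L v.
pose q : PR n D := 1 - \sum_j c j * fD D j.
have qI m : I (q m).
  have e : (ma_c (expo n) a * q : PR n D) m = 0 by rewrite mulrC ec.
  by apply: etrans e; rewrite (monaMd a q m) mulrC.
have : peval (D := LD) x q = 0.
  rewrite [q]monalg_sum rmorph_sum big1 // => m _.
  rewrite /peval mona_ev_d -[alg_str LD _]/(u (p (q m))) pI; last exact: qI.
  by rewrite rmorph0 mul0r.
rewrite /q rmorphB rmorph1 rmorph_sum big1 ?subr0 => [|j _]; last first.
  by rewrite rmorphM peval_bc hx mulr0.
by case: fL => /eqP.
Qed.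

(** D[X]/(f). It receives a map from A' and stands for the base change of the cover to D. *)
Definition QD (D : alg A) : alg A :=
  @restr A D (quot (fam_idealP (A := PR n D) (fD D))).
Definition QD_pi (D : alg A) : hom (@restr A D (PR n D)) (QD D) :=
  @rh A D _ _ (qpi (fam_idealP (A := PR n D) (fD D))).
Definition QD_in (D : alg A) : hom D (QD D) :=
  @restr_str A D (quot (fam_idealP (A := PR n D) (fD D))).

Lemma QD_inE (D : alg A) (a : D) : QD_in D a = QD_pi D (ma_c _ a).
Proof. by []. Qed.

Lemma QD_pi0 (D : alg A) p : QD_pi D p = 0 <-> fam_ideal (fD D) p.
Proof.
have := @qpiP D (PR n D) _ (fam_idealP (A := PR n D) (fD D)) p 0.
by rewrite subr0.
Qed.

Lemma QD_surj (D : alg A) (y : QD D) : exists x, QD_pi D x = y.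
Proof.
exists (@qrepr D (PR n D) _ (fam_idealP (A := PR n D) (fD D)) y).
exact: (@qreprK D (PR n D) _ (fam_idealP (A := PR n D) (fD D)) y).
Qed.

Lemma QD_inj (D : alg A) : injective (QD_in D).
Proof.
move=> x y e; apply/eqP; rewrite -subr_eq0; apply/eqP/pure_core/QD_pi0.
by rewrite -QD_inE rmorphB e subrr.
Qed.

Lemma QD_sec (D : alg A) : inhabited (hom A' (QD D)).
Proof.
apply: (@univ (QD D) (fun i : 'I_n => QD_pi D (pX D i))) => j.
have /QD_pi0 <- : fam_ideal (fD D) (fD D j) by exact: fam_ideal_gen.
rewrite /fD -[RHS]/(hcomp (QD_pi D) (bch n D) (f j)).
by congr (hom_fun _ (f j)); apply: PR_ext => i; rewrite hcompE pevalX /= bcX.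
Qed.

(* Equalizers along [i] whose base change to [A'] has a retraction; the proof
   applies purity to the algebra [B + eps (B#/B)]. *)
Lemma effective_core (B B' : alg A) (i : hom B B') (y : B') :
  (forall (D : alg A) (d : hom B D), inhabited (hom A' D) ->
     exists b : hom B' D, hcomp b i = d) ->
  (forall (D : alg A) (a b : hom B' D), hcomp a i = hcomp b i -> a y = b y) ->
  exists b, i b = y.
Proof.
move=> sec eqz; have [be beE] := sec _ (QD_in B) (QD_sec B).
have [g1 g1E] : exists g : hom (QD B) (QD B'), hcomp g (QD_pi B) = hcomp (QD_pi B') (bcA n i).
  apply: hom_quot; first exact: QD_surj.
  move=> a /QD_pi0 [c ->]; rewrite hcompE; apply/QD_pi0.
  exists (fun j => bc i (c j)); rewrite rmorph_sum; apply: eq_bigr => j _.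
  by rewrite rmorphM; congr (_ * _); exact: bc_comp.
(* [be] extends B -> B[X]/(f) to B'. After passage to B'[X]/(f) it agrees at y with the canonical
   map, so that modulo (f) the element y is congruent to a polynomial over B. *)
have e : QD_in B' y = g1 (be y).
  apply: (eqz _ (QD_in B') (hcomp g1 be)); rewrite -hcompA beE; apply: hom_ext => b.
  by rewrite !hcompE !QD_inE -[g1 _]/(hcomp g1 (QD_pi B) _) g1E hcompE /= bcC.
have [w ew] : exists w, QD_pi B w = be y by exact: QD_surj.
have {e ew} : QD_pi B' (ma_c _ y - bc i w) = 0.
  rewrite rmorphB -QD_inE e -ew -[g1 _]/(hcomp g1 (QD_pi B) _) g1E; exact: subrr.
move/QD_pi0 => [c ec].
pose Bi : alg B := @Alg B B' i.
pose Sq : alg A := @sqz A B Bi.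
pose I : set Sq := [set x : sqz_car Bi | sq0 x = 0 /\ exists b, sq1 x = i b].
have hI : is_ideal I.
  split; first by split=> //; exists 0; rewrite rmorph0.
    move=> x z [x0 [b xb]] [z0 [d zd]]; split; first by rewrite /= x0 z0 addr0.
    by exists (b + d); rewrite rmorphD -xb -zd.
  move=> x z [z0 [d zd]]; split; first by rewrite /= z0 mulr0.
  exists (sq0 x * d); rewrite rmorphM -zd /= z0 rmorph0 mul0r addr0 //.
pose D : alg A := quot hI.
pose io : hom B D := hcomp (qpi hI) (sqz_inh Bi).
(* The projection B' -> B'/B, placed in a square-zero extension because purity is a statement about
   algebras. It kills the polynomial over B, so e(y) lies in the ideal (f) of D[X]. *)
pose e v : D := qpi hI (Sqz 0 v).
have eD v w' : e (v + w') = e v + e w'.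
  by rewrite /e -rmorphD; congr (qpi hI _); apply: sqz_ext; rewrite /= ?addr0.
have eM v b : e (v * i b) = e v * io b.
  rewrite /e /io hcompE -rmorphM; congr (qpi hI _); apply: sqz_ext; rewrite /= ?mul0r //.
  by rewrite mulr0 add0r mulrC.
have ei b : e (i b) = 0 by apply/(qpi0 hI); split=> //; exists b.
suff /(qpi0 hI) [_ [b eb]] : e y = 0 by exists b.
apply: pure_core; exists (fun j => pmap (map0 eD) (c j)).
have -> : ma_c (expo n) (e y) = pmap (map0 eD) (ma_c _ y - bc i w).
  apply: monalg_ext => m /=.
  have eB v w' : e (v - i w') = e v.
    by rewrite -[- i w']mulN1r -(rmorphN1 i) -rmorphM eD ei addr0.
  by rewrite eB; case: eqP => // _; rewrite map0.
rewrite ec.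
have psum (r : seq J) (F : J -> PR n B') :
    pmap (map0 eD) (\sum_(j <- r) F j) = \sum_(j <- r) pmap (map0 eD) (F j).
  elim: r => [|j r IH]; last by rewrite !big_cons pmapD IH.
  by rewrite !big_nil; apply: monalg_ext => m; exact: map0.
rewrite psum; apply: eq_bigr => j _.
have -> : fD B' j = bc i (fD B j) by rewrite /fD bc_comp.
rewrite /bc (pmapM eD eM); congr (_ * _).
by apply: monalg_ext => m /=; exact: (homE io).
Qed.

End Purity.

Section EtaleDescent.
Variables (k : fieldType) (A : alg k) (A' : alg A).
Hypothesis cA : etale_cover A'.

Lemma etale_pure (D : alg A) : exists (D1 : alg A) (j : hom D D1),
  injective j /\ inhabited (hom A' D1).
Proof.
have [n [J [f [xi [h [h1 h2 h3]]]]]] := etale_data cA.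
by exists (QD f D), (QD_in f D); split; [exact: (QD_inj h1 h3) | exact: QD_sec].
Qed.

Lemma etale_effective (B B' : alg A) (i : hom B B') (y : B') :
  (forall (D : alg A) (d : hom B D), inhabited (hom A' D) ->
     exists b : hom B' D, hcomp b i = d) ->
  (forall (D : alg A) (a b : hom B' D), hcomp a i = hcomp b i -> a y = b y) ->
  exists b, i b = y.
Proof.
have [n [J [f [xi [h [h1 h2 h3]]]]]] := etale_data cA.
exact: (effective_core h1 h2 h3).
Qed.
End EtaleDescent.

(** * Points of torsors as trivializations *)

Section TorsorPoints.
Variables (k : fieldType) (G : grp k) (X : kfun k) (aX : gaction G X).
Local Notation M := (quot_stack aX).
Local Notation GG := (gring G).

(** The definition of a torsor provides the translating element only over an étale cover. Being
    unique there, it is equalized by all pairs of maps that agree on C, so [etale_effective]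
    descends it. *)
Lemma tors_unique (A : alg k) (x : ob M A) (C : alg k) (p p' : hom (tors_ring x) C) :
  hcomp p (tors_proj x) = hcomp p' (tors_proj x) ->
  exists! g : hom GG C, tors_act x C g p = p'.
Proof.
move=> epp; pose a0 := hcomp p (tors_proj x).
have [A' [cA [s [s1 s2]]]] := tors_loc x.
have actN (E F : alg k) (u : hom E F) g (q : hom (tors_ring x) E) :
    hcomp u (tors_act x E g q) = tors_act x F (hcomp u g) (hcomp u q).
  by rewrite -[LHS]/(kmap u (_ : Spec (tors_ring x) E)) act_nat.
have loc (E : alg k) (u : hom C E) (c : hom (restr A') E) :
    hcomp c (restr_str A') = hcomp u a0 ->
    exists! g : hom GG E, tors_act x E g (hcomp u p) = hcomp u p'.
  move=> e; have e1 : hcomp (hcomp u p) (tors_proj x) = hcomp c (restr_str A').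
    by rewrite -hcompA e.
  have e2 : hcomp (hcomp u p') (tors_proj x) = hcomp c (restr_str A').
    by rewrite -hcompA -epp e.
  have [g1 [h1 u1]] := s2 E c _ e1; have [g2 [h2 u2]] := s2 E c _ e2.
  exists (gmul g2 (ginv g1)); split.
    by rewrite -h1 -actM -gmulA gmulV gmul_r1.
  move=> g hg; have -> : g2 = gmul g g1 by apply: u2; rewrite actM h1.
  by rewrite -gmulA gmul_rV gmul_r1.
pose B : alg A := along a0.
pose B' : alg A := tensor B A'.
pose i : hom B B' := tensl B A'.
have sec (D : alg A) (d : hom B D) : inhabited (hom A' D) ->
    exists b : hom B' D, hcomp b i = d.
  by move=> [c]; exists (tens_lift d c); exact: tens_liftl.
have inj_i : injective i.
  have [D1 [j [jinj /(sec _ j) [b bE]]]] := etale_pure cA B.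
  by move=> y z e; apply: jinj; rewrite -bE !hcompE e.
pose E : alg k := restr B'.
have uk c : i (alg_str C c) = alg_str E c.
  by rewrite -(homE a0) -[a0 _]/(alg_str B (alg_str A c)) homE.
pose u : hom C E := @hom_of k C E i (rmorphD i) (rmorphM i) uk.
pose c : hom (restr A') E := rh (tensr B A').
have ec : hcomp c (restr_str A') = hcomp u a0.
  apply: hom_ext => y; rewrite !hcompE.
  by rewrite -[LHS]/(tensr B A' (alg_str A' y)) homE -[RHS]/(i (alg_str B y)) homE.
have [g1 [g1E g1u]] := loc E u c ec.
have [g gE] : exists g : hom GG C, hcomp u g = g1.
  apply: hom_factor => // y; apply: (etale_effective cA (i := i)) => // D a b eab.
  pose Dk : alg k := restr D.
  have vk v c0 : hom_fun (v : hom B' D) (alg_str E c0) = alg_str Dk c0.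
    by rewrite -[alg_str E c0]/(alg_str B' (alg_str A c0)) homE.
  pose ak : hom E Dk := @hom_of k E Dk a (rmorphD a) (rmorphM a) (vk a).
  pose bk : hom E Dk := @hom_of k E Dk b (rmorphD b) (rmorphM b) (vk b).
  have eu : hcomp ak u = hcomp bk u.
    by apply: hom_ext => z; rewrite !hcompE -[LHS]/(hcomp a i z) eab.
  have [g0 [_ g0u]] := loc Dk (hcomp ak u) (hcomp ak c)
    (etrans (esym (hcompA _ _ _)) (etrans (congr1 (hcomp ak) ec) (hcompA _ _ _))).
  have ha : hcomp ak g1 = g0.
    by apply/esym/g0u; rewrite -!hcompA -actN g1E.
  have hb : hcomp bk g1 = g0.
    by apply/esym/g0u; rewrite eu -!hcompA -actN g1E.
  by rewrite -[LHS]/(hcomp ak g1 y) ha -hb.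
have inju D (f f' : hom D C) : hcomp u f = hcomp u f' -> f = f'.
  by move=> e; apply: hom_ext => y; apply: inj_i; rewrite -[LHS]/(hcomp u f y) e.
exists g; split; first by apply: inju; rewrite actN gE g1E.
by move=> g' hg'; apply: inju; rewrite gE; apply: g1u; rewrite -actN hg'.
Qed.

(** The orbit map of [s] trivializes the pulled back torsor; that the square is cartesian is
    [tors_unique]. *)
Lemma tors_point (A : alg k) (x : ob M A) (C : alg k) (s : hom (tors_ring x) C) :
  exists m : @mor _ M A C (triv_ob aX (kmap s (tors_map x))) x,
    mor_base m = hcomp s (tors_proj x) /\
    forall D (a : hom C D) (h : hom GG D),
      hcomp (tens_lift a h) (qm_fun m) = tors_act x D h (hcomp a s).
Proof.
set y := kmap s _.
pose q : hom (tors_ring x) (tensor C GG) :=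
  tors_act x _ (tensr C GG) (hcomp (tensl C GG) s).
have qE D (p : hom (tensor C GG) D) : hcomp p q =
    tors_act x D (hcomp p (tensr C GG)) (hcomp (hcomp p (tensl C GG)) s).
  by rewrite /q -[LHS]/(kmap p (_ : Spec (tors_ring x) _)) act_nat /= hcompA.
have p1 : hcomp q (tors_proj x) = hcomp (tensl C GG) (hcomp s (tors_proj x)).
  by rewrite tors_inv hcompA.
have p2 D (g : hom GG D) (p : hom (tensor C GG) D) :
    hcomp (triv_fun g p) q = tors_act x D g (hcomp p q).
  by rewrite qE [in RHS]qE /triv_fun tens_liftl tens_liftr actM.
have p3 D (p : hom (tors_ring x) D) (a : hom C D) :
    hcomp p (tors_proj x) = hcomp a (hcomp s (tors_proj x)) ->
    exists! p' : hom (tensor C GG) D, hcomp p' q = p /\ hcomp p' (tensl C GG) = a.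
  move=> e; have [|g [g1 g2]] := @tors_unique A x D (hcomp a s) p.
    by rewrite e hcompA.
  exists (tens_lift a g); split.
    by split; [rewrite qE tens_liftl tens_liftr | exact: tens_liftl].
  move=> p' [e1 e2]; rewrite [RHS]tens_split e2; congr (tens_lift _ _).
  by apply: g2; rewrite -e1 qE e2.
have p4 : kmap q (tors_map x) = tors_map (triv_ob aX y).
  by rewrite /q tors_equiv /= /y kmap_comp.
exists (@QuotMor k G X aX A C (triv_ob aX y) x (hcomp s (tors_proj x)) q p1 p2 p3 p4).
by split=> // D a h; rewrite /= qE tens_liftl tens_liftr.
Qed.

(* A morphism of torsors is determined by its base and its composite with a
   cartesian morphism. *)
Lemma cart_uniq (A A1 A' : alg k) (x : ob M A) (x1 : ob M A1) (x' : ob M A')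
    (m : mor x1 x) (q q' : mor x' x1) :
  mor_base q = mor_base q' -> mcomp m q = mcomp m q' -> q = q'.
Proof.
move=> eb e; apply: quot_mor_ext => //.
have e1 : hcomp (qm_fun q) (qm_fun m) = hcomp (qm_fun q') (qm_fun m).
  exact: (congr1 (fun w : quot_mor x' x => qm_fun w) e).
have [|r [_ ru]] := @qm_cart _ _ _ _ _ _ _ _ m _ (hcomp (qm_fun q) (qm_fun m))
   (hcomp (qm_fun q) (tors_proj x1)).
  by rewrite -!hcompA qm_proj.
rewrite -(ru (qm_fun q)) // -(ru (qm_fun q')) //; split=> //.
have e2 : qm_base q = qm_base q' by [].
by rewrite !qm_proj e2.
Qed.

(* The element of G comparing trivializations along [n : W -> Z]. *)
Lemma compare (A A' : alg k) (Z : ob M A) (W : ob M A') (y : X A) (w : X A')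
    (m : @mor _ M A A (triv_ob aX y) Z) (p : @mor _ M A' A' (triv_ob aX w) W)
    (n : mor W Z) : mor_base m = hid A -> mor_base p = hid A' ->
  exists q : @mor _ M A A' (triv_ob aX w) (triv_ob aX y),
    [/\ mor_base q = mor_base n, mcomp m q = mcomp n p
      & w = aX A' (gel q) (kmap (mor_base n) y)].
Proof.
move=> em ep; have [|q [q1 q2]] := @quot_cart _ _ _ _ _ _ _ _ _ _ m (mcomp n p) (mor_base n).
  by rewrite mor_base_comp em ep hcompf1 hcomp1f.
by exists q; split=> //; rewrite -q1; exact: gelP.
Qed.

Lemma pull_triv (A A' : alg k) (Z : ob M A) (W : ob M A') (y : X A)
    (m : @mor _ M A A (triv_ob aX y) Z) (n : mor W Z) : mor_base m = hid A ->
  exists p : @mor _ M A' A' (triv_ob aX (kmap (mor_base n) y)) W,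
    mor_base p = hid A' /\
    exists t : @mor _ M A A' (triv_ob aX (kmap (mor_base n) y)) (triv_ob aX y),
      [/\ mor_base t = mor_base n, gel t = gone G A' & mcomp n p = mcomp m t].
Proof.
move=> em; have [t [t1 t2]] : exists t : @mor _ M A A'
   (triv_ob aX (kmap (mor_base n) y)) (triv_ob aX y),
   mor_base t = mor_base n /\ gel t = gone G A'.
  by apply: triv_mor_ex; rewrite act1.
have [|p [p1 p2]] := @quot_cart _ _ _ _ _ _ _ _ _ _ n (mcomp m t) (hid A').
  by rewrite mor_base_comp t1 em hcompf1 hcomp1f.
by exists p; split=> //; exists t.
Qed.

End TorsorPoints.

(** * Points of the torus and of the toric monoid *)

Section ToricPoints.
Variables (k : comPzRingType) (M : zmodType) (P : set M).
Hypothesis P0 : P 0.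
Hypothesis PD : forall m n, P m -> P n -> P (m + n).
Local Notation TT := (torus k M).
Local Notation U := (mon_alg k P).

Definition tv (C : alg k) (g : hom (gring TT) C) (m : M) : C :=
  g (chi k (exist setT m Logic.I)).

Lemma tv_ext (C : alg k) (g h : hom (gring TT) C) : tv g =1 tv h -> g = h.
Proof. by move=> e; apply: mon_ext => -[m []]; exact: e. Qed.

Lemma tv0 (C : alg k) (g : hom (gring TT) C) : tv g 0 = 1.
Proof. by have [H _] := character_of g; exact: H. Qed.

Lemma tvD (C : alg k) (g : hom (gring TT) C) m n : tv g (m + n) = tv g m * tv g n.
Proof. by have [_ H] := character_of g; exact: H. Qed.

Lemma tvM (C : alg k) (g h : hom (gring TT) C) m : tv (gmul g h) m = tv g m * tv h m.
Proof. by rewrite /tv torus_act_funE. Qed.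

Lemma tv1 (C : alg k) m : tv (gone TT C) m = 1.
Proof. by rewrite /tv of_characterE. Qed.

Lemma tv_nat (C D : alg k) (f : hom C D) (g : hom (gring TT) C) m :
  tv (hcomp f g) m = f (tv g m).
Proof. by []. Qed.

Lemma tpt_subproof (C : alg k) (h : M -> C) : h 0 = 1 ->
  (forall m n, h (m + n) = h m * h n) ->
  is_character (fun m : {m | [set: M] m} => h (sval m)).
Proof. by move=> h0 hD; split=> [m -> //|m m1 m2 ->]. Qed.

Definition tpt (C : alg k) (h : M -> C) (h0 : h 0 = 1)
  (hD : forall m n, h (m + n) = h m * h n) : hom (gring TT) C :=
  of_character (tpt_subproof h0 hD).

Lemma tptE (C : alg k) (h : M -> C) h0 hD m : tv (@tpt C h h0 hD) m = h m.
Proof. exact: of_characterE. Qed.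

Definition uv (C : alg k) (p : hom U C) (m : {m | P m}) : C := p (chi k m).

Lemma uv_ext (C : alg k) (p q : hom U C) : uv p =1 uv q -> p = q.
Proof. exact: mon_ext. Qed.

Lemma upt_subproof (C : alg k) (h : M -> C) : h 0 = 1 ->
  (forall m n, P m -> P n -> h (m + n) = h m * h n) ->
  is_character (fun m : {m | P m} => h (sval m)).
Proof.
move=> h0 hD; split=> [m -> //|m m1 m2 ->].
by apply: hD; [exact: (svalP m1) | exact: (svalP m2)].
Qed.

Definition upt (C : alg k) (h : M -> C) (h0 : h 0 = 1)
  (hD : forall m n, P m -> P n -> h (m + n) = h m * h n) : hom U C :=
  of_character (upt_subproof h0 hD).

Lemma uptE (C : alg k) (h : M -> C) h0 hD m : uv (@upt C h h0 hD) m = h (sval m).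
Proof. exact: of_characterE. Qed.

Lemma umul_subproof (C : alg k) (p q : hom U C) :
  is_character (fun m => uv p m * uv q m).
Proof.
have [p0 pD] := character_of p; have [q0 qD] := character_of q.
split=> [m m0|m m1 m2 e]; first by rewrite /uv p0 // q0 // mulr1.
by rewrite /uv (pD _ m1 m2) // (qD _ m1 m2) // mulrACA.
Qed.

(** U_tau is a commutative monoid extending T. Multiplication by one of its points commutes with T,
    hence acts on Theta_tau. *)
Definition umul (C : alg k) (p q : hom U C) : hom U C := of_character (umul_subproof p q).

Lemma umulE (C : alg k) (p q : hom U C) m : uv (umul p q) m = uv p m * uv q m.
Proof. exact: of_characterE. Qed.

Lemma umul_nat (C D : alg k) (f : hom C D) (p q : hom U C) :
  hcomp f (umul p q) = umul (hcomp f p) (hcomp f q).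
Proof.
apply: uv_ext => m; rewrite umulE -[LHS]/(f (uv (umul p q) m)) umulE.
by rewrite rmorphM.
Qed.

Local Notation act := (torus_act k P).

Lemma actE (C : alg k) (g : hom (gring TT) C) (p : hom U C) m :
  uv (act C g p) m = tv g (sval m) * uv p m.
Proof. by rewrite /uv torus_act_funE. Qed.

Lemma umul_act (C : alg k) (g : hom (gring TT) C) (p q : hom U C) :
  umul (act C g p) q = act C g (umul p q).
Proof. by apply: uv_ext => m; rewrite umulE !actE umulE mulrA. Qed.

Lemma umul1 (C : alg k) (p : hom U C) : umul (torus_one P C) p = p.
Proof. by apply: uv_ext => m; rewrite umulE /uv of_characterE mul1r. Qed.

Local Notation Th := (quot_stack (torus_act k P)).

Section MulOb.
Variables (C : alg k) (X : ob Th C) (p : hom U C).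
Lemma mul_ob_equiv D (g : hom (gring TT) D) (q : hom (tors_ring X) D) :
  kmap (tors_act X D g q) (umul (tors_map X) (hcomp (tors_proj X) p) : Spec U _) =
  act D g (kmap q (umul (tors_map X) (hcomp (tors_proj X) p) : Spec U _)).
Proof.
have -> : kmap q (umul (tors_map X) (hcomp (tors_proj X) p) : Spec U _) =
    umul (kmap q (tors_map X)) (hcomp (hcomp q (tors_proj X)) p).
  by rewrite -hcompA -umul_nat.
have -> : kmap (tors_act X D g q) (umul (tors_map X) (hcomp (tors_proj X) p) : Spec U _)
    = umul (kmap (tors_act X D g q) (tors_map X))
       (hcomp (hcomp (tors_act X D g q) (tors_proj X)) p).
  by rewrite -hcompA -umul_nat.
by rewrite tors_equiv tors_inv umul_act.
Qed.

(** The torsor is kept and only its equivariant map to U_tau is multiplied by p. *)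
Definition mul_ob : ob Th C :=
  @QuotOb k TT (Spec U) act C (tors_ring X) (tors_proj X) (tors_act X)
    (@tors_inv _ _ _ _ _ X) (tors_loc X) (umul (tors_map X) (hcomp (tors_proj X) p))
    mul_ob_equiv.
End MulOb.

Section MulMor.
Variables (C C' : alg k) (X : ob Th C) (X' : ob Th C') (m : mor X' X).
Variables (p : hom U C) (p' : hom U C') (e : p' = hcomp (mor_base m) p).

Lemma mul_mor_map :
  kmap (qm_fun m) (tors_map (mul_ob X p)) = tors_map (mul_ob X' p').
Proof.
rewrite -[LHS]/(hcomp (qm_fun m) (umul _ _)) umul_nat /=; congr umul.
  exact: (qm_map m).
by rewrite e hcompA qm_proj hcompA.
Qed.

Definition mul_mor : @mor _ Th C C' (mul_ob X' p') (mul_ob X p) :=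
  @QuotMor k TT (Spec U) act C C' (mul_ob X' p') (mul_ob X p) (qm_base m)
    (qm_fun m) (qm_proj m) (@qm_equiv _ _ _ _ _ _ _ _ m) (@qm_cart _ _ _ _ _ _ _ _ m)
    mul_mor_map.
End MulMor.

(* [F |-> F (p . -)] for a point [p] of the monoid [U_tau]. *)
Section MulFunctor.
Variables (A0 A : alg k) (iota : hom A0 A) (p : hom U A).

Lemma mul_functor_e (C C' : alg k) (x' : prod_ob Th A C') (x : prod_ob Th A C)
    (f : prod_mor x' x) : hcomp x'.2 p = hcomp (mor_base (sval f)) (hcomp x.2 p).
Proof. by case: f => f /= ->; rewrite hcompA. Qed.

Lemma mul_functor_e2 (C C' : alg k) (x' : prod_ob Th A C') (x : prod_ob Th A C)
    (f : prod_mor x' x) : hcomp x'.2 iota =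
  hcomp (mor_base (mul_mor (mul_functor_e f))) (hcomp x.2 iota).
Proof. by rewrite -[mor_base _]/(mor_base (sval f)); case: f => f /= ->; rewrite hcompA. Qed.

Definition mul_functor : functor (prod_stack Th A) (prod_stack Th A0).
Proof.
refine (@Functor k (prod_stack Th A) (prod_stack Th A0)
  (fun C x => (mul_ob x.1 (hcomp x.2 p), hcomp x.2 iota))
  (fun C C' x' x f => exist _ (mul_mor (mul_functor_e f)) (mul_functor_e2 f)) _ _ _).
- by [].
- by move=> C x; apply: eq_exist; exact: quot_mor_ext.
- by move=> C C' C'' x'' x' x f g; apply: eq_exist; exact: quot_mor_ext.
Defined.
End MulFunctor.

End ToricPoints.

(** * Connected components and families over the affine line *)

Section ComponentFacts.
Variables (k : closedFieldType) (X : aff_cat k).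

Lemma component_trans (p q s : stack_space X) :
  component p q -> component q s -> component p s.
Proof.
move=> [C1 [c1 p1 q1]] [C2 [c2 q2 s2]].
exists (fun x => C1 x \/ C2 x); split; [|by left|by right].
move=> U V oU oV cov dis.
have d1 x : C1 x -> U x -> V x -> False by move=> h; apply: dis; left.
have d2 x : C2 x -> U x -> V x -> False by move=> h; apply: dis; right.
have [h1|h1] := c1 U V oU oV (fun x h => cov x (or_introl h)) d1;
  have [h2|h2] := c2 U V oU oV (fun x h => cov x (or_intror h)) d2.
- by left=> x [/h1|/h2].
- by case: (d1 q q1 (h1 q q1) (h2 q q2)).
- by case: (d1 q q1 (h2 q q2) (h1 q q1)).
- by right=> x [/h1|/h2].
Qed.

Definition polyA : alg k := @Alg k {poly k} polyC.

Definition ev_at (c : k) : hom polyA (self_alg k) :=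
  @hom_of k polyA (self_alg k) (horner_eval c) (fun x y => hornerD x y c)
   (fun x y => hornerM x y c) (fun a => hornerC a c).

Lemma poly_nonroot (p : {poly k}) : [pchar k] =i pred0 -> p != 0 ->
  exists c, ev_at c p != 0.
Proof.
move=> ch p0; apply: contrapT => h.
have := @max_poly_roots k p [seq i%:R | i <- iota 0 (size p)] p0.
rewrite size_map size_iota ltnn => H; suff: false by []; apply: H.
  apply/allP => x /mapP [i _ ->]; apply/eqP; apply/eqP.
  by apply: contraT => hi; case: h; exists i%:R.
rewrite map_inj_uniq ?iota_uniq // => i j /eqP.
wlog le_ij : i j / (i <= j)%N => [W|].
  by case/orP: (leq_total i j) => ij /eqP e; [|symmetry]; apply: W => //; rewrite e.
move=> e; have : (j - i)%:R = 0 :> k by rewrite natrB // (eqP e) subrr.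
by move/eqP; rewrite (pcharf0P k).1 // subn_eq0 => ji; apply/eqP; rewrite eqn_leq le_ij.
Qed.

Definition fp_k (x : ob X (self_alg k)) : fpoint X :=
  @FPoint k X (self_alg k) (closedField_is_field k) x.

(** The affine line is connected: two nonvanishing loci of nonzero polynomials share a k-point c,
    found among the natural numbers, and the member [y c] of the family would lie in both open
    sets. *)
Lemma poly_family (char0 : [pchar k] =i pred0) (x : ob X polyA)
    (y : k -> ob X (self_alg k)) (m : forall c, mor (y c) x) :
  (forall c, mor_base (m c) = ev_at c) ->
  forall (p q : fpoint X) (f : mor (fp_ob p) x) (g : mor (fp_ob q) x),
  component (pt_class p) (pt_class q).
Proof.
move=> em p q f g; pose C s := exists (p : fpoint X) (f : mor (fp_ob p) x), s = pt_class p.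
exists C; split; [|by exists p, f|by exists q, g].
move=> U V oU oV cov dis.
have [EU hU] := oU _ x; have [EV hV] := oV _ x.
case: (pselect (exists a, EU a /\ a != 0)) => [[a [Ua a0]]|hn]; last first.
  right=> s [p' [f' ->]]; case: (cov (pt_class p')) => //; first by exists p', f'.
  move=> /(hU _ f') [b [Ub fb]]; case: hn; exists b; split=> //.
  by apply: contraNneq fb => ->; rewrite rmorph0.
left=> s [p' [f' ->]]; case: (cov (pt_class p')) => //; first by exists p', f'.
move=> /(hV _ f') [b [Vb fb]].
have b0 : b != 0 by apply: contraNneq fb => ->; rewrite rmorph0.
have [|c] := @poly_nonroot (a * b : {poly k}) char0; first by rewrite mulf_neq0.
rewrite rmorphM mulf_eq0 negb_or => /andP [ha hb].
case: (dis (pt_class (fp_k (y c)))); first by exists (fp_k (y c)), (m c).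
- by apply/(hU (fp_k (y c)) (m c)); exists a; rewrite em.
- by apply/(hV (fp_k (y c)) (m c)); exists b; rewrite em.
Qed.

Lemma poly_family_in (char0 : [pchar k] =i pred0) (S : stack_space X -> Prop)
    (x : ob X polyA) (y : k -> ob X (self_alg k)) (m : forall c, mor (y c) x) :
  union_of_components S -> (forall c, mor_base (m c) = ev_at c) ->
  S (pt_class (fp_k (y 1))) ->
  forall (p : fpoint X) (f : mor (fp_ob p) x), S (pt_class p).
Proof.
move=> [F HF] em /HF [s [Fs hs]] p f; apply/HF; exists s; split=> //.
by apply: component_trans hs _; apply: (@poly_family char0 x y m em (fp_k (y 1)) p (m 1) f).
Qed.

End ComponentFacts.

(** * The maps F(p . -) for a point p of U_tau *)

Section MapPull.
Variables (k : comPzRingType) (M : zmodType) (P : set M) (N : aff_cat k).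
Local Notation U := (mon_alg k P).
Local Notation Th := (quot_stack (torus_act k P)).
Local Notation MS := (Map_stack Th N).

Section Mul.
Variables (A0 A A' : alg k) (iota : hom A0 A) (p : hom U A) (h : hom A A').
Variables (iota' : hom A0 A') (p' : hom U A').
Hypotheses (ei : iota' = hcomp h iota) (ep : p' = hcomp h p).
Variable F : ob MS A0.

Definition mul_map (A1 : alg k) (i : hom A0 A1) (q : hom U A1) : ob MS A1 :=
  fcomp F (mul_functor i q).

Lemma mul_map_e1 (C : alg k) (x : ob Th C) (a' : hom A' C) (a : hom A C) :
  a = hcomp a' h -> hcomp a' p' = hcomp (mor_base (idm x)) (hcomp a p).
Proof. by move=> ->; rewrite mor_base_id hcomp1f ep hcompA. Qed.

Lemma mul_map_e2 (C : alg k) (x : ob Th C) (a' : hom A' C) (a : hom A C)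
  (e : a = hcomp a' h) : hcomp a' iota' = hcomp (mor_base (mul_mor (mul_map_e1 x e))) (hcomp a iota).
Proof. by rewrite -[mor_base _]/(hid C) hcomp1f ei e hcompA. Qed.

Definition mul_map_mor : @mor _ MS A A' (mul_map iota' p') (mul_map iota p).
Proof.
refine (@MapMor k Th N A A' (mul_map iota' p') (mul_map iota p) h
  (fun C x a' a e => fmor F (pmor (mul_map_e2 x e))) _ _).
- by move=> C x a' a e; exact: (fover F (pmor (mul_map_e2 x e))).
- move=> C C' x' x f a1' a2' a1 a2 e1 e2 e' e.
  rewrite -[fmor (mul_map iota p) (pmor e)]/(fmor F _) -[fmor (mul_map iota' p') (pmor e')]/(fmor F _).
  rewrite -!(fmor_comp F); congr (fmor F _); apply: eq_exist; apply: quot_mor_ext => /=.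
    by rewrite hcomp1f hcompf1.
  by rewrite hcomp1f hcompf1.
Defined.

End Mul.

Section One.
Variables (A : alg k) (F : ob MS A).
Let F1 := mul_map F (hid A) (torus_one P A).

Lemma mul_one_map (C : alg k) (x : ob Th C) (a : hom A C) :
  kmap (hid (tors_ring x)) (tors_map x) = tors_map (mul_ob x (hcomp a (torus_one P A))).
Proof.
rewrite kmap_id /=; apply: uv_ext => m; rewrite umulE.
rewrite -[hcomp _ (hcomp _ _)]/(kmap (tors_proj x) (kmap a (torus_one P A))) !torus_one_nat.
by rewrite [uv (torus_one _ _) m]of_characterE mulr1.
Qed.

Definition mul_one (C : alg k) (x : ob Th C) (a : hom A C) :
  @mor _ Th C C (mul_ob x (hcomp a (torus_one P A))) x.
Proof.
refine (@QuotMor k _ _ _ C C (mul_ob x (hcomp a (torus_one P A))) x (hid C)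
 (hid (tors_ring x)) _ _ _ (mul_one_map x a)).
- by rewrite hcomp1f hcompf1.
- by move=> D g q; rewrite !hcompf1.
- move=> D q b; rewrite hcompf1 => e; exists q; split; first by rewrite hcompf1.
  by move=> p' [<- _]; rewrite hcompf1.
Defined.

Lemma mul_one_e (C : alg k) (x : ob Th C) (a' a : hom A C) : a = hcomp a' (hid A) ->
  hcomp a' (hid A) = hcomp (mor_base (mul_one x a')) a.
Proof. by move=> ->; rewrite -[mor_base _]/(hid C) hcomp1f hcompf1. Qed.

Definition mul_map_one : @mor _ MS A A F1 F.
Proof.
refine (@MapMor k Th N A A F1 F (hid A)
  (fun C x a' a e => fmor F (pmor (mul_one_e x e))) _ _).
- by move=> C x a' a e; exact: (fover F (pmor (mul_one_e x e))).
- move=> C C' x' x f a1' a2' a1 a2 e1 e2 e' e.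
  rewrite -[fmor F1 (pmor e')]/(fmor F _) -!(fmor_comp F); congr (fmor F _); apply: eq_exist; apply: quot_mor_ext => /=.
    by rewrite hcomp1f hcompf1.
  by rewrite hcomp1f hcompf1.
Defined.
End One.
End MapPull.

(** * Powers along a cocharacter *)

Section IntPowers.
Variables (C : comPzRingType) (w w' : C).
Hypothesis ww : w * w' = 1.

(** Integral powers of a unit [w] of a ring without chosen inverses; the inverse [w'] is carried
    along. *)
Definition zp (n : int) : C := match n with Posz n => w ^+ n | Negz n => w' ^+ n.+1 end.

Lemma zp_pow a b : w ^+ (a + b) * w' ^+ b = w ^+ a.
Proof. by rewrite exprD -mulrA -exprMn ww expr1n mulr1. Qed.

Lemma zpE (a b : nat) : zp (a%:Z - b%:Z) = w ^+ a * w' ^+ b.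
Proof.
case: (leqP b a) => [h|h].
  by rewrite subzn //= -{2}(subnKC h) [(b + _)%N]addnC zp_pow.
have -> : a%:Z - b%:Z = Negz (b - a).-1 by lia.
rewrite /= prednK ?subn_gt0 // -{2}(subnKC (ltnW h)) exprD mulrA -exprMn ww expr1n.
by rewrite mul1r.
Qed.

Lemma zp_rep (n : int) : exists a b : nat, n = a%:Z - b%:Z.
Proof. by case: n => n; [exists n, 0%N | exists 0%N, n.+1]; lia. Qed.

Lemma zpD m n : zp (m + n) = zp m * zp n.
Proof.
have [a [b ->]] := zp_rep m; have [c [d ->]] := zp_rep n.
have -> : a%:Z - b%:Z + (c%:Z - d%:Z) = (a + c)%N%:Z - (b + d)%N%:Z by lia.
by rewrite !zpE !exprD mulrACA.
Qed.

Lemma zp0 : zp 0 = 1. Proof. exact: expr0. Qed.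

Lemma zp_nneg n : 0 <= n -> zp n = w ^+ `|n|%N. Proof. by case: n. Qed.

End IntPowers.

Lemma zp_map (C D : comPzRingType) (f : {rmorphism C -> D}) w w' n :
  f (zp w w' n) = zp (f w) (f w') n.
Proof. by case: n => n; rewrite /= rmorphXn. Qed.

Section PowerPoints.
Variables (k : comPzRingType) (M : zmodType) (P : set M).
Variables (b : M -> int).
Hypothesis bD : forall m n, b (m + n) = b m + b n.
Hypothesis bP : forall m, P m -> 0 <= b m.
Local Notation TT := (torus k M).
Local Notation U := (mon_alg k P).

Let b0 : b 0 = 0.
Proof. by have := bD 0 0; rewrite addr0 => /(congr1 (fun x => x - b 0)); rewrite subrr addrK. Qed.

Lemma upow_subproof0 (C : comPzRingType) (x : C) : x ^+ `|b 0|%N = 1.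
Proof. by rewrite b0 expr0. Qed.

Lemma upow_subproofD (C : comPzRingType) (x : C) m n : P m -> P n ->
  x ^+ `|b (m + n)|%N = x ^+ `|b m|%N * x ^+ `|b n|%N.
Proof.
move=> /bP hm /bP hn; rewrite -exprD bD; congr (_ ^+ _).
by apply/eqP; rewrite -eqz_nat PoszD !gez0_abs ?addr_ge0.
Qed.

(** The one-parameter subgroup b, extended to a map from the affine line to U_tau by its
    nonnegativity on P. Its value at x = 0 is the fixed point of T as soon as b vanishes on P only
    at 0 ([b_pointed]). *)
Definition upow (C : alg k) (x : C) : hom U C :=
  @upt k M P C (fun m => x ^+ `|b m|%N) (@upow_subproof0 C x) (@upow_subproofD C x).

Lemma upowE C x m : uv (@upow C x) m = x ^+ `|b (sval m)|%N.
Proof. exact: uptE. Qed.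

Lemma upow_nat (C D : alg k) (f : hom C D) x : hcomp f (upow x) = upow (f x).
Proof.
apply: uv_ext => m; rewrite upowE -rmorphXn -(upowE x m).
by [].
Qed.

Lemma upow1 (C : alg k) : upow (1 : C) = torus_one P C.
Proof. by apply: uv_ext => m; rewrite upowE expr1n [RHS]of_characterE. Qed.

Section Tpow.
Variables (C : alg k) (w w' : C).
Hypothesis ww : w * w' = 1.

Lemma tpow_subproof0 : zp w w' (b 0) = 1. Proof. by rewrite b0 zp0. Qed.
Lemma tpow_subproofD m n : zp w w' (b (m + n)) = zp w w' (b m) * zp w w' (b n).
Proof. by rewrite bD zpD. Qed.

Definition tpow : hom (gring TT) C := tpt tpow_subproof0 tpow_subproofD.
Lemma tpowE m : tv tpow m = zp w w' (b m). Proof. exact: tptE. Qed.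

Lemma tpow_one : torus_act k P C tpow (torus_one P C) = upow w.
Proof.
apply: uv_ext => m; rewrite actE tpowE upowE [uv _ m]of_characterE mulr1.
by rewrite zp_nneg // bP //; exact: (svalP m).
Qed.
End Tpow.

Hypothesis b_pointed : forall m, P m -> b m = 0 -> m = 0.

Lemma upow0_act (C : alg k) (g : hom (gring TT) C) :
  torus_act k P C g (upow (0 : C)) = upow (0 : C).
Proof.
apply: uv_ext => -[m Pm]; rewrite actE upowE /=.
case: (eqVneq (b m) 0) => [e|e].
  by rewrite (b_pointed Pm e) b0 expr0 mulr1 tv0.
by rewrite expr0n absz_eq0 (negbTE e) mulr0.
Qed.

Lemma umul_upow0 (C : alg k) (p : hom U C) : umul p (upow (0 : C)) = upow (0 : C).
Proof.
apply: uv_ext => -[m Pm]; rewrite umulE upowE /=.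
case: (eqVneq (b m) 0) => [e|e].
  rewrite e expr0 mulr1; have [H _] := character_of p; apply: H.
  exact: b_pointed Pm e.
by rewrite expr0n absz_eq0 (negbTE e) mulr0.
Qed.

End PowerPoints.

Lemma lconvM_aux (K : comPzRingType) (n1 n2 m1 m2 q dy dz y0 z0 a c a0 b0 A C : K) :
  n1 * dy = A -> n2 * dz = C -> m1 * y0 = a0 -> m2 * z0 = b0 ->
  A = q * a -> C = q * c ->
  n1 * n2 * (m1 * m2) * (dy * dz + dy * z0 + y0 * dz) =
  q * (m1 * m2 * q * a * c + n2 * m1 * a * b0 + n1 * m2 * a0 * c).
Proof.
move=> e1 e2 e3 e4 eA eC.
transitivity (m1 * m2 * (n1 * dy) * (n2 * dz) + n2 * m1 * (n1 * dy) * (m2 * z0)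
   + n1 * m2 * (m1 * y0) * (n2 * dz)); first by ring.
by rewrite e1 e2 e3 e4 eA eC; ring.
Qed.

Lemma lconv_inv_aux (K : comPzRingType) (n1 m1 r q dy w0 a c v y w A : K) :
  n1 * dy = A -> m1 * w0 = c -> A = q * a -> w = w0 * v -> dy * w0 = y * w0 - 1 ->
  y * (w0 * v) = 1 ->
  n1 * m1 * m1 * r * (w - w0) = q * - (r * a * c * c * v).
Proof.
move=> e1 e2 eA -> e4 e5.
have -> : w0 * v - w0 = - (dy * w0 * w0 * v).
  rewrite e4; transitivity (w0 * v - w0 * (y * (w0 * v))); last by ring.
  by rewrite e5 mulr1.
transitivity (- ((n1 * dy) * (m1 * w0) * (m1 * w0) * r * v)); first by ring.
by rewrite e1 e2 eA; ring.
Qed.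

(* Convergence of sequences of Laurent series, up to a fixed pole. *)
Section Limits.
Variable k : fieldType.
Local Notation K := (laurent k).
Local Notation gen := (generic_point k).
Local Notation t := (fps_t k).

Definition lconv (y : nat -> K) (y0 : K) : Prop :=
  exists N, forall q, (N <= q)%N ->
    exists a, gen (t ^+ N) * (y q - y0) = gen (t ^+ q * a).

Lemma gen_t_unit n : gen (t ^+ n) * lt_inv k ^+ n = 1.
Proof. exact: lt_invP. Qed.

Lemma lconv_widen y y0 N : (forall q, (N <= q)%N ->
    exists a, gen (t ^+ N) * (y q - y0) = gen (t ^+ q * a)) ->
  forall N', (N <= N')%N -> forall q, (N' <= q)%N ->
    exists a, gen (t ^+ N') * (y q - y0) = gen (t ^+ q * a).
Proof.
move=> h N' le q hq; have [a ea] := h q (leq_trans le hq).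
exists (t ^+ (N' - N) * a).
by rewrite -{1}(subnK le) exprD rmorphM -mulrA ea -rmorphM mulrCA.
Qed.

Lemma lconvC c : lconv (fun=> c) c.
Proof. by exists 0%N => q _; exists 0; rewrite subrr !mulr0 rmorph0. Qed.

Lemma lconvD y y0 z z0 : lconv y y0 -> lconv z z0 ->
  lconv (fun q => y q + z q) (y0 + z0).
Proof.
move=> [N1 h1] [N2 h2]; exists (maxn N1 N2) => q hq.
have [a ea] := lconv_widen h1 (leq_maxl N1 N2) hq.
have [c ec] := lconv_widen h2 (leq_maxr N1 N2) hq.
exists (a + c); rewrite opprD addrACA mulrDr ea ec -rmorphD; congr (gen _).
by rewrite mulrDr.
Qed.

Lemma lconvM y y0 z z0 : lconv y y0 -> lconv z z0 ->
  lconv (fun q => y q * z q) (y0 * z0).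
Proof.
move=> [N1 h1] [N2 h2].
have [a0 [n0 ey0]] := lau_rep y0; have [b0 [n1 ez0]] := lau_rep z0.
exists (N1 + N2 + (n0 + n1))%N => q hq.
have hq1 : (N1 <= q)%N by lia. have hq2 : (N2 <= q)%N by lia.
have [a ea] := h1 q hq1; have [c ec] := h2 q hq2.
have py : gen (t ^+ n0) * y0 = gen a0.
  by rewrite ey0 mulrCA gen_t_unit mulr1.
have pz : gen (t ^+ n1) * z0 = gen b0.
  by rewrite ez0 mulrCA gen_t_unit mulr1.
have -> : y q * z q - y0 * z0 = (y q - y0) * (z q - z0) + (y q - y0) * z0 + y0 * (z q - z0).
  by ring.
exists (t ^+ (n0 + n1) * t ^+ q * a * c + t ^+ (N2 + n0) * a * b0 + t ^+ (N1 + n1) * a0 * c).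
rewrite !rmorphM !rmorphD !rmorphM !exprD !rmorphM.
by apply: lconvM_aux ea ec py pz _ _; rewrite ?rmorphM.
Qed.

(* [y q * w0 = 1 + t u] is a unit of the power series ring for large [q] *)
Lemma lconv_aux y y0 w0 : lconv y y0 -> y0 * w0 = 1 ->
  exists N n c, forall q, (N + n + n < q)%N -> exists a v, 
   [/\ gen (t ^+ N) * (y q - y0) = gen (t ^+ q * a),
      gen (t ^+ n) * w0 = gen c & y q * (w0 * gen v) = 1].
Proof.
move=> [N h] e0; have [c [n ew0]] := lau_rep w0.
have pw : gen (t ^+ n) * w0 = gen c by rewrite ew0 mulrCA gen_t_unit mulr1.
exists N, n, c => q hq; have hq1 : (N <= q)%N by lia.
have [a ea] := h q hq1.
have [q' eq'] : exists q', q = (N + n + q'.+1)%N by exists (q - N - n).-1; lia.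
have eu : y q * w0 = gen (1 + t ^+ q'.+1 * (a * c)).
  have -> : y q * w0 = 1 + (y q - y0) * w0 by rewrite mulrBl e0; ring.
  rewrite rmorphD rmorph1; congr (_ + _).
  have tt : gen (t ^+ (N + n)) * ((y q - y0) * w0) = gen (t ^+ (N + n)) * gen (t ^+ q'.+1 * (a * c)).
    rewrite exprD rmorphM mulrACA ea pw -!rmorphM; congr (gen _).
    by rewrite {1}eq' exprD (exprD t N n); ring.
  have := congr1 (fun x => lt_inv k ^+ (N + n) * x) tt.
  by rewrite !mulrA [lt_inv k ^+ _ * _]mulrC gen_t_unit !mul1r.
have [v ev] : exists v, (1 + t ^+ q'.+1 * (a * c)) * v = 1.
  by apply: fps_nilp_unit; rewrite fps_coefD fps_coefXnM fps_coef1 /= addr0.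
by exists a, v; split=> //; rewrite mulrA eu -rmorphM ev rmorph1.
Qed.

Lemma lconv_unit y y0 w0 : lconv y y0 -> y0 * w0 = 1 ->
  exists q0, forall q, (q0 <= q)%N -> exists v, y q * v = 1.
Proof.
move=> hy e; have [N [n [c H]]] := lconv_aux hy e.
exists (N + n + n).+1 => q /H [a [v [_ _ h]]]; by exists (w0 * gen v).
Qed.

Lemma lconv_inv y y0 w w0 q0 : lconv y y0 -> y0 * w0 = 1 ->
  (forall q, (q0 <= q)%N -> y q * w q = 1) -> lconv w w0.
Proof.
move=> hy e0 ew; have [N [n [c H]]] := lconv_aux hy e0.
exists (maxn q0 (N + n + n).+1) => q hq.
have hq1 : (N + n + n < q)%N by apply: leq_trans hq; exact: leq_maxr.
have hq2 : (q0 <= q)%N by apply: leq_trans hq; exact: leq_maxl.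
have [a [v [h1 h2 h3]]] := H q hq1.
have ewq : w q = w0 * gen v by apply: inv_uniq h3; exact: ew.
have [s es] : exists s, maxn q0 (N + n + n).+1 = (N + n + n + s)%N.
  exists (maxn q0 (N + n + n).+1 - (N + n + n))%N; rewrite subnKC //.
  by apply: leq_trans (leq_maxr _ _); exact: leqnSn.
exists (- (t ^+ s * a * c * c * v)).
rewrite es !rmorphM rmorphN !rmorphM !exprD !rmorphM.
by apply: lconv_inv_aux h1 h2 _ ewq _ h3; rewrite ?rmorphM // mulrBl e0.
Qed.

(** The error is divisible by t^(q - N) with N fixed, hence by t once q exceeds N. *)
Lemma lconv_int y a0 : lconv y (gen a0) ->
  exists q0, forall q, (q0 <= q)%N -> exists a, y q = gen (a0 + t * a).
Proof.
move=> [N h]; exists N.+1 => q hq; have [a ea] := h q (ltnW hq).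
exists (t ^+ (q - N.+1) * a).
have e : gen (t ^+ N) * (y q - gen a0) = gen (t ^+ N) * gen (t * (t ^+ (q - N.+1) * a)).
  by rewrite ea -rmorphM; congr (gen _); rewrite -{1}(subnKC hq) addSn exprS exprD; ring.
have := congr1 (fun x => lt_inv k ^+ N * x) e.
rewrite !mulrA [lt_inv k ^+ _ * _]mulrC gen_t_unit !mul1r => e'.
rewrite -[LHS](subrK (gen a0)) e' rmorphD [LHS]addrC; congr (_ + gen _); ring.
Qed.

(** Ramification by q + 1 makes the nonconstant part of a divisible by t^q. *)
Lemma lconv_ram (a : pser k) : lconv (fun q => gen (ramify k (ltn0Sn q) a))
  (gen (fps_const (fcoef a 0))).
Proof.
exists 0%N => q _; rewrite expr0 rmorph1 mul1r -rmorphB.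
have [|b eb] := @fps_divXn _ q (ramify k (ltn0Sn q) a - fps_const (fcoef a 0)).
  move=> i lt; rewrite fps_coefB fps_coefC /=; case: eqP => [->|/eqP i0].
    by rewrite dvdn0 div0n subrr.
  by rewrite gtnNdvd ?subr0 // ?lt0n // (ltn_trans lt).
by exists b; rewrite eb.
Qed.

End Limits.

(** * Limits of curves *)

Section HomGenerators.
Variable k : comPzRingType.

Lemma fg_hom_ext (B C : alg k) n (b : 'I_n -> B) (f g : hom B C) :
  (forall y, exists t, teval b t = y) -> (forall i, f (b i) = g (b i)) -> f = g.
Proof.
move=> gen e; apply: hom_ext => y; have [t <-] := gen y.
elim: t => [i|c|t IHt s IHs|t IHt s IHs] /=; rewrite ?rmorphD ?rmorphM ?IHt ?IHs //.
by rewrite !homE.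
Qed.

Lemma fg_hom_in (B C D : alg k) n (b : 'I_n -> B) (f : hom B D) (i : hom C D) :
  (forall y, exists t, teval b t = y) -> injective i ->
  (forall j, exists c, i c = f (b j)) -> exists g : hom B C, hcomp i g = f.
Proof.
move=> gen inj h; apply: hom_factor => // y; have [t <-] := gen y.
elim: t => [j|c|t [x hx] s [z hz]|t [x hx] s [z hz]] /=; first exact: h.
- by exists (alg_str C c); rewrite !homE.
- by exists (x + z); rewrite !rmorphD hx hz.
- by exists (x * z); rewrite !rmorphM hx hz.
Qed.

End HomGenerators.

Section LimitPoint.
Variables (k : fieldType) (G : grp k) (H : kfun k) (aH : gaction G H).
Hypothesis H_ft : scheme_of_finite_type H.
Local Notation GG := (gring G).
Local Notation K := (laurent k).
Local Notation gen := (generic_point k).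
Local Notation t := (fps_t k).
Local Notation cl := (closed_point k).

Lemma pser_local : (forall y, exists a, cl a = y) /\
  (forall a, cl a = 1 -> exists b, a * b = 1).
Proof.
split=> [y|a e]; last exact: fps_nilp_unit.
by exists (fps_const y); rewrite -[LHS]/(fcoef (fps_const y) 0) fps_coefC.
Qed.

Lemma field_chart (x : H (self_alg k)) : exists (U : alg k) (u : H U),
  [/\ finitely_generated U, open_immersion u & in_chart u x].
Proof.
have [_ [n [B [u [hu cov]]]]] := H_ft.
have fk : is_field (self_alg k) by split=> [|y y0]; [exact: oner_neq0 | exists y^-1; exact: mulfV].
have [i [g e]] := cov _ x fk; exists (B i), (u i).
by have [h1 h2] := hu i; split=> //; exists g.
Qed.

(** Under t -> t^q with q large, [fh] tends t-adically to its constant value, while the pole of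
    [Gam] stays fixed. So the translate of fh(t^q) by [Gam] tends to u; since u is integral in a
    chart, the translate is eventually integral there and has the same closed point. *)
Lemma limit_point (fh u : H (pser k)) (Gam : hom GG K) :
  kmap gen u = aH K Gam (kmap gen (kmap (kin (pser k)) (kmap cl fh))) ->
  exists (q : nat) (q0 : (0 < q)%N) (f1 : H (pser k)), kmap cl f1 = kmap cl u /\
    kmap gen f1 = aH K Gam (kmap gen (kmap (ramify k q0) fh)).
Proof.
move=> eu; have [U [uV [[n [b hb]] hV [c0k ec0]]]] := field_chart (kmap cl u).
have [csurj cunit] := pser_local.
have [c0 ec] : in_chart uV u.
  by apply: (in_chart_local hV csurj cunit); exists c0k.
(* The universal translate of [fh], over G x Spec k[[t]]. Evaluating it at (Gam, t^q) reduces
   convergence to the two factors of the tensor product. *)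
pose D := tensor GG (pser k).
pose w : H D := aH D (tensl GG (pser k)) (kmap (tensr GG (pser k)) fh).
pose pt (h : hom (pser k) (pser k)) : hom D K := tens_lift Gam (hcomp gen h).
have ptw h : kmap (pt h) w = aH K Gam (kmap gen (kmap h fh)).
  by rewrite act_nat tens_liftl -(kmap_comp _ (tensr _ _)) tens_liftr kmap_comp.
pose h0 := hcomp (kin (pser k)) cl.
pose hq q := ramify k (ltn0Sn q).
have conv d : lconv (fun q => pt (hq q) d) (pt h0 d).
  rewrite -[d]pres_reprK -teval_gen; elim: (pres_repr d) => [a|c|s IHs s' IHs'|s IHs s' IHs'].
  - have er h : pt h (tensr GG (pser k) a) = gen (h a).
      exact: (congr1 (fun f : hom _ _ => f a) (tens_liftr Gam (hcomp gen h))).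
    rewrite (_ : (fun _ => _) = fun q => gen (hq q a)); last by apply/funext => q; exact: er.
    have -> : pt h0 (pres_gen (@tensor_rel k GG (pser k)) a) = gen (h0 a) by exact: er.
    exact: lconv_ram.
  - have el h : pt h (tensl GG (pser k) c) = Gam c.
      exact: (congr1 (fun f : hom _ _ => f c) (tens_liftl Gam (hcomp gen h))).
    rewrite (_ : (fun _ => _) = fun=> Gam c); last by apply/funext => q; exact: el.
    have -> : pt h0 (alg_str (tensorA GG (pser k)) c) = Gam c by exact: el.
    exact: lconvC.
  - rewrite (_ : (fun _ => _) = fun q => pt (hq q) (teval (pres_gen (@tensor_rel k GG (pser k))) s) + 
       pt (hq q) (teval (pres_gen (@tensor_rel k GG (pser k))) s')); last by apply/funext => q; exact: rmorphD.
    have -> : pt h0 (teval (pres_gen (@tensor_rel k GG (pser k))) s + teval (pres_gen (@tensor_rel k GG (pser k))) s') =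
      pt h0 (teval (pres_gen (@tensor_rel k GG (pser k))) s) +
      pt h0 (teval (pres_gen (@tensor_rel k GG (pser k))) s') by exact: rmorphD.
    exact: lconvD IHs IHs'.
  - rewrite (_ : (fun _ => _) = fun q => pt (hq q) (teval (pres_gen (@tensor_rel k GG (pser k))) s) * 
       pt (hq q) (teval (pres_gen (@tensor_rel k GG (pser k))) s')); last by apply/funext => q; exact: rmorphM.
    have -> : pt h0 (teval (pres_gen (@tensor_rel k GG (pser k))) s * teval (pres_gen (@tensor_rel k GG (pser k))) s') =
      pt h0 (teval (pres_gen (@tensor_rel k GG (pser k))) s) *
      pt h0 (teval (pres_gen (@tensor_rel k GG (pser k))) s') by exact: rmorphM.
    exact: lconvM IHs IHs'.
have K1 : 1 != 0 :> K by case: (lau_field k).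
have w0 : in_chart uV (kmap (pt h0) w).
  by rewrite ptw /h0 kmap_comp -eu; apply: in_chart_map; exists c0.
(* Where e is invertible the translate lies in the chart around u; its coordinates are fractions
   with powers of e as denominators, so their convergence also uses that of the inverses of e. *)
have [e [e0 [c hc]]] := in_chart_loc hV K1 w0.
have [v0 ev0] : exists v, pt h0 e * v = 1 by case: (lau_field k) => _ /(_ _ e0).
have [q0 hq0] := lconv_unit (conv e) ev0.
pose v q := if pselect (exists v, pt (hq q) e * v = 1) is left h then projT1 (cid h) else 0.
have vE q : (q0 <= q)%N -> pt (hq q) e * v q = 1.
  by move=> /hq0 h; rewrite /v; case: pselect => // h'; case: cid.
have convv : lconv v v0 := lconv_inv (conv e) ev0 vE.
have e00 : loc_lift ev0 = loc_lift ev0 by [].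
have c0E : hcomp (loc_lift ev0) c = hcomp gen c0.
  by apply: (chart_inj hV); rewrite !kmap_comp hc -kmap_comp loc_liftE ptw /h0 kmap_comp -eu -ec.
have conv2 i : exists y : nat -> K, lconv y (gen (c0 (b i))) /\
    forall q (hq' : (q0 <= q)%N), y q = loc_lift (vE q hq') (c (b i)).
  have [a [m ea]] := loc_ind_eq (c (b i)).
  exists (fun q => pt (hq q) a * v q ^+ m); split.
    have -> : gen (c0 (b i)) = pt h0 a * v0 ^+ m.
      rewrite -hcompE -c0E hcompE ea rmorphM rmorphXn loc_lift_inv; congr (_ * _).
      exact: (congr1 (fun f : hom _ _ => f a) (loc_liftE ev0)).
    apply: lconvM => //; elim: m {ea} => [|m IH]; first exact: lconvC.
    rewrite exprS (_ : (fun _ => _) = fun q => v q * v q ^+ m); first exact: lconvM.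
    by apply/funext => q; rewrite exprS.
  move=> q hq'; rewrite ea rmorphM rmorphXn loc_lift_inv; congr (_ * _).
  exact/esym/(congr1 (fun f : hom _ _ => f a) (loc_liftE (vE q hq'))).
pose y i := projT1 (cid (conv2 i)).
have yP i : lconv (y i) (gen (c0 (b i))) by rewrite /y; case: cid => ? [].
have yE i q (hq' : (q0 <= q)%N) : y i q = loc_lift (vE q hq') (c (b i)).
  by rewrite /y; case: cid => ? [].
have /choice [N hN] i := lconv_int (yP i).
pose q := maxn q0 (\max_i N i).
have q0q : (q0 <= q)%N by exact: leq_maxl.
have hqi i : exists a, loc_lift (vE q q0q) (c (b i)) = gen (c0 (b i) + t * a).
  rewrite -yE; apply: hN; apply: leq_trans (leq_maxr _ _); exact: leq_bigmax.
have [j|g eg] := @fg_hom_in k U (pser k) K n b (hcomp (loc_lift (vE q q0q)) c) gen hb (@generic_inj k).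
  by have [a ea] := hqi j; exists (c0 (b j) + t * a); rewrite hcompE ea.
exists q.+1, (ltn0Sn q), (kmap g uV); split; last first.
  by rewrite -(kmap_comp gen g) eg kmap_comp hc -(kmap_comp _ (loc_map e)) loc_liftE ptw.
rewrite -kmap_comp -ec -kmap_comp; congr (kmap _ uV).
apply: (fg_hom_ext hb) => i; rewrite !hcompE.
have [a ea] := hqi i; have -> : g (b i) = c0 (b i) + t * a.
  by apply: generic_inj; rewrite -ea; exact: (congr1 (fun f : hom _ _ => f (b i)) eg).
rewrite rmorphD rmorphM -[X in X * _]/(fcoef t 0) /= coefX mul0r addr0.
by [].
Qed.

End LimitPoint.

Section TrivialMorphisms.
Variables (k : comPzRingType) (G : grp k) (X : kfun k) (aX : gaction G X).
Local Notation M := (quot_stack aX).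

Lemma triv_base (A A' : alg k) (y : X A) (f : hom A A') :
  exists m : @mor _ M A A' (triv_ob aX (kmap f y)) (triv_ob aX y),
    mor_base m = f /\ gel m = gone G A'.
Proof. by apply: triv_mor_ex; rewrite act1. Qed.

Lemma triv_act_mor (A : alg k) (y : X A) (g : hom (gring G) A) :
  exists m : @mor _ M A A (triv_ob aX (aX A g y)) (triv_ob aX y),
    mor_base m = hid A /\ gel m = g.
Proof. by apply: triv_mor_ex; rewrite kmap_id. Qed.

End TrivialMorphisms.

Section MulTriv.
Variables (k : comPzRingType) (M : zmodType) (P : set M).
Local Notation Th := (quot_stack (torus_act k P)).
Local Notation U := (mon_alg k P).

Lemma mul_triv_mor (C : alg k) (y p q : Spec U C) : umul y p = q ->
  exists m : @mor _ Th C C (mul_ob (triv_ob (torus_act k P) y) p) (triv_ob (torus_act k P) q),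
    mor_base m = hid C.
Proof.
move=> e; subst q; set x := mul_ob _ p; set x' := triv_ob _ (umul y p : Spec U C).
have em : kmap (hid (tors_ring x)) (tors_map x') = tors_map x.
  rewrite kmap_id.
  apply: etrans (esym (umul_act (tensr C (gring (torus k M)))
    (hcomp (tensl C (gring (torus k M))) y) (hcomp (tensl C (gring (torus k M))) p))).
  congr (torus_act_fun _ _); exact: umul_nat.
have [m1 m2 m3] : [/\ hcomp (hid (tors_ring x)) (tors_proj x') = hcomp (tors_proj x) (hid C),
   forall D (g : hom (gring (torus k M)) D) (r : hom (tors_ring x) D),
   hcomp (tors_act x D g r) (hid (tors_ring x)) = tors_act x' D g (hcomp r (hid _)) &
   forall D (r : hom (tors_ring x') D) (a : hom C D),
    hcomp r (tors_proj x') = hcomp a (hid C) ->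
    exists! p' : hom (tors_ring x) D, hcomp p' (hid _) = r /\ hcomp p' (tors_proj x) = a].
  split; first by rewrite hcomp1f hcompf1.
    by move=> D g r; rewrite !hcompf1.
  move=> D r a; rewrite hcompf1 => er; exists r; split; first by rewrite hcompf1.
  by move=> p' [<- _]; rewrite hcompf1.
by exists (@QuotMor k _ _ _ C C x x' (hid C) (hid (tors_ring x)) m1 m2 m3 em).
Qed.
End MulTriv.

Section Stratum.
Variables (k : closedFieldType) (M : zmodType) (P : set M).
Variables (G : grp k) (H : kfun k) (aH : gaction G H).
Local Notation Th := (quot_stack (torus_act k P)).
Local Notation N := (quot_stack aH).
Local Notation MS := (Map_stack Th N).
Local Notation one := (quot_point (torus_act k P) (@torus_one_nat k _ P)).
Variable S : stack_space MS -> Prop.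
Definition str_ev := fcomp (ev N one) (sub_incl S).
Local Notation cl := (closed_point k).
Local Notation gen := (generic_point k).

(* the points of the closed subscheme of [H] over [Z^+] *)
Definition zplus (A : alg k) (y : H A) := factors_through str_ev (hid A) (triv_ob aH y).

Lemma zplus_factors (A A' : alg k) (f : hom A A') (y : H A) :
  factors_through str_ev f (triv_ob aH y) <-> zplus (kmap f y).
Proof.
have [m [m1 _]] := triv_base aH y f.
by rewrite /zplus (factors_comp str_ev m (hid A')) m1 hcomp1f.
Qed.

Lemma zplus_act (A : alg k) (g : hom (gring G) A) (y : H A) :
  zplus (aH A g y) <-> zplus y.
Proof.
have [m [m1 _]] := triv_act_mor aH y g.
by rewrite /zplus (factors_comp str_ev m (hid A)) m1 hcomp1f.
Qed.

Hypothesis cE : closed_embedding str_ev.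

Lemma zplus_ideal (A : alg k) (y : H A) : exists I : set A,
  forall (A' : alg k) (f : hom A A'), zplus (kmap f y) <-> forall a, I a -> f a = 0.
Proof.
have [I HI] := cE (triv_ob aH y); exists I => A' f.
by rewrite -zplus_factors; exact: (HI A' f).1.
Qed.

Lemma zplus_map (A A' : alg k) (f : hom A A') (y : H A) : zplus y -> zplus (kmap f y).
Proof.
have [I HI] := zplus_ideal y; rewrite -{1}[y]kmap_id => /HI h; apply/HI => a Ia.
by rewrite -[LHS]/(f (hid A a)) h // rmorph0.
Qed.

Lemma zplus_inj (A A' : alg k) (f : hom A A') (y : H A) :
  injective f -> zplus (kmap f y) -> zplus y.
Proof.
have [I HI] := zplus_ideal y => inj /HI h; rewrite -[y]kmap_id; apply/HI => a Ia.
by apply: inj; rewrite h // rmorph0.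
Qed.

Variables (b : M -> int).
Hypothesis bD : forall m n, b (m + n) = b m + b n.
Hypothesis bP : forall m, P m -> 0 <= b m.
Hypothesis b_pointed : forall m, P m -> b m = 0 -> m = 0.
Local Notation upow := (upow bD bP).

(** The maps F(c . -) form a family over the affine line joining F, at c = 1, to the degenerate map,
    at c = 0; and S is a union of connected components. *)
Lemma mul_map_in (char0 : [pchar k] =i pred0) (F : ob MS (self_alg k)) :
  union_of_components S ->
  (forall (p : fpoint MS) (f : mor (fp_ob p) F), S (pt_class p)) ->
  forall (p : fpoint MS) (f : mor (fp_ob p) (mul_map F (hid _) (upow (0 : self_alg k)))),
    S (pt_class p).
Proof.
move=> US hF p f.
pose FF := mul_map F (kin (polyA k)) (upow ('X : polyA k)).
pose y c := mul_map F (hid (self_alg k)) (upow (c : self_alg k)).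
have ei c : hid (self_alg k) = hcomp (ev_at c) (kin (polyA k)) by exact: kin_uniq.
have ep c : upow (c : self_alg k) = hcomp (ev_at c) (upow ('X : polyA k)).
  by rewrite upow_nat; congr (upow _); rewrite /= /horner_eval hornerX.
pose m c : mor (y c) FF := mul_map_mor (ei c) (ep c) F.
have h1 : S (pt_class (fp_k (y 1))).
  apply: hF; rewrite /= /y upow1; exact: mul_map_one.
apply: (@poly_family_in k MS char0 S FF y m US) => //.
exact: mcomp (m 0) f.
Qed.

Section Step1.
Hypothesis G_lin : linear_algebraic G.
Hypothesis H_ft : scheme_of_finite_type H.
Hypothesis char0 : [pchar k] =i pred0.
Hypothesis US : union_of_components S.

(** Evaluating F on the arc x = t^b gives a torsor over k[[t]], hence, after a trivialization, a
    point u of H. Generically the arc lies in T, where F is isomorphic to its value fh(0) at the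
    identity; so u is generically a translate of fh(0). At t = 0 it is the value of the degenerate
    map. Now [limit_point] applies to u. *)
Lemma closed_limit (fh : H (pser k)) : zplus (kmap cl fh) ->
  exists (F : ob MS (self_alg k)) (z : H (self_alg k))
    (q : nat) (q0 : (0 < q)%N) (f1 : H (pser k)) (Gam : hom (gring G) (laurent k)),
  let F0 := mul_map F (hid _) (upow (0 : self_alg k)) in
  [/\ forall (p : fpoint MS) (f : mor (fp_ob p) F0), S (pt_class p),
      exists m : @mor _ N _ _ (triv_ob aH z) (F0 _ (one _ tt, hid _)), mor_base m = hid _,
      kmap cl f1 = z &
      kmap gen f1 = aH _ Gam (kmap gen (kmap (ramify k q0) fh))].
Proof.
move=> [[F hF] [m0 em0]]; pose fh0 := kmap cl fh.
have {}em0 : mor_base m0 = hid (self_alg k) by [].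
have [k1 ek1] := quot_inv em0.
pose one1 : ob Th (self_alg k) := one (self_alg k) tt.
pose oneK : ob Th (laurent k) := one (laurent k) tt.
pose Xx : ob Th (pser k) := triv_ob (torus_act k P) (upow (fps_t k : pser k)).
have [u [mu emu]] := henselian_triv (F _ (Xx, kin (pser k))) (@henselian_pser k).
have [n1 [en1 _]] : exists n1 : @mor _ Th _ _ oneK Xx, mor_base n1 = gen /\
   gel n1 = ginv (tpow bD (loc_invP (fps_t k))).
  apply: triv_mor_ex; rewrite -[kmap gen _]/(hcomp gen (upow _)) upow_nat.
  by rewrite -(tpow_one bD bP (loc_invP (fps_t k))) -actM gmulV act1.
have en1' : kin (laurent k) = hcomp (mor_base n1) (kin (pser k)) by exact: kin_uniq.
pose n2 : @mor _ Th _ _ oneK one1 := @fmor _ _ _ one (self_alg k) (laurent k) tt tt (kin (laurent k)).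
have en2' : kin (laurent k) = hcomp (mor_base n2) (hid (self_alg k)) by exact: kin_uniq.
pose f1 := fmor F (pmor en1'); pose f2 := fmor F (pmor en2').
have ef1 : mor_base f1 = gen by rewrite /f1 fover.
pose k2 : @mor _ N _ _ (triv_ob aH fh0) (F _ (one1, hid (self_alg k))) := k1.
have ek2 : mor_base k2 = hid (self_alg k) by exact: ek1.
have [pK [epK _]] := pull_triv f2 ek2.
have [w [_ _ ew]] := compare f1 emu epK.
move: (gel w) ew => Gam ew {w}.
have {}ew : kmap gen u = aH _ (ginv Gam) (kmap gen (kmap (kin (pser k)) fh0)).
  have e1 : kmap gen (kmap (kin (pser k)) fh0) = kmap (mor_base f2) fh0.
    by rewrite -kmap_comp; congr (kmap _ _); exact: kin_uniq.
  by rewrite e1 ew ef1 -actM gmulV act1.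
have [q [q0 [g1 [eg1 eg2]]]] := limit_point H_ft ew.
exists F, (kmap cl u), q, q0, g1, (ginv Gam); split=> //.
  exact: mul_map_in.
have [n3 en3] : exists n3 : @mor _ Th _ _ (mul_ob one1 (hcomp (hid _) (upow (0 : self_alg k)))) Xx,
    mor_base n3 = cl.
  have [|m1 em1] := @mul_triv_mor k M P (self_alg k) (torus_one P _)
     (hcomp (hid _) (upow (0 : self_alg k))) (kmap cl (upow (fps_t k : pser k) : Spec (mon_alg k P) _)).
    rewrite umul1 hcomp1f -[RHS]/(hcomp cl _) upow_nat; congr (upow _).
    by rewrite /= /fcoef0 /= coefX.
  have [m2 [em2 _]] := triv_base (torus_act k P) (upow (fps_t k : pser k) : Spec _ _) cl.
  by exists (mcomp m2 m1); rewrite mor_base_comp em1 em2 hcomp1f.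
have en3' : hcomp (hid _) (hid (self_alg k)) = hcomp (mor_base n3) (kin (pser k)) by exact: kin_uniq.
have [p [ep _]] := pull_triv (fmor F (pmor en3')) emu.
have ecl : mor_base (fmor F (pmor en3')) = cl by rewrite fover.
by rewrite -ecl; exists p.
Qed.

End Step1.
End Stratum.

(** * The degenerate map and its one-parameter subgroups *)

Section Cocharacter.
Variables (k : fieldType) (M : zmodType) (P : set M).
Variables (G : grp k) (H : kfun k) (aH : gaction G H).
Local Notation Th := (quot_stack (torus_act k P)).
Local Notation N := (quot_stack aH).
Local Notation MS := (Map_stack Th N).
Local Notation TT := (gring (torus k M)).
Variables (b : M -> int).
Hypothesis bD : forall m n, b (m + n) = b m + b n.
Hypothesis bP : forall m, P m -> 0 <= b m.
Hypothesis b_pointed : forall m, P m -> b m = 0 -> m = 0.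
Local Notation upow := (upow bD bP).
Variable F : ob MS (self_alg k).

Definition Fk (C : alg k) (X : ob Th C) : ob N C := F C (X, kin C).

Lemma Fm_e (C C' : alg k) (X : ob Th C) (X' : ob Th C') (m : mor X' X) :
  kin C' = hcomp (mor_base m) (kin C).
Proof. exact: kin_uniq. Qed.

Definition Fm (C C' : alg k) (X : ob Th C) (X' : ob Th C') (m : mor X' X) :
  mor (Fk X') (Fk X) := fmor F (pmor (Fm_e m)).

Lemma Fm_base (C C' : alg k) (X : ob Th C) (X' : ob Th C') (m : mor X' X) :
  mor_base (Fm m) = mor_base m.
Proof. by rewrite /Fm fover. Qed.

Lemma Fm_comp (C C' C'' : alg k) (X : ob Th C) (X' : ob Th C') (X'' : ob Th C'')
    (m : mor X' X) (n : mor X'' X') : Fm (mcomp m n) = mcomp (Fm m) (Fm n).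
Proof. by rewrite /Fm (fmor_pmor_comp F _ _ (Fm_e (mcomp m n))). Qed.

Lemma Fm_id (C : alg k) (X : ob Th C) : Fm (idm X) = idm (Fk X).
Proof. by rewrite /Fm /Fk -fmor_id; congr (fmor F _); exact: eq_exist. Qed.

(** The fixed point of U_tau. All elements of T(C) are automorphisms of this object, and applying F
    to them produces [lam]. *)
Definition Oz (C : alg k) : ob Th C := triv_ob (torus_act k P) (upow (0 : C) : Spec _ C).

Lemma Oz_mor_ex (C D : alg k) (h : hom C D) (a : hom TT D) :
  exists m : @mor _ Th C D (Oz D) (Oz C), mor_base m = h /\ gel m = a.
Proof.
apply: triv_mor_ex; rewrite -[kmap h _]/(hcomp h (upow _)) upow_nat rmorph0.
exact: upow0_act.
Qed.

Definition Oz_mor (C D : alg k) (h : hom C D) (a : hom TT D) :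
  @mor _ Th C D (Oz D) (Oz C) := projT1 (cid (Oz_mor_ex h a)).
Lemma Oz_mor_base (C D : alg k) (h : hom C D) (a : hom TT D) : mor_base (Oz_mor h a) = h.
Proof. by rewrite /Oz_mor; case: cid => m []. Qed.
Lemma Oz_mor_gel (C D : alg k) (h : hom C D) (a : hom TT D) : gel (Oz_mor h a) = a.
Proof. by rewrite /Oz_mor; case: cid => m []. Qed.

Lemma Oz_mor_comp (C D E : alg k) (h : hom C D) (h' : hom D E) (a : hom TT D) (a' : hom TT E) :
  mcomp (Oz_mor h a) (Oz_mor h' a') = Oz_mor (hcomp h' h) (gmul a' (hcomp h' a)).
Proof.
apply: triv_mor_ext; first by rewrite mor_base_comp !Oz_mor_base.
by rewrite gel_comp !Oz_mor_gel Oz_mor_base.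
Qed.

Variables (z : H (self_alg k)).
Variable kap : @mor _ N _ _ (triv_ob aH z) (Fk (Oz (self_alg k))).
Hypothesis ekap : mor_base kap = hid _.

Definition zC (C : alg k) : H C := kmap (kin C) z.

Lemma zC_nat (C D : alg k) (f : hom C D) : kmap f (zC C) = zC D.
Proof. by rewrite /zC -kmap_comp; congr (kmap _ z); exact: kin_uniq. Qed.

(** The trivializations over all C are induced from the one over k along morphisms with trivial
    torus part. This normalization is what makes [lam] natural, through [gel_lamq1]. *)
Lemma kapC_ex (C : alg k) : exists p : @mor _ N C C (triv_ob aH (zC C)) (Fk (Oz C)),
  mor_base p = hid C /\ exists t : @mor _ N _ C (triv_ob aH (zC C)) (triv_ob aH z),
     [/\ mor_base t = kin C, gel t = gone G C &
         mcomp (Fm (Oz_mor (kin C) (gone _ C))) p = mcomp kap t].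
Proof.
have e : mor_base (Fm (Oz_mor (kin C) (gone (torus k M) C))) = kin C.
  by rewrite Fm_base Oz_mor_base.
have [p [p1 [t [t1 t2 t3]]]] := pull_triv (Fm (Oz_mor (kin C) (gone _ C))) ekap.
move: p p1 t t1 t2 t3; rewrite e => p p1 t t1 t2 t3.
by exists p; split=> //; exists t.
Qed.

Definition kapC (C : alg k) : @mor _ N C C (triv_ob aH (zC C)) (Fk (Oz C)) :=
  projT1 (cid (kapC_ex C)).
Lemma kapC_base C : mor_base (kapC C) = hid C.
Proof. by rewrite /kapC; case: cid => p []. Qed.
Lemma kapC_P C : exists t : @mor _ N _ C (triv_ob aH (zC C)) (triv_ob aH z),
     [/\ mor_base t = kin C, gel t = gone G C &
         mcomp (Fm (Oz_mor (kin C) (gone _ C))) (kapC C) = mcomp kap t].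
Proof. by rewrite /kapC; case: cid => p []. Qed.

Lemma lam_ex (C D : alg k) (h : hom C D) (a : hom TT D) :
  exists q : @mor _ N C D (triv_ob aH (zC D)) (triv_ob aH (zC C)),
    mor_base q = h /\ mcomp (kapC C) q = mcomp (Fm (Oz_mor h a)) (kapC D).
Proof.
have [q []] := compare (Fm (Oz_mor h a)) (kapC_base C) (kapC_base D).
by rewrite Fm_base Oz_mor_base => e1 e2 _; exists q.
Qed.

Definition lamq (C D : alg k) (h : hom C D) (a : hom TT D) := projT1 (cid (lam_ex h a)).
Lemma lamq_base (C D : alg k) (h : hom C D) a : mor_base (lamq h a) = h.
Proof. by rewrite /lamq; case: cid => q []. Qed.
Lemma lamq_P (C D : alg k) (h : hom C D) a :
  mcomp (kapC C) (lamq h a) = mcomp (Fm (Oz_mor h a)) (kapC D).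
Proof. by rewrite /lamq; case: cid => q []. Qed.

Definition lam (C : alg k) (a : hom TT C) : hom (gring G) C := gel (lamq (hid C) a).

Lemma lamq_comp (C D E : alg k) (h : hom C D) (h' : hom D E) (a : hom TT D) (a' : hom TT E) :
  mcomp (lamq h a) (lamq h' a') = lamq (hcomp h' h) (gmul a' (hcomp h' a)).
Proof.
apply: (cart_uniq (m := kapC C)); first by rewrite mor_base_comp !lamq_base.
by rewrite mcompA !lamq_P -mcompA lamq_P mcompA -Fm_comp Oz_mor_comp.
Qed.

Lemma gel_lamq1 (C D : alg k) (h : hom C D) : gel (lamq h (gone _ D)) = gone G D.
Proof.
have [tC [t1 t2 t3]] := kapC_P C; have [tD [s1 s2 s3]] := kapC_P D.
have e : mcomp tC (lamq h (gone _ D)) = tD.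
  apply: (cart_uniq (m := kap)).
    by rewrite mor_base_comp lamq_base t1 s1; exact: kin_uniq.
  rewrite mcompA -t3 -mcompA lamq_P mcompA -Fm_comp Oz_mor_comp gmul1 gone_nat.
  by rewrite (_ : hcomp h (kin C) = kin D) //; exact: kin_uniq.
by rewrite -s2 -e gel_comp lamq_base t2 gone_nat gmul_r1.
Qed.

Lemma gel_lamq (C D : alg k) (h : hom C D) (a : hom TT D) : gel (lamq h a) = lam a.
Proof.
have <- : mcomp (lamq h (gone _ D)) (lamq (hid D) a) = lamq h a.
  by rewrite lamq_comp hcomp1f gone_nat gmul_r1.
by rewrite gel_comp lamq_base gel_lamq1 gone_nat gmul_r1.
Qed.

Lemma lam_fix (C : alg k) (a : hom TT C) : aH C (lam a) (zC C) = zC C.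
Proof. by have := gelP (lamq (hid C) a); rewrite lamq_base kmap_id => e; exact/esym/e. Qed.

Lemma lamM (C : alg k) (a a' : hom TT C) : lam (gmul a a') = gmul (lam a) (lam a').
Proof.
have e : mcomp (lamq (hid C) a') (lamq (hid C) a) = lamq (hid C) (gmul a a').
  by rewrite lamq_comp !hcomp1f.
by rewrite /lam -e gel_comp lamq_base hcomp1f.
Qed.

Lemma lam_nat (C D : alg k) (h : hom C D) (a : hom TT C) : hcomp h (lam a) = lam (hcomp h a).
Proof.
have e : mcomp (lamq (hid C) a) (lamq h (gone _ D)) = lamq h (hcomp h a).
  by rewrite lamq_comp hcompf1 gmul1.
by rewrite -(gel_lamq h) -e gel_comp lamq_base gel_lamq1 gmul1.
Qed.

End Cocharacter.

Lemma qm_fun_eq (k : comPzRingType) (G : grp k) (X : kfun k) (aX : gaction G X)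
    (C D : alg k) (y1 y2 : X C) (y1' y2' : X D)
    (m1 : @mor _ (quot_stack aX) C D (triv_ob aX y1') (triv_ob aX y1))
    (m2 : @mor _ (quot_stack aX) C D (triv_ob aX y2') (triv_ob aX y2)) :
  mor_base m1 = mor_base m2 -> gel m1 = gel m2 -> qm_fun m1 = qm_fun m2.
Proof.
move=> eb eg; rewrite -[qm_fun m1]hcomp1f -[qm_fun m2]hcomp1f.
by rewrite [hid _]tens_split !qm_funE eb eg.
Qed.

(** * Factorization of the degenerate map through BT *)

Section DegenerateTriv.
Variables (k : fieldType) (M : zmodType) (P : set M).
Variables (G : grp k) (H : kfun k) (aH : gaction G H).
Local Notation Th := (quot_stack (torus_act k P)).
Local Notation N := (quot_stack aH).
Local Notation MS := (Map_stack Th N).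
Local Notation one := (quot_point (torus_act k P) (@torus_one_nat k _ P)).
Local Notation TT := (gring (torus k M)).
Local Notation U := (Spec (mon_alg k P)).

(* The degenerate map [F0 = F(0 . -)] factors through [BT]: it is trivialized
   on trivial torsors, and [lam] gives its action on morphisms. *)
Record degenerate (F0 : ob MS (self_alg k)) (z : H (self_alg k))
  (lam : forall C : alg k, hom TT C -> hom (gring G) C) := Degenerate {
  deg_triv : forall (C : alg k) (y : U C),
    @mor _ N C C (triv_ob aH (zC z C)) (Fk F0 (triv_ob (torus_act k P) y));
  deg_base : forall C (y : U C), mor_base (deg_triv y) = hid C;
  deg_mor : forall (C D : alg k) (y : U C) (y' : U D)
    (m : @mor _ Th C D (triv_ob _ y') (triv_ob _ y)),
    exists q : @mor _ N C D (triv_ob aH (zC z D)) (triv_ob aH (zC z C)),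
    [/\ mor_base q = mor_base m, gel q = lam D (gel m) &
        mcomp (deg_triv y) q = mcomp (Fm F0 m) (deg_triv y')];
  deg_nat : forall (C D : alg k) (h : hom C D) a, hcomp h (lam C a) = lam D (hcomp h a);
  degM : forall (C : alg k) a a', lam C (gmul a a') = gmul (lam C a) (lam C a');
  deg_fix : forall (C : alg k) a, aH C (lam C a) (zC z C) = zC z C
}.

Variables (b : M -> int).
Hypothesis bD : forall m n, b (m + n) = b m + b n.
Hypothesis bP : forall m, P m -> 0 <= b m.
Hypothesis b_pointed : forall m, P m -> b m = 0 -> m = 0.
Local Notation upow := (upow bD bP).
Variable F : ob MS (self_alg k).
Let zero : U (self_alg k) := upow (0 : self_alg k).
Let F0 := mul_map F (hid _) zero.

Section Iota.
Variables (C : alg k) (y : U C).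
Let zz : hom (mon_alg k P) C := hcomp (kin C) zero.

Lemma iotaE : umul y zz = (upow (0 : C) : U C).
Proof. by rewrite /zz upow_nat rmorph0 umul_upow0. Qed.

(** The fixed point absorbs y ([umul_upow0]), so the rescaled object has the same torsor and the
    same map to U_tau as the origin. *)
Lemma iota_ex : exists m : @mor _ Th C C (mul_ob (triv_ob (torus_act k P) y) zz) (Oz bD bP C),
  mor_base m = hid C /\ qm_fun m = hid _.
Proof.
have em : kmap (hid (tors_ring (Oz bD bP C))) (tors_map (Oz bD bP C)) = 
  tors_map (mul_ob (triv_ob (torus_act k P) y) zz).
  rewrite kmap_id.
  apply: etrans (esym (umul_act (tensr C (gring (torus k M)))
    (hcomp (tensl C (gring (torus k M))) y) (hcomp (tensl C (gring (torus k M))) zz))).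
  rewrite -umul_nat iotaE.
  by [].
set x := mul_ob _ zz in em *; set x' := Oz _ _ _ in em *.
have [m1 m2 m3] : [/\ hcomp (hid (tors_ring x)) (tors_proj x') = hcomp (tors_proj x) (hid C),
   forall D (g : hom (gring (torus k M)) D) (r : hom (tors_ring x) D),
   hcomp (tors_act x D g r) (hid (tors_ring x)) = tors_act x' D g (hcomp r (hid _)) &
   forall D (r : hom (tors_ring x') D) (a : hom C D),
    hcomp r (tors_proj x') = hcomp a (hid C) ->
    exists! p' : hom (tors_ring x) D, hcomp p' (hid _) = r /\ hcomp p' (tors_proj x) = a].
  split; first by rewrite hcomp1f hcompf1.
    by move=> D g r; rewrite !hcompf1.
  move=> D r a; rewrite hcompf1 => er; exists r; split; first by rewrite hcompf1.
  by move=> p' [<- _]; rewrite hcompf1.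
by exists (@QuotMor k _ _ _ C C x x' (hid C) (hid (tors_ring x)) m1 m2 m3 em).
Qed.

Definition iota : @mor _ Th C C (mul_ob (triv_ob (torus_act k P) y) zz) (Oz bD bP C) :=
  projT1 (cid iota_ex).
Lemma iota_base : mor_base iota = hid C. Proof. by rewrite /iota; case: cid => m []. Qed.
Lemma iota_fun : qm_fun iota = hid _. Proof. by rewrite /iota; case: cid => m []. Qed.

Lemma Fiota_e : hcomp (kin C) (hid (self_alg k)) = hcomp (mor_base iota) (kin C).
Proof. exact: kin_uniq. Qed.

Definition Fiota : mor (Fk F0 (triv_ob (torus_act k P) y)) (Fk F (Oz bD bP C)) :=
  fmor F (pmor Fiota_e).
Lemma Fiota_base : mor_base Fiota = hid C.
Proof. by rewrite -iota_base; exact: (fover F (pmor Fiota_e)). Qed.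
End Iota.

Lemma Fiota_nat (C D : alg k) (y : U C) (y' : U D)
    (m : @mor _ Th C D (triv_ob _ y') (triv_ob _ y)) :
  mcomp (Fiota y) (Fm F0 m) = mcomp (Fm F (Oz_mor bD bP b_pointed (mor_base m) (gel m))) (Fiota y').
Proof.
rewrite /Fiota -[Fm F0 m]/(fmor F _) /Fm -!(fmor_comp F); congr (fmor F _).
apply: eq_exist; apply: quot_mor_ext.
  rewrite -[LHS]/(hcomp (mor_base m) (mor_base (iota y))).
  rewrite -[RHS]/(hcomp (mor_base (iota y')) (mor_base (Oz_mor bD bP b_pointed (mor_base m) (gel m)))).
  by rewrite !iota_base Oz_mor_base hcomp1f hcompf1.
rewrite -[LHS]/(hcomp (qm_fun m) (qm_fun (iota y))).
rewrite -[RHS]/(hcomp (qm_fun (iota y')) (qm_fun (Oz_mor bD bP b_pointed (mor_base m) (gel m)))).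
rewrite !iota_fun hcompf1 hcomp1f.
apply: (@qm_fun_eq k (torus k M) U (torus_act k P) C D y (upow (0 : C)) y' (upow (0 : D)) m
  (Oz_mor bD bP b_pointed (mor_base m) (gel m))).
  by rewrite Oz_mor_base.
by rewrite Oz_mor_gel.
Qed.

Lemma degenerate_ex (z : H (self_alg k)) 
    (m0 : @mor _ N _ _ (triv_ob aH z) (F0 _ (one _ tt, hid (self_alg k)))) :
  mor_base m0 = hid _ -> exists lam, inhabited (degenerate F0 z lam).
Proof.
move=> em0; have ehid : hid (self_alg k) = kin (self_alg k) by exact: kin_uniq.
have [m1 em1] : exists m1 : @mor _ N _ _ (triv_ob aH z) (Fk F0 (one (self_alg k) tt)), mor_base m1 = hid _.
  by rewrite /Fk -ehid; exists m0.
pose kap : @mor _ N _ _ (triv_ob aH z) (Fk F (Oz bD bP (self_alg k))) := 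
   mcomp (Fiota (torus_one P (self_alg k))) m1.
have ekap : mor_base kap = hid _ by rewrite mor_base_comp Fiota_base em1 hcomp1f.
exists (lam b_pointed ekap).
have ex (C : alg k) (y : U C) : exists m : @mor _ N C C (triv_ob aH (zC z C)) 
    (Fk F0 (triv_ob (torus_act k P) y)), mor_base m = hid C /\ 
    mcomp (Fiota y) m = kapC b_pointed ekap C.
  by apply: quot_cart; rewrite kapC_base Fiota_base hcomp1f.
pose d C y := projT1 (cid (ex C y)).
have d1 C y : mor_base (d C y) = hid C by rewrite /d; case: cid => m [].
have d2 C y : mcomp (Fiota y) (d C y) = kapC b_pointed ekap C by rewrite /d; case: cid => m [].
split; apply: (@Degenerate F0 z _ d d1).
- move=> C D y y' m; exists (lamq b_pointed ekap (mor_base m) (gel m)).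
  split; [exact: lamq_base | exact: gel_lamq |].
  apply: (cart_uniq (m := Fiota y)).
    by rewrite !mor_base_comp lamq_base d1 hcompf1 d1 Fm_base hcomp1f.
  by rewrite !mcompA d2 lamq_P Fiota_nat -[RHS]mcompA d2.
- by move=> C D h a; exact: lam_nat.
- by move=> C a a'; exact: lamM.
- by move=> C a; exact: lam_fix.
Qed.

End DegenerateTriv.

Section DegLam.
Variables (k : fieldType) (M : zmodType) (P : set M).
Variables (G : grp k) (H : kfun k) (aH : gaction G H).
Variables (F0 : ob (Map_stack (quot_stack (torus_act k P)) (quot_stack aH)) (self_alg k))
  (z : H (self_alg k)) (lam : forall C : alg k, hom (gring (torus k M)) C -> hom (gring G) C).
Hypothesis dg : degenerate F0 z lam.

Lemma deg_lam1 (C : alg k) : lam (gone _ C) = gone G C.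
Proof.
have e : gmul (lam (gone _ C)) (lam (gone (torus k M) C)) = lam (gone _ C).
  by rewrite -(degM dg) gmul1.
by apply: (@gmul_cancel _ _ _ (lam (gone _ C))); rewrite e gmul_r1.
Qed.

Lemma deg_lamV (C : alg k) a : lam (ginv a) = ginv (lam a : hom (gring G) C).
Proof. by apply: ginv_uniq; rewrite -(degM dg) gmulV deg_lam1. Qed.
End DegLam.

(** * Tangent vectors of the stratum *)

Section DualNumbers.
Variable k : comPzRingType.

(* [B[e]], [e^2 = 0] *)
Definition dual (B : alg k) : alg k := @sqz k B (self_alg B).
Definition dpr (B : alg k) : hom (dual B) B := sqz_pr (self_alg B).
Definition din (B : alg k) : hom B (dual B) := sqz_inh (self_alg B).
Definition dmap (B B' : alg k) (f : hom B B') : hom (dual B) (dual B') :=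
  @sqz_map k B B' (self_alg B) (self_alg B') f f (rmorphD f) (rmorphM f).

Lemma dpr_din B : hcomp (dpr B) (din B) = hid B.
Proof. exact: hom_ext. Qed.
Lemma dpr_dmap (B B' : alg k) (f : hom B B') : hcomp (dpr B') (dmap f) = hcomp f (dpr B).
Proof. exact: hom_ext. Qed.
Lemma dmap_comp (B B' B'' : alg k) (g : hom B' B'') (f : hom B B') :
  hcomp (dmap g) (dmap f) = dmap (hcomp g f).
Proof. exact: hom_ext. Qed.
Lemma dmap_din (B B' : alg k) (f : hom B B') : hcomp (dmap f) (din B) = hcomp (din B') f.
Proof. by apply: hom_ext => x; apply: sqz_ext; rewrite //= rmorph0. Qed.
End DualNumbers.

Lemma base_comp (k : comPzRingType) (X : aff_cat k) (A A' A'' : alg k) (x'' : ob X A'')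
    (x' : ob X A') (x : ob X A) (f : mor x' x) (g : mor x'' x') a c :
  mor_base f = a -> mor_base g = c -> mor_base (mcomp f g) = hcomp c a.
Proof. by move=> <- <-; exact: mor_base_comp. Qed.

Lemma reduction_diagram (k : fieldType) (G : grp k) (X : kfun k) (aX : gaction G X)
    (A k0 : alg k) (a0 F1 Q0 : ob (quot_stack aX) k0) (Q zt : ob (quot_stack aX) A)
    (m : mor Q zt) (m0 : mor zt Q) (e0 : mor Q0 Q) (tau : mor a0 zt) (m' : mor Q0 a0)
    (kap : mor a0 F1) (m1 : mor F1 a0) (h : mor F1 Q0) (pr : hom A k0) :
  mor_base m0 = hid A -> mor_base e0 = pr -> mor_base tau = pr ->
  mor_base kap = hid k0 -> mor_base h = hid k0 ->
  mcomp m m0 = idm zt -> mcomp tau m' = mcomp m e0 -> mcomp m1 kap = idm a0 ->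
  mcomp m' h = m1 -> mcomp (mcomp e0 h) kap = mcomp m0 tau.
Proof.
move=> b0 be bt bk bh mm0 mm' m1k mh; apply: (cart_uniq (m := m)).
  by rewrite !mor_base_comp b0 be bt bk bh !hcomp1f hcompf1.
by rewrite !mcompA mm0 mcomp1m -mm' -(mcompA tau) mh -mcompA m1k mcompm1.
Qed.

Section Tangent.
Variables (k : closedFieldType) (M : zmodType) (P : set M).
Variables (G : grp k) (H : kfun k) (aH : gaction G H).
Local Notation Th := (quot_stack (torus_act k P)).
Local Notation N := (quot_stack aH).
Local Notation MS := (Map_stack Th N).
Local Notation one := (quot_point (torus_act k P) (@torus_one_nat k _ P)).
Local Notation TT := (gring (torus k M)).
Local Notation U := (Spec (mon_alg k P)).
Local Notation k0 := (self_alg k).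
Local Notation tac := (torus_act k P).
Variable S : stack_space MS -> Prop.
Hypothesis cE : closed_embedding (str_ev S).
Variables (F0 : ob MS k0) (z : H k0) (lam : forall C : alg k, hom TT C -> hom (gring G) C).
Hypothesis dg : degenerate F0 z lam.
Hypothesis hF0 : forall (p : fpoint MS) (f : mor (fp_ob p) F0), S (pt_class p).

(* [F0] is the restriction to [e = 0] of any family in the stratum
   evaluating to a deformation of [z]. *)
Lemma reduction (A : alg k) (pr : hom A k0) (zeta : H A) :
  kmap pr zeta = zC z k0 -> zplus S zeta ->
  exists (Psi : ob MS A) (m0 : @mor _ N A A (triv_ob aH zeta) (Psi A (one A tt, hid A)))
    (sg : map_mor F0 Psi) (tau : @mor _ N A k0 (triv_ob aH (zC z k0)) (triv_ob aH zeta)),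
    [/\ mor_base m0 = hid A, nt_base sg = pr, mor_base tau = pr, gel tau = gone G k0 &
      mcomp (ev_mor one sg) (deg_triv dg (torus_one P k0) : 
          @mor _ N _ _ (triv_ob aH (zC z k0)) (F0 _ (one k0 tt, hid k0))) = mcomp m0 tau].
Proof.
move=> ez [[Psi hPsi] [m em]].
have {}em : mor_base m = hid A by exact: em.
have [m0 [em0 mm0]] : exists m0 : @mor _ N A A (triv_ob aH zeta) (Psi A (one A tt, hid A)),
    mor_base m0 = hid A /\ mcomp m m0 = idm (triv_ob aH zeta : ob N A).
  by apply: quot_cart; rewrite mor_base_id em hcomp1f.
pose Psi0 := mul_map Psi pr (torus_one P k0).
have epr : pr = hcomp pr (hid A) by rewrite hcompf1.
have eto : torus_one P k0 = hcomp pr (torus_one P A).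
  by rewrite -[RHS]/(kmap pr (torus_one P A)) torus_one_nat.
pose e0 : @mor _ MS A k0 Psi0 Psi := mcomp (mul_map_one Psi) (mul_map_mor epr eto Psi).
have ee0 : mor_base e0 = pr by rewrite mor_base_comp hcompf1.
have hPsi0 (p : fpoint MS) (f : mor (fp_ob p) Psi0) : S (pt_class p).
  exact: hPsi (mcomp e0 f).
pose sF0 : ob (substack S) k0 := exist _ F0 hF0.
pose sPsi0 : ob (substack S) k0 := exist _ Psi0 hPsi0.
pose eve0 : @mor _ N A k0 (Psi0 k0 (one k0 tt, hid k0)) (Psi A (one A tt, hid A)) :=
  fmor (ev N one) e0.
have eeve0 : mor_base eve0 = pr by rewrite -ee0; exact: (fover (ev N one) e0).
have [tau [etau gtau]] : exists tau : @mor _ N A k0 (triv_ob aH (zC z k0)) (triv_ob aH zeta),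
   mor_base tau = pr /\ gel tau = gone G k0.
  by apply: triv_mor_ex; rewrite act1.
have [m' [em' mm']] : exists m' : @mor _ N k0 k0 (Psi0 k0 (one k0 tt, hid k0)) (triv_ob aH (zC z k0)),
   mor_base m' = hid k0 /\ mcomp tau m' = mcomp m eve0.
  by apply: quot_cart; rewrite mor_base_comp em eeve0 etau hcompf1 hcomp1f.
pose kap0 : @mor _ N _ _ (triv_ob aH (zC z k0)) (F0 _ (one k0 tt, hid k0)) :=
  deg_triv dg (torus_one P k0).
have ekap0 : mor_base kap0 = hid k0 by exact: deg_base.
have [m1 [em1 mm1]] : exists m1 : @mor _ N k0 k0 (F0 _ (one k0 tt, hid k0)) (triv_ob aH (zC z k0)),
   mor_base m1 = hid k0 /\ mcomp kap0 m1 = idm _.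
  by apply: quot_cart; rewrite mor_base_id ekap0 hcomp1f.
have m1k : mcomp m1 kap0 = idm _.
  apply: (cart_uniq (m := kap0)); first by rewrite mor_base_comp mor_base_id ekap0 em1 hcomp1f.
  by rewrite mcompA mm1 mcomp1m mcompm1.
have [I HI] := cE (triv_ob aH (zC z k0)).
(* [F0] and the restriction of [Psi] are two objects of the stratum over the same point z; that
   evaluation is a closed embedding gives the isomorphism between them. *)
have [h [[eh mh] _]] := (HI k0 (hid k0)).2 sF0 sPsi0 m1 m' em1 em'.
pose sg : @mor _ MS A k0 F0 Psi := mcomp e0 (h : @mor _ MS k0 k0 F0 Psi0).
exists Psi, m0, sg, tau; split=> //.
  rewrite -[LHS]/(mor_base sg) /sg mor_base_comp ee0.
  by rewrite (_ : mor_base _ = hid k0) ?hcomp1f //; exact: eh.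
pose evh : @mor _ N k0 k0 (F0 _ (one k0 tt, hid k0)) (Psi0 k0 (one k0 tt, hid k0)) :=
  fmor (ev N one) (h : @mor _ MS k0 k0 F0 Psi0).
have eevh : mor_base evh = hid k0.
  exact: etrans (fover (ev N one) (h : @mor _ MS k0 k0 F0 Psi0)) eh.
have -> : ev_mor one sg = mcomp eve0 evh.
  exact: (fmor_comp (ev N one) e0 (h : @mor _ MS k0 k0 F0 Psi0)).
have mh' : mcomp m' evh = m1 by exact: mh.
exact: reduction_diagram em0 eeve0 etau ekap0 eevh mm0 mm' m1k mh'.
Qed.
End Tangent.

(* The torsor comparisons behind [tangent_extends], with all evaluations of
   the families abstracted. *)
Lemma tangent_diagram (k : fieldType) (G : grp k) (X : kfun k) (aX : gaction G X)
    (k0 ke A1 K1 B K : alg k) (jK : hom ke K1) (ge : hom A1 K1) (pr1 : hom A1 B)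
    (sec : hom B A1) (prK : hom K1 K) (gen : hom B K) (pr : hom ke k0) (kk : hom k0 K)
    (zt : X ke) (zB : X B) (zK : X K) (z0 : X k0) (u0 : X A1)
    (Q : ob (quot_stack aX) ke) (W1 : ob (quot_stack aX) A1) (QK : ob (quot_stack aX) K1)
    (FX : ob (quot_stack aX) B) (FK : ob (quot_stack aX) K) (F1 : ob (quot_stack aX) k0)
    (m0 : mor (triv_ob aX zt : ob (quot_stack aX) ke) Q) (a : mor QK W1) (c : mor QK Q)
    (rho : mor FX W1) (s : mor FK QK) (fx : mor FK FX) (f1 : mor FK F1) (es : mor F1 Q)
    (kX : mor (triv_ob aX zB : ob (quot_stack aX) B) FX)
    (kK : mor (triv_ob aX zK : ob (quot_stack aX) K) FK)
    (k1 : mor (triv_ob aX z0 : ob (quot_stack aX) k0) F1)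
    (tau : @mor _ (quot_stack aX) _ _ (triv_ob aX z0) (triv_ob aX zt))
    (q5 : @mor _ (quot_stack aX) _ _ (triv_ob aX zK) (triv_ob aX zB))
    (q3 : @mor _ (quot_stack aX) _ _ (triv_ob aX zK) (triv_ob aX z0))
    (mu : mor (triv_ob aX u0 : ob (quot_stack aX) A1) W1) :
  hcomp pr1 sec = hid B ->
  mor_base m0 = hid ke -> mor_base a = ge -> mor_base c = jK -> mor_base rho = pr1 ->
  mor_base s = prK -> mor_base tau = pr ->
  mor_base q5 = gen -> mor_base q3 = kk -> mor_base kX = hid B -> mor_base kK = hid K ->
  mor_base mu = hid A1 ->
  mcomp a s = mcomp rho fx -> mcomp c s = mcomp es f1 -> mcomp es k1 = mcomp m0 tau ->
  mcomp kX q5 = mcomp fx kK -> mcomp k1 q3 = mcomp f1 kK ->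
  gel q3 = gone G K -> gel tau = gone G k0 ->
  exists (u1 : X A1) (Gam : hom (gring G) K1),
    [/\ hcomp prK Gam = ginv (gel q5), aX _ Gam (kmap jK zt) = kmap ge u1 & kmap pr1 u1 = zB].
Proof.
move=> esec bm0 ba bc brho bs btau bq5 bq3 bkX bkK bmu Eas Ecs Eesk EkX Ek1 gq3 gtau.
have bfx : mor_base fx = gen.
  by have := congr1 (fun w => mor_base w) EkX; rewrite !mor_base_comp bkX bkK bq5 hcompf1 hcomp1f.
have egen : hcomp prK ge = hcomp gen pr1.
  by have := congr1 (fun w => mor_base w) Eas; rewrite !mor_base_comp ba bs brho bfx.
have [q [bq muq _]] := compare rho bmu bkX.
rewrite brho in bq.
pose gt := hcomp sec (gel q).
have [am [bam gam]] := triv_act_mor aX u0 gt.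
have [u1 [mu1 [bmu1 [q1 [bq1 gq1 muq1]]]]] : exists (u1 : X A1)
    (mu1 : mor (triv_ob aX u1 : ob (quot_stack aX) A1) W1), mor_base mu1 = hid A1 /\
    exists q1 : @mor _ (quot_stack aX) _ _ (triv_ob aX zB) (triv_ob aX u1),
     [/\ mor_base q1 = pr1, gel q1 = gone G B & mcomp mu1 q1 = mcomp rho kX].
  exists (aX _ gt u0), (mcomp mu am); split; first by rewrite mor_base_comp bmu bam hcomp1f.
  have [|q1 [bq1 amq1]] := @quot_cart _ _ _ _ _ _ _ _ _ _ am q pr1.
    by rewrite bq bam hcompf1.
  exists q1; split=> //; last by rewrite -mcompA amq1.
  have := congr1 (fun w => gel w) amq1; rewrite gel_comp bq1 gam /gt hcompA esec hcomp1f => e.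
  by rewrite -[gel q1]gmul_r1 -(gmul_rV (gel q)) gmulA e.
have [pK [bpK [t [bt gt1 Et]]]] : exists pK : mor (triv_ob aX (kmap jK zt) : ob (quot_stack aX) K1) QK,
    mor_base pK = hid K1 /\ exists t : @mor _ (quot_stack aX) _ _ (triv_ob aX (kmap jK zt)) (triv_ob aX zt),
      [/\ mor_base t = jK, gel t = gone G K1 & mcomp c pK = mcomp m0 t].
  have := pull_triv c bm0; rewrite bc => -[pK [bpK [t [bt gt1 Et]]]].
  by exists pK; split=> //; exists t.
have [w [bw Ew ew]] := compare a bmu1 bpK.
rewrite ba in bw ew.
have [v [bv Ev _]] := compare s bpK bkK.
rewrite bs in bv.
have gv : gel v = gone G K.
  have e : mcomp tau q3 = mcomp t v.
    apply: (cart_uniq (m := m0)).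
      have := congr1 (fun w => mor_base w) Ecs; rewrite !mor_base_comp bc bs bt bv btau bq3 => ->.
      have := congr1 (fun w => mor_base w) Eesk; rewrite !mor_base_comp bm0 btau hcompf1.
      have := congr1 (fun w => mor_base w) Ek1; rewrite !mor_base_comp bkK bq3 hcomp1f => <- <-.
      by rewrite hcompA.
    by rewrite !mcompA -Eesk -Et -(mcompA es) Ek1 -(mcompA c) Ev !mcompA Ecs.
  have := congr1 (fun w => gel w) e; rewrite !gel_comp gq3 gtau gt1 !gone_nat !gmul_r1.
  by move=> <-.
have E : mcomp w v = mcomp q1 q5.
  apply: (cart_uniq (m := mu1)); first by rewrite !mor_base_comp bw bv bq1 bq5.
  by rewrite !mcompA Ew muq1 -!mcompA Ev EkX !mcompA Eas.
have Eg := congr1 (fun w => gel w) E.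
rewrite !gel_comp gv bv gmul1 gq1 gone_nat gmul_r1 in Eg.
exists u1, (ginv (gel w)); split.
- by rewrite ginv_nat Eg.
- by apply/esym/act_flip; rewrite -ew.
- by have := gelP q1; rewrite gq1 act1 bq1 => ->.
Qed.

Arguments nt_at {k X M A A' F' F} _ {C} x {a' a} e.
Arguments nt_over {k X M A A' F' F} _ {C} x {a' a} e.
Arguments nt_nat {k X M A A' F' F} _ {C C' x' x f a1' a2' a1 a2} e1 e2 e' e.

Section TangentExtends.
Variables (k : closedFieldType) (M : zmodType) (P : set M).
Variables (G : grp k) (H : kfun k) (aH : gaction G H).
Local Notation Th := (quot_stack (torus_act k P)).
Local Notation N := (quot_stack aH).
Local Notation MS := (Map_stack Th N).
Local Notation one := (quot_point (torus_act k P) (@torus_one_nat k _ P)).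
Local Notation TT := (gring (torus k M)).
Local Notation k0 := (self_alg k).
Local Notation tac := (torus_act k P).
Variable S : stack_space MS -> Prop.
Hypothesis cE : closed_embedding (str_ev S).
Variables (F0 : ob MS k0) (z : H k0) (lam : forall C : alg k, hom TT C -> hom (gring G) C).
Hypothesis dg : degenerate F0 z lam.
Hypothesis hF0 : forall (p : fpoint MS) (f : mor (fp_ob p) F0), S (pt_class p).
Variables (b : M -> int).
Hypothesis bD : forall m n, b (m + n) = b m + b n.
Hypothesis bP : forall m, P m -> 0 <= b m.

Lemma nt_square (A : alg k) (Psi : ob MS A) (sg : map_mor F0 Psi)
    (C C1 D D1 : alg k) (a : hom A D) (a1 : hom A D1)
    (Y : ob Th C) (Y1 : ob Th C1) (X : ob Th D) (X1 : ob Th D1)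
    (r : mor Y X) (r1 : mor Y1 X1) (n : mor Y1 Y) (n1 : mor X1 X) 
    (e0 : hcomp (mor_base r) a = hcomp (kin C) (nt_base sg))
    (e1 : hcomp (mor_base r1) a1 = hcomp (kin C1) (nt_base sg))
    (e2 : a1 = hcomp (mor_base n1) a) :
  mcomp r n = mcomp n1 r1 ->
  mcomp (fmor Psi (pmor e2)) (mcomp (fmor Psi (pmor (erefl (hcomp (mor_base r1) a1)))) (nt_at sg Y1 e1))
  = mcomp (mcomp (fmor Psi (pmor (erefl (hcomp (mor_base r) a)))) (nt_at sg Y e0)) (Fm F0 n).
Proof.
move=> E.
have e3 : hcomp (mor_base r1) a1 = hcomp (mor_base (mcomp n1 r1)) a.
  by rewrite mor_base_comp -hcompA -e2.
have e4 : hcomp (mor_base r1) a1 = hcomp (mor_base n) (hcomp (mor_base r) a).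
  by rewrite e3 -E mor_base_comp hcompA.
rewrite mcompA (fmor_pmor_comp Psi e2 (erefl _) e3 erefl) -mcompA.
rewrite -(nt_nat sg e1 e0 (Fm_e n) e4) mcompA; congr (mcomp _ _).
by rewrite (fmor_pmor_comp Psi (erefl _) e4 e3 E).
Qed.

Lemma nt_fmor_irr (A C D : alg k) (Psi : ob MS A) (sg : map_mor F0 Psi)
    (a : hom A D) (Y : ob Th C) (X : ob Th D) (r : mor Y X) (a' : hom k0 C) (a1 a2 : hom A C)
    (e1 : a1 = hcomp (mor_base r) a) (f1 : a1 = hcomp a' (nt_base sg))
    (e2 : a2 = hcomp (mor_base r) a) (f2 : a2 = hcomp a' (nt_base sg)) :
  mcomp (fmor Psi (pmor e1)) (nt_at sg Y f1) = mcomp (fmor Psi (pmor e2)) (nt_at sg Y f2).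
Proof.
have E : a1 = a2 by rewrite e1 e2.
by case: _ / E e2 f2 => e2 f2; rewrite (Prop_irrelevance e1 e2) (Prop_irrelevance f1 f2).
Qed.

Lemma ev_mor_at (A : alg k) (pr : hom A k0) (Psi : ob MS A) (sg : map_mor F0 Psi)
    (r := @fmor _ _ _ one A k0 tt tt pr : @mor _ Th A k0 (one k0 tt) (one A tt))
    (e : hcomp (mor_base r) (hid A) = hcomp (kin k0) (nt_base sg)) : nt_base sg = pr ->
  mcomp (fmor Psi (pmor (erefl (hcomp (mor_base r) (hid A))))) (nt_at sg (one k0 tt) e) =
  ev_mor one sg.
Proof.
move=> ep; rewrite {}/r in e *; case: _ / ep e => e.
exact: (@nt_fmor_irr A k0 A Psi sg (hid A) (one k0 tt) (one A tt)
  (@fmor _ _ _ one A k0 tt tt (nt_base sg)) (kin k0) _ _ _ _ (ev_subproof _ _) (ev_subproof2 _)).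
Qed.

(** [zeta] is the value at the identity of a family over Theta_tau x Spec k[e], which can be
    evaluated on the arc x = t^b including t = 0. Modulo e the family is the degenerate map,
    constant along the arc up to lam(t^b). Hence lam(t^b) zeta, corrected by an infinitesimal
    element of G over k((t)), has no pole. Here b is any functional nonnegative on P, for example a
    single ray. *)
Lemma tangent_extends (zeta : H (dual k0)) :
  kmap (dpr k0) zeta = zC z k0 -> zplus S zeta ->
  exists (u1 : H (dual (pser k))) (Gam : hom (gring G) (dual (laurent k))),
    [/\ hcomp (dpr _) Gam = lam (tpow bD (loc_invP (fps_t k))),
      aH _ Gam (kmap (dmap (kin (laurent k))) zeta) = kmap (dmap (generic_point k)) u1 &
      kmap (dpr _) u1 = zC z (pser k)].
Proof.
move=> ez hz.
have [Psi [m0 [sg [tau [em0 esg etau gtau Esg]]]]] := reduction cE dg hF0 ez hz.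
pose j := dmap (kin (pser k)); pose jK := dmap (kin (laurent k)).
pose ge := dmap (generic_point k).
have hw : dpr (pser k) (din (pser k) (fps_t k)) = fps_t k by [].
pose X1 : ob Th (dual (pser k)) := triv_ob tac (upow bD bP (din (pser k) (fps_t k))).
pose X0 : ob Th (pser k) := triv_ob tac (upow bD bP (fps_t k : pser k)).
pose oneK1 : ob Th (dual (laurent k)) := one (dual (laurent k)) tt.
pose oneK : ob Th (laurent k) := one (laurent k) tt.
pose oneE : ob Th (dual k0) := one (dual k0) tt.
pose one0 : ob Th k0 := one k0 tt.
have [u0 [mu bmu]] := henselian_triv (Psi _ (X1, j)) (@henselian_sqz k (pser k) (self_alg (pser k)) (@henselian_pser k)).
pose tp := tpow bD (loc_invP (fps_t k)).
have [r1 [br1 gr1]] : exists r1 : @mor _ Th _ _ X0 X1, mor_base r1 = dpr (pser k) /\ gel r1 = gone _ _.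
  apply: triv_mor_ex; rewrite act1 -[kmap _ _]/(hcomp (dpr (pser k)) (upow _ _ _)) upow_nat.
  by rewrite hw.
have [n1' [bn1' gn1']] : exists n1' : @mor _ Th _ _ oneK X0, mor_base n1' = generic_point k /\
   gel n1' = ginv tp.
  apply: triv_mor_ex; rewrite -[kmap _ _]/(hcomp (generic_point k) (upow _ _ _)) upow_nat.
  by rewrite -(tpow_one bD bP (loc_invP (fps_t k))) -actM gmulV act1.
have [n1 [bn1 gn1]] : exists n1 : @mor _ Th _ _ oneK1 X1, mor_base n1 = ge /\
   gel n1 = hcomp (din (laurent k)) (ginv tp).
  apply: triv_mor_ex.
  have -> : kmap ge (upow bD bP (din (pser k) (fps_t k)) : Spec _ _) =
     kmap (din (laurent k)) (kmap (generic_point k) (upow bD bP (fps_t k : pser k) : Spec _ _)).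
    rewrite -[LHS]/(hcomp ge (upow _ _ _)) upow_nat -kmap_comp -dmap_din.
    by rewrite -[RHS]/(hcomp (hcomp ge (din (pser k))) (upow _ _ _)) upow_nat.
  rewrite -act_nat -[kmap (generic_point k) _]/(hcomp (generic_point k) (upow _ _ _)) upow_nat.
  rewrite -(tpow_one bD bP (loc_invP (fps_t k))) -actM gmulV act1.
  exact: torus_one_nat.
have [r2 [br2 gr2]] : exists r2 : @mor _ Th _ _ oneK oneK1, mor_base r2 = dpr (laurent k) /\ gel r2 = gone _ _.
  by apply: triv_mor_ex; rewrite act1; exact: torus_one_nat.
have [n2 [bn2 gn2]] : exists n2 : @mor _ Th _ _ oneK1 oneE, mor_base n2 = jK /\ gel n2 = gone _ _.
  by apply: triv_mor_ex; rewrite act1; exact: torus_one_nat.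
have [n3 [bn3 gn3]] : exists n3 : @mor _ Th _ _ oneK one0, mor_base n3 = kin (laurent k) /\ gel n3 = gone _ _.
  by apply: triv_mor_ex; rewrite act1; exact: torus_one_nat.
pose r3 : @mor _ Th _ _ one0 oneE := @fmor _ _ _ one (dual k0) k0 tt tt (dpr k0).
have br3 : mor_base r3 = dpr k0 by [].
have gr3 : gel r3 = gone _ k0.
  by rewrite /gel /r3 /= tens_liftr /tunit tens_liftr.
have e0X : hcomp (mor_base r1) j = hcomp (kin (pser k)) (nt_base sg).
  by rewrite br1 esg; exact: dpr_dmap.
have e0K : hcomp (mor_base r2) jK = hcomp (kin (laurent k)) (nt_base sg).
  by rewrite br2 esg; exact: dpr_dmap.
have e01 : hcomp (mor_base r3) (hid (dual k0)) = hcomp (kin k0) (nt_base sg).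
  by rewrite br3 hcompf1 esg hcomp1f.
have en1 : jK = hcomp (mor_base n1) j by rewrite bn1 dmap_comp; congr dmap; exact: kin_uniq.
have en2 : jK = hcomp (mor_base n2) (hid _) by rewrite bn2 hcompf1.
have E1 : mcomp r1 n1' = mcomp n1 r2.
  apply: triv_mor_ext; first by rewrite !mor_base_comp br1 bn1' bn1 br2 dpr_dmap.
  rewrite !gel_comp gr1 gn1' gn1 gr2 br2 gone_nat gmul_r1 gmul1 hcompA dpr_din hcomp1f.
  by [].
have E3 : mcomp r3 n3 = mcomp n2 r2.
  apply: triv_mor_ext; first by rewrite !mor_base_comp br3 bn3 bn2 br2 dpr_dmap.
  by rewrite !gel_comp gr3 gn3 gn2 gr2 !gone_nat !gmul_r1.
have S1 := nt_square e0X e0K en1 E1.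
have S3 := nt_square e01 e0K en2 E3.
have [q5 [bq5 gq5 Eq5]] := deg_mor dg n1'.
have [q3 [bq3 gq3 Eq3]] := deg_mor dg n3.
have Esg' : mcomp (mcomp (fmor Psi (pmor (erefl (hcomp (mor_base r3) (hid (dual k0)))))) (nt_at sg one0 e01))
    (deg_triv dg (torus_one P k0)) = mcomp m0 tau.
  by rewrite -Esg -(ev_mor_at e01 esg).
have [||||||||u1 [Gam [h1 h2 h3]]] := tangent_diagram (jK := jK) (ge := ge) (pr1 := dpr (pser k)) (sec := din (pser k)) (prK := dpr (laurent k))
  (gen := generic_point k) (kk := kin (laurent k)) _ em0 _ _ _ _ etau _ _ (deg_base dg _) (deg_base dg _) bmu S1 S3 Esg' Eq5 Eq3 _ gtau.
- exact: dpr_din.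
- exact: etrans (fover Psi (pmor en1)) bn1.
- exact: etrans (fover Psi (pmor en2)) bn2.
- apply: etrans (base_comp (etrans (fover Psi (pmor (erefl _))) br1) (nt_over sg X0 e0X)) _.
  by rewrite hcomp1f.
- apply: etrans (base_comp (etrans (fover Psi (pmor (erefl _))) br2) (nt_over sg oneK e0K)) _.
  by rewrite hcomp1f.
- by rewrite bq5.
- by rewrite bq3.
- by rewrite gq3 gn3 (deg_lam1 dg).
exists u1, Gam; split=> //.
by rewrite h1 gq5 gn1' (deg_lamV dg) ginvK.
Qed.
End TangentExtends.

(** * Gluing along étale covers *)

Lemma dep_choice (I : Type) (T : I -> Type) (Q : forall i, T i -> Prop) :
  (forall i, exists x, Q i x) -> exists f : forall i, T i, forall i, Q i (f i).
Proof. by move=> h; exists (fun i => projT1 (cid (h i))) => i; case: cid. Qed.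

Section EtaleK.
Variables (k : fieldType) (C : alg k) (A' : alg C).
Hypothesis cA : etale_cover A'.
Local Notation A1 := (restr A').
Local Notation str := (restr_str A').

(** This lemma and the next ones restate purity and descent for k-algebras with a given map from C,
    the form in which points of torsors and of H occur. *)
Lemma pure_k (D : alg k) (g : hom C D) : exists (D1 : alg k) (j : hom D D1)
  (s : hom A1 D1), injective j /\ hcomp s str = hcomp j g.
Proof.
have [D1 [j [ij [s]]]] := etale_pure cA (along g).
have jk c : j (alg_str D c) = alg_str (restr D1) c.
  by rewrite -(homE g) -[g _]/(alg_str (along g) (alg_str C c)) homE.
exists (restr D1), (@hom_of k D (restr D1) j (rmorphD j) (rmorphM j) jk), (rh s).
split=> //; apply: hom_ext => c.
by rewrite -[LHS]/(s (alg_str A' c)) -[RHS]/(j (alg_str (along g) c)) !homE.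
Qed.

Lemma effective_k (B R : alg k) (g : hom C B) (r : hom B R) :
  (forall D (d : hom B D) (s : hom A1 D), hcomp s str = hcomp d g ->
     exists b : hom R D, hcomp b r = d) ->
  forall y : R, (forall D (a b : hom R D), hcomp a r = hcomp b r -> a y = b y) ->
  exists x, r x = y.
Proof.
move=> split_r y hy; pose Bc : alg C := along g; pose Rc : alg C := along (hcomp r g).
have rk c : r (alg_str Bc c) = alg_str Rc c by [].
pose rc := @hom_of C Bc Rc r (rmorphD r) (rmorphM r) rk.
have toK (D : alg C) (E : alg k) (gE : hom C E) (u : hom (along gE) D) c :
    u (alg_str E c) = alg_str (restr D) c.
  by rewrite -(homE gE) -[gE _]/(alg_str (along gE) (alg_str C c)) homE.
have [|D a b eab|x ex] := etale_effective cA (i := rc) (y := y).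
- move=> D d [s].
  pose dk := @hom_of k B (restr D) d (rmorphD d) (rmorphM d) (@toK D B g d).
  have [|b eb] := split_r (restr D) dk (rh s).
    apply: hom_ext => c.
    by rewrite -[LHS]/(s (alg_str A' c)) -[RHS]/(d (alg_str Bc c)) !homE.
  have bk c : b (alg_str Rc c) = alg_str D c.
    rewrite -[alg_str Rc c]/(r (g c)) -[LHS]/(hcomp b r (g c)) eb.
    by rewrite -[LHS]/(d (alg_str Bc c)) homE.
  exists (@hom_of C Rc D b (rmorphD b) (rmorphM b) bk); apply: hom_ext => x.
  exact: (congr1 (fun h : hom B (restr D) => h x) eb).
- pose ak := @hom_of k R (restr D) a (rmorphD a) (rmorphM a) (@toK D R (hcomp r g) a).
  pose bk := @hom_of k R (restr D) b (rmorphD b) (rmorphM b) (@toK D R (hcomp r g) b).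
  apply: (hy (restr D) ak bk); apply: hom_ext => x.
  exact: (congr1 (fun h : hom Bc D => h x) eab).
- by exists x.
Qed.

Lemma surj_k (K : alg k) (g : hom C K) : is_field K -> exists (L : alg k)
  (j : hom K L) (s : hom A1 L), is_field L /\ hcomp s str = hcomp j g.
Proof.
move=> fK; have [L [fL [j] [s]]] := cA.2 (along g) fK.
have jk c : j (alg_str K c) = alg_str (restr L) c.
  by rewrite -(homE g) -[g _]/(alg_str (along g) (alg_str C c)) homE.
exists (restr L), (@hom_of k K (restr L) j (rmorphD j) (rmorphM j) jk), (rh s).
split=> //; apply: hom_ext => c.
by rewrite -[LHS]/(s (alg_str A' c)) -[RHS]/(j (alg_str (along g) c)) !homE.
Qed.

Lemma base_change_k (D : alg k) (g : hom C D) : exists (R : alg k) (r : hom D R) (s : hom A1 R),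
  hcomp s str = hcomp r g /\ forall E (d : hom D E) (t : hom A1 E), hcomp t str = hcomp d g ->
     exists b : hom R E, hcomp b r = d.
Proof.
pose Dc : alg C := along g; pose Rc : alg C := tensor Dc A'; pose R : alg k := restr Rc.
have rk c : tensl Dc A' (alg_str D c) = alg_str R c.
  by rewrite -(homE g) -[g _]/(alg_str Dc (alg_str C c)) homE.
pose r := @hom_of k D R (tensl Dc A') (rmorphD _) (rmorphM _) rk.
exists R, r, (rh (tensr Dc A')); split.
  apply: hom_ext => c.
  by rewrite -[LHS]/(tensr Dc A' (alg_str A' c)) -[RHS]/(tensl Dc A' (alg_str Dc c)) !homE.
move=> E d t et; pose Ec : alg C := along (hcomp d g).
have dk c : d (alg_str Dc c) = alg_str Ec c by [].
have tk c : t (alg_str A' c) = alg_str Ec c by exact: (congr1 (fun h : hom C E => h c) et).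
pose dc := @hom_of C Dc Ec d (rmorphD d) (rmorphM d) dk.
pose tc := @hom_of C A' Ec t (rmorphD t) (rmorphM t) tk.
pose l := tens_lift dc tc.
have lk c : l (alg_str R c) = alg_str E c.
  rewrite -[alg_str R c]/(alg_str Rc (alg_str C c)) homE -[LHS]/(d (g (alg_str C c))) !homE.
  by [].
exists (@hom_of k R E l (rmorphD l) (rmorphM l) lk); apply: hom_ext => x.
exact: (congr1 (fun h : hom Dc Ec => h x) (tens_liftl dc tc)).
Qed.

End EtaleK.

(* a family of elements not vanishing simultaneously at any field point
   generates the unit ideal *)
Lemma unit_ideal (k : comPzRingType) (A : alg k) (E : set A) :
  (forall (K : alg k) (f : hom A K), is_field K -> exists e, E e /\ f e != 0) ->
  exists n (e c : 'I_n -> A), (forall i, E (e i)) /\ \sum_(i < n) c i * e i = 1.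
Proof.
move=> h; pose I : set A := [set a | exists n (e c : 'I_n -> A),
  (forall i, E (e i)) /\ \sum_(i < n) c i * e i = a].
have hI : is_ideal I.
  split.
  - by exists 0%N, (fun i => 0), (fun i => 0); split=> [[]|]; rewrite ?big_ord0.
  - move=> x y [n [e [c [he <-]]]] [n' [e' [c' [he' <-]]]].
    pose mk T (u : 'I_n -> T) (v : 'I_n' -> T) (i : 'I_(n + n')) :=
      match fintype.split i with inl j => u j | inr j => v j end.
    exists (n + n')%N, (mk _ e e'), (mk _ c c'); split.
      by move=> i; rewrite /mk; case: fintype.split.
    rewrite big_split_ord /=; congr (_ + _); apply: eq_bigr => i _; rewrite /mk.
      by rewrite (unsplitK (inl i)).
    by rewrite (unsplitK (inr i)).
  - move=> x y [n [e [c [he <-]]]]; exists n, e, (fun i => x * c i); split=> //.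
    by rewrite mulr_sumr; apply: eq_bigr => i _; rewrite mulrA.
apply: contrapT => hn; have n1 : ~ I 1 by move=> [n [e [c H1]]]; apply: hn; exists n, e, c.
have [K [f [fK hf]]] := quot_field hI n1.
have [e [Ee /eqP]] := h K f fK; apply; apply: hf.
by exists 1%N, (fun=> e), (fun=> 1); split=> //; rewrite big_ord1 mul1r.
Qed.

Section Descent.
Variables (k : fieldType) (C : alg k) (A' : alg C).
Hypothesis cA : etale_cover A'.
Local Notation A1 := (restr A').
Local Notation str := (restr_str A').
Variables (H : kfun k).
Hypothesis H_ft : scheme_of_finite_type H.

(** Less rigid than being the base change of the cover: over every B-algebra with a point of the
    cover, the structure map factors through [r]. The torsor of a trivialization over the cover is
    of this kind. *)
Definition etale_split (B R : alg k) (g : hom C B) (r : hom B R) :=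
  forall D (d : hom B D) (s : hom A1 D), hcomp s str = hcomp d g ->
    exists b : hom R D, hcomp b r = d.

Lemma field_nz (K : alg k) (n : nat) (e c : 'I_n -> K) :
  is_field K -> \sum_(i < n) c i * e i = 1 -> exists i, e i != 0.
Proof.
move=> [K1 _] s1; apply: contrapT => h; case/eqP: K1; rewrite -s1 big1 // => i _.
have -> : e i = 0 by apply/eqP; apply: contraT => h'; case: h; exists i.
by rewrite mulr0.
Qed.

Lemma in_chart_at (U A : alg k) (u : H U) (x : H A) (E : set A) (e : A) (D : alg k)
    (f : hom A D) (v : D) : 
  (forall (D : alg k) (f : hom A D), (exists g : hom U D, kmap g u = kmap f x) <->
    (exists n (e : 'I_n -> A) (c : 'I_n -> D),
       (forall i, E (e i)) /\ \sum_(i < n) c i * f (e i) = 1)) ->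
  E e -> v * f e = 1 -> in_chart u (kmap f x).
Proof.
move=> HE Ee ev; apply/HE; exists 1%N, (fun=> e), (fun=> v); split=> //.
by rewrite big_ord1.
Qed.

(** At a field point both points agree after a field extension, so they lie in a common chart, and
    they do so on a principal open set. There they are compared in coordinates, after an injective
    base change that factors through [r]. *)
Lemma etale_sep (B R : alg k) (g : hom C B) (r : hom B R) (x y : H B) :
  etale_split g r -> kmap r x = kmap r y -> x = y.
Proof.
move=> sp exy; have [sh [n [Bs [u [hu cov]]]]] := H_ft.
have /choice [Ex HEx] i := (hu i).2.2 B x; have /choice [Ey HEy] i := (hu i).2.2 B y.
pose E : set B := [set e | exists i e1 e2, [/\ Ex i e1, Ey i e2 & e = e1 * e2]].
have [K f fK|m [e [c [Ee ce]]]] := @unit_ideal k B E.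
  have [L [j [s [fL es]]]] := surj_k cA (hcomp f g) fK.
  have [b eb] := sp L (hcomp j f) s (etrans es (hcompA _ _ _)).
  have [i [w ew]] := cov K (kmap f x) fK.
  have [w' ew'] : in_chart (u i) (kmap f y).
    apply: (in_chart_inj (hu i).2 (f := j) fK fL.1).
    have -> : kmap j (kmap f y) = kmap j (kmap f x) by rewrite -!kmap_comp -eb !kmap_comp exy.
    by exists (hcomp j w); rewrite kmap_comp ew.
  have [n1 [e1 [c1 [h1 s1]]]] := (HEx i K f).1 (ex_intro _ w ew).
  have [n2 [e2 [c2 [h2 s2]]]] := (HEy i K f).1 (ex_intro _ w' ew').
  have [i1 f1] := field_nz fK s1; have [i2 f2] := field_nz fK s2.
  exists (e1 i1 * e2 i2); split; first by exists i, (e1 i1), (e2 i2).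
  rewrite rmorphM; apply/eqP => e0; case/eqP: f2.
  have [v ev] := fK.2 _ f1.
  by rewrite -[f (e2 i2)]mul1r -ev mulrAC e0 mul0r.
have loc_eq l : kmap (loc_map (e l)) x = kmap (loc_map (e l)) y.
  have [i [e1 [e2 [h1 h2 h12]]]] := Ee l; set f := loc_map (e l).
  have inv : f (e1 * e2) * loc_inv (e l) = 1 by rewrite -h12; exact: loc_invP.
  have [w1 ew1] : in_chart (u i) (kmap f x).
    apply: (in_chart_at (v := f e2 * loc_inv (e l)) (HEx i) h1).
    by rewrite mulrAC -rmorphM [e2 * _]mulrC.
  have [w2 ew2] : in_chart (u i) (kmap f y).
    apply: (in_chart_at (v := f e1 * loc_inv (e l)) (HEy i) h2).
    by rewrite mulrAC -rmorphM.
  have [D1 [j [s [ij es]]]] := pure_k cA (hcomp f g).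
  have [b eb] := sp D1 (hcomp j f) s (etrans es (hcompA _ _ _)).
  rewrite -ew2; apply: (chart_descend (hu i).2 ij); first by exists w1.
  by rewrite ew2 -!kmap_comp -eb !kmap_comp exy.
have [|i j D a b eab|h [_ hu']] := sh B m e (fun l => loc (e l)) (fun l => loc_map (e l)) _ (fun l => loc_is_localization (e l)) (fun l => kmap (loc_map (e l)) x).
- by exists c.
- by rewrite -!kmap_comp eab.
- by rewrite -(hu' x) // -(hu' y).
Qed.

(** The reference point [h0] replaces the openness of étale maps: it provides principal open sets of
    Spec B over which y lies in a chart. There the coordinates of y descend by [effective_k], and
    [etale_sep] makes the results agree on overlaps. *)
Lemma etale_glue (B R : alg k) (g : hom C B) (r : hom B R) (h0 : H B) (y : H R) :
  etale_split g r ->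
  (forall D (a b : hom R D), hcomp a r = hcomp b r -> kmap a y = kmap b y) ->
  (forall (U : alg k) (u : H U) e, open_immersion u ->
     in_chart u (kmap (loc_map e) h0) -> in_chart u (kmap (loc_map (r e)) y)) ->
  exists h, kmap r h = y.
Proof.
move=> sp hy near; have [sh [n [Bs [u [hu cov]]]]] := H_ft.
have /choice [E0 HE0] i := (hu i).2.2 B h0.
pose E : set B := [set e | exists i, E0 i e].
have [K f fK|m [e [c [/choice [i Ee] ce]]]] := @unit_ideal k B E.
  have [i [w ew]] := cov K (kmap f h0) fK.
  have [n1 [e1 [c1 [h1 s1]]]] := (HE0 i K f).1 (ex_intro _ w ew).
  by have [i1 f1] := field_nz fK s1; exists (e1 i1); split=> //; exists i.
have ch l : in_chart (u (i l)) (kmap (loc_map (r (e l))) y).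
  apply: near; first exact: (hu _).2.
  apply: (in_chart_at (v := loc_inv (e l)) (HE0 (i l)) (Ee l)).
  by rewrite mulrC loc_invP.
have /dep_choice [q qE] : forall l, exists q : hom (loc (e l)) (loc (r (e l))),
    hcomp q (loc_map (e l)) = hcomp (loc_map (r (e l))) r.
  move=> l; by exists (loc_lift (loc_invP (r (e l)) : hcomp (loc_map (r (e l))) r (e l) * _ = 1)); exact: loc_liftE.
have ext l D (d : hom (loc (e l)) D) (p : hom R D) : hcomp p r = hcomp d (loc_map (e l)) ->
    exists p' : hom (loc (r (e l))) D, hcomp p' (loc_map (r (e l))) = p /\ hcomp p' (q l) = d.
  move=> epd; have inv : p (r (e l)) * d (loc_inv (e l)) = 1.
    have -> : p (r (e l)) = d (loc_map (e l) (e l)).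
      exact: (congr1 (fun f : hom B D => f (e l)) epd).
    by rewrite -rmorphM loc_invP rmorph1.
  exists (loc_lift inv); split; first exact: loc_liftE.
  by apply: loc_ext; rewrite -hcompA qE hcompA loc_liftE.
have spl l : etale_split (hcomp (loc_map (e l)) g) (q l).
  move=> D d s es; have [b eb] := sp D (hcomp d (loc_map (e l))) s (etrans es (hcompA _ _ _)).
  by have [p' [_ ep']] := ext l D d b eb; exists p'.
have qinj l : injective (q l).
  have [D1 [j [s [ij es]]]] := pure_k cA (hcomp (loc_map (e l)) g).
  have [b eb] := spl l D1 j s es.
  by move=> a1 a2 ea; apply: ij; rewrite -eb !hcompE ea.
have /dep_choice [h hE] : forall l, exists h : H (loc (e l)), in_chart (u (i l)) h /\
   kmap (q l) h = kmap (loc_map (r (e l))) y.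
  move=> l; have [w ew] := ch l.
  have [v|w' ew'] := @hom_factor k (Bs (i l)) (loc (e l)) _ (q l) w (@qinj l).
    apply: (effective_k cA (spl l)) => D a b eab.
    have eab' : hcomp (hcomp a (loc_map (r (e l)))) r = hcomp (hcomp b (loc_map (r (e l)))) r.
      by rewrite -!hcompA -qE !hcompA eab.
    have E1 : hcomp a w = hcomp b w; last exact: (congr1 (fun f : hom _ _ => f v) E1).
    by apply: (chart_inj (hu (i l)).2); rewrite !kmap_comp ew -!kmap_comp; exact: hy eab'.
  by exists (kmap w' (u (i l))); split; [exists w' | rewrite -kmap_comp ew'].
have star l D (d : hom (loc (e l)) D) (p : hom R D) : hcomp p r = hcomp d (loc_map (e l)) ->
    kmap d (h l) = kmap p y.
  move=> epd; have [p' [e1 e2]] := ext l D d p epd.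
  by rewrite -e2 kmap_comp (hE l).2 -kmap_comp e1.
have [|l l' D a b eab|hh [hh1 _]] := sh B m e (fun l => loc (e l)) (fun l => loc_map (e l)) _ (fun l => loc_is_localization (e l)) h.
- by exists c.
- have [R' [r' [s' [es' sp']]]] := base_change_k A' (hcomp (hcomp a (loc_map (e l))) g).
  apply: (etale_sep (g := hcomp (hcomp a (loc_map (e l))) g) (r := r') sp').
  have [p ep] := sp R' (hcomp r' (hcomp a (loc_map (e l)))) s' (etrans es' (hcompA _ _ _)).
  rewrite -!kmap_comp (star l R' (hcomp r' a) p) ?ep -?hcompA //.
  by rewrite (star l' R' (hcomp r' b) p) ?ep -?hcompA ?eab.
exists hh.
have [|l l' D a b eab|h' [_ hu']] := sh R m (fun l => r (e l)) (fun l => loc (r (e l))) (fun l => loc_map (r (e l)))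
   _ (fun l => loc_is_localization (r (e l))) (fun l => kmap (loc_map (r (e l))) y).
- exists (fun l => r (c l)); rewrite -(rmorph1 r) -ce rmorph_sum; apply: eq_bigr => l _.
  by rewrite rmorphM.
- by rewrite -!kmap_comp eab.
- rewrite -(hu' y) // -(hu' (kmap r hh)) // => l.
  by rewrite -kmap_comp -qE kmap_comp hh1 (hE l).2.
Qed.
End Descent.

Lemma qm_fun_id (k : comPzRingType) (G : grp k) (X : kfun k) (aX : gaction G X)
    (C : alg k) (y y' : X C) (m : @mor _ (quot_stack aX) C C (triv_ob aX y') (triv_ob aX y)) :
  mor_base m = hid C -> gel m = gone G C -> qm_fun m = hid (tensor C (gring G)).
Proof.
move=> eb eg; rewrite -[qm_fun m]hcomp1f [in LHS](tens_split (hid _)) qm_funE eb eg.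
by rewrite gone_nat gmul_r1 hcompf1 -tens_split.
Qed.

Lemma qm_funM (k : comPzRingType) (G : grp k) (X : kfun k) (aX : gaction G X)
    (A A' A'' : alg k) (x : quot_ob aX A) (x' : quot_ob aX A') (x'' : quot_ob aX A'')
    (f : @mor _ (quot_stack aX) A A' x' x) (g : @mor _ (quot_stack aX) A' A'' x'' x') :
  @qm_fun k G X aX A A'' x'' x (@mcomp k (quot_stack aX) A A' A'' x'' x' x f g) =
  hcomp (qm_fun g) (qm_fun f).
Proof. by []. Qed.

Lemma principal_quot (k : comPzRingType) (R : alg k) (t : R) : exists (Q : alg k) (p : hom R Q),
  [/\ forall y, exists x, p x = y, forall x, p x = 1 -> exists y, x - 1 = t * y & p t = 0].
Proof.
have hI : is_ideal [set x : R | exists y, x = t * y].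
  split; first by exists 0; rewrite mulr0.
    by move=> _ _ [x ->] [y ->]; exists (x + y); rewrite mulrDr.
  by move=> x _ [y ->]; exists (x * y); rewrite mulrCA.
exists (quot hI), (qpi hI); split.
- by move=> y; exists (qrepr y); exact: qreprK.
- by move=> x ex; apply: (qpiP hI x 1).1.
- have : qpi hI t = qpi hI 0 by apply/(qpiP hI); exists 1; rewrite subr0 mulr1.
  by rewrite rmorph0.
Qed.

Lemma unipotent_unit (R : comPzRingType) (t x y : R) n : t ^+ n = 0 -> x - 1 = t * y ->
  exists b, x * b = 1.
Proof.
move=> tn ey; have ny : (- (t * y)) ^+ n = 0 by rewrite exprNn exprMn tn mul0r mulr0.
exists (\sum_(i < n) (- (t * y)) ^+ i).
have -> : x = 1 - (- (t * y)) by rewrite opprK -ey addrC subrK.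
by rewrite -[LHS]opprK -mulNr opprB -subrX1 ny sub0r opprK.
Qed.

(** * Extension of the degenerate map over an infinitesimal thickening *)

Section Extension.
Variables (k : closedFieldType) (M : zmodType) (P : set M).
Variables (G : grp k) (H : kfun k) (aH : gaction G H).
Local Notation Th := (quot_stack (torus_act k P)).
Local Notation N := (quot_stack aH).
Local Notation MS := (Map_stack Th N).
Local Notation one := (quot_point (torus_act k P) (@torus_one_nat k _ P)).
Local Notation TT := (gring (torus k M)).
Local Notation GG := (gring G).
Local Notation U := (Spec (mon_alg k P)).
Local Notation k0 := (self_alg k).
Local Notation tac := (torus_act k P).
Hypothesis H_ft : scheme_of_finite_type H.
Variables (F0 : ob MS k0) (z : H k0) (lam : forall C : alg k, hom TT C -> hom GG C).
Hypothesis dg : degenerate F0 z lam.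

Section Points.
Variables (C : alg k) (X : ob Th C).

Definition mpt (D : alg k) (s : hom (tors_ring X) D) :
  @mor _ Th C D (triv_ob tac (kmap s (tors_map X))) X := projT1 (cid (tors_point s)).
Lemma mpt_base D (s : hom (tors_ring X) D) : mor_base (mpt s) = hcomp s (tors_proj X).
Proof. by rewrite /mpt; case: cid => m []. Qed.
Lemma mptE D (s : hom (tors_ring X) D) E (a : hom D E) h :
  hcomp (tens_lift a h) (qm_fun (mpt s)) = tors_act X E h (hcomp a s).
Proof. by rewrite /mpt; case: cid => m []. Qed.

(** The trivialization of F0(X) at a point of the torsor X. Varying the point gives all the local
    trivializations that are used, with transition functions [lam] (see [vpt_key]). *)
Definition vpt (D : alg k) (s : hom (tors_ring X) D) :
  @mor _ N C D (triv_ob aH (zC z D)) (Fk F0 X) :=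
  mcomp (Fm F0 (mpt s)) (deg_triv dg (kmap s (tors_map X))).

Lemma vpt_base D (s : hom (tors_ring X) D) : mor_base (vpt s) = hcomp s (tors_proj X).
Proof. by rewrite /vpt mor_base_comp deg_base hcomp1f Fm_base mpt_base. Qed.

Lemma tors_actN (E F : alg k) (u : hom E F) g (q : hom (tors_ring X) E) :
  hcomp u (tors_act X E g q) = tors_act X F (hcomp u g) (hcomp u q).
Proof. by rewrite -[LHS]/(kmap u (_ : Spec (tors_ring X) E)) act_nat. Qed.

Lemma vpt_comp (D E : alg k) (f : hom D E) (t : hom TT E) (s : hom (tors_ring X) D)
    (s' : hom (tors_ring X) E) : s' = tors_act X E t (hcomp f s) ->
  exists q : @mor _ N D E (triv_ob aH (zC z E)) (triv_ob aH (zC z D)),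
    [/\ mor_base q = f, gel q = lam t & vpt s' = mcomp (vpt s) q].
Proof.
move=> es; have [n [bn gn]] : exists n : @mor _ Th D E (triv_ob tac (kmap s' (tors_map X)))
    (triv_ob tac (kmap s (tors_map X))), mor_base n = f /\ gel n = t.
  by apply: triv_mor_ex; rewrite es tors_equiv kmap_comp.
have em : mpt s' = mcomp (mpt s) n.
  apply: quot_mor_ext.
    rewrite -[LHS]/(mor_base (mpt s')) -[RHS]/(mor_base (mcomp (mpt s) n)).
    by rewrite mor_base_comp !mpt_base bn es tors_inv -hcompA.
  rewrite -[LHS]hcomp1f -[RHS]hcomp1f [hid _](tens_split (hid (tensor E TT))).
  rewrite mptE qm_funM hcompA qm_funE.
  rewrite mptE bn gn es tors_actN actM hcompA.
  by [].
have [q [bq gq eq]] := deg_mor dg n.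
exists q; split; [by rewrite bq | by rewrite gq gn|].
by rewrite /vpt em Fm_comp -!mcompA eq.
Qed.

Lemma vpt_key (D D1 E : alg k) (s : hom (tors_ring X) D) (s1 : hom (tors_ring X) D1)
    (f : hom D E) (f1 : hom D1 E) (t : hom TT E) (g : hom GG E) :
  hcomp f s = tors_act X E t (hcomp f1 s1) ->
  hcomp (tens_lift f g) (qm_fun (vpt s)) =
  hcomp (tens_lift f1 (gmul g (lam t))) (qm_fun (vpt s1)).
Proof.
move=> e; have [q [bq gq eq]] := vpt_comp e.
have [|q' [bq' gq' eq']] := @vpt_comp D E f (gone _ E) s (hcomp f s); first by rewrite act1.
have l1 : hcomp (tens_lift (hid E) g) (qm_fun (vpt (hcomp f s))) =
    hcomp (tens_lift f1 (gmul g (lam t))) (qm_fun (vpt s1)).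
  by rewrite eq qm_funM hcompA qm_funE bq gq !hcomp1f.
by rewrite -l1 eq' qm_funM [RHS]hcompA (qm_funE q') bq' gq' !hcomp1f (deg_lam1 dg) gmul_r1.
Qed.

Lemma vpt_inj (D E : alg k) (s : hom (tors_ring X) D) (p p' : hom (tensor D GG) E) :
  hcomp p (qm_fun (vpt s)) = hcomp p' (qm_fun (vpt s)) ->
  hcomp p (tensl D GG) = hcomp p' (tensl D GG) -> p = p'.
Proof.
move=> e1 e2.
have pr : hcomp (qm_fun (vpt s)) (tors_proj (Fk F0 X)) = hcomp (tensl D GG) (mor_base (vpt s)).
  exact: (qm_proj (vpt s)).
have [|r [_ ru]] := @qm_cart _ _ _ _ _ _ _ _ (vpt s) E (hcomp p (qm_fun (vpt s))) (hcomp p (tensl D GG)).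
  exact: etrans (esym (hcompA _ _ _)) (etrans (congr1 (hcomp p) pr) (hcompA _ _ _)).
by rewrite -(ru p) // -(ru p').
Qed.

Lemma vpt_lift (D E : alg k) (s : hom (tors_ring X) D) (p : hom (tors_ring (Fk F0 X)) E) (a : hom D E) :
  hcomp p (tors_proj (Fk F0 X)) = hcomp a (hcomp s (tors_proj X)) ->
  exists g, hcomp (tens_lift a g) (qm_fun (vpt s)) = p.
Proof.
move=> e; have [|r [[r1 r2] _]] := @qm_cart _ _ _ _ _ _ _ _ (vpt s) E p a.
  by rewrite e -(vpt_base s).
have r2' : hcomp r (tensl D GG) = a by exact: r2.
by exists (hcomp r (tensr D GG)); rewrite -r1 -r2' -tens_split.
Qed.
End Points.

Lemma vpt_mor (C C' : alg k) (X : ob Th C) (X' : ob Th C') (m : mor X' X) (D : alg k)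
    (s : hom (tors_ring X') D) :
  hcomp (qm_fun (vpt s)) (qm_fun (Fm F0 m)) = qm_fun (vpt (hcomp s (qm_fun m))).
Proof.
have [n [bn gn]] : exists n : @mor _ Th D D (triv_ob tac (kmap s (tors_map X')))
    (triv_ob tac (kmap (hcomp s (qm_fun m)) (tors_map X))), mor_base n = hid D /\ gel n = gone _ D.
  by apply: triv_mor_ex; rewrite act1 kmap_id kmap_comp qm_map.
have em : mcomp m (mpt s) = mcomp (mpt (hcomp s (qm_fun m))) n.
  apply: quot_mor_ext.
    have pm : hcomp (qm_fun m) (tors_proj X) = hcomp (tors_proj X') (mor_base m) by exact: (qm_proj m).
    apply: etrans (base_comp (erefl (mor_base m)) (mpt_base s)) _.
    apply: etrans _ (esym (base_comp (mpt_base (hcomp s (qm_fun m))) bn)).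
    by rewrite hcomp1f -[LHS]hcompA -[RHS]hcompA pm.
  rewrite -[LHS]hcomp1f -[RHS]hcomp1f [hid _](tens_split (hid (tensor D TT))).
  rewrite qm_funM hcompA mptE.
  rewrite qm_funM hcompA qm_funE.
  by rewrite mptE bn gn gone_nat gmul_r1 hcompf1 qm_equiv -hcompA.
have [q [bq gq eq]] := deg_mor dg n.
have E : mcomp (Fm F0 m) (vpt s) = mcomp (vpt (hcomp s (qm_fun m))) q.
  by rewrite /vpt mcompA -Fm_comp em Fm_comp -!mcompA eq.
have := congr1 (fun w : quot_mor _ _ => qm_fun w) E.
rewrite -[LHS]/(hcomp (qm_fun (vpt s)) (qm_fun (Fm F0 m))) => ->.
rewrite -[LHS]/(hcomp (qm_fun q) (qm_fun (vpt (hcomp s (qm_fun m))))).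
rewrite qm_fun_id ?hcomp1f //; first by rewrite bq.
by rewrite gq gn (deg_lam1 dg).
Qed.

(* A family [cfam] over [U_tau x Spec A], equivariant for [lam], defines a
   morphism [Theta_tau x Spec A -> [H/G]]. *)
Variables (A : alg k) (h : H A) (tau : A).
Variable cfam : forall D : alg k, hom A D -> hom (mon_alg k P) D -> H D.
Hypothesis cn : forall (D E : alg k) (f : hom D E) al si,
  kmap f (cfam al si) = cfam (hcomp f al) (hcomp f si).
Hypothesis ct : forall (D : alg k) (al : hom A D) si (t : hom TT D),
  cfam al (tac D t si) = aH D (lam t) (cfam al si).
Hypothesis c1 : forall D (al : hom A D), cfam al (torus_one P D) = kmap al h.
Hypothesis c0 : forall D (al : hom A D) si, al tau = 0 -> cfam al si = zC z D.
Variable nn : nat.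
Hypothesis tau_nil : tau ^+ nn = 0.

Section Glue.
Variables (C : alg k) (X : ob Th C) (a : hom A C).
Local Notation x0 := (Fk F0 X).
Local Notation B := (tors_ring (Fk F0 X)).

Definition cpt (D : alg k) (s : hom (tors_ring X) D) : H D :=
  cfam (hcomp (hcomp s (tors_proj X)) a) (kmap s (tors_map X)).

Definition ypt (D : alg k) (s : hom (tors_ring X) D) : H (tensor D GG) :=
  tors_map (triv_ob aH (cpt s)).

Lemma cpt_nat (D E : alg k) (f : hom D E) (s : hom (tors_ring X) D) : kmap f (cpt s) = cpt (hcomp f s).
Proof. by rewrite /cpt cn; congr cfam; [rewrite !hcompA | exact: hcompA]. Qed.

Lemma ypt_key (D D1 E : alg k) (s : hom (tors_ring X) D) (s1 : hom (tors_ring X) D1)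
    (f : hom D E) (f1 : hom D1 E) (t : hom TT E) (g : hom GG E) :
  hcomp f s = tors_act X E t (hcomp f1 s1) ->
  kmap (tens_lift f g) (ypt s) = kmap (tens_lift f1 (gmul g (lam t))) (ypt s1).
Proof.
move=> e; rewrite /ypt !orbitE !cpt_nat e actM; congr (aH _ _ _).
by rewrite /cpt tors_inv tors_equiv ct.
Qed.

(** The extension keeps the torsor of [F0] and changes only its map to H; in the trivialization at
    [s] this map has to be the orbit map of the family. *)
Definition good (hP : H B) := forall (D : alg k) (s : hom (tors_ring X) D),
  kmap (qm_fun (vpt s)) hP = ypt s.

Section Cover.
Variables (A' : alg C) (s0 : hom (tors_ring X) (restr A')).
Hypothesis cA : etale_cover A'.
Hypothesis es0 : hcomp s0 (tors_proj X) = restr_str A'.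
Let r0 : hom B (tensor (restr A') GG) := qm_fun (vpt s0).

Lemma split_r0 : etale_split A' (tors_proj x0) r0.
Proof.
move=> D d s es; have [|g eg] := @vpt_lift C X (restr A') D s0 d s.
  by rewrite es0 es.
by exists (tens_lift s g).
Qed.

Lemma good_uniq (hP hP' : H B) : good hP -> good hP' -> hP = hP'.
Proof.
move=> h1 h2.
apply: (@etale_sep k C A' cA H H_ft B _ (tors_proj x0) r0 hP hP' split_r0).
exact: etrans (h1 _ s0) (esym (h2 _ s0)).
Qed.

(** Equivariance of the family makes the orbit maps agree under changes of trivialization, which is
    the descent condition of [etale_glue]. The reference point is the map of [F0]: tau is nilpotent
    and modulo tau the family is constantly z, so both lie in the same charts. *)
Lemma good_ex : exists hP, good hP.
Proof.
have [D p p' epp|Uc u e hu hc|hP ehP] :=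
  @etale_glue k C A' cA H H_ft B _ (tors_proj x0) r0 (tors_map x0) (ypt s0) split_r0.
- have eb : hcomp (hcomp (hcomp p (tensl _ GG)) s0) (tors_proj X) =
      hcomp (hcomp (hcomp p' (tensl _ GG)) s0) (tors_proj X).
    have pr : hcomp r0 (tors_proj x0) = hcomp (tensl (restr A') GG) (mor_base (vpt s0)).
      exact: (qm_proj (vpt s0)).
    have eqb (w : hom (tensor (restr A') GG) D) : hcomp (hcomp (hcomp w (tensl _ GG)) s0) (tors_proj X) =
        hcomp (hcomp w r0) (tors_proj x0).
      rewrite -[LHS]hcompA -(vpt_base s0) -[LHS]hcompA -pr; exact: hcompA.
    by rewrite !eqb epp.
  have [t [et _]] := tors_unique eb.
  pose g2 := hcomp p' (tensr _ GG).
  have e' : hcomp (hcomp p' (tensl _ GG)) s0 = tors_act X D t (hcomp (hcomp p (tensl _ GG)) s0).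
    by rewrite et.
  have ep' := vpt_key g2 e'; rewrite -(tens_split p') in ep'.
  have -> : p = tens_lift (hcomp p (tensl _ GG)) (gmul g2 (lam t)).
    by apply: (vpt_inj (s := s0)); rewrite ?tens_liftl // -ep' epp.
  by rewrite [in RHS](tens_split p') (ypt_key g2 e').
- pose Rl := loc (r0 e); pose tr : Rl := loc_map (r0 e) (tensl _ GG (hcomp (hcomp s0 (tors_proj X)) a tau)).
  have trn : tr ^+ nn = 0 by rewrite /tr -!rmorphXn tau_nil !rmorph0.
  have [Q [pq [pq1 pq2 pq3]]] := principal_quot tr.
  apply: (in_chart_local (r := pq) hu pq1).
  + by move=> x /pq2 [y ey]; exact: unipotent_unit trn ey.
  + pose Phi := hcomp pq (loc_map (r0 e)).
    have tz : Phi (tensl _ GG (hcomp (hcomp s0 (tors_proj X)) a tau)) = 0 by exact: pq3.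
    have -> : kmap pq (kmap (loc_map (r0 e)) (ypt s0)) = kmap Phi (kmap r0 (tors_map x0)).
      have -> : kmap r0 (tors_map x0) = tors_map (triv_ob aH (zC z (restr A'))).
        exact: (qm_map (vpt s0)).
      rewrite -kmap_comp -/Phi (tens_split Phi) /ypt !orbitE cpt_nat zC_nat.
      by rewrite /cpt c0.
    rewrite -kmap_comp.
    have inv : hcomp Phi r0 e * pq (loc_inv (r0 e)) = 1.
      by rewrite -[hcomp Phi r0 e]/(pq (loc_map (r0 e) (r0 e))) -rmorphM loc_invP rmorph1.
    rewrite -(loc_liftE inv) kmap_comp; exact: in_chart_map.
exists hP => D s.
have [R' [r' [s' [es' sp']]]] := base_change_k A' (hcomp (tensl D GG) (hcomp s (tors_proj X))).
apply: (@etale_sep k C A' cA H H_ft _ R' (hcomp (tensl D GG) (hcomp s (tors_proj X))) r' _ _ sp').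
have eb : hcomp (hcomp s' s0) (tors_proj X) = hcomp (hcomp (hcomp r' (tensl D GG)) s) (tors_proj X).
  by rewrite -hcompA es0 es' !hcompA.
have [t [et _]] := tors_unique eb.
have key1 := vpt_key (hcomp r' (tensr D GG)) (esym et).
have key2 := ypt_key (hcomp r' (tensr D GG)) (esym et).
rewrite -tens_split in key1; rewrite -tens_split in key2.
by rewrite -kmap_comp key1 key2 kmap_comp -/r0 ehP.
Qed.

Lemma good_equiv (hP : H B) : good hP -> forall D (g : hom GG D) (p : hom B D),
  kmap (tors_act x0 D g p) hP = aH D g (kmap p hP).
Proof.
move=> gh D g p.
have [R' [r' [s' [es' sp']]]] := base_change_k A' (hcomp p (tors_proj x0)).
apply: (@etale_sep k C A' cA H H_ft D R' (hcomp p (tors_proj x0)) r' _ _ sp').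
have [|g1 eg1] := @vpt_lift C X (restr A') R' s0 (hcomp r' p) s'.
  by rewrite es0 es' hcompA.
rewrite act_nat -!kmap_comp.
have -> : hcomp r' (tors_act x0 D g p) = tors_act x0 R' (hcomp r' g) (hcomp r' p).
  by rewrite -[LHS]/(kmap r' (_ : Spec (tors_ring x0) D)) act_nat.
have gh0 : kmap r0 hP = ypt s0 by exact: gh.
have e1 : tors_act x0 R' (hcomp r' g) (hcomp (tens_lift s' g1) r0) =
    hcomp (tens_lift s' (gmul (hcomp r' g) g1)) r0.
  have -> : tens_lift s' (gmul (hcomp r' g) g1) = triv_fun (hcomp r' g) (tens_lift s' g1).
    by rewrite /triv_fun tens_liftl tens_liftr.
  exact/esym/(qm_equiv (vpt s0)).
have eg1' : hcomp r' p = hcomp (tens_lift s' g1) r0 by exact/esym/eg1.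
rewrite eg1' e1 (kmap_comp _ r0) (kmap_comp _ r0) gh0 /ypt !orbitE actM.
by [].
Qed.
End Cover.
End Glue.

Lemma good_exists (C : alg k) (X : ob Th C) (a : hom A C) : exists hP, good (X := X) a hP.
Proof. by have [A' [cA [s0 [es0 _]]]] := tors_loc X; exact: good_ex cA es0. Qed.

Lemma good_unique (C : alg k) (X : ob Th C) (a : hom A C) hP hP' :
  good (X := X) a hP -> good a hP' -> hP = hP'.
Proof. by have [A' [cA [s0 [es0 _]]]] := tors_loc X; exact: good_uniq cA es0 hP hP'. Qed.

Lemma good_equivariant (C : alg k) (X : ob Th C) (a : hom A C) hP : good (X := X) a hP ->
  forall D (g : hom GG D) (p : hom (tors_ring (Fk F0 X)) D),
  kmap (tors_act (Fk F0 X) D g p) hP = aH D g (kmap p hP).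
Proof. by have [A' [cA [s0 [es0 _]]]] := tors_loc X; exact: good_equiv cA es0 hP. Qed.

Definition gmap (C : alg k) (X : ob Th C) (a : hom A C) : H (tors_ring (Fk F0 X)) :=
  projT1 (cid (good_exists X a)).
Lemma gmapP (C : alg k) (X : ob Th C) (a : hom A C) : good a (gmap X a).
Proof. by rewrite /gmap; case: cid. Qed.

Definition ext_ob (C : alg k) (x : prod_ob Th A C) : ob N C :=
  let x0 := Fk F0 x.1 in
  @QuotOb k G H aH C (tors_ring x0) (tors_proj x0) (tors_act x0)
    (@tors_inv _ _ _ _ _ x0) (tors_loc x0) (gmap x.1 x.2) (good_equivariant (@gmapP C x.1 x.2)).

Lemma ext_map (C C' : alg k) (X : ob Th C) (X' : ob Th C') (m : mor X' X)
    (a : hom A C) (a' : hom A C') : a' = hcomp (mor_base m) a ->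
  kmap (qm_fun (Fm F0 m)) (gmap X a) = gmap X' a'.
Proof.
move=> ea; apply: (@good_unique C' X' a') (@gmapP C' X' a') => D s.
rewrite -kmap_comp.
have -> : hcomp (qm_fun (vpt s)) (qm_fun (Fm F0 m)) = qm_fun (vpt (hcomp s (qm_fun m))).
  exact: vpt_mor.
have := @gmapP C X a D (hcomp s (qm_fun m)); rewrite /ypt => ->.
congr (tors_map (triv_ob aH _)).
have pm : hcomp (qm_fun m) (tors_proj X) = hcomp (tors_proj X') (mor_base m) by exact: (qm_proj m).
rewrite /cpt; congr cfam; first by rewrite ea -(hcompA s) pm !hcompA.
by rewrite kmap_comp qm_map.
Qed.

Definition ext_mor (C C' : alg k) (x : prod_ob Th A C) (x' : prod_ob Th A C')
    (f : prod_mor x' x) : mor (ext_ob x') (ext_ob x) :=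
  let m := Fm F0 (sval f) in
  @QuotMor k G H aH C C' (ext_ob x') (ext_ob x) (qm_base m) (qm_fun m) (qm_proj m)
   (@qm_equiv _ _ _ _ _ _ _ _ m) (@qm_cart _ _ _ _ _ _ _ _ m) (ext_map (svalP f)).

Lemma ext_mor_base (C C' : alg k) (x : prod_ob Th A C) (x' : prod_ob Th A C')
    (f : prod_mor x' x) : mor_base (ext_mor f) = mor_base (sval f).
Proof. exact: (Fm_base F0 (sval f)). Qed.

Definition ext_fun : functor (prod_stack Th A) N.
Proof.
refine (@Functor k (prod_stack Th A) N ext_ob (fun A0 A1 x' x f => ext_mor f)
  (fun A0 A1 x' x f => ext_mor_base f) _ _).
- move=> C x; have e := Fm_id F0 x.1.
  apply: quot_mor_ext; first exact: (congr1 (fun w : quot_mor _ _ => qm_base w) e).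
  exact: (congr1 (fun w : quot_mor _ _ => qm_fun w) e).
- move=> C C' C'' x'' x' x f g; have e := Fm_comp F0 (sval f) (sval g).
  apply: quot_mor_ext; first exact: (congr1 (fun w : quot_mor _ _ => qm_base w) e).
  exact: (congr1 (fun w : quot_mor _ _ => qm_fun w) e).
Defined.

Lemma ext_eval : exists m : @mor _ N A A (ext_fun A (one A tt, hid A)) (triv_ob aH h),
  mor_base m = hid A.
Proof.
pose X : ob Th A := one A tt.
pose s : hom (tors_ring X) A := tunit (torus k M) A.
have es : hcomp s (tors_proj X) = hid A by exact: tens_liftl.
have ec : cpt (X := X) (hid A) s = h.
  rewrite /cpt es hcompf1 (_ : kmap s (tors_map X) = (torus_one P A : U A)).
    by rewrite c1 kmap_id.
  by rewrite orbitE act1 kmap_id.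
have bv : qm_base (vpt s) = hid A by rewrite -es; exact: vpt_base.
have em : kmap (qm_fun (vpt s)) (tors_map (ext_ob (X, hid A))) = tors_map (triv_ob aH h).
  by rewrite -ec; exact: (@gmapP A X (hid A) A s).
pose m : @mor _ N A A (triv_ob aH h) (ext_ob (X, hid A)) :=
  @QuotMor k G H aH A A (triv_ob aH h) (ext_ob (X, hid A)) (qm_base (vpt s)) (qm_fun (vpt s))
   (qm_proj (vpt s)) (@qm_equiv _ _ _ _ _ _ _ _ (vpt s)) (@qm_cart _ _ _ _ _ _ _ _ (vpt s)) em.
exact: (quot_inv (m := m) bv).
Qed.

Variable ev0 : hom A k0.
Hypothesis ev0_tau : ev0 tau = 0.

Section Fibre.
Variables (C : alg k) (X : ob Th C) (a' : hom k0 C) (a : hom A C).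
Hypothesis ea : a = hcomp a' ev0.

Lemma fib_map : kmap (hid _) (gmap X a) = tors_map (Fk F0 X).
Proof.
rewrite kmap_id; apply: good_unique (@gmapP C X a) _ => D s.
have -> : kmap (qm_fun (vpt s)) (tors_map (Fk F0 X)) = tors_map (triv_ob aH (zC z D)).
  exact: (qm_map (vpt s)).
rewrite /ypt; congr (tors_map (triv_ob aH _)); rewrite /cpt c0 //.
by rewrite ea !hcompE ev0_tau !rmorph0.
Qed.

Definition fib : @mor _ N C C (Fk F0 X) (ext_ob (X, a)).
Proof.
refine (@QuotMor k G H aH C C (Fk F0 X) (ext_ob (X, a)) (hid C) (hid _) _ _ _ fib_map).
- by rewrite hcomp1f hcompf1.
- by move=> D g q; rewrite !hcompf1.
- move=> D q b; rewrite hcompf1 => e; exists q; split; first by rewrite hcompf1.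
  by move=> p' [<- _]; rewrite hcompf1.
Defined.

Lemma toFk_e : a' = hcomp (mor_base (idm X)) (kin C). Proof. exact: kin_uniq. Qed.
Definition toFk : mor (F0 C (X, a')) (Fk F0 X) := fmor F0 (pmor toFk_e).
Lemma toFk_base : mor_base toFk = hid C.
Proof. by rewrite /toFk fover -[LHS]/(mor_base (idm X)) mor_base_id. Qed.
End Fibre.

Lemma fib_nat (C C' : alg k) (X : ob Th C) (X' : ob Th C') (m : mor X' X)
   (a1' : hom k0 C') (a2' : hom k0 C) (a1 : hom A C') (a2 : hom A C)
   (e1 : a1 = hcomp a1' ev0) (e2 : a2 = hcomp a2' ev0) (e : a1 = hcomp (mor_base m) a2) :
  mcomp (ext_mor (pmor e)) (fib X' e1) = mcomp (fib X e2) (Fm F0 m).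
Proof.
apply: quot_mor_ext.
  rewrite -[LHS]/(hcomp (hid C') (qm_base (Fm F0 m))) -[RHS]/(hcomp (qm_base (Fm F0 m)) (hid C)).
  by rewrite hcomp1f hcompf1.
rewrite -[LHS]/(hcomp (hid _) (qm_fun (Fm F0 m))) -[RHS]/(hcomp (qm_fun (Fm F0 m)) (hid _)).
by rewrite hcomp1f hcompf1.
Qed.

(** Where tau vanishes the family is constantly z, so the extended map on each torsor is that of
    [F0] and the identity of torsors is a morphism. *)
Definition ext_fibre : map_mor F0 (ext_fun : ob MS A).
Proof.
refine (@MapMor k Th N A k0 F0 (ext_fun : ob MS A) ev0
  (fun C x a' a e => mcomp (fib x e) (toFk x a')) _ _).
- move=> C x a' a e.
  have b1 : mor_base (fib x e) = hid C by [].
  by have := base_comp b1 (toFk_base x a'); rewrite hcomp1f.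
- move=> C C' x' x f a1' a2' a1 a2 e1 e2 e' e.
  have E1 : mcomp (ext_mor (pmor e)) (mcomp (fib x' e1) (toFk x' a1')) =
      mcomp (fib x e2) (mcomp (Fm F0 f) (toFk x' a1')).
    by rewrite mcompA (fib_nat (m := f) e1 e2 e) mcompA.
  apply: etrans E1 _; apply: etrans _ (mcompA _ _ _); congr (mcomp _ _).
  have ef : a1' = hcomp (mor_base f) (kin C) by exact: kin_uniq.
  rewrite /Fm /toFk (fmor_pmor_comp F0 (Fm_e f) (toFk_e x' a1') ef) ?mcompm1 //.
  by rewrite (fmor_pmor_comp F0 (toFk_e x a2') e' ef) // mcomp1m.
Defined.

Lemma map_cart (A0 A1 A2 : alg k) (F : ob MS A0) (F1 : ob MS A1) (F2 : ob MS A2)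
    (m1 : map_mor F1 F) (m : map_mor F2 F) (f : hom A1 A2) :
  nt_base m = hcomp f (nt_base m1) -> inhabited (map_mor F2 F1).
Proof.
move=> eb.
have eA (C : alg k) (a' : hom A2 C) (a : hom A1 C) : a = hcomp a' f ->
   hcomp a' (nt_base m) = hcomp a (nt_base m1) by move=> ->; rewrite eb hcompA.
have ex (C : alg k) (x : ob Th C) (a' : hom A2 C) (a : hom A1 C) (e : a = hcomp a' f) :
  exists w : mor (F2 C (x, a')) (F1 C (x, a)), mor_base w = hid C /\
    mcomp (nt_at m1 x (eA C a' a e)) w = nt_at m x (erefl (hcomp a' (nt_base m))).
  by apply: quot_cart; rewrite !nt_over hcomp1f.
pose w C x a' a e := projT1 (cid (ex C x a' a e)).
have w1 C x a' a e : mor_base (w C x a' a e) = hid C by rewrite /w; case: cid => ? [].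
have w2 C x a' a e : mcomp (nt_at m1 x (eA C a' a e)) (w C x a' a e) =
   nt_at m x (erefl (hcomp a' (nt_base m))) by rewrite /w; case: cid => ? [].
split; apply: (@MapMor k Th N A1 A2 F2 F1 f w w1).
move=> C C' x' x g a1' a2' a1 a2 e1 e2 e' e.
have ee : hcomp a1' (nt_base m) = hcomp (mor_base g) (hcomp a2' (nt_base m)).
  by rewrite e' -hcompA.
apply: (cart_uniq (m := nt_at m1 x (eA C a2' a2 e2))).
  rewrite !mor_base_comp !w1 !fover hcomp1f hcompf1.
  by [].
rewrite !mcompA w2 -(nt_nat m1 (eA C' a1' a1 e1) (eA C a2' a2 e2) e ee) -mcompA w2.
exact: (nt_nat m).
Qed.

Hypothesis ev0_ker : forall x, ev0 x = 0 -> exists y, x = tau * y.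
Variable S : stack_space MS -> Prop.
Hypothesis hF0 : forall (p : fpoint MS) (f : mor (fp_ob p) F0), S (pt_class p).

(** A nilpotent vanishes in every field, so each field-valued point of the extension is a point of
    [F0] and lies in S. Evaluation at the identity gives h. *)
Lemma ext_zplus : zplus S h.
Proof.
have hS (p : fpoint MS) (f : mor (fp_ob p) (ext_fun : ob MS A)) : S (pt_class p).
  have [K1 Kinv] := fp_field p.
  have f0 : nt_base f tau = 0.
    have : nt_base f tau ^+ nn = 0 by rewrite -rmorphXn tau_nil rmorph0.
    elim: nn => [|i IH]; first by move/eqP; rewrite expr0 (negbTE K1).
    rewrite exprS => e; case: (eqVneq (nt_base f tau) 0) => // /Kinv [v ev].
    by apply: IH; rewrite -[_ ^+ i]mul1r -ev mulrAC e mul0r.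
  have [] := @map_cart A k0 (fp_ring p) ext_fun F0 (fp_ob p) ext_fibre f (kin (fp_ring p)).
    apply: hom_ext => x; rewrite hcompE -[nt_base ext_fibre]/ev0.
    have [|y ey] := ev0_ker (x := x - alg_str A (ev0 x)).
      by rewrite rmorphB homE subrr.
    have -> : x = alg_str A (ev0 x) + tau * y by rewrite -ey addrC subrK.
    rewrite !rmorphD !rmorphM f0 ev0_tau !mul0r !addr0 !homE.
    by rewrite [X in _ + X * _](rmorph0 (alg_str (fp_ring p))) mul0r addr0.
  by move=> m; exact: hF0 m.
have [m em] := ext_eval.
by exists (exist _ (ext_fun : ob MS A) hS), m.
Qed.

End Extension.

(** * Weights along the torus orbit of a curve *)

Section MonAlgNz.
Variables (R : comNzRingType) (M : nmodType).
Lemma monalg_nz : (1 : monalg R M) != 0.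
Proof.
apply/eqP => /(congr1 (fun f : monalg R M => f 0)); rewrite /= eqxx => /eqP.
by rewrite oner_eq0.
Qed.
HB.instance Definition _ := GRing.PzSemiRing_isNonZero.Build (monalg R M) monalg_nz.
End MonAlgNz.

Section MonAlgFacts.
Variables (R : comPzRingType) (M : zmodType).
Implicit Types f g : monalg R M.

Lemma ma_coefD f g m : (f + g) m = f m + g m. Proof. by []. Qed.
Lemma ma_coefN f m : (- f) m = - f m. Proof. by []. Qed.
Lemma ma_coef_sum (I : Type) (s : seq I) (F : I -> monalg R M) m :
  (\sum_(i <- s) F i) m = \sum_(i <- s) F i m.
Proof. by elim: s => [|i s IH]; rewrite ?big_nil // !big_cons ma_coefD IH. Qed.

Lemma ma_mul_supp f g m : (f * g) m != 0 ->
  exists i j, [/\ f i != 0, g j != 0 & m = i + j].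
Proof.
apply: contraPP => h; apply/negP; rewrite negbK; apply/eqP.
rewrite -[LHS]/(ma_mulf f g m) /ma_mulf; apply: pr0 => i.
case: (eqVneq (f i) 0) => [->|fi].
  by apply: pr0 => j; rewrite mul0r if_same.
apply: pr0 => j; case: eqP => // e; case: (eqVneq (g j) 0) => [->|gj]; first by rewrite mulr0.
by case: h; exists i, j.
Qed.

Lemma ma_supp0 f : (forall m, f m != 0 -> m = 0) -> f = ma_c M (f 0).
Proof.
move=> h; apply: monalg_ext => m /=; case: eqP => [->|m0] //.
by apply/eqP; apply: contraT => /h.
Qed.

Lemma eq_pr_supp (V : nmodType) (F G : M -> R -> V) f :
  (forall m, F m (f m) = G m (f m)) -> pr F f = pr G f.
Proof. by move=> e; apply: eq_bigr => m _; exact: e. Qed.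

End MonAlgFacts.

(** * Power series over R[M] with weights prescribed order by order *)

Section Supports.
Variables (k : fieldType) (M : zmodType).

Definition mnz (R : nzalg k) : nzalg k :=
  @NzAlg k (monalg R M) (ma_c M \o nz_str R).

Definition mst (R : nzalg k) : hom (nza R) (nza (mnz R)) :=
  @Hom k (nza R) (nza (mnz R)) (ma_c M) (fun=> erefl).

Section Twist.
Variables (R R' : nzalg k) (h : hom (nza R) (nza R')) (y : M -> R').
Hypothesis y0 : y 0 = 1.
Hypothesis yD : forall m n, y (m + n) = y m * y n.

Lemma tw_fin (f : monalg R M) : finsup (fun m => h (f m) * y m).
Proof.
exists (supp f) => m; apply: contraNT => hm.
have -> : f m = 0 by apply/eqP; apply: contraNT hm => /suppP.
by rewrite rmorph0 mul0r.
Qed.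

(** Translation of the torus variable by the point y: x^m goes to y^m x^m, along a change of
    coefficients. *)
Definition tw_fun (f : monalg R M) : monalg R' M := MonAlg (tw_fin f).

Lemma tw_sum (f : monalg R M) : tw_fun f = pr (fun m a => ma_d m (h a * y m)) f.
Proof.
apply: monalg_ext => m; rewrite /pr ma_coef_sum /=.
transitivity (\sum_(i <- supp f) (if i == m then h (f i) * y i else 0)).
  rewrite -[RHS]/(pr (fun i a => if i == m then h a * y i else 0) f).
  rewrite (@prE _ _ _ _ _ (m :: [seq i <- supp f | i != m])).
  - rewrite big_cons eqxx big_filter big1_seq ?addr0 // => i /andP [/negbTE -> _].
    by [].
  - by move=> i; rewrite rmorph0 mul0r if_same.
  - by rewrite /= mem_filter eqxx /= filter_uniq // supp_uniq.
  - by move=> i /suppP; rewrite inE mem_filter => ->; case: eqP.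
by apply: eq_bigr => i _; rewrite eq_sym.
Qed.

Lemma twM (f g : monalg R M) : tw_fun (f * g) = tw_fun f * tw_fun g.
Proof.
have F0 m : ma_d m (h 0 * y m) = 0 :> monalg R' M.
  by apply: monalg_ext => i /=; rewrite rmorph0 mul0r if_same.
have FD m a b : ma_d m (h (a + b) * y m) = ma_d m (h a * y m) + ma_d m (h b * y m) :> monalg R' M.
  by rewrite rmorphD mulrDl ma_dD.
rewrite !tw_sum -[f * g]/(ma_mul f g) prM // /pr mulr_suml.
apply: eq_bigr => i _; rewrite mulr_sumr; apply: eq_bigr => j _.
by rewrite ma_dM rmorphM yD mulrACA.
Qed.

Lemma twDf (f g : monalg R M) : tw_fun (f + g) = tw_fun f + tw_fun g.
Proof. by apply: monalg_ext => m /=; rewrite rmorphD mulrDl. Qed.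

Lemma twk c : tw_fun (alg_str (nza (mnz R)) c) = alg_str (nza (mnz R')) c.
Proof.
apply: monalg_ext => m /=.
case: eqP => [->|]; rewrite ?y0 ?mulr1 ?rmorph0 ?mul0r //; exact: (homE h).
Qed.

Definition tw : hom (nza (mnz R)) (nza (mnz R')) :=
  @hom_of k (nza (mnz R)) (nza (mnz R')) tw_fun twDf twM twk.

End Twist.

(** The additivity makes the series with weights of order i in [AA i] a subalgebra, and the
    condition at 0 makes its reduction at t = 0 independent of the torus variable. *)
Record admissible (AA : nat -> set M) : Prop := Admissible {
  adm0 : AA 0%N = [set 0];
  admD : forall i j m n, AA i m -> AA j n -> AA (i + j)%N (m + n)
}.

Section Sub.
Variables (AA : nat -> set M) (hA : admissible AA) (R : nzalg k).

Definition wset : set (fpsA (mnz R)) :=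
  [set a | forall i m, (fcoef a i : monalg R M) m != 0 -> AA i m].

Lemma wset_mul_aux (a b : fpsA (mnz R)) n : 
  (forall i, (i <= n)%N -> forall m, (fcoef a i : monalg R M) m != 0 -> AA i m) ->
  (forall i, (i <= n)%N -> forall m, (fcoef b i : monalg R M) m != 0 -> AA i m) ->
  forall m, (fcoef (a * b) n : monalg R M) m != 0 -> AA n m.
Proof.
move=> ha hb m; rewrite fps_coefM ma_coef_sum => h.
have [i hi] : exists i : 'I_n.+1, (fcoef a i * fcoef b (n - i) : monalg R M) m != 0.
  apply: contrapT => hn; case/eqP: h; apply: big1 => i _; apply/eqP; apply: contraT => hi.
  by case: hn; exists i.
have [x [y [/ha hx /hb hy ->]]] := ma_mul_supp hi.
have le : (i <= n)%N by rewrite -ltnS.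
by rewrite -(subnKC le); apply: (admD hA); [exact: hx | apply: hy; exact: leq_subr].
Qed.

Lemma wset_closed : subalg_closed wset.
Proof.
split.
- move=> c i m; rewrite /= coefC; case: i => [|i] /=; last by rewrite eqxx.
  by rewrite (adm0 hA); case: (eqVneq m 0) => [->|] //; rewrite eqxx.
- move=> a b ha hb i m; rewrite fps_coefD ma_coefD => h.
  case: (eqVneq ((fcoef a i : monalg R M) m) 0) h => [->|/ha //].
  by rewrite add0r => /hb.
- by move=> a b ha hb n; apply: wset_mul_aux => i _ m; [exact: ha | exact: hb].
Qed.

Definition WW : alg k := subalg wset_closed.
Definition Winc : hom WW (fpsA (mnz R)) := sub_inc wset_closed.

Lemma Winc_inj : injective Winc. Proof. exact: sub_inc_inj. Qed.

Lemma WW0 (a : WW) : fcoef (Winc a) 0 = ma_c M ((fcoef (Winc a) 0 : monalg R M) 0).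
Proof. by apply: ma_supp0 => m /(svalP a); rewrite (adm0 hA). Qed.

Definition Wr : hom WW (nza R).
Proof.
refine (@hom_of k WW (nza R) (fun a => (fcoef (Winc a) 0 : monalg R M) 0) _ _ _).
- by move=> a b; rewrite rmorphD fps_coefD.
- move=> a b; rewrite rmorphM fps_coefM big_ord1 (WW0 a) subn0.
  by rewrite -[_ * _]/(ma_c M _ * _) monaMd [in RHS]/= eqxx.
- by move=> c; rewrite homE /= coefC /= eqxx.
Defined.

Lemma WrE a : Wr a = (fcoef (Winc a) 0 : monalg R M) 0. Proof. by []. Qed.

Lemma Wconst_sub (c : R) : wset (fps_const (ma_c M c)).
Proof.
move=> i m; rewrite fps_coefC; case: i => [|i] /=; last by rewrite eqxx.
by rewrite (adm0 hA); case: (eqVneq m 0) => [->|] //; rewrite eqxx.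
Qed.

Definition Wcst : hom (nza R) WW.
Proof.
refine (@hom_of k (nza R) WW (fun c => exist _ _ (@Wconst_sub c)) _ _ _).
- by move=> a b; apply: Winc_inj; rewrite /= !rmorphD.
- by move=> a b; apply: Winc_inj; rewrite /= !rmorphM.
- by move=> c; apply: Winc_inj; rewrite homE.
Defined.

Lemma Winc_cst : hcomp Winc Wcst = hcomp (fcst (mnz R)) (mst R).
Proof. exact: hom_ext. Qed.

Lemma Wr_cst : hcomp Wr Wcst = hid _.
Proof. by apply: hom_ext => c; rewrite hcompE WrE /= coefC /= eqxx. Qed.

Lemma Wr_surj (c : nza R) : exists a, Wr a = c.
Proof. by exists (Wcst c); exact: (congr1 (fun f : hom _ _ => f c) Wr_cst). Qed.

(** The recursion for the inverse series respects the weights. By [in_chart_local], [WW] thus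
    behaves like a thickening of R, and charts extend from R to it. *)
Lemma Wr_unit (a : WW) : Wr a = 1 -> exists b, a * b = 1.
Proof.
move=> ea; have a0 : fcoef (Winc a) 0 = 1 by rewrite WW0 -WrE ea rmorph1.
pose b := fps_inv 1 (Winc a).
have wb n : forall m, (fcoef b n : monalg R M) m != 0 -> AA n m.
  elim/ltn_ind: n => n IH m; rewrite /b fps_invE mul1r -/b ma_coefD ma_coefN ma_coef_sum => h.
  case: (pselect (exists i : 'I_n, (fcoef b i * fcoef (Winc a) (n - i) : monalg R M) m != 0)) => [[i hi]|hn].
    have [x [y [hx hy ->]]] := ma_mul_supp hi.
    by rewrite -(subnKC (ltnW (ltn_ord i))); apply: (admD hA); [exact: IH | exact: (svalP a)].
  move: h; rewrite big1 ?subr0; last first.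
    by move=> i _; apply/eqP; apply: contraT => hi; case: hn; exists i.
  case: n {IH hn} => [|n] /=; last by rewrite eqxx.
  by rewrite (adm0 hA); case: (eqVneq m 0) => [->|] //; rewrite eqxx.
exists (exist _ b wb); apply: Winc_inj; rewrite rmorphM rmorph1 mulrC.
by apply: fps_mulV; rewrite a0 mulr1.
Qed.

Section Pi.
Variables (j : nat) (j0 : (0 < j)%N) (De : set M).
Hypothesis De_ext : forall i m n, (0 < i)%N -> (i < j)%N -> AA i m -> AA (j - i)%N n -> ~ De (m + n).

Definition dsum (f : monalg R M) : R := pr (fun m c => if `[< De m >] then c else 0) f.

Lemma dsumD (f g : monalg R M) : dsum (f + g) = dsum f + dsum g.
Proof. by apply: prD => [m|m a b]; case: ifP => //; rewrite addr0. Qed.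

Lemma dsumZ c (f : monalg R M) : dsum (ma_c M c * f) = c * dsum f.
Proof.
rewrite /dsum -[ma_c M c * f]/(ma_mul (ma_c M c) f) prM; last 2 first.
- by move=> m; rewrite if_same.
- by move=> m a b; case: ifP => //; rewrite addr0.
rewrite pr_d.
  by rewrite /pr mulr_sumr; apply: eq_bigr => m _; rewrite add0r; case: ifP; rewrite ?mulr0.
by move=> m; apply: pr0 => i; rewrite mul0r if_same.
Qed.

Lemma dsum0 (f : monalg R M) : (forall m, f m != 0 -> ~ De m) -> dsum f = 0.
Proof.
move=> h; apply: pr0 => m; case: asboolP => // hm.
by apply/eqP; apply: contraT => /h.
Qed.

(** The coefficient of order j, restricted to weights in [De], is a derivation at t = 0, as products
    of terms of intermediate orders have no weight in [De]. The torus variable is then set to 1 by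
    summing. *)
Definition Wpi : hom WW (dual (nza R)).
Proof.
refine (@hom_of k WW (dual (nza R)) (fun a => @Sqz k (nza R) (self_alg (nza R)) (Wr a) (dsum (fcoef (Winc a) j))) _ _ _).
- by move=> a b; apply: sqz_ext; rewrite /= ?rmorphD // -dsumD.
- move=> a b; apply: sqz_ext; first by rewrite rmorphM.
  rewrite [LHS]/= -[X in dsum X]/(fcoef (Winc (a * b)) j) rmorphM fps_coefM.
  rewrite (big_morph dsum dsumD (_ : dsum 0 = 0)); last by apply: dsum0 => m; rewrite eqxx.
  rewrite big_ord_recl /= subn0 {1}WW0 dsumZ; congr (_ + _).
  case: j j0 De_ext => // j' _ De_ext'; rewrite big_ord_recr /= big1 ?add0r => [|i _].
    by rewrite /bump /= add1n subnn [X in _ * X]WW0 mulrC dsumZ.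
  apply: dsum0 => m /ma_mul_supp [x [y [hx hy ->]]].
  apply: (De_ext' (bump 0 i)) => //; first by rewrite /bump /= add1n ltnS.
    exact: (svalP a).
  exact: (svalP b).
- move=> c; apply: sqz_ext; first exact: (homE Wr).
  rewrite /= coefC; case: j j0 => //= j' _; apply: dsum0 => m; by rewrite eqxx.
Defined.

Lemma WpiE a : Wpi a = @Sqz k (nza R) (self_alg (nza R)) (Wr a) (dsum (fcoef (Winc a) j)). Proof. by []. Qed.
End Pi.
End Sub.
End Supports.

Lemma trunc_conv (D : comPzRingType) (t : D) N (a b : nat -> D) : t ^+ N = 0 ->
  (\sum_(i < N) t ^+ i * a i) * (\sum_(i < N) t ^+ i * b i) =
  \sum_(n < N) t ^+ n * \sum_(i < n.+1) a i * b (n - i)%N.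
Proof.
move=> tN; pose F i j := t ^+ (i + j) * (a i * b j).
have tri n : \sum_(l < n) \sum_(i < l.+1) F i (l - i)%N = \sum_(i < n) \sum_(j < n - i) F i j.
  elim: n => [|n IH]; first by rewrite !big_ord0.
  rewrite big_ord_recr /= IH [RHS]big_ord_recr /= subSnn big_ord1.
  rewrite [X in _ + X]big_ord_recr /= subnn addrA; congr (_ + _).
  rewrite -big_split /=; apply: eq_bigr => i _.
  by rewrite subSn ?big_ord_recr //; exact: ltnW.
transitivity (\sum_(i < N) \sum_(j < N - i) F i j).
  rewrite mulr_suml; apply: eq_bigr => i _; rewrite mulr_sumr.
  have -> : \sum_(j < N) t ^+ i * a i * (t ^+ j * b j) = \sum_(j < N) F i j.
    by apply: eq_bigr => j _; rewrite /F exprD mulrACA.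
  rewrite [RHS](big_ord_widen N (fun j => F i j) (leq_subr i N)) [RHS]big_mkcond /=.
  apply: eq_bigr => j _; case: ltnP => // le.
  rewrite /F (_ : (i + j)%N = (N + (i + j - N))%N) ?exprD ?tN ?mul0r //.
  by rewrite subnKC // -leq_subLR.
rewrite -tri; apply: eq_bigr => n _; rewrite mulr_sumr; apply: eq_bigr => i _.
by rewrite /F subnKC // -ltnS.
Qed.

Section Wev.
Variables (k : fieldType) (M : zmodType) (AA : nat -> set M) (hA : admissible AA).
Variables (R : nzalg k) (P : set M) (N : nat).
Hypothesis AP : forall i m, (i < N)%N -> AA i m -> P m.
Variables (D : alg k) (ro : hom (nza R) D) (s : M -> D) (t : D).
Hypothesis s0 : s 0 = 1.
Hypothesis sD : forall m n, P m -> P n -> s (m + n) = s m * s n.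
Hypothesis tN : t ^+ N = 0.
Hypothesis N0 : (0 < N)%N.

Definition pev (f : monalg R M) : D := pr (fun m c => ro c * s m) f.

Lemma pevD (f g : monalg R M) : pev (f + g) = pev f + pev g.
Proof. by apply: prD => [m|m a b]; rewrite ?rmorph0 ?mul0r // rmorphD mulrDl. Qed.

Lemma pevM (f g : monalg R M) : (forall m, f m != 0 -> P m) -> (forall m, g m != 0 -> P m) ->
  pev (f * g) = pev f * pev g.
Proof.
move=> hf hg; rewrite /pev -[f * g]/(ma_mul f g) prM; last 2 first.
- by move=> m; rewrite rmorph0 mul0r.
- by move=> m a b; rewrite rmorphD mulrDl.
rewrite /pr mulr_suml; apply: eq_bigr => i _; rewrite mulr_sumr; apply: eq_bigr => j _.
case: (eqVneq (f i) 0) => [->|/hf Pi]; first by rewrite mul0r !rmorph0 !mul0r.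
case: (eqVneq (g j) 0) => [->|/hg Pj]; first by rewrite mulr0 !rmorph0 !mul0r mulr0.
by rewrite sD // rmorphM mulrACA.
Qed.

Lemma pev_c c : pev (ma_c M c) = ro c.
Proof. by rewrite /pev pr_d ?s0 ?mulr1 // => m; rewrite rmorph0 mul0r. Qed.

Lemma pev0 : pev 0 = 0.
Proof. by apply: pr0 => m; rewrite rmorph0 mul0r. Qed.

Definition Wev_fun (a : WW hA R) : D := \sum_(i < N) t ^+ i * pev (fcoef (Winc hA R a) i).

Lemma Wev_funM a b : Wev_fun (a * b) = Wev_fun a * Wev_fun b.
Proof.
rewrite /Wev_fun (trunc_conv (fun i => pev (fcoef (Winc hA R a) i))
  (fun i => pev (fcoef (Winc hA R b) i)) tN).
apply: eq_bigr => n _; congr (_ * _); rewrite rmorphM fps_coefM.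
rewrite (big_morph pev pevD pev0); apply: eq_bigr => i _.
have le : (i <= n)%N by rewrite -ltnS.
apply: pevM => m h.
  by apply: (AP (i := i)); [exact: leq_ltn_trans le (ltn_ord n) | exact: (svalP a)].
apply: (AP (i := n - i)); last exact: (svalP b).
by apply: leq_ltn_trans (ltn_ord n); exact: leq_subr.
Qed.

Lemma Wev_funC c : Wev_fun (Wcst hA R c) = ro c.
Proof.
rewrite /Wev_fun; case: N N0 => // n _; rewrite big_ord_recl expr0 mul1r big1 ?addr0.
  by rewrite -[RHS](pev_c c) /= coefC.
move=> i _; rewrite (_ : fcoef _ _ = 0) ?pev0 ?mulr0 //.
by rewrite /= coefC.
Qed.

(** A point of U_tau, multiplicative on P only, is substituted for the torus variable. This is
    compatible with products because t^N = 0 and all weights below order N lie in P. *)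
Definition Wev : hom (WW hA R) D.
Proof.
refine (@hom_of k (WW hA R) D Wev_fun _ Wev_funM _).
- move=> a b; rewrite /Wev_fun -big_split; apply: eq_bigr => i _ /=.
  by rewrite pevD mulrDr.
- by move=> c; rewrite -(homE (Wcst hA R)) Wev_funC homE.
Defined.

Lemma WevE a : Wev a = \sum_(i < N) t ^+ i * pev (fcoef (Winc hA R a) i). Proof. by []. Qed.

Lemma Wev_cst : hcomp Wev (Wcst hA R) = ro.
Proof. by apply: hom_ext => c; exact: Wev_funC. Qed.
End Wev.

(** * The torus orbit of a curve in a chart *)

Section Orbit.
Variables (k : closedFieldType) (M : zmodType).
Variables (G : grp k) (H : kfun k) (aH : gaction G H).
Local Notation TT := (gring (torus k M)).
Local Notation GG := (gring G).
Local Notation k0 := (self_alg k).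
Variables (z : H k0) (lam : forall C : alg k, hom TT C -> hom GG C).
Hypothesis lnat : forall (C D : alg k) (h : hom C D) (a : hom TT C), hcomp h (lam a) = lam (hcomp h a).
Hypothesis lM : forall (C : alg k) (a a' : hom TT C), lam (gmul a a') = gmul (lam a) (lam a').
Hypothesis l1 : forall C : alg k, lam (gone _ C) = gone G C.
Hypothesis lfix : forall (C : alg k) (a : hom TT C), aH C (lam a) (zC z C) = zC z C.
Variables (U : alg k) (uV : H U) (hu : open_immersion uV) (zh : hom U k0).
Hypothesis ezh : kmap zh uV = z.

Definition kz : nzalg k := @NzAlg k k idfun.
Definition nkin (R : nzalg k) : hom (nza kz) (nza R) := @Hom k (nza kz) (nza R) (nz_str R) (fun=> erefl).
Definition kto (D : alg k) : hom (nza kz) D := @Hom k (nza kz) D (alg_str D) (fun=> erefl).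

Lemma zh_zC (D : alg k) : kmap (hcomp (kin D) zh) uV = zC z D.
Proof. by rewrite kmap_comp ezh. Qed.

Definition xpt (R : nzalg k) : hom TT (nza (mnz M R)).
Proof.
refine (@tpt k M (nza (mnz M R)) (fun m => ma_d m 1) _ _) => //.
by move=> m n; rewrite ma_dM mulr1.
Defined.

Lemma xptE (R : nzalg k) m : tv (xpt R) m = ma_d m 1. Proof. exact: tptE. Qed.

(* the orbit [lam(x) f], [x] the universal point of the torus *)
Definition orb (f : H (pser k)) : H (fpsA (mnz M kz)) :=
  aH _ (lam (hcomp (fcst (mnz M kz)) (xpt kz))) (kmap (pser_map (mnz M kz)) f).

Definition twT (R : nzalg k) (y : hom TT (nza R)) : hom (nza (mnz M kz)) (nza (mnz M R)) :=
  tw (nkin R) (tv0 y) (tvD y).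

Lemma twTE (R : nzalg k) (y : hom TT (nza R)) (f : monalg kz M) m : (twT y f : monalg R M) m = nz_str R (f m) * tv y m.
Proof. by []. Qed.

Section InW.
Variables (AA : nat -> set M) (hA : admissible AA).

Lemma twW_ex (R : nzalg k) (y : hom TT (nza R)) : exists w : hom (WW hA kz) (WW hA R),
  hcomp (Winc hA R) w = hcomp (fpsA_map (twT y)) (Winc hA kz).
Proof.
apply: hom_factor; first exact: Winc_inj.
move=> a; have h : wset AA (fpsA_map (twT y) (Winc hA kz a)).
  move=> i m h; apply: (svalP a i m); apply: contraNneq h => e.
  apply/eqP; rewrite -[LHS]/(nz_str R ((fcoef (sval a) i : monalg kz M) m) * tv y m).
  by rewrite e rmorph0 mul0r.
by exists (exist _ _ h).
Qed.

Definition twW (R : nzalg k) (y : hom TT (nza R)) := projT1 (cid (twW_ex y)).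
Lemma twWP (R : nzalg k) (y : hom TT (nza R)) :
  hcomp (Winc hA R) (twW y) = hcomp (fpsA_map (twT y)) (Winc hA kz).
Proof. by rewrite /twW; case: cid. Qed.

Lemma twWE (R : nzalg k) (y : hom TT (nza R)) a i m :
  (fcoef (Winc hA R (twW y a)) i : monalg R M) m =
  nz_str R ((fcoef (Winc hA kz a) i : monalg kz M) m) * tv y m.
Proof.
exact: (congr1 (fun f : hom (WW hA kz) (fpsA (mnz M R)) =>
  (fcoef (f a) i : monalg R M) m) (twWP y)).
Qed.

Lemma Wr_tw (R : nzalg k) (y : hom TT (nza R)) : hcomp (Wr hA R) (twW y) = hcomp (nkin R) (Wr hA kz).
Proof. by apply: hom_ext => a; rewrite !hcompE !WrE twWE tv0 mulr1. Qed.

Variables (f : H (pser k)).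
Hypothesis f0 : kmap (closed_point k) f = z.
Variable ph : hom U (WW hA kz).
Hypothesis eph : kmap (hcomp (Winc hA kz) ph) uV = orb f.

Lemma orb_at0 : kmap (fps_at0 (mnz M kz)) (orb f) = zC z _.
Proof.
rewrite /orb act_nat lnat -kmap_comp.
have -> : hcomp (fps_at0 (mnz M kz)) (pser_map (mnz M kz)) =
    hcomp (kin (nza (mnz M kz))) (closed_point k) by apply: hom_ext.
by rewrite kmap_comp f0 -[kmap (kin _) z]/(zC z _) lfix.
Qed.

Lemma Wr_ph : hcomp (Wr hA kz) ph = hcomp (kin (nza kz)) zh.
Proof.
have e : hcomp (mst M kz) (hcomp (Wr hA kz) ph) = hcomp (mst M kz) (hcomp (kin (nza kz)) zh).
  apply: (chart_inj hu).
  have -> : hcomp (mst M kz) (hcomp (kin (nza kz)) zh) = hcomp (kin (nza (mnz M kz))) zh.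
    by rewrite hcompA; congr hcomp; exact: kin_uniq.
  rewrite zh_zC -orb_at0 -eph -kmap_comp; congr (kmap _ uV).
  by apply: hom_ext => u; apply: esym; exact: (@WW0 k M AA hA kz (ph u)).
apply: hom_ext => u; have := congr1 (fun g : hom U (nza (mnz M kz)) => (g u : monalg kz M) 0) e.
by rewrite !hcompE /= eqxx.
Qed.

(** In the full series ring, translating the torus variable by y amounts to acting by lam(y), as
    [lam] is a homomorphism. Both sides are defined over [WW] and equal z at t = 0, hence lie in the
    chart, and [chart_descend] descends the identity. *)
Lemma orb_W (R : nzalg k) (y : hom TT (nza R)) :
  aH _ (lam (hcomp (Wcst hA R) y)) (kmap (hcomp (twW (gone _ (nza R))) ph) uV) =
  kmap (hcomp (twW y) ph) uV.
Proof.
apply: (chart_descend hu (@Winc_inj _ _ _ hA R)).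
  apply: (in_chart_local hu (@Wr_surj _ _ _ hA R) (@Wr_unit _ _ _ hA R)).
  rewrite act_nat lnat hcompA Wr_cst hcomp1f -kmap_comp hcompA Wr_tw -hcompA Wr_ph hcompA.
  have -> : hcomp (nkin R) (kin (nza kz)) = kin (nza R) by exact: kin_uniq.
  by rewrite zh_zC lfix; exists (hcomp (kin _) zh); exact: zh_zC.
have tf (w : hom TT (nza R)) : kmap (Winc hA R) (kmap (hcomp (twW w) ph) uV) =
    aH _ (lam (hcomp (fcst (mnz M R)) (gmul (hcomp (mst M R) w) (xpt R)))) (kmap (pser_map (mnz M R)) f).
  rewrite -kmap_comp hcompA twWP -hcompA kmap_comp eph /orb act_nat lnat -kmap_comp.
  congr (aH _ (lam _) (kmap _ f)).
    rewrite hcompA; apply: tv_ext => m; rewrite !tv_nat tvM tv_nat !xptE.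
    apply: fps_ext => -[|i]; rewrite /= !coefC /=; last first.
      by apply: monalg_ext => n /=; rewrite rmorph0 mul0r.
    apply: monalg_ext => n; rewrite -[RHS]/((ma_c M (tv w m) * ma_d m 1) n) monaMd /=.
    by case: eqP => [->|_]; rewrite ?rmorph1 ?mul1r ?mulr1 // rmorph0 mul0r mulr0.
  apply: hom_ext => a; apply: fps_ext => i; apply: monalg_ext => m /=.
  by case: eqP => [->|_]; rewrite ?tv0 ?mulr1 ?rmorph0 ?mul0r.
rewrite act_nat tf tf lnat hcompA Winc_cst -actM -lM; congr (aH _ (lam _) _).
rewrite -hcompA gmul_nat [in RHS]gmul_nat gone_nat gone_nat gmul1.
by [].
Qed.
End InW.

Definition Atot (i : nat) : set M := if i == 0%N then [set 0] else setT.
Lemma Atot_adm : admissible Atot.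
Proof.
split=> // i j m n; rewrite /Atot addn_eq0; case: eqP => [_|_] /=; last by [].
by move=> /= ->; case: eqP => //= _ ->; rewrite addr0.
Qed.

(** The point z is fixed by [lam], so the orbit is constant at t = 0; the chart at z therefore
    contains it without being stable under the torus. *)
Lemma orb_exists (f : H (pser k)) : kmap (closed_point k) f = z ->
  exists c : hom U (fpsA (mnz M kz)), kmap c uV = orb f /\ forall u, wset Atot (c u).
Proof.
move=> f0; have at0 : kmap (fps_at0 (mnz M kz)) (orb f) = zC z _ by exact: orb_at0.
have [c ec] : in_chart uV (orb f).
  apply: (in_chart_local hu (r := fps_at0 (mnz M kz))).
  - move=> y; exists (fps_const (y : monalg kz M)).
    by rewrite -[LHS]/(fcoef (fps_const (y : monalg kz M)) 0) fps_coefC.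
  - by move=> a ea; exact: fps_nilp_unit.
  - by rewrite at0; exists (hcomp (kin _) zh); exact: zh_zC.
have e0 : hcomp (fps_at0 (mnz M kz)) c = hcomp (kin _) zh.
  by apply: (chart_inj hu); rewrite (kmap_comp (fps_at0 (mnz M kz)) c) zh_zC -at0; congr (kmap _ _).
exists c; split=> // u [|i] m //= h.
have e1 : fcoef (c u) 0 = ma_c M (zh u) :> monalg kz M.
  exact: (congr1 (fun g : hom U (nza (mnz M kz)) => (g u : monalg kz M)) e0).
by apply/eqP; apply: contraNT h => m0; rewrite e1 /= (negbTE m0).
Qed.

Section FG.
Variables (nu : nat) (bu : 'I_nu -> U).
Hypothesis bU : forall y, exists t, teval bu t = y.

Lemma orb_inW (c : hom U (fpsA (mnz M kz))) AA (hA : admissible AA) :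
  (forall i, wset AA (c (bu i))) -> exists ph : hom U (WW hA kz), hcomp (Winc hA kz) ph = c.
Proof.
move=> h; apply: (fg_hom_in bU); first exact: Winc_inj.
by move=> i; exists (exist _ _ (h i)).
Qed.
End FG.

Section PiTangent.
Variables (AA : nat -> set M) (hA : admissible AA) (f : H (pser k)).
Hypothesis f0 : kmap (closed_point k) f = z.
Variable ph : hom U (WW hA kz).
Hypothesis eph : kmap (hcomp (Winc hA kz) ph) uV = orb f.
Variables (j : nat) (j0 : (0 < j)%N) (De : set M).
Hypothesis De_ext : forall i m n, (0 < i)%N -> (i < j)%N -> AA i m -> AA (j - i)%N n -> ~ De (m + n).

Definition cf (u : U) : monalg kz M := fcoef (Winc hA kz (ph u)) j.

(* [zh + e \sum_(m in De) c_m y^m] with [c = cf u] *)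
Definition tz (R : nzalg k) (y : hom TT (nza R)) : hom U (dual (nza R)) :=
  hcomp (Wpi hA R j0 De_ext) (hcomp (twW hA y) ph).

Definition dsumT (R : nzalg k) (y : hom TT (nza R)) (c : monalg kz M) : R :=
  pr (fun m a => if `[< De m >] then nz_str R a * tv y m else 0) c.

Lemma tzE (R : nzalg k) (y : hom TT (nza R)) u :
  tz y u = @Sqz k (nza R) (self_alg (nza R)) (nz_str R (zh u)) (dsumT y (cf u)).
Proof.
rewrite /tz !hcompE WpiE; congr Sqz.
  rewrite -[LHS]/(hcomp (Wr hA R) (twW hA y) (ph u)) Wr_tw.
  rewrite -[LHS]/(nz_str R (hcomp (Wr hA kz) ph u)) (Wr_ph f0 eph).
  by [].
rewrite /dsum /dsumT (_ : fcoef _ j = twT y (cf u)); last first.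
  by apply: monalg_ext => m; exact: twWE.
rewrite (@prE _ _ _ _ _ (supp (cf u))).
- by [].
- by move=> m; rewrite if_same.
- exact: supp_uniq.
- move=> m h; apply: suppP; apply: contraNneq h => e.
  by apply/eqP; rewrite twTE e rmorph0 mul0r.
Qed.

Lemma tz_act (R : nzalg k) (y : hom TT (nza R)) :
  aH _ (lam (hcomp (din (nza R)) y)) (kmap (tz (gone _ (nza R))) uV) = kmap (tz y) uV.
Proof.
have := congr1 (kmap (Wpi hA R j0 De_ext)) (orb_W f0 eph y).
rewrite act_nat lnat -!kmap_comp.
have -> : hcomp (Wpi hA R j0 De_ext) (hcomp (Wcst hA R) y) = hcomp (din (nza R)) y; last by [].
rewrite hcompA; congr (hcomp _ y).
apply: hom_ext => c; rewrite hcompE WpiE; apply: sqz_ext => /=.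
  exact: (congr1 (fun g : hom (nza R) (nza R) => g c) (Wr_cst hA R)).
rewrite coefC; case: (j) j0 => //= j' _; apply: pr0 => m.
by rewrite if_same.
Qed.
End PiTangent.

End Orbit.

Section PevFacts.
Variables (k : closedFieldType) (M : zmodType).
Local Notation kz := (kz k).

Lemma pev_hom (R : nzalg k) (D E : alg k) (g : hom D E) (ro : hom (nza R) D) (s : M -> D) (c : monalg R M) :
  g (pev ro s c) = pev (hcomp g ro) (fun m => g (s m)) c.
Proof. by rewrite /pev /pr rmorph_sum; apply: eq_bigr => m _; rewrite rmorphM. Qed.

Lemma eq_pev (R : nzalg k) (D : alg k) (ro ro' : hom (nza R) D) (s s' : M -> D) (c : monalg R M) :
  ro =1 ro' -> (forall m, c m != 0 -> s m = s' m) -> pev ro s c = pev ro' s' c.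
Proof.
move=> er es; apply: eq_pr_supp => m; rewrite er.
by case: (eqVneq (c m) 0) => [->|/es ->] //; rewrite rmorph0 !mul0r.
Qed.

Lemma pev_tw (R : nzalg k) (D : alg k) (ro : hom (nza R) D) (y : hom (gring (torus k M)) (nza R))
    (s : M -> D) (c : monalg kz M) :
  pev ro s (twT y c) = pev (kto D) (fun m => ro (tv y m) * s m) c.
Proof.
rewrite /pev (@prE _ _ _ _ _ (supp c)).
- apply: eq_bigr => m _; rewrite twTE rmorphM mulrA; congr (_ * _ * _).
  exact: (homE ro).
- by move=> m; rewrite rmorph0 mul0r.
- exact: supp_uniq.
- move=> m h; apply: suppP; apply: contraNneq h => e.
  by apply/eqP; rewrite twTE e rmorph0 mul0r.
Qed.

Lemma mz_ev_ex (D : alg k) (t : hom (gring (torus k M)) D) :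
  exists ro : hom (nza (mnz M kz)) D, forall c, ro c = pev (kto D) (tv t) c.
Proof.
pose e := mona_ev (D := D : alg k) (chi := tv t) (tv0 t) (tvD t).
have ek c : e (alg_str (nza (mnz M kz)) c) = alg_str D c by exact: (homE e).
by exists (@hom_of k (nza (mnz M kz)) D e (rmorphD e) (rmorphM e) ek).
Qed.

Lemma pev_dm (D : alg k) (s : M -> D) m c : pev (kto D) s (ma_d m c : monalg kz M) = alg_str D c * s m.
Proof. by rewrite /pev pr_d // => i; rewrite rmorph0 mul0r. Qed.

End PevFacts.

Lemma pser_trunc (k : comNzRingType) (D : alg k) (g : hom (pser k) D) N (a : pser k) :
  g (fps_t k) ^+ N = 0 -> g a = \sum_(i < N) g (fps_t k) ^+ i * alg_str D (fcoef a i).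
Proof.
move=> gN; have [|b eb] := @fps_divXn k N (a - \sum_(i < N) fps_t k ^+ i * fps_const (fcoef a i)).
  move=> i iN; rewrite fps_coefB.
  have -> : fcoef (\sum_(l < N) fps_t k ^+ l * fps_const (fcoef a l)) i =
      \sum_(l < N) fcoef (fps_t k ^+ l * fps_const (fcoef a l)) i.
    by apply: (big_morph (fun x => fcoef x i)).
  have h (l : 'I_N) : fcoef (fps_t k ^+ l * fps_const (fcoef a l)) i =
      if (l == i :> nat) then fcoef a l else 0.
    rewrite fps_coefXnM fps_coefC subn_eq0.
    by case: (ltngtP l i).
  rewrite (eq_bigr _ (fun l _ => h l)) -big_mkcond (big_pred1 (Ordinal iN)) ?subrr //.
have -> : a = \sum_(i < N) fps_t k ^+ i * fps_const (fcoef a i) + fps_t k ^+ N * b.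
  by rewrite -eb addrC subrK.
rewrite rmorphD rmorphM rmorphXn gN mul0r addr0 rmorph_sum.
apply: eq_bigr => i _; rewrite rmorphM rmorphXn; congr (_ * _).
rewrite -eb addrC subrK; exact: (homE g).
Qed.

(** * Curves all of whose weights up to some order are regular *)

Section Regular.
Variables (k : closedFieldType) (M : zmodType) (P : set M).
Hypothesis P0 : P 0.
Hypothesis PD : forall m n, P m -> P n -> P (m + n).
Variables (G : grp k) (H : kfun k) (aH : gaction G H).
Local Notation Th := (quot_stack (torus_act k P)).
Local Notation N := (quot_stack aH).
Local Notation MS := (Map_stack Th N).
Local Notation TT := (gring (torus k M)).
Local Notation k0 := (self_alg k).
Local Notation kz := (kz k).
Hypothesis H_ft : scheme_of_finite_type H.
Variable S : stack_space MS -> Prop.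
Variables (F0 : ob MS k0) (z : H k0) (lam : forall C : alg k, hom TT C -> hom (gring G) C).
Hypothesis dg : degenerate F0 z lam.
Hypothesis hF0 : forall (p : fpoint MS) (f : mor (fp_ob p) F0), S (pt_class p).
Variables (U : alg k) (uV : H U) (hu : open_immersion uV) (zh : hom U k0).
Hypothesis ezh : kmap zh uV = z.
Let lnat := deg_nat dg.
Let lfix := deg_fix dg.
Let l1 := deg_lam1 dg.

(** Extension by zero from P to M, since the sums over weights run over M. *)
Definition sfun (D : alg k) (si : hom (mon_alg k P) D) (m : M) : D :=
  match pselect (P m) with left Pm => uv si (exist _ m Pm) | right _ => 0 end.

Lemma sfunE (D : alg k) (si : hom (mon_alg k P) D) m (Pm : P m) : sfun si m = uv si (exist _ m Pm).
Proof.
rewrite /sfun; case: pselect => // Pm'.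
by rewrite (Prop_irrelevance Pm' Pm).
Qed.

Lemma sfun0 (D : alg k) (si : hom (mon_alg k P) D) : sfun si 0 = 1.
Proof. by rewrite (sfunE si P0); have [h _] := character_of si; exact: h. Qed.

Lemma sfunD (D : alg k) (si : hom (mon_alg k P) D) m n : P m -> P n -> sfun si (m + n) = sfun si m * sfun si n.
Proof.
move=> Pm Pn; rewrite (sfunE si Pm) (sfunE si Pn) (sfunE si (PD Pm Pn)).
by have [_ h] := character_of si; exact: h.
Qed.

Lemma sfun_nat (D E : alg k) (g : hom D E) (si : hom (mon_alg k P) D) m :
  g (sfun si m) = sfun (hcomp g si) m.
Proof. by rewrite /sfun; case: pselect => // _; rewrite rmorph0. Qed.

Variables (AA : nat -> set M) (hA : admissible AA) (f : H (pser k)).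
Hypothesis f0 : kmap (closed_point k) f = z.
Variable ph : hom U (WW hA kz).
Hypothesis eph : kmap (hcomp (Winc hA kz) ph) uV = orb aH lam f.
Variable n : nat.
Hypothesis n0 : (0 < n)%N.
Hypothesis AP : forall i m, (i < n)%N -> AA i m -> P m.

(** The orbit series can be evaluated at every point of U_tau over an algebra in which t^n = 0. This
    is a [lam]-equivariant family with value f at the identity, and [ext_zplus] applies with A =
    k[[t]]/t^n and tau = t. *)
Lemma regular_zplus : exists (Q : alg k) (p : hom (pser k) Q),
  zplus S (kmap p f) /\ forall x, p x = 0 -> exists y, x = fps_t k ^+ n * y.
Proof.
have [Q [p [psurj p1 pt0]]] := principal_quot (fps_t k ^+ n : pser k).
have pker x : p x = 0 -> exists y, x = fps_t k ^+ n * y.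
  move=> px; have [|y ey] := p1 (1 + x); first by rewrite rmorphD px rmorph1 addr0.
  by exists y; rewrite -ey addrAC subrr add0r.
exists Q, p; split=> //.
have [ev0 eev0] : exists ev0 : hom Q k0, hcomp ev0 p = closed_point k.
  apply: hom_quot => // x /pker [y ->].
  by rewrite rmorphM rmorphXn /= /fcoef0 /= coefX /= expr0n (gtn_eqF n0) mul0r.
pose tau : Q := p (fps_t k).
have tauN : tau ^+ n = 0 by rewrite -rmorphXn pt0.
have altN (D : alg k) (al : hom Q D) : al tau ^+ n = 0 by rewrite -rmorphXn tauN rmorph0.
pose wv (R : nzalg k) (D : alg k) (ro : hom (nza R) D) (al : hom Q D) (si : hom (mon_alg k P) D) :=
  @Wev k M AA hA R P n AP D ro (sfun si) (al tau) (sfun0 si) (@sfunD D si) (altN D al) n0.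
pose cfam (D : alg k) (al : hom Q D) (si : hom (mon_alg k P) D) : H D := kmap (hcomp (wv kz D (kto D) al si) ph) uV.
have ev0tau : ev0 tau = 0.
  rewrite -[LHS]/(hcomp ev0 p (fps_t k)) eev0 /= /fcoef0 /= coefX.
  by [].
apply: (@ext_zplus k M P G H aH H_ft F0 z lam dg Q (kmap p f) tau cfam _ _ _ _ n tauN ev0 ev0tau _ S hF0).
- move=> D E g al si; rewrite /cfam -kmap_comp; congr (kmap _ uV); apply: hom_ext => u.
  rewrite !hcompE /wv !WevE rmorph_sum; apply: eq_bigr => i _.
  rewrite rmorphM rmorphXn pev_hom; congr (_ * _); apply: eq_pev => [c|m _]; last exact: sfun_nat.
  exact: (homE g).
(* Equivariance is [orb_W] for the universal torus point, specialized to [t] by [ro]. *)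
- move=> D al si t; pose R := mnz M kz; pose y := xpt M kz.
  have [ro ero] := mz_ev_ex t.
  have ery : hcomp ro y = t.
    by apply: tv_ext => m; rewrite tv_nat xptE ero pev_dm rmorph1 mul1r.
  have roy m : ro (tv y m) = tv t m by rewrite -tv_nat ery.
  have := congr1 (kmap (wv R D ro al si)) (orb_W lnat (degM dg) lfix hu ezh f0 eph y).
  rewrite act_nat lnat -!kmap_comp.
  have -> : hcomp (wv R D ro al si) (hcomp (Wcst hA R) y) = t by rewrite hcompA Wev_cst.
  have -> : hcomp (wv R D ro al si) (hcomp (twW hA y) ph) = hcomp (wv kz D (kto D) al (torus_act k P D t si)) ph.
    apply: hom_ext => u; rewrite !hcompE /wv !WevE; apply: eq_bigr => i _; congr (_ * _).
    have -> : fcoef (Winc hA R (twW hA y (ph u))) i = twT y (fcoef (Winc hA kz (ph u)) i).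
      by apply: monalg_ext => m; exact: twWE.
    rewrite pev_tw; apply: eq_pev => // m hm; rewrite roy.
    have Pm : P m by apply: (AP (ltn_ord i)); exact: (svalP (ph u)).
    by rewrite !(sfunE _ Pm) actE.
  have -> : hcomp (wv R D ro al si) (hcomp (twW hA (gone _ (nza R))) ph) = hcomp (wv kz D (kto D) al si) ph.
    apply: hom_ext => u; rewrite !hcompE /wv !WevE; apply: eq_bigr => i _; congr (_ * _).
    have -> : fcoef (Winc hA R (twW hA (gone _ (nza R)) (ph u))) i = twT (gone _ (nza R)) (fcoef (Winc hA kz (ph u)) i).
      by apply: monalg_ext => m; exact: twWE.
    by rewrite pev_tw; apply: eq_pev => // m _; rewrite tv1 rmorph1 mul1r.
  by move=> ->.
- move=> D al; have [ro ero] := mz_ev_ex (gone (torus k M) (nza kz)).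
  have [cf ecf] : in_chart uV f.
    have [c1 c2] := pser_local k.
    by apply: (in_chart_local hu c1 c2); exists zh; rewrite f0.
  have E : hcomp (fpsA_map ro) (hcomp (Winc hA kz) ph) = hcomp (pser_map kz) cf.
    apply: (chart_inj hu); rewrite (kmap_comp (fpsA_map ro)) eph /orb act_nat lnat -kmap_comp.
    have -> : hcomp (fpsA_map ro) (hcomp (fcst (mnz M kz)) (xpt M kz)) = gone _ _.
      apply: tv_ext => m; rewrite !tv_nat xptE tv1; apply: fps_ext => i.
      rewrite fps_coef1 /= coefC; case: i => [|i] /=; last by rewrite rmorph0.
      by rewrite ero pev_dm rmorph1 mul1r tv1.
    rewrite l1 act1 (kmap_comp (pser_map kz) cf) ecf; congr (kmap _ f); apply: hom_ext => a; apply: fps_ext => i.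
    rewrite -[LHS]/(ro (ma_d 0 (fcoef a i))) ero pev_dm tv1 mulr1.
    by [].
  rewrite -(kmap_comp al p) -ecf -(kmap_comp _ cf) /cfam; congr (kmap _ uV); apply: hom_ext => u.
  rewrite !hcompE -[RHS]/(hcomp al p (cf u)) (@pser_trunc k D (hcomp al p) n (cf u) (altN D al)).
  rewrite /wv WevE; apply: eq_bigr => i _; congr (_ * _).
  have -> : fcoef (cf u) i = ro (fcoef (Winc hA kz (ph u)) i).
    by have := congr1 (fun g : hom U (fpsA kz) => fcoef (g u) i) E; rewrite !hcompE => /esym.
  rewrite ero (pev_hom (kto D)); apply: eq_pev => // m hm.
  have Pm : P m by apply: (AP (ltn_ord i)); exact: (svalP (ph u)).
  rewrite (sfunE _ Pm) tv1 [uv _ _]of_characterE.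
  by rewrite rmorph1.
- move=> D al si al0; rewrite /cfam -(zh_zC ezh); congr (kmap _ uV); apply: hom_ext => u.
  rewrite !hcompE /wv WevE al0; case: (n) n0 => // n' _.
  rewrite big_ord_recl expr0 mul1r big1 ?addr0 => [|i _]; last by rewrite exprS !mul0r.
  rewrite [X in pev _ _ X](@WW0 k M AA hA kz (ph u)) -WrE.
  have -> : Wr hA kz (ph u) = zh u.
    by have := congr1 (fun g : hom U (nza kz) => g u) (Wr_ph lnat lfix hu ezh f0 eph).
  by rewrite pev_dm sfun0 mulr1.
- move=> x ex; have [a ea] := psurj x.
  have : closed_point k a = 0 by rewrite -eev0 hcompE ea ex.
  move=> a0; have [|b eb] := @fps_divXn k 1 a.
    by move=> i; rewrite ltnS leqn0 => /eqP ->.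
  by exists (p b); rewrite -ea eb expr1 rmorphM.
Qed.

End Regular.

(** * Finiteness of the tangent weights *)

Section Weights.
Variables (k : closedFieldType) (M : zmodType).
Variables (G : grp k) (H : kfun k) (aH : gaction G H).
Local Notation TT := (gring (torus k M)).
Local Notation k0 := (self_alg k).
Local Notation kz := (kz k).
Local Notation L := (nza (mnz M kz)).
Variables (z : H k0) (lam : forall C : alg k, hom TT C -> hom (gring G) C).
Hypothesis lnat : forall (C D : alg k) (h : hom C D) (a : hom TT C), hcomp h (lam a) = lam (hcomp h a).
Hypothesis lfix : forall (C : alg k) (a : hom TT C), aH C (lam a) (zC z C) = zC z C.
Variables (U : alg k) (uV : H U) (hu : open_immersion uV) (zh : hom U k0).
Hypothesis ezh : kmap zh uV = z.
Variables (nu : nat) (bu : 'I_nu -> U).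
Hypothesis bU : forall y, exists t, teval bu t = y.

(** U modulo the square of the maximal ideal of z. The differences between the generators of U and
    their values at z generate that ideal, so their products generate its square. *)
Lemma first_order_nbhd : exists (A : alg k) (p : hom U A) (q : hom A k0),
  [/\ forall y, exists x, p x = y, hcomp q p = zh,
      forall x y, q x = 0 -> q y = 0 -> x * y = 0 &
      forall (C : alg k) (g : hom U C), (forall x y, zh x = 0 -> zh y = 0 -> g x * g y = 0) ->
        exists g' : hom A C, hcomp g' p = g].
Proof.
pose d i := bu i - alg_str U (zh (bu i)).
pose f (ij : 'I_nu * 'I_nu) := d ij.1 * d ij.2.
have zd i : zh (d i) = 0 by rewrite rmorphB homE subrr.
have hI := @fam_idealP k U _ f.
have hJ := @fam_idealP k U _ d.
have gen y : fam_ideal d (y - alg_str U (zh y)).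
  have [t <-] := bU y; elim: t => [i|c|t IHt s IHs|t IHt s IHs] /=.
  - exact: fam_ideal_gen.
  - by rewrite homE subrr; case: hJ.
  - rewrite !rmorphD opprD addrACA; case: hJ => _ h _; exact: h.
  - rewrite !rmorphM; set a := teval _ t in IHt *; set b := teval _ s in IHs *.
    have -> : a * b - alg_str U (zh a) * alg_str U (zh b) =
      b * (a - alg_str U (zh a)) + alg_str U (zh a) * (b - alg_str U (zh b)) by ring.
    by case: hJ => _ h1 h2; apply: h1; apply: h2.
have genz y : zh y = 0 -> fam_ideal d y by move=> e; have := gen y; rewrite e rmorph0 subr0.
have sq x y : zh x = 0 -> zh y = 0 -> fam_ideal f (x * y).
  move=> /genz [c ->] /genz [c' ->].
  exists (fun ij => c ij.1 * c' ij.2); rewrite mulr_suml -(pair_bigA _ (fun i j => c i * c' j * f (i, j))) /=.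
  by apply: eq_bigr => i _; rewrite mulr_sumr; apply: eq_bigr => j _; rewrite /f mulrACA.
exists (quot hI), (qpi hI).
have psurj (y : quot hI) : exists x, qpi hI x = y by exists (qrepr y); exact: qreprK.
have pk x : qpi hI x = 0 -> fam_ideal f x.
  by move=> e; have := (qpiP hI x 0).1; rewrite subr0; apply; rewrite -[LHS]/(qpi hI x) e -(rmorph0 (qpi hI)).
have [q eq] : exists q, hcomp q (qpi hI) = zh.
  apply: hom_quot => // x /pk [c ->]; rewrite rmorph_sum big1 // => ij _.
  by rewrite !rmorphM zd mul0r mulr0.
exists q; split=> //.
- move=> x y; have [x' <-] := psurj x; have [y' <-] := psurj y.
  rewrite -!hcompE eq => h1 h2; rewrite -rmorphM -(rmorph0 (qpi hI)).
  by apply/(qpiP hI); rewrite subr0; exact: sq.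
- move=> C g hg; apply: hom_quot => // x /pk [c ->]; rewrite rmorph_sum big1 // => ij _.
  by rewrite rmorphM /f [g (_ * _)]rmorphM hg ?mulr0.
Qed.

(** The translate by lam(x) of the universal first-order point has finitely many coordinates in
    A[M], each of finite support. A tangent vector of weight m is a specialization of that point, so
    m occurs in one of the supports. *)
Lemma weights_finite : exists F : seq M, forall (psi : hom U (dual k0)) (m : M) (a b : hom U (dual L)),
  (forall u, sq0 (psi u) = zh u) ->
  (forall u, a u = @Sqz k L (self_alg L) (ma_c M (zh u)) (ma_c M (sq1 (psi u)))) ->
  (forall u, b u = @Sqz k L (self_alg L) (ma_c M (zh u)) (ma_d m (sq1 (psi u) : k))) ->
  aH _ (lam (hcomp (din L) (xpt M kz))) (kmap a uV) = kmap b uV ->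
  (exists u, sq1 (psi u) != 0) -> m \in F.
Proof.
have [A [p [q [psurj eqp qsq puniv]]]] := first_order_nbhd.
pose AM : alg k := restr (mona A M).
pose cst : hom A AM := restr_str (mona A M).
have xA0 : (ma_d 0 1 : AM) = 1 by [].
have xAD m n : (ma_d (m + n) 1 : AM) = ma_d m 1 * ma_d n 1 by rewrite ma_dM mulr1.
pose xA : hom TT AM := @tpt k M AM (fun m => ma_d m 1) xA0 xAD.
pose gL : hom A L := hcomp (kin L) q.
have [red [redE redc redx]] : exists red : hom AM L, [/\ forall (f : monalg A M) m, (red f : monalg kz M) m = q (f m),
    hcomp red cst = gL & hcomp red xA = xpt M kz].
  have x0 : (ma_d 0 1 : along gL) = 1 by [].
  have xD m n : (ma_d (m + n) 1 : along gL) = ma_d m 1 * ma_d n 1 by rewrite ma_dM mulr1.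
  pose e := mona_ev (D := along gL) (chi := fun m => ma_d m 1) x0 xD.
  have ek c : e (alg_str AM c) = alg_str L c.
    by rewrite -[LHS]/(e (alg_str (mona A M) (alg_str A c))) homE -[LHS]/(gL (alg_str A c)) homE.
  pose red := @hom_of k AM L e (rmorphD e) (rmorphM e) ek.
  have rE (f : monalg A M) m : (red f : monalg kz M) m = q (f m).
    rewrite -[red f]/(\sum_(i <- supp f) (ma_c M (q (f i)) * ma_d i 1 : monalg kz M)) ma_coef_sum.
    rewrite (eq_bigr (fun i => (if i == m then q (f i) else 0) : k)); last first.
      by move=> i _; rewrite monaMd /= eq_sym; case: eqP; rewrite ?mulr1 ?mulr0.
    rewrite -[LHS]/(pr (fun i a => if i == m then q a else 0) f) [in RHS](coefE f m).
    rewrite /pr rmorph_sum; apply: eq_bigr => i _.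
    by case: eqP => _; rewrite ?rmorph0.
  exists red; split=> //.
    apply: hom_ext => c; exact: (homE e).
  apply: tv_ext => m; rewrite tv_nat xptE [tv xA m]tptE.
  by apply: monalg_ext => n; rewrite rE /=; case: eqP => _; rewrite ?rmorph1 ?rmorph0.
have [th eth] : in_chart uV (aH AM (lam xA) (kmap (hcomp cst p) uV)).
  apply: (in_chart_local hu (r := red)).
  - move=> f; have fin : finsup (fun m => alg_str A ((f : monalg kz M) m)).
      exists (supp (f : monalg kz M)) => m; apply: contraNT => hm.
      have -> : (f : monalg kz M) m = 0 by apply/eqP; apply: contraNT hm => /suppP.
      by rewrite rmorph0.
    exists (MonAlg fin : monalg A M); apply: monalg_ext => m; rewrite redE /=.
    exact: (homE q).
  - move=> f ef; pose d : AM := f - 1.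
    have d0 m : q ((d : monalg A M) m) = 0.
      by rewrite -redE /d rmorphB ef rmorph1 subrr.
    have dd : d * d = 0.
      apply: monalg_ext => m; rewrite -[LHS]/(ma_mulf d d m) /ma_mulf.
      rewrite (@eq_pr_supp _ _ _ _ (fun _ _ => 0)) => [|i]; first exact: pr0.
      rewrite (@eq_pr_supp _ _ _ _ (fun _ _ => 0)) => [|j]; first exact: pr0.
      by rewrite qsq // if_same.
    exists (1 - d); have -> : f = 1 + d by rewrite /d addrC subrK.
    by rewrite -[RHS]subr0 -dd; ring.
  - rewrite act_nat lnat -kmap_comp hcompA redc redx -hcompA eqp.
    have -> : aH L (lam (xpt M kz)) (kmap (hcomp (kin L) zh) uV) = kmap (hcomp (kin L) zh) uV.
      by rewrite (zh_zC ezh) lfix.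
    by exists (hcomp (kin L) zh).
exists (flatten [seq supp (th (bu i) : monalg A M) | i <- enum 'I_nu]).
move=> psi m a b psi0 ea eb eab [u hu0].
have [pb epb] : exists pb : hom A (dual k0), hcomp pb p = psi.
  apply: puniv => x y hx hy; apply: sqz_ext.
    by rewrite /= !psi0 hx mul0r.
  by rewrite -[LHS]/(sq0 (psi x) * sq1 (psi y) + sq0 (psi y) * sq1 (psi x)) !psi0 hx hy !mul0r addr0.
pose g : hom A (dual L) := hcomp (dmap (kin L)) pb.
pose ch m : along g := din L (ma_d m 1 : monalg kz M).
have ch0 : ch 0 = 1 by exact: rmorph1 (din L).
have chD m1 m2 : ch (m1 + m2) = ch m1 * ch m2.
  rewrite /ch -[RHS]/(din L (ma_d m1 1 : monalg kz M) * din L (ma_d m2 1 : monalg kz M)) -rmorphM.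
  congr (din L _).
  by have := @ma_dM kz M m1 m2 1 1; rewrite mulr1 => e1; exact/esym/e1.
pose e0 := mona_ev (D := along g) (chi := ch) ch0 chD.
have ek c : e0 (alg_str AM c) = alg_str (dual L) c.
  by rewrite -[LHS]/(e0 (alg_str (mona A M) (alg_str A c))) homE -[LHS]/(g (alg_str A c)) homE.
pose e := @hom_of k AM (dual L) e0 (rmorphD e0) (rmorphM e0) ek.
have e_cst : hcomp e cst = g by apply: hom_ext => c; exact: (homE e0).
have e_x : hcomp e xA = hcomp (din L) (xpt M kz).
  apply: tv_ext => n; rewrite !tv_nat xptE [tv xA n]tptE -[LHS]/(e0 (ma_d n 1)) mona_ev_d rmorph1 mul1r.
  by [].
have eth' : hcomp e th = b.
  apply: (chart_inj hu); rewrite (kmap_comp e) eth act_nat lnat e_x -eab -kmap_comp hcompA e_cst.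
  congr (aH _ _ (kmap _ uV)); apply: hom_ext => v.
  by rewrite -[LHS]/(dmap (kin L) (hcomp pb p v)) epb ea -psi0.
have eE (F : monalg A M) n : F n = 0 -> (sq1 (e F) : monalg kz M) n = 0.
  move=> Fn; rewrite -[e F]/(\sum_(i <- supp F) (g (F i) * ch i : dual L)).
  elim: (supp F) => [|i s IH]; first by rewrite big_nil.
  rewrite big_cons -[LHS]/((sq1 (g (F i) * ch i) : monalg kz M) n + (sq1 (\sum_(j <- s) (g (F j) * ch j : dual L)) : monalg kz M) n).
  rewrite IH addr0.
  have -> : sq1 (g (F i) * ch i : dual L) = (ma_c M (sq1 (pb (F i))) * ma_d i 1 : monalg kz M).
    rewrite -[LHS]/(sq0 (g (F i)) * 0 + (ma_d i 1 : monalg kz M) * (ma_c M (sq1 (pb (F i))) : monalg kz M)).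
    by rewrite mulr0 add0r mulrC.
  rewrite monaMd /=; case: eqP => [<-|_]; last by rewrite mulr0.
  by rewrite Fn rmorph0 mul0r.
have [i hi] : exists i, sq1 (psi (bu i)) != 0.
  apply: contrapT => hn; case/eqP: hu0.
  have E : psi = hcomp (din k0) zh.
    apply: (fg_hom_ext bU) => i; apply: sqz_ext; first exact: psi0.
    by apply/eqP; apply: contraT => hi; case: hn; exists i.
  by rewrite E.
apply/flattenP; exists (supp (th (bu i) : monalg A M)); first by apply/mapP; exists i; rewrite ?mem_enum.
apply: suppP; apply: contraNneq hi => h0.
have := eE _ m h0; rewrite -[e _]/(hcomp e th (bu i)) eth' eb /= eqxx => ->.
by [].
Qed.
End Weights.

(** * Weight projection and gauge transformations *)

(* [B + e C] for a [B]-algebra [C], between [B[e]] and [C[e]]. *)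
Section MixedDual.
Variables (k : fieldType) (B C : alg k) (h : hom B C).
Hypothesis h_inj : injective h.
Let Sm : alg k := @sqz k B (along h).

Definition mixed_inc : hom Sm (dual C) :=
  @sqz_map k B C (along h) (self_alg C) h (fun d => d) (fun x y => erefl) (fun b d => erefl).

Lemma mixed_inc_inj : injective mixed_inc.
Proof. by move=> x y e; apply: sqz_ext; [apply: h_inj; exact: (congr1 (fun w : dual C => sq0 w) e) | exact: (congr1 (fun w : dual C => sq1 w) e)]. Qed.

Lemma mixed_factor (A : alg k) (g : hom A (dual C)) : (forall a, exists b, sq0 (g a) = h b) ->
  exists g' : hom A Sm, hcomp mixed_inc g' = g.
Proof.
move=> hg; apply: hom_factor => [|a]; first exact: mixed_inc_inj.
have [b eb] := hg a; exists (@Sqz k B (along h) b (sq1 (g a))).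
by apply: sqz_ext => //=; rewrite -eb.
Qed.

Variable phi : C -> B.
Hypothesis phiD : forall x y, phi (x + y) = phi x + phi y.
Hypothesis phiZ : forall b x, phi (h b * x) = b * phi x.

Definition mixed_fun : hom Sm (dual B) :=
  @sqz_map k B B (along h) (self_alg B) (hid B) phi phiD phiZ.

Lemma mixed_funE (A : alg k) (g : hom A (dual C)) (g' : hom A Sm) : hcomp mixed_inc g' = g ->
  forall a b, sq0 (g a) = h b ->
  hcomp mixed_fun g' a = @Sqz k B (self_alg B) b (phi (sq1 (g a))).
Proof.
move=> <- a b e; rewrite !hcompE; apply: sqz_ext => //=.
exact: h_inj.
Qed.

Variables (G : grp k) (H : kfun k) (aH : gaction G H).

(** The infinitesimal action is linear, so [phi] may be applied to the infinitesimal parts of both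
    sides. The identity is first descended to B + e C, from which [phi] is a ring map to B[e]; the
    chart makes the descent injective. *)
Lemma mixed_act (z : H (self_alg k)) (U : alg k) (uV : H U) (g : hom (gring G) (dual C)) (T : hom U (dual C)) :
  open_immersion uV ->
  (forall a, exists b, sq0 (g a) = h b) -> (forall u, exists b, sq0 (T u) = h b) ->
  aH _ g (zC z _) = kmap T uV -> in_chart uV (aH _ (hcomp (dpr C) g) (zC z C)) ->
  (forall (y : H B), in_chart uV (kmap h y) -> in_chart uV y) ->
  exists (g' : hom (gring G) (dual B)) (T' : hom U (dual B)),
  [/\ forall a b, sq0 (g a) = h b -> g' a = @Sqz k B (self_alg B) b (phi (sq1 (g a))),
      forall u b, sq0 (T u) = h b -> T' u = @Sqz k B (self_alg B) b (phi (sq1 (T u))) &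
      aH _ g' (zC z _) = kmap T' uV].
Proof.
move=> hu hg hT e ic ich; have [g1 eg1] := mixed_factor hg; have [T1 eT1] := mixed_factor hT.
exists (hcomp mixed_fun g1), (hcomp mixed_fun T1); split; [exact: mixed_funE|exact: mixed_funE|].
rewrite kmap_comp -(zC_nat z mixed_fun) -act_natE; congr (kmap mixed_fun _).
apply: (chart_descend hu mixed_inc_inj).
  apply: (in_chart_local hu (r := sqz_pr (along h))).
  - exact: sqz_pr_surj.
  - exact: sqz_pr_unit.
  - apply: ich; rewrite -kmap_comp.
    have -> : hcomp h (sqz_pr (along h)) = hcomp (dpr C) mixed_inc by exact: hom_ext.
    by rewrite kmap_comp act_nat eg1 zC_nat act_nat zC_nat.
by rewrite act_nat eg1 zC_nat -kmap_comp eT1.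
Qed.

Lemma mixed_act2 (U : alg k) (uV : H U) (g : hom (gring G) (dual C)) (T0 T : hom U (dual C)) :
  open_immersion uV ->
  (forall a, exists b, sq0 (g a) = h b) -> (forall u, exists b, sq0 (T0 u) = h b) ->
  (forall u, exists b, sq0 (T u) = h b) ->
  aH _ g (kmap T0 uV) = kmap T uV ->
  (forall (y : H B), in_chart uV (kmap h y) -> in_chart uV y) ->
  exists (g' : hom (gring G) (dual B)) (T0' T' : hom U (dual B)),
  [/\ forall a b, sq0 (g a) = h b -> g' a = @Sqz k B (self_alg B) b (phi (sq1 (g a))),
      forall u b, sq0 (T0 u) = h b -> T0' u = @Sqz k B (self_alg B) b (phi (sq1 (T0 u))),
      forall u b, sq0 (T u) = h b -> T' u = @Sqz k B (self_alg B) b (phi (sq1 (T u))) &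
      aH _ g' (kmap T0' uV) = kmap T' uV].
Proof.
move=> hu hg hT0 hT e ich; have [g1 eg1] := mixed_factor hg.
have [S1 eS1] := mixed_factor hT0; have [T1 eT1] := mixed_factor hT.
have e1 : kmap mixed_inc (aH _ g1 (kmap S1 uV)) = kmap T uV.
  by rewrite act_nat eg1 -kmap_comp eS1.
exists (hcomp mixed_fun g1), (hcomp mixed_fun S1), (hcomp mixed_fun T1).
split; [exact: mixed_funE|exact: mixed_funE|exact: mixed_funE|].
rewrite !kmap_comp -act_natE; congr (kmap mixed_fun _).
apply: (chart_descend hu mixed_inc_inj); last by rewrite e1 -kmap_comp eT1.
apply: (in_chart_local hu (r := sqz_pr (along h))).
- exact: sqz_pr_surj.
- exact: sqz_pr_unit.
apply: ich; rewrite -kmap_comp.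
have -> : hcomp h (sqz_pr (along h)) = hcomp (dpr C) mixed_inc by exact: hom_ext.
by rewrite kmap_comp e1 -kmap_comp; eexists.
Qed.

Lemma mixed_conj (m : hom (gring G) B) (g1 g2 : hom (gring G) (dual C)) :
  (forall a, exists b, sq0 (g1 a) = h b) -> (forall a, exists b, sq0 (g2 a) = h b) ->
  g1 = gmul (hcomp (din C) (hcomp h m)) (gmul g2 (ginv (hcomp (din C) (hcomp h m)))) ->
  exists g1' g2' : hom (gring G) (dual B),
  [/\ forall a b, sq0 (g1 a) = h b -> g1' a = @Sqz k B (self_alg B) b (phi (sq1 (g1 a))),
      forall a b, sq0 (g2 a) = h b -> g2' a = @Sqz k B (self_alg B) b (phi (sq1 (g2 a))) &
      g1' = gmul (hcomp (din B) m) (gmul g2' (ginv (hcomp (din B) m)))].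
Proof.
move=> hg1 hg2 e; have [f1 ef1] := mixed_factor hg1; have [f2 ef2] := mixed_factor hg2.
exists (hcomp mixed_fun f1), (hcomp mixed_fun f2); split; [exact: mixed_funE|exact: mixed_funE|].
have einh : hcomp mixed_inc (sqz_inh (along h)) = hcomp (din C) h by apply: hom_ext => x; exact: sqz_ext.
have finh : hcomp mixed_fun (sqz_inh (along h)) = din B.
  apply: hom_ext => x; apply: sqz_ext => //=.
  by have := phiD 0 0; rewrite addr0 -[X in X = _]addr0 => /addrI <-.
have -> : f1 = gmul (hcomp (sqz_inh (along h)) m) (gmul f2 (ginv (hcomp (sqz_inh (along h)) m))).
  apply: hom_ext => a; apply: mixed_inc_inj; rewrite -[LHS]/(hcomp mixed_inc f1 a) ef1 e.
  rewrite -[RHS]/(hcomp mixed_inc (gmul _ _) a) !gmul_nat ef2 ginv_nat !hcompA einh.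
  by [].
by rewrite !gmul_nat ginv_nat !hcompA finh.
Qed.
End MixedDual.

Section WeightParts.
Variables (k : closedFieldType) (M : zmodType).
Variables (G : grp k).
Local Notation TT := (gring (torus k M)).
Local Notation GG := (gring G).
Local Notation k0 := (self_alg k).
Local Notation kz := (kz k).
Local Notation Lz := (mnz M kz).
Local Notation L := (nza (mnz M kz)).
Variables (lam : forall C : alg k, hom TT C -> hom GG C).
Hypothesis lnat : forall (C D : alg k) (h : hom C D) (a : hom TT C), hcomp h (lam a) = lam (hcomp h a).
Hypothesis lM : forall (C : alg k) (a a' : hom TT C), lam (gmul a a') = gmul (lam a) (lam a').

Definition cj (C : alg k) (y : hom TT C) (g : hom GG C) := gmul (lam y) (gmul g (ginv (lam y))).

Lemma cj_nat (C D : alg k) (h : hom C D) y g : hcomp h (cj y g) = cj (hcomp h y) (hcomp h g).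
Proof. by rewrite /cj !gmul_nat ginv_nat lnat. Qed.

Lemma cjM (C : alg k) (y y' : hom TT C) g : cj (gmul y y') g = cj y (cj y' g).
Proof. by rewrite /cj lM ginvM !gmulA. Qed.

Lemma cj1 (C : alg k) (y : hom TT C) : cj y (gone G C) = gone G C.
Proof. by rewrite /cj gmul1 gmul_rV. Qed.

Variable g : hom GG (dual k0).
Hypothesis g1 : hcomp (dpr k0) g = gone G k0.

Definition cjg (C : alg k) (y : hom TT C) : hom GG (dual C) := cj (hcomp (din C) y) (hcomp (dmap (kin C)) g).

Lemma cjg_nat (C D : alg k) (h : hom C D) y : hcomp (dmap h) (cjg y) = cjg (hcomp h y).
Proof.
rewrite /cjg cj_nat !hcompA dmap_din dmap_comp; congr (cj _ (hcomp (dmap _) g)).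
exact: kin_uniq.
Qed.

Lemma cjg_pr (C : alg k) (y : hom TT C) : hcomp (dpr C) (cjg y) = gone G C.
Proof. by rewrite /cjg cj_nat [X in cj _ X]hcompA dpr_dmap -hcompA g1 gone_nat cj1. Qed.

Lemma cjg_sq0 (C : alg k) (y : hom TT C) a : sq0 (cjg y a) = alg_str C (gone G k0 a).
Proof.
have := congr1 (fun w : hom GG C => w a) (cjg_pr y); rewrite -(gone_nat G (kin C)).
by [].
Qed.

(** The adjoint orbit of the Lie algebra element g, as a function on T; its coefficients are the
    weight components of g. *)
Definition xi (a : GG) : monalg kz M := sq1 (cjg (xpt M kz) a).

Lemma coefm_Z (R : nzalg k) m (b : nza R) (x : nza (mnz M R)) : ((mst M R b * x : nza (mnz M R)) : monalg R M) m = b * (x : monalg R M) m.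
Proof. exact: monaMd. Qed.
Lemma mst_inj (R : nzalg k) : injective (mst M R).
Proof. by move=> x y /(congr1 (fun f : monalg R M => f 0)); rewrite /= eqxx. Qed.

(** With two torus variables, conjugation by lam(y) carries the adjoint orbit at x to that at yx,
    whose coefficient of x^m is multiplied by y^m. Extracting this coefficient by [mixed_conj] gives
    the eigenvector property. *)
Lemma weight_part m : exists gm : hom GG (dual k0),
  [/\ forall a, gm a = @Sqz k k0 (self_alg k0) (gone G k0 a) (xi a m), hcomp (dpr k0) gm = gone G k0 &
   forall a, cj (hcomp (din L) (xpt M kz)) (hcomp (dmap (kin L)) gm) a =
     @Sqz k L (self_alg L) (ma_c M (gone G k0 a)) (ma_d m (xi a m))].
Proof.
pose R2 := mnz M Lz; pose y2 := xpt M kz.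
have E0 : hcomp (twT y2) (xpt M kz) = gmul (hcomp (mst M Lz) y2) (xpt M Lz).
  apply: tv_ext => n; rewrite tv_nat tvM tv_nat !xptE; apply: monalg_ext => i.
  rewrite twTE -[RHS]/((ma_c M (ma_d n 1 : monalg kz M) * ma_d n 1 : monalg Lz M) i) monaMd /= xptE.
  by case: eqP => [->|_]; rewrite ?mulr1 ?mulr0 ?rmorph1 ?mul1r // rmorph0 mul0r.
have E1 : hcomp (twT (gone _ L)) (xpt M kz) = xpt M Lz.
  apply: tv_ext => n; rewrite tv_nat !xptE; apply: monalg_ext => i; rewrite twTE tv1 mulr1 /=.
  by case: eqP => _; rewrite ?rmorph1 ?rmorph0.
pose X1 := hcomp (dmap (twT y2)) (cjg (xpt M kz)).
pose X2 := hcomp (dmap (twT (gone _ L))) (cjg (xpt M kz)).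
have eX1 : X1 = cj (hcomp (din (nza R2)) (hcomp (mst M Lz) y2)) (cjg (xpt M Lz)).
  apply: etrans (cjg_nat (twT y2) (xpt M kz)) _.
  apply: etrans (congr1 (@cjg (nza R2)) E0) _.
  apply: etrans (congr1 (fun w => cj w _) (gmul_nat (din (nza R2)) _ _)) _.
  exact: cjM.
have eX2 : X2 = cjg (xpt M Lz) := etrans (cjg_nat (twT (gone _ L)) (xpt M kz)) (congr1 (@cjg (nza R2)) E1).
have el : lam (hcomp (din (nza R2)) (hcomp (mst M Lz) y2)) = hcomp (din (nza R2)) (hcomp (mst M Lz) (lam y2)).
  exact: esym (etrans (congr1 (hcomp (din (nza R2))) (lnat (mst M Lz) y2)) (lnat (din (nza R2)) _)).
have eX : X1 = gmul (hcomp (din (nza R2)) (hcomp (mst M Lz) (lam y2)))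
     (gmul X2 (ginv (hcomp (din (nza R2)) (hcomp (mst M Lz) (lam y2))))).
  by apply: etrans eX1 _; rewrite /cj el eX2.
have s0 w : hcomp (w : hom L (nza R2)) (kin L) = hcomp (mst M Lz) (kin L) by exact: kin_uniq.
have sX (w : hom L (nza R2)) a : sq0 (hcomp (dmap w) (cjg (xpt M kz)) a) = mst M Lz (ma_c M (gone G k0 a)).
  rewrite -[LHS]/(w (sq0 (cjg (xpt M kz) a))) cjg_sq0.
  exact: (congr1 (fun v : hom k0 (nza R2) => v (gone G k0 a)) (s0 w)).
have [||X1' [X2' [e1 e2 e3]]] := mixed_conj (@mst_inj Lz) (fun x y => erefl) (@coefm_Z Lz m) _ _ eX.
- by move=> a; exists (ma_c M (gone G k0 a)); exact: sX.
- by move=> a; exists (ma_c M (gone G k0 a)); exact: sX.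
have kinj : injective (kin L).
  by move=> x y /(congr1 (fun f : L => (f : monalg kz M) 0)); rewrite /= eqxx.
pose ph (x : L) : k0 := (x : monalg kz M) m.
have phD (x y : L) : ph (x + y) = ph x + ph y by [].
have phZ (b : k0) (x : L) : ph (kin L b * x) = b * ph x by exact: (@coefm_Z kz m b x).
have [f ef] := @mixed_factor k k0 L (kin L) kinj GG (cjg (xpt M kz)) (fun a => ex_intro _ (gone G k0 a) (cjg_sq0 _ a)).
pose gm := hcomp (mixed_fun (h := kin L) phD phZ) f.
have gmE a : gm a = @Sqz k k0 (self_alg k0) (gone G k0 a) (xi a m).
  by apply: etrans (mixed_funE kinj phD phZ ef (cjg_sq0 (xpt M kz) a)) _.
exists gm; split=> //; first by apply: hom_ext => a; rewrite hcompE gmE.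
move=> a; have E2 : hcomp (dmap (kin L)) gm = X2'.
  apply: hom_ext => c; rewrite (e2 c _ (sX _ c)) hcompE gmE; apply: sqz_ext => //=.
  by rewrite -[RHS]/((twT (gone _ L) (xi c) : monalg Lz M) m) twTE tv1 mulr1.
rewrite E2 /cj -(lnat (din L)) -e3 (e1 a _ (sX _ a)); apply: sqz_ext => //=.
rewrite -[LHS]/((twT y2 (xi a) : monalg Lz M) m) twTE xptE; apply: monalg_ext => i.
by rewrite -[LHS]/((ma_c M (xi a m) * ma_d m 1 : monalg kz M) i) monaMd /=; case: eqP; rewrite ?mulr1 ?mulr0.
Qed.

End WeightParts.

Section Projection.
Variables (k : closedFieldType) (M : zmodType).
Variables (G : grp k) (H : kfun k) (aH : gaction G H).
Local Notation TT := (gring (torus k M)).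
Local Notation GG := (gring G).
Local Notation k0 := (self_alg k).
Local Notation kz := (kz k).
Local Notation Lz := (mnz M kz).
Local Notation L := (nza (mnz M kz)).
Variables (z : H k0) (lam : forall C : alg k, hom TT C -> hom GG C).
Hypothesis lnat : forall (C D : alg k) (h : hom C D) (a : hom TT C), hcomp h (lam a) = lam (hcomp h a).
Hypothesis lM : forall (C : alg k) (a a' : hom TT C), lam (gmul a a') = gmul (lam a) (lam a').
Hypothesis lfix : forall (C : alg k) (a : hom TT C), aH C (lam a) (zC z C) = zC z C.
Variables (U : alg k) (uV : H U) (hu : open_immersion uV) (zh : hom U k0).
Hypothesis ezh : kmap zh uV = z.

Lemma zh_in (C : alg k) : in_chart uV (zC z C).
Proof. by exists (hcomp (kin C) zh); rewrite (zh_zC ezh). Qed.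

Section Weights.
Variables (AA : nat -> set M) (hA : admissible AA) (f : H (pser k)).
Hypothesis f0 : kmap (closed_point k) f = z.
Variable ph : hom U (WW hA kz).
Hypothesis eph : kmap (hcomp (Winc hA kz) ph) uV = orb aH lam f.
Variables (j : nat) (j0 : (0 < j)%N) (De : set M).
Hypothesis De_ext : forall i m n, (0 < i)%N -> (i < j)%N -> AA i m -> AA (j - i)%N n -> ~ De (m + n).

Definition wt_at (g : hom GG (dual k0)) m := forall a,
  cj lam (hcomp (din L) (xpt M kz)) (hcomp (dmap (kin L)) g) a =
  @Sqz k L (self_alg L) (ma_c M (gone G k0 a)) (ma_d m (sq1 (g a))).

(** As [lam] fixes z, translating the identity g z = T by lam(x) conjugates g and twists T. The
    coefficient of x^m is the same identity for the components of weight m. *)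
Lemma weight_projection (g : hom GG (dual k0)) (T : hom U (dual k0)) m : De m ->
  hcomp (dpr k0) g = gone G k0 ->
  (forall u, T u = @Sqz k k0 (self_alg k0) (zh u) (dsumT De (gone _ (nza kz)) (cf ph j u))) ->
  aH _ g (zC z _) = kmap T uV ->
  exists (gm : hom GG (dual k0)) (Tm : hom U (dual k0)),
  [/\ hcomp (dpr k0) gm = gone G k0, wt_at gm m, aH _ gm (zC z _) = kmap Tm uV &
      forall u, Tm u = @Sqz k k0 (self_alg k0) (zh u) ((cf ph j u : monalg kz M) m)].
Proof.
move=> Dm g1 eT egT; pose y := xpt M kz.
have eTL : hcomp (dmap (kin L)) T = tz ph j0 De_ext (gone _ L).
  apply: hom_ext => u; rewrite (tzE lnat lfix hu ezh f0 eph j0 De_ext) hcompE eT; apply: sqz_ext => //=.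
  rewrite /dsumT /pr rmorph_sum; apply: eq_bigr => i _; case: asboolP => _; last by rewrite rmorph0.
  by rewrite rmorphM !tv1 rmorph1.
have e1 : aH _ (cjg lam g y) (zC z _) = kmap (tz ph j0 De_ext y) uV.
  rewrite /cjg /cj !actM -(tz_act lnat lM lfix hu ezh f0 eph j0 De_ext) -eTL kmap_comp -egT act_natE zC_nat.
  congr (aH _ _ (aH _ _ _)).
  have := lfix (hcomp (din L) y); rewrite -{2}(lfix (hcomp (din L) y)) => e.
  by rewrite -[in LHS](lfix (hcomp (din L) y)) -actM gmulV act1.
have kinj : injective (kin L).
  by move=> a b /(congr1 (fun f : L => (f : monalg kz M) 0)); rewrite /= eqxx.
pose phm (x : L) : k0 := (x : monalg kz M) m.
have phD (a b : L) : phm (a + b) = phm a + phm b by [].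
have phZ (b : k0) (x : L) : phm (kin L b * x) = b * phm x by exact: (@coefm_Z k M kz m b x).
have s1 a : sq0 (cjg lam g y a) = kin L (gone G k0 a) by exact: (cjg_sq0 lnat g1).
have s2 u : sq0 (tz ph j0 De_ext y u) = kin L (zh u).
  by rewrite (tzE lnat lfix hu ezh f0 eph j0 De_ext).
have [||||g' [T' [eg' eT' e']]] := @mixed_act k k0 L (kin L) kinj phm phD phZ G H aH z U uV (cjg lam g y) (tz ph j0 De_ext y) hu _ _ e1.
- by move=> a; exists (gone G k0 a).
- by move=> u; exists (zh u).
- by rewrite (cjg_pr lnat g1) act1; exact: zh_in.
- by move=> x; apply: (in_chart_inj hu); [split=> [|c c0]; [exact: oner_neq0 | by exists c^-1; exact: mulfV] | exact: oner_neq0].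
have [gm [egm gm1 wgm]] := weight_part lnat lM g1 m.
exists gm, T'; split=> //.
- by move=> a; rewrite wgm egm.
- have -> : gm = g' by apply: hom_ext => a; rewrite egm (eg' _ _ (s1 a)).
  exact: e'.
move=> u; rewrite (eT' _ _ (s2 u)); congr Sqz; rewrite (tzE lnat lfix hu ezh f0 eph j0 De_ext) /=.
rewrite /phm -[dsumT De y _]/(dsumT (R := Lz) De y (cf ph j u)) /dsumT /pr.
rewrite (ma_coef_sum _ _ m); set c := cf ph j u.
have F0 i : (if `[< De i >] then nz_str Lz (c i) * tv y i else 0 : monalg kz M) m = if i == m then c i else 0.
  case: asboolP => [Di|nDi]; last by case: eqP => // e; case: nDi; rewrite e.
  by rewrite -[LHS]/((ma_c M (c i) * tv y i : monalg kz M) m) monaMd xptE /= eq_sym; case: eqP; rewrite ?mulr1 ?mulr0.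
rewrite (eq_bigr _ (fun i _ => F0 i)).
case: (eqVneq (c m) 0) => [e|ne].
  by rewrite e big1 // => i _; case: eqP => // ->.
rewrite (bigD1_seq m) ?(suppP ne) ?supp_uniq //= eqxx big1 ?addr0 // => i.
by move=> /negbTE ->.
Qed.
End Weights.

(** * Exponentials of weight vectors of the Lie algebra *)

Section Derivative.
Variable R : comNzRingType.

Definition fder (f : fps R) : fps R := Fps (fun i => fcoef f i.+1 *+ i.+1).

Lemma fderD f g : fder (f + g) = fder f + fder g.
Proof. by apply: fps_ext => i; rewrite fps_coefD /= mulrnDl. Qed.

Lemma fderC c : fder (fps_const c) = 0.
Proof. by apply: fps_ext => i; rewrite /= coefC mul0rn. Qed.

Lemma fderM f g : fder (f * g) = f * fder g + g * fder f.
Proof.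
apply: fps_ext => n; rewrite fps_coefD [g * _]mulrC !fps_coefM.
rewrite -[LHS]/(fcoef (f * g) n.+1 *+ n.+1) fps_coefM -sumrMnl.
transitivity (\sum_(i < n.+2) fcoef f i * fcoef g (n.+1 - i) *+ (n.+1 - i) +
              \sum_(i < n.+2) fcoef f i * fcoef g (n.+1 - i) *+ i).
  by rewrite -big_split; apply: eq_bigr => i _ /=; rewrite -mulrnDr subnK // -ltnS.
congr (_ + _).
  rewrite big_ord_recr /= subnn mulr0n addr0; apply: eq_bigr => i _.
  by rewrite (subSn (_ : (i <= n)%N)) ?mulrnAr // -ltnS.
rewrite big_ord_recl mulr0n add0r; apply: eq_bigr => i _.
by rewrite lift0 subSS mulrnAl.
Qed.
End Derivative.

Section Exponential.
Local Notation FL := (fpsA (mnz M kz)).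

Definition fder_hom : hom FL (dual FL).
Proof.
refine (@hom_of k FL (dual FL) (fun f => @Sqz k FL (self_alg FL) f (fder f)) _ _ _).
- by move=> x y; apply: sqz_ext; rewrite //= fderD.
- by move=> x y; apply: sqz_ext; rewrite //= fderM.
- by move=> c; apply: sqz_ext => //; exact: fderC.
Defined.

Lemma fder_cst : hcomp fder_hom (fcst Lz) = hcomp (din FL) (fcst Lz).
Proof. by apply: hom_ext => c; apply: sqz_ext => //; exact: fderC. Qed.

Variable eta : hom GG (dual k0).
Hypothesis eta1 : hcomp (dpr k0) eta = gone G k0.
Hypothesis char0 : [pchar k] =i pred0.

Definition linv (C : alg k) (g : hom GG C) : hom GG (dual C) :=
  gmul (hcomp (din C) g) (hcomp (dmap (kin C)) eta).

Lemma linv_nat (C D : alg k) (h : hom C D) g : hcomp (dmap h) (linv g) = linv (hcomp h g).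
Proof.
rewrite /linv gmul_nat !hcompA dmap_din dmap_comp; congr (gmul _ (hcomp (dmap _) _)).
exact: kin_uniq.
Qed.

(* the left-invariant derivation of [GG] defined by [eta] *)
Definition lder (a : GG) : GG := sq1 (linv (hid GG) a).

Lemma linvE (C : alg k) (g : hom GG C) a : linv g a = @Sqz k C (self_alg C) (g a) (g (lder a)).
Proof.
have e0 : sq0 (linv (hid GG) a) = a.
  have := congr1 (fun w : hom GG GG => w a) (_ : hcomp (dpr GG) (linv (hid GG)) = hid GG); apply.
  rewrite /linv gmul_nat !hcompA dpr_din hcomp1f dpr_dmap -hcompA eta1 gone_nat.
  exact: gmul_r1.
have := congr1 (fun w : hom GG (dual C) => w a) (linv_nat g (hid GG)).
rewrite hcompf1 => <-; apply: sqz_ext => //=.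
by rewrite e0.
Qed.

Lemma lderD a b : lder (a + b) = lder a + lder b. Proof. by rewrite /lder rmorphD. Qed.
Lemma lderM a b : lder (a * b) = a * lder b + b * lder a.
Proof.
have := congr1 (fun w : dual GG => sq1 w) (rmorphM (linv (hid GG)) a b).
by rewrite !linvE.
Qed.
Lemma lderC c : lder (alg_str GG c) = 0.
Proof.
rewrite /lder homE /=.
by [].
Qed.

(** The Taylor coefficient of the function a along exp(t eta). *)
Definition expc i a : k := gone G k0 (iter i lder a) / (i`!)%:R.

Lemma char0_neq0 n : (n.+1%:R : k) != 0.
Proof. by rewrite ((pcharf0P k).1 char0). Qed.

Lemma expcS i a : expc i.+1 a *+ i.+1 = expc i (lder a).
Proof.
rewrite /expc -iterSr factS natrM invfM mulrA -[LHS]mulr_natr.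
by rewrite [LHS]mulrAC divfK // char0_neq0.
Qed.

Definition expf a : fps k := Fps (fun i => expc i a).

Lemma fder_expf a : fder (expf a) = expf (lder a).
Proof. by apply: fps_ext => i; exact: expcS. Qed.

Lemma mulSn_inj n (x y : k) : x *+ n.+1 = y *+ n.+1 -> x = y.
Proof. by move=> e; apply: (mulIf (char0_neq0 n)); rewrite !mulr_natr. Qed.

Lemma fder_uniq (f g : fps k) : fcoef f 0 = fcoef g 0 -> fder f = fder g -> f = g.
Proof.
move=> e0 e; apply: fps_ext => -[//|i].
by apply: (@mulSn_inj i); exact: (congr1 (fun w : fps k => fcoef w i) e).
Qed.

Lemma expf0 a : fcoef (expf a) 0 = gone G k0 a.
Proof. by rewrite /= /expc fact0 divr1. Qed.

Lemma expfD a b : expf (a + b) = expf a + expf b.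
Proof.
apply: fps_ext => i; rewrite fps_coefD /= /expc -mulrDl -rmorphD; congr (gone G k0 _ / _).
by elim: i => //= i ->; rewrite lderD.
Qed.

(** Induction on the order: by the Leibniz rule both sides satisfy the same first-order differential
    equation, and in characteristic 0 the derivative determines all coefficients but the constant
    one. *)
Lemma expfM a b : expf (a * b) = expf a * expf b.
Proof.
suff h i : forall a b, fcoef (expf (a * b)) i = fcoef (expf a * expf b) i.
  by apply: fps_ext => i; exact: h.
elim: i => [|i IH] {}a {}b.
  by rewrite fps_coefM big_ord1 !expf0 rmorphM.
apply: (@mulSn_inj i); rewrite -[LHS]/(fcoef (fder (expf (a * b))) i) -[RHS]/(fcoef (fder (expf a * expf b)) i).
by rewrite fder_expf lderM expfD fderM !fps_coefD !IH !fder_expf.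
Qed.

Lemma expfC c : expf (alg_str GG c) = fps_const c.
Proof.
apply: fder_uniq; first by rewrite expf0 homE fps_coefC.
by rewrite fder_expf lderC fderC; apply: (addrI (expf 0)); rewrite -expfD !addr0.
Qed.

Definition expg : hom GG (pser k) := @hom_of k GG (pser k) expf expfD expfM expfC.

Variable m : M.

Definition expE := cj lam (hcomp (fcst Lz) (xpt M kz)) (hcomp (pser_map Lz) expg).

Hypothesis wt : forall a,
  cj lam (hcomp (din (nza Lz)) (xpt M kz)) (hcomp (dmap (kin (nza Lz))) eta) a =
  @Sqz k (nza Lz) (self_alg (nza Lz)) (ma_c M (gone G k0 a)) (ma_d m (sq1 (eta a))).

Definition dscal (B : alg k) (c : B) : hom (dual B) (dual B).
Proof.
refine (@sqz_map k B B (self_alg B) (self_alg B) (hid B) (fun d => c * d) _ _).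
- by move=> x y; exact: mulrDr.
- by move=> b d; rewrite /= mulrCA.
Defined.

(** exp(t eta) solves the equation g' = g eta. Conjugation by lam(x), which is constant in t, turns
    eta into x^m eta by the weight hypothesis. *)
Lemma expE_der a : fder (expE a) = fps_const (ma_d m 1 : monalg kz M) * expE (lder a).
Proof.
pose c : FL := fps_const (ma_d m 1 : monalg kz M).
have e1 : hcomp fder_hom (hcomp (pser_map Lz) expg) = linv (hcomp (pser_map Lz) expg).
  apply: hom_ext => b; rewrite linvE; apply: sqz_ext => //.
  apply: fps_ext => i; rewrite -[RHS]/(ma_c M (expc i (lder b))) -expcS.
  by rewrite -[LHS]/(ma_c M (expc i.+1 b) *+ i.+1) -rmorphMn.
have e2 : hcomp fder_hom expE = hcomp (dscal c) (linv expE).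
  pose lx := lam (hcomp (fcst Lz) (xpt M kz)); pose e := hcomp (pser_map Lz) expg.
  have el : hcomp fder_hom lx = hcomp (din FL) lx by rewrite /lx !lnat !hcompA fder_cst.
  have e3 : hcomp (dscal c) (linv expE) = gmul (hcomp (din FL) expE) (hcomp (dscal c) (hcomp (dmap (kin FL)) eta)).
    rewrite /linv gmul_nat hcompA; congr (gmul (hcomp _ _) _).
    by apply: hom_ext => b; apply: sqz_ext => //=; rewrite mulr0.
  have e4 : hcomp (dscal c) (hcomp (dmap (kin FL)) eta) =
      gmul (hcomp (din FL) lx) (gmul (hcomp (dmap (kin FL)) eta) (ginv (hcomp (din FL) lx))).
    transitivity (hcomp (dmap (fcst Lz)) (cj lam (hcomp (din (nza Lz)) (xpt M kz)) (hcomp (dmap (kin (nza Lz))) eta))).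
      apply: hom_ext => b; rewrite [RHS]hcompE wt.
      have e0 : sq0 (eta b) = gone G k0 b := congr1 (fun w : hom GG k0 => w b) eta1.
      apply: sqz_ext => /=; first by rewrite e0; apply: fps_ext => i; rewrite /= !coefC; case: ifP.
      by apply: fps_ext => i; rewrite fps_coefCM /= !coefC; case: ifP => _; rewrite ?mulr0 // ma_dM addr0 mul1r.
    have ek : hcomp (fcst Lz) (kin (nza Lz)) = kin FL by exact: kin_uniq.
    by rewrite (cj_nat lnat) /cj !hcompA dmap_din dmap_comp ek -!hcompA /lx -lnat.
  rewrite e3 e4 /expE /cj -/lx -/e !gmul_nat !ginv_nat el e1 /linv -!gmulA gmulKV.
  by [].
have := congr1 (fun w : hom GG (dual FL) => sq1 (w a)) e2.
by rewrite hcompE [hcomp (dscal c) _ a]hcompE linvE.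
Qed.

Lemma expE0 a : fcoef (expE a) 0 = ma_c M (gone G k0 a) :> monalg kz M.
Proof.
have e : hcomp (fps_at0 Lz) expE = gone G (nza Lz).
  rewrite /expE (cj_nat lnat) [X in cj _ _ X]hcompA.
  have -> : hcomp (hcomp (fps_at0 Lz) (pser_map Lz)) expg = gone G (nza Lz).
    rewrite -(gone_nat G (kin (nza Lz))); apply: hom_ext => b.
    by rewrite -[LHS]/(ma_c M (expc 0 b)) /expc fact0 divr1.
  exact: cj1.
rewrite -[LHS]/(hcomp (fps_at0 Lz) expE a) e -(gone_nat G (kin (nza Lz))).
by [].
Qed.

Lemma expEE i a : fcoef (expE a) i = ma_d (m *+ i) (expc i a) :> monalg kz M.
Proof.
elim: i a => [|i IH] a; first by rewrite expE0 mulr0n /expc fact0 divr1.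
have := congr1 (fun w : fps (monalg kz M) => fcoef w i) (expE_der a).
rewrite fps_coefCM IH ma_dM mul1r -mulrS => e.
apply: monalg_ext => n; apply: (@mulSn_inj i).
have := congr1 (fun w : monalg kz M => w n) e.
rewrite -[fcoef (fder _) i]/(fcoef (expE a) i.+1 *+ i.+1).
have cMn (w : monalg kz M) l : (w *+ l : monalg kz M) n = w n *+ l by elim: l => // l IHl; rewrite !mulrS ma_coefD IHl.
by rewrite cMn /= => ->; case: eqP => _; rewrite ?mul0rn // expcS.
Qed.

Section Gauge.
Variables (j : nat) (j0 : (0 < j)%N).

Definition fps_ram : hom FL FL := @rh k (nza Lz) (pser Lz) (pser Lz) (ramify Lz j0).
Definition expj := hcomp (ramify k j0) expg.
Definition expEj := hcomp fps_ram expE.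

Lemma expEj_cj : expEj = cj lam (hcomp (fcst Lz) (xpt M kz)) (hcomp (pser_map Lz) expj).
Proof.
have e1 : hcomp fps_ram (fcst Lz) = fcst Lz.
  apply: hom_ext => c; apply: fps_ext => i; rewrite /= !coefC.
  case: i => [|i]; first by rewrite dvdn0 div0n.
  by rewrite [RHS]/=; case: ifP => // /dvdnP[[//|l] ->]; rewrite mulnK.
have e2 : hcomp fps_ram (hcomp (pser_map Lz) expg) = hcomp (pser_map Lz) expj.
  by apply: hom_ext => c; apply: fps_ext => i; rewrite /=; case: ifP => // _; rewrite rmorph0.
by rewrite /expEj /expE (cj_nat lnat) hcompA e1 e2.
Qed.

Lemma expEjE i a : fcoef (expEj a) i =
  (if (j %| i)%N then ma_d (m *+ (i %/ j)) (expc (i %/ j) a) else 0) :> monalg kz M.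
Proof. by rewrite -expEE. Qed.

Lemma expc1 a : expc 1 a = sq1 (eta a).
Proof.
rewrite /expc divr1 /=; have <- : linv (gone G k0) = eta.
  rewrite /linv gone_nat gmul1; apply: hom_ext => b; exact: sqz_ext.
by rewrite linvE.
Qed.

Variables (AA : nat -> set M) (hA : admissible AA).
Hypothesis AAj : AA j m.

(** The conjugated exp(t^j eta) has terms of order lj and weight lm only, so admissibility keeps it
    inside [WW]. *)
Lemma AA_mul l : AA (l * j)%N (m *+ l).
Proof. by elim: l => [|l IH]; [rewrite (adm0 hA) | rewrite mulSn mulrS; exact: (admD hA)]. Qed.

Lemma expW_ex : exists Ew : hom GG (WW hA kz), hcomp (Winc hA kz) Ew = expEj.
Proof.
apply: hom_factor => [|a]; first exact: Winc_inj.
have h : wset AA (expEj a).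
  move=> i n; rewrite expEjE; case: ifP => [/dvdnP[l ->]|_]; last by rewrite eqxx.
  rewrite mulnK //= => h; suff -> : n = m *+ l by exact: AA_mul.
  by apply/eqP; apply: contraNT h => /negbTE ->.
by exists (exist _ _ h).
Qed.

Lemma dsum1 (De : set M) m' (g : monalg kz M) : De = [set m'] -> dsum De g = g m'.
Proof.
move=> ->; rewrite /dsum /pr.
case: (eqVneq (g m') 0) => [e|ne].
  by rewrite e big1 // => i _; case: asboolP => // ->.
rewrite (bigD1_seq m') ?(suppP ne) ?supp_uniq //= big1 ?addr0 => [|i /eqP ni]; by case: asboolP.
Qed.

(** Exactly the condition under which the part of order j and weight m' is a tangent vector, namely
    [Wpi] for the singleton of m'. *)
Definition extremal m' := forall i m1 m2, (0 < i)%N -> (i < j)%N -> AA i m1 -> AA (j - i)%N m2 -> m1 + m2 <> m'.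

Definition extD m' (x' : extremal m') : forall i a b, (0 < i)%N -> (i < j)%N ->
  AA i a -> AA (j - i)%N b -> ~ [set m'] (a + b) := x'.

Variables (f : H (pser k)).
Hypothesis f0 : kmap (closed_point k) f = z.
Variable ph : hom U (WW hA kz).
Hypothesis eph : kmap (hcomp (Winc hA kz) ph) uV = orb aH lam f.
Variable Tm : hom U (dual k0).
Hypothesis eTm : forall u, Tm u = @Sqz k k0 (self_alg k0) (zh u) ((cf ph j u : monalg kz M) m).
Hypothesis eact : aH _ eta (zC z _) = kmap Tm uV.

Lemma ginv1 (C : alg k) : ginv (gone G C) = gone G C.
Proof. by apply: esym; apply: ginv_uniq; exact: gmul1. Qed.

(** The inverse of exp(t^j eta) acts on extremal parts of order j as on tangent vectors. In weight m
    it subtracts the image of eta, which is the whole component; in other extremal weights exp(t^j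
    eta) reduces to the identity. *)
Lemma gauge : extremal m -> exists (ga : hom GG (pser k)) (ph' : hom U (WW hA kz)),
  [/\ kmap (closed_point k) (aH _ ga f) = z,
      kmap (hcomp (Winc hA kz) ph') uV = orb aH lam (aH _ ga f),
      forall u, (cf ph' j u : monalg kz M) m = 0 &
      forall m' u, extremal m' -> m' <> m -> (cf ph' j u : monalg kz M) m' = (cf ph j u : monalg kz M) m'].
Proof.
move=> xm; have [Ew eEw] := expW_ex.
have eWi i a : fcoef (Winc hA kz (Ew a)) i = fcoef (expEj a) i :> monalg kz M.
  exact: (congr1 (fun g : hom GG FL => fcoef (g a) i) eEw).
have eW0 : hcomp (Wr hA kz) Ew = gone G (nza kz).
  apply: hom_ext => a; rewrite hcompE WrE eWi expEjE dvdn0 div0n mulr0n /= eqxx /expc fact0 divr1.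
  by rewrite -(gone_nat G (kin (nza kz))).
have [ph' eph'] : in_chart uV (aH _ (ginv Ew) (kmap ph uV)).
  apply: (in_chart_local hu (@Wr_surj _ _ _ hA kz) (@Wr_unit _ _ _ hA kz)).
  rewrite act_nat ginv_nat eW0 ginv1 act1 -kmap_comp (Wr_ph lnat lfix hu ezh f0 eph) (zh_zC ezh).
  exact: zh_in.
have eWp m' (x' : extremal m') (De_ext := extD x') :
  kmap (hcomp (Wpi hA kz j0 De_ext) ph') uV =
  aH _ (ginv (hcomp (Wpi hA kz j0 De_ext) Ew)) (kmap (hcomp (Wpi hA kz j0 De_ext) ph) uV).
  by rewrite (kmap_comp _ ph') eph' act_nat ginv_nat -kmap_comp.
have eWE m' (x' : extremal m') (De_ext := extD x') a :
  Wpi hA kz j0 De_ext (Ew a) = @Sqz k k0 (self_alg k0) (gone G k0 a) (if m' == m then sq1 (eta a) else 0).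
  rewrite WpiE (dsum1 _ (erefl [set m'])) eWi expEjE dvdnn divnn j0 mulr1n /= expc1; congr Sqz.
  apply: etrans (congr1 (fun g : hom GG (nza kz) => g a) eW0) _.
  by rewrite -(gone_nat G (kin (nza kz))).
have cfE (p : hom U (WW hA kz)) m' (x' : extremal m') (De_ext := extD x') u :
  sq1 (hcomp (Wpi hA kz j0 De_ext) p u) = (cf p j u : monalg kz M) m'.
  by rewrite hcompE WpiE; exact: (dsum1 _ (erefl [set m'])).
have e0 a : sq0 (eta a) = gone G k0 a := congr1 (fun w : hom GG k0 => w a) eta1.
exists (ginv expj), ph'; split.
- rewrite act_nat ginv_nat f0; have -> : hcomp (closed_point k) expj = gone G k0.
    apply: hom_ext => a; rewrite -[LHS]/(if (j %| 0)%N then expc (0 %/ j) a else 0).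
    by rewrite dvdn0 div0n /expc fact0 divr1.
  by rewrite ginv1 act1.
- rewrite kmap_comp eph' act_nat ginv_nat eEw -kmap_comp eph /orb act_nat ginv_nat expEj_cj /cj.
  by rewrite !ginvM ginvK -!actM -!gmulA gmulV gmul_r1.
- move=> u; rewrite -(cfE ph' m xm).
  have e : hcomp (Wpi hA kz j0 (extD xm)) ph' = hcomp (kin (dual k0)) zh; last by rewrite e.
  apply: (chart_inj hu); rewrite (eWp m xm) (zh_zC ezh).
  have -> : hcomp (Wpi hA kz j0 (extD xm)) Ew = eta.
    by apply: hom_ext => a; rewrite hcompE (eWE m xm) eqxx -e0; exact: sqz_ext.
  have -> : hcomp (Wpi hA kz j0 (extD xm)) ph = Tm.
    apply: hom_ext => v; rewrite eTm -(cfE ph m xm); apply: sqz_ext => //=.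
    have := congr1 (fun g : hom U (nza kz) => g v) (Wr_ph lnat lfix hu ezh f0 eph).
    by [].
  by rewrite -eact -actM gmulV act1.
move=> m' u x' /eqP ne.
have e : hcomp (Wpi hA kz j0 (extD x')) ph' = hcomp (Wpi hA kz j0 (extD x')) ph.
  apply: (chart_inj hu); rewrite (eWp m' x').
  have -> : hcomp (Wpi hA kz j0 (extD x')) Ew = gone G _; last by rewrite ginv1 act1.
  apply: hom_ext => a; rewrite hcompE (eWE m' x') (negbTE ne) -(gone_nat G (din k0)).
  by [].
exact: etrans (esym (cfE ph' m' x' u)) (etrans (congr1 (fun g : hom U (dual (nza kz)) => sq1 (g u)) e) (cfE ph m' x' u)).
Qed.
End Gauge.
End Exponential.
End Projection.

(** * Replacing the limit *)

Section TangentOrbit.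
Variables (k : closedFieldType) (M : zmodType) (P : set M).
Variables (G : grp k) (H : kfun k) (aH : gaction G H).
Local Notation TT := (gring (torus k M)).
Local Notation GG := (gring G).
Local Notation k0 := (self_alg k).
Local Notation kz := (kz k).
Local Notation Lz := (mnz M kz).
Local Notation L := (nza (mnz M kz)).
Variable S : stack_space (Map_stack (quot_stack (torus_act k P)) (quot_stack aH)) -> Prop.
Hypothesis cE : closed_embedding (str_ev S).
Variables (F0 : ob (Map_stack (quot_stack (torus_act k P)) (quot_stack aH)) k0).
Variables (z : H k0) (lam : forall C : alg k, hom TT C -> hom GG C).
Hypothesis dg : degenerate F0 z lam.
Hypothesis hF0 : forall p : fpoint (Map_stack (quot_stack (torus_act k P)) (quot_stack aH)),
  mor (fp_ob p) F0 -> S (pt_class p).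
Let lnat := deg_nat dg.
Let lM := degM dg.
Let lfix := deg_fix dg.
Variables (U : alg k) (uV : H U) (hu : open_immersion uV) (zh : hom U k0).
Hypothesis ezh : kmap zh uV = z.
Variables (AA : nat -> set M) (hA : admissible AA) (f : H (pser k)).
Hypothesis f0 : kmap (closed_point k) f = z.
Variable ph : hom U (WW hA kz).
Hypothesis eph : kmap (hcomp (Winc hA kz) ph) uV = orb aH lam f.
Variables (j : nat) (j0 : (0 < j)%N) (De : set M).
Hypothesis De_ext : forall i m n, (0 < i)%N -> (i < j)%N -> AA i m -> AA (j - i)%N n -> ~ De (m + n).
Variables (b : M -> int) (bD : forall m n, b (m + n) = b m + b n) (bP : forall m, P m -> 0 <= b m).
Variables (Q : nat) (Q0 : (0 < Q)%N).
Hypothesis hDe : forall m, De m -> b m = - (Q%:Z).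

Lemma ev_xpt (D : alg k) (y : hom TT D) : exists ro : hom L D, hcomp ro (xpt M kz) = y.
Proof.
have [ro ero] := mz_ev_ex y; exists ro.
by apply: tv_ext => m; rewrite tv_nat xptE ero pev_dm rmorph1 mul1r.
Qed.

Lemma dsumT_gone c : dsumT De (gone _ L) c = kin L (dsumT De (gone _ (nza kz)) c).
Proof.
rewrite /dsumT /pr rmorph_sum; apply: eq_bigr => i _; case: asboolP => _; last by rewrite rmorph0.
by rewrite rmorphM !tv1 rmorph1.
Qed.

(** All weights in [De] pair to -Q with b, so the infinitesimal part of lam(t^b) zeta is zeta times
    t^(-Q). By [tangent_extends] an infinitesimal element of G over k((t)) makes it integral. Taking
    coefficients of t^(-Q), which vanish on the integral side as Q > 0, gives an element of Lie G
    carrying zeta to zero. *)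
Lemma tangent_orbit : zplus S (kmap (tz ph j0 De_ext (gone _ (nza kz))) uV) ->
  exists (g : hom GG (dual k0)) (T : hom U (dual k0)),
  [/\ hcomp (dpr k0) g = gone G k0,
      forall u, T u = @Sqz k k0 (self_alg k0) (zh u) (dsumT De (gone _ (nza kz)) (cf ph j u)) &
      aH _ g (zC z _) = kmap T uV].
Proof.
set zeta := kmap _ uV => zp; pose C := laurent k.
pose y : hom TT C := tpow bD (loc_invP (fps_t k)).
have tzE' R (w : hom TT (nza R)) u := tzE lnat lfix hu ezh f0 eph j0 De_ext w u.
have pz : kmap (dpr k0) zeta = zC z k0.
  rewrite /zeta -kmap_comp.
  have -> : hcomp (dpr k0) (tz ph j0 De_ext (gone _ (nza kz))) = hcomp (kin k0) zh.
    by apply: hom_ext => u; rewrite hcompE tzE'.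
  exact: (zh_zC ezh).
have [u1 [Gam [eG eGa eu1]]] := tangent_extends cE dg hF0 bD bP pz zp.
pose et := gmul Gam (ginv (hcomp (din C) (lam y))).
have [T1 eT1] : in_chart uV u1.
  apply: (in_chart_local hu (r := dpr (pser k))); [exact: sqz_pr_surj | exact: sqz_pr_unit |].
  by rewrite eu1; exact: (zh_in ezh).
have eT1s : hcomp (dpr (pser k)) T1 = hcomp (kin _) zh.
  by apply: (chart_inj hu); rewrite (kmap_comp (dpr (pser k)) T1) eT1 eu1 (zh_zC ezh).
have [ro ery] := ev_xpt y.
have rok c : ro (kin L c) = kin C c by exact: (homE ro c).
pose T2 := hcomp (dmap ro) (tz ph j0 De_ext (xpt M kz)).
have act : aH _ (lam (hcomp (din C) y)) (kmap (dmap (kin C)) zeta) = kmap T2 uV.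
  have e2 : hcomp (dmap ro) (tz ph j0 De_ext (gone _ L)) = hcomp (dmap (kin C)) (tz ph j0 De_ext (gone _ (nza kz))).
    apply: hom_ext => u; rewrite [LHS]hcompE [RHS]hcompE (tzE' Lz) (tzE' kz).
    apply: sqz_ext; first by exact: rok.
    by rewrite -[LHS]/(ro (dsumT De (gone _ L) (cf ph j u))) dsumT_gone; exact: rok.
  have := congr1 (kmap (dmap ro)) (tz_act lnat lM lfix hu ezh f0 eph j0 De_ext (xpt M kz)).
  rewrite act_nat lnat hcompA dmap_din -hcompA ery -(kmap_comp (dmap ro) (tz _ _ _ (gone _ L))) e2.
  rewrite (kmap_comp (dmap (kin C))) -(kmap_comp (dmap ro)) => e3; exact: e3.
have lMi : lam (hcomp (din C) y) = hcomp (din C) (lam y) by rewrite lnat.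
have main : aH _ et (kmap T2 uV) = kmap (hcomp (dmap (generic_point k)) T1) uV.
  by rewrite -act -actM /et lMi -gmulA gmulV gmul_r1 eGa kmap_comp eT1.
have et1 a : sq0 (et a) = kin C (gone G k0 a).
  have e : hcomp (dpr C) et = gone G C.
    by rewrite /et gmul_nat ginv_nat eG !hcompA dpr_din hcomp1f gmul_rV.
  by have := congr1 (fun w : hom GG C => w a) e; rewrite -(gone_nat G (kin C)).
have T2s u : sq0 (T2 u) = kin C (zh u) by rewrite /T2 hcompE tzE'; exact: rok.
have Ts u : sq0 (hcomp (dmap (generic_point k)) T1 u) = kin C (zh u).
  have e : sq0 (T1 u) = kin (pser k) (zh u) := congr1 (fun w : hom U (pser k) => w u) eT1s.
  by rewrite -[LHS]/(generic_point k (sq0 (T1 u))) e; exact: (homE (generic_point k)).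
have T2e u : sq1 (T2 u) = alg_str C (dsumT De (gone _ (nza kz)) (cf ph j u)) * lt_inv k ^+ Q.
  rewrite /T2 hcompE tzE' -[LHS]/(ro (dsumT De (xpt M kz) (cf ph j u))) /dsumT /pr !rmorph_sum mulr_suml.
  apply: eq_bigr => i _; case: asboolP => [Di|_]; last by rewrite !rmorph0 mul0r.
  rewrite rmorphM -[ro (tv _ _)]tv_nat ery tpowE (hDe Di) tv1 mulr1; congr (_ * _); first exact: rok.
  by case: (Q) Q0 => // Q' _; rewrite -NegzE.
have kinj : injective (kin C).
  move=> c d e; have := generic_inj (e : generic_point k (fps_const c) = generic_point k (fps_const d)).
  by move=> /(congr1 (fun w : fps k => fcoef w 0)); rewrite !fps_coefC.
have [||||g' [T0' [T' [eg' eT0' eT' eq]]]] := @mixed_act2 k k0 C (kin C) kinj (lcoef Q) (@lcoefD k Q) (@lcoefZ k Q) G H aH U uV et T2 _ hu _ _ _ main.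
- by move=> a; exists (gone G k0 a).
- by move=> u; exists (zh u).
- by move=> u; exists (zh u).
- move=> w; apply: (in_chart_inj hu); last exact: (lau_field k).1.
  by split=> [|c c0]; [exact: oner_neq0 | exists c^-1; exact: mulfV].
exists (ginv g'), T0'; split.
- rewrite ginv_nat; have -> : hcomp (dpr k0) g' = gone G k0; last exact: ginv1.
  by apply: hom_ext => a; rewrite hcompE (eg' _ _ (et1 a)).
- by move=> u; rewrite (eT0' _ _ (T2s u)) T2e lcoefZ lcoef_inv mulr1.
apply: esym; apply: act_flip; rewrite eq -(zh_zC ezh); congr (kmap _ uV).
apply: hom_ext => u; rewrite (eT' _ _ (Ts u)); apply: sqz_ext => //.
exact: (lcoef_gen (sq1 (T1 u)) Q0).
Qed.

End TangentOrbit.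

Lemma xpow_zp (C : comPzRingType) (x xi : C) (n q : nat) (c : int) : x * xi = 1 -> 0 <= n%:Z + q%:Z * c ->
  x ^+ n * zp (x ^+ q) (xi ^+ q) c = x ^+ (absz (n%:Z + q%:Z * c)).
Proof.
move=> e; case: c => c h /=.
  by rewrite -exprM -exprD; congr (_ ^+ _); lia.
rewrite -exprM; have en : n = (absz (n%:Z + q%:Z * Negz c)%R + q * c.+1)%N by rewrite NegzE in h *; nia.
by rewrite {1}en exprD -mulrA -exprMn e expr1n mulr1.
Qed.

Lemma zpM (C : comPzRingType) (a a' b b' : C) n : zp (a * b) (a' * b') n = zp a a' n * zp b b' n.
Proof. by case: n => n; rewrite /= exprMn. Qed.

Lemma inverse_uniq (C : comPzRingType) (a b b' : C) : a * b = 1 -> a * b' = 1 -> b = b'.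
Proof. by move=> e e'; rewrite -[b]mulr1 -e' mulrA [b * a]mulrC e mul1r. Qed.

Lemma tpow_map (k : comPzRingType) (M : zmodType) (b : M -> int) (bD : forall m n, b (m + n) = b m + b n)
    (C D : alg k) (h : hom C D) (w w' : C) (v v' : D) (ww : w * w' = 1) (vv : v * v' = 1) :
  h w = v -> hcomp h (tpow (k := k) bD ww) = tpow bD vv.
Proof.
move=> e; have e' : h w' = v' by apply: (inverse_uniq (a := v)); rewrite // -e -rmorphM ww rmorph1.
by apply: tv_ext => m; rewrite tv_nat !tpowE zp_map e e'.
Qed.

(** * Laurent series over algebras *)

Section LaurentNz.
Variable k : comNzRingType.

Definition fz_t (L : nzalg k) : fpsA L := fps_t L.
Definition lz_t (L : nzalg k) : lauA L := genA L (fz_t L).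

Lemma fpsA_scale_t (L : nzalg k) (c : L) : fpsA_scale c (fz_t L) = fcst L c * fz_t L.
Proof.
apply: fps_ext => i; apply: etrans _ (esym (fps_coefCM c (fps_t L) i)).
by rewrite /= coefX; case: eqP => [->|_]; rewrite ?expr1 // !mulr0.
Qed.

Lemma pser_map_t (L : nzalg k) : pser_map L (fps_t k) = fz_t L.
Proof. by apply: fps_ext => i; rewrite /= !coefX rmorph_nat. Qed.
Definition lz_i (L : nzalg k) : lauA L := loc_inv (fps_t L).
Lemma lz_ti (L : nzalg k) : lz_t L * lz_i L = 1. Proof. exact: (loc_invP (fps_t L)). Qed.

Lemma lz_pow (L : nzalg k) q : lz_t L ^+ q * lz_i L ^+ q = 1.
Proof. by rewrite -exprMn lz_ti expr1n. Qed.

Lemma lt_pow q : generic_point k (fps_t k) ^+ q * lt_inv k ^+ q = 1.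
Proof. by rewrite -exprMn loc_invP expr1n. Qed.

Lemma lz_rep (L : nzalg k) (y : lauA L) : exists a n, y = genA L a * lz_i L ^+ n.
Proof. exact: (lau_rep (y : laurent L)). Qed.

Lemma lz_inj (L : nzalg k) : injective (genA L).
Proof. exact: (@generic_inj L). Qed.

Lemma fpsA_map_t (L L' : nzalg k) (h : hom (nza L) (nza L')) : fpsA_map h (fz_t L) = fz_t L'.
Proof. by apply: fps_ext => i; rewrite /= !coefX rmorph_nat. Qed.

Lemma lauA_map_ex (L L' : nzalg k) (h : hom (nza L) (nza L')) :
  exists g : hom (lauA L) (lauA L'), hcomp g (genA L) = hcomp (genA L') (fpsA_map h).
Proof. by apply: (@fpsA_to k L _ _ (lz_i L')); rewrite hcompE; have := lz_ti L'; rewrite /lz_t -(fpsA_map_t h). Qed.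

Lemma fpsA_map_inj (L L' : nzalg k) (h : hom (nza L) (nza L')) : injective h -> injective (fpsA_map h).
Proof.
move=> hi x y e; apply: fps_ext => i; apply: hi.
exact: (congr1 (fun w : fps L' => fcoef w i) e).
Qed.

Lemma lauA_map_inj (L L' : nzalg k) (h : hom (nza L) (nza L')) (g : hom (lauA L) (lauA L')) :
  hcomp g (genA L) = hcomp (genA L') (fpsA_map h) -> injective h -> injective g.
Proof.
move=> eg hi; suff g0 y : g y = 0 -> y = 0.
  by move=> x y e; apply/eqP; rewrite -subr_eq0; apply/eqP; apply: g0; rewrite rmorphB e subrr.
have [a [n ->]] := lz_rep y; rewrite rmorphM => e.
have e1 : g (genA L a) = 0.
  have ii : g (lz_t L ^+ n) * g (lz_i L ^+ n) = 1 by rewrite -rmorphM lz_pow rmorph1.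
  by rewrite -[LHS]mulr1 -ii mulrCA e mulr0.
have e2 : genA L' (fpsA_map h a) = genA L' 0.
  by rewrite rmorph0; exact: etrans (esym (congr1 (fun w : hom (fpsA L) (lauA L') => w a) eg)) e1.
have /(fpsA_map_inj hi) -> : fpsA_map h a = fpsA_map h 0 by rewrite rmorph0; exact: (lz_inj e2).
by rewrite rmorph0 mul0r.
Qed.
End LaurentNz.

(** * The limit of lam(t^(q b)) f(t^p) *)

Section NewMap.
Variables (k : closedFieldType) (M : zmodType) (P : set M).
Variables (G : grp k) (H : kfun k) (aH : gaction G H).
Hypothesis H_ft : scheme_of_finite_type H.
Local Notation TT := (gring (torus k M)).
Local Notation GG := (gring G).
Local Notation k0 := (self_alg k).
Local Notation kz := (kz k).
Local Notation Lz := (mnz M kz).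
Local Notation L := (nza (mnz M kz)).
Variable S : stack_space (Map_stack (quot_stack (torus_act k P)) (quot_stack aH)) -> Prop.
Hypothesis cE : closed_embedding (str_ev S).
Variables (z : H k0) (lam : forall C : alg k, hom TT C -> hom GG C).
Hypothesis lnat : forall (C D : alg k) (h : hom C D) (a : hom TT C), hcomp h (lam a) = lam (hcomp h a).
Hypothesis lM : forall (C : alg k) (a a' : hom TT C), lam (gmul a a') = gmul (lam a) (lam a').
Hypothesis lfix : forall (C : alg k) (a : hom TT C), aH C (lam a) (zC z C) = zC z C.
Variables (U : alg k) (uV : H U) (hu : open_immersion uV) (zh : hom U k0).
Hypothesis ezh : kmap zh uV = z.
Variables (AA : nat -> set M) (hA : admissible AA) (f : H (pser k)).
Hypothesis f0 : kmap (closed_point k) f = z.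
Variable ph : hom U (WW hA kz).
Hypothesis eph : kmap (hcomp (Winc hA kz) ph) uV = orb aH lam f.
Variables (b : M -> int) (bD : forall m n, b (m + n) = b m + b n).
Variables (p q j : nat) (p0 : (0 < p)%N) (j0 : (0 < j)%N).
Hypothesis slope : forall i m, AA i m -> 0 <= (p * i)%N%:Z + q%:Z * b m.
Hypothesis slope_lt : forall i m, (0 < i)%N -> (i < j)%N -> AA i m -> 0 < (p * i)%N%:Z + q%:Z * b m.

(** The weights for which a term of order j becomes constant in lam(t^(q b)) f(t^p). *)
Definition edge : set M := [set m | (p * j)%N%:Z + q%:Z * b m = 0].

Lemma edge_ext i m n : (0 < i)%N -> (i < j)%N -> AA i m -> AA (j - i)%N n -> ~ edge (m + n).
Proof.
move=> i0 ij h1 h2; rewrite /edge /= bD => e.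
have := slope_lt i0 ij h1; have := slope h2.
by rewrite -(subnKC (ltnW ij)) in e; lia.
Qed.

Let PX : nzalg k := @NzAlg k {poly k} polyC.
Variables (KX : nzalg k) (io : hom (nza PX) (nza KX)) (xi : KX).
Hypothesis io_inj : injective io.
Let x : KX := io 'X.
Hypothesis exi : x * xi = 1.
Hypothesis fldK : is_field (lauA KX).
Definition at_zero : hom (nza PX) (nza kz) :=
  @hom_of k (nza PX) (nza kz) (fun r : {poly k} => r.[0]) (fun r s => hornerD r s 0) (fun r s => hornerM r s 0) (fun c => hornerC c 0).

Lemma xq : x ^+ q * xi ^+ q = 1. Proof. by rewrite -exprMn exi expr1n. Qed.

Let yx : hom TT (nza KX) := tpow (k := k) bD (C := nza KX) xq.
Let Bc (n : nat) (c : monalg kz M) : {poly k} :=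
  if (p %| n)%N then pr (fun m a => a *: 'X^(absz (n%:Z + q%:Z * b m))) c else 0.

(** The series lam(X^(q b)) f((Xt)^p): a term of order i and weight m is multiplied by X^(p i + q
    b(m)), which is a polynomial by [slope]. At X = 0 only the terms with exponent 0 survive. *)
Lemma u2_ex : exists (th : hom L (nza KX)) (u2 : hom (WW hA kz) (fpsA PX)),
  [/\ hcomp th (xpt M kz) = yx,
   hcomp (fpsA_map io) u2 = hcomp (hcomp (fpsA_scale (L := KX) x) (hcomp (fpsA_ram KX p0) (fpsA_map th))) (Winc hA kz) &
   forall a n, fcoef (u2 a) n = Bc n (fcoef (Winc hA kz a) (n %/ p))].
Proof.
have [th eth] := mz_ev_ex yx; pose Z := hcomp (fpsA_scale (L := KX) x) (hcomp (fpsA_ram KX p0) (fpsA_map th)).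
have BZ (a : WW hA kz) : fpsA_map io (Fps (fun n => Bc n (fcoef (Winc hA kz a) (n %/ p))) : fpsA PX) = Z (Winc hA kz a).
  apply: fps_ext => n; rewrite -[LHS]/(io (Bc n (fcoef (Winc hA kz a) (n %/ p)))).
  rewrite -[RHS]/(x ^+ n * (if (p %| n)%N then th (fcoef (Winc hA kz a) (n %/ p)) else 0)) /Bc.
  case: ifP => [pn|_]; last by rewrite rmorph0 mulr0.
  rewrite eth /pev /pr rmorph_sum mulr_sumr; apply: eq_bigr => m _.
  set c := (X in X *: _); case: (eqVneq c 0) => [ec|nc].
    transitivity (0 : nza KX); first by rewrite ec scale0r rmorph0.
    by apply: esym; rewrite -[kto (nza KX) _]/(kto (nza KX) c) ec rmorph0 mul0r mulr0.
  have Am : AA (n %/ p) m by exact: (svalP a _ _ nc).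
  have := slope Am; rewrite [(p * _)%N]mulnC divnK // => h.
  rewrite tpowE -mul_polyC rmorphM rmorphXn -/x -(xpow_zp exi h) mulrCA.
  by congr (_ * (_ * _)); exact: (homE io c).
have [u2 eu2] : exists u2 : hom (WW hA kz) (fpsA PX), hcomp (fpsA_map io) u2 = hcomp Z (Winc hA kz).
  apply: hom_factor; first exact: (fpsA_map_inj io_inj).
  by move=> a; eexists; exact: BZ.
exists th, u2; split=> //.
  by apply: tv_ext => m; rewrite tv_nat xptE eth pev_dm rmorph1 mul1r.
move=> a n; have e : u2 a = Fps (fun n => Bc n (fcoef (Winc hA kz a) (n %/ p))) :> fpsA PX.
  apply: (fpsA_map_inj io_inj); rewrite BZ.
  exact: (congr1 (fun w : hom (WW hA kz) (fpsA KX) => w a) eu2).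
by rewrite e.
Qed.

Lemma Bc_at0 (n : nat) (c : monalg kz M) : (forall m, c m != 0 -> 0 <= n%:Z + q%:Z * b m) ->
  (Bc n c).[0] = if (p %| n)%N then pr (fun m (a : kz) => if n%:Z + q%:Z * b m == 0 then a else 0 : k) c else 0.
Proof.
move=> h; rewrite /Bc; case: ifP => _; last exact: horner0.
rewrite /pr horner_sum; apply: eq_bigr => m _; rewrite hornerZ hornerXn.
case: (eqVneq (c m) 0) => [->|/h]; first by rewrite mul0r if_same.
case: eqVneq => [->|ne hm]; first by rewrite mulr1.
by rewrite expr0n absz_eq0 (negbTE ne) mulr0.
Qed.

(* two-term truncation: [k + y^J k[[y]]] maps onto [k[e]] *)
Lemma jet_factor (J : nat) (v : hom U (fpsA kz)) (T : hom U (dual k0)) : (0 < J)%N ->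
  (forall u i, (0 < i)%N -> (i < J)%N -> fcoef (v u) i = 0) ->
  (forall u, T u = @Sqz k k0 (self_alg k0) (fcoef (v u) 0) (fcoef (v u) J)) ->
  zplus S (kmap v uV) -> zplus S (kmap T uV).
Proof.
move=> J0 hv eT; pose SJ : set (fpsA kz) := [set a | forall i, (0 < i)%N -> (i < J)%N -> fcoef a i = 0].
have cS : subalg_closed SJ.
  split=> [c|r s hr hs i i0 iJ|r s hr hs i i0 iJ].
  - by move=> i i0 _; rewrite /= coefC; case: i i0.
  - by rewrite fps_coefD hr ?hs ?addr0.
  rewrite fps_coefM big1 // => l _; case: (posnP l) => [l0|l0].
    by rewrite [X in _ * X]hs ?mulr0 // l0 subn0.
  by rewrite hr ?mul0r // (leq_ltn_trans _ iJ) // -ltnS.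
have [v' ev] : exists v' : hom U (subalg cS), hcomp (sub_inc cS) v' = v.
  by apply: hom_factor; [exact: sub_inc_inj | move=> u; exists (exist _ (v u) (hv u))].
have cJ (r s : subalg cS) : fcoef (sval (r * s)) J = fcoef (sval r) 0 * fcoef (sval s) J + fcoef (sval r) J * fcoef (sval s) 0.
  have hr i : (0 < i)%N -> (i < J)%N -> fcoef (sval r) i = 0 by exact: (svalP r i).
  rewrite -[sval (r * s)]/(sval r * sval s) fps_coefM; case: (J) J0 hr => // J' _ hr.
  rewrite big_ord_recl big_ord_recr /= subn0 subnn big1 ?add0r // => l _.
  by rewrite [X in X * _](hr (bump 0 l) isT (ltn_ord l)) mul0r.
have ro_ex : exists ro : hom (subalg cS) (dual k0), forall r, ro r = @Sqz k k0 (self_alg k0) (fcoef (sval r) 0) (fcoef (sval r) J).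
  unshelve eexists; first refine (@hom_of k (subalg cS) (dual k0) (fun r => @Sqz k k0 (self_alg k0) (fcoef (sval r) 0) (fcoef (sval r) J)) _ _ _); last by [].
  - by move=> r s; apply: sqz_ext.
  - move=> r s; apply: sqz_ext; first by rewrite /= big_ord1.
    by rewrite [LHS]cJ /= [X in _ + X]mulrC.
  - by move=> c; apply: sqz_ext; rewrite /= coefC //; case: (J) J0.
have [ro ero] := ro_ex.
rewrite -ev kmap_comp => /(zplus_inj cE (sub_inc_inj (hS := cS))) /(zplus_map cE ro).
rewrite -kmap_comp; congr (zplus S (kmap _ uV)); apply: hom_ext => u.
rewrite hcompE ero eT -[sval (v' u)]/(hcomp (sub_inc cS) v' u) ev.
by [].
Qed.

Let sigP : hom (pser k) (fpsA PX) := hcomp (fpsA_scale (L := PX) 'X) (pser_map PX).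
Let sigK : hom (pser k) (fpsA KX) := hcomp (fpsA_scale (L := KX) x) (pser_map KX).

Lemma sigPK : hcomp (fpsA_map io) sigP = sigK.
Proof.
apply: hom_ext => a; apply: fps_ext => i.
rewrite -[LHS]/(io ('X ^+ i * (fcoef a i)%:P)) -[RHS]/(x ^+ i * nz_str KX (fcoef a i)).
by rewrite rmorphM rmorphXn; congr (_ * _); exact: (homE io).
Qed.

Lemma sigP0 : hcomp (fpsA_map at_zero) sigP = hcomp (kin (fpsA kz)) (closed_point k).
Proof.
apply: hom_ext => a; apply: fps_ext => -[|i].
  by rewrite -[LHS]/(('X ^+ 0 * (fcoef a 0)%:P : {poly k}).[0]) expr0 mul1r hornerC /= coefC.
by rewrite -[LHS]/(('X ^+ i.+1 * (fcoef a i.+1)%:P : {poly k}).[0]) hornerM hornerXn expr0n mul0r /= coefC.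
Qed.

Lemma sigK_t : sigK (fps_t k) = fcst KX x * fz_t KX.
Proof. by rewrite /sigK hcompE pser_map_t fpsA_scale_t. Qed.

Lemma sig_ex : exists sig : hom (laurent k) (lauA KX), hcomp sig (generic_point k) = hcomp (genA KX) sigK.
Proof.
have e : hcomp (genA KX) sigK (fps_t k) * (genA KX (fcst KX xi) * lz_i KX) = 1.
  rewrite hcompE sigK_t rmorphM mulrACA -!rmorphM exi !rmorph1 mul1r.
  exact: lz_ti.
by exists (loc_lift e); exact: loc_liftE.
Qed.

Definition fnew := aH _ (lam (tpow (k := k) bD (lt_pow k q))) (kmap (generic_point k) (kmap (ramify k p0) f)).

(** lam((Xt)^(q b)) is the product of lam(t^(q b)) and lam(X^(q b)). So after t -> Xt the new curve
    is the translate by lam(t^(q b)) of the series [u2], which still makes sense at X = 0. *)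
Lemma fnew_compare th u2 sig gK : hcomp th (xpt M kz) = yx ->
  hcomp (fpsA_map io) u2 = hcomp (hcomp (fpsA_scale (L := KX) x) (hcomp (fpsA_ram KX p0) (fpsA_map th))) (Winc hA kz) ->
  hcomp sig (generic_point k) = hcomp (genA KX) sigK ->
  hcomp gK (genA PX) = hcomp (genA KX) (fpsA_map io) ->
  kmap sig fnew = kmap gK (aH _ (lam (tpow (k := k) bD (lz_pow PX q))) (kmap (hcomp (genA PX) (hcomp u2 ph)) uV)).
Proof.
set Z := hcomp (fpsA_scale (L := KX) x) _ => eth eu2 esig egK.
have Z1 : hcomp Z (hcomp (fcst Lz) (xpt M kz)) = hcomp (fcst KX) yx.
  have ethm m : th (ma_d m 1) = tv yx m by rewrite -eth tv_nat xptE.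
  apply: tv_ext => m; rewrite !tv_nat xptE; apply: fps_ext => i.
  rewrite -[LHS]/(x ^+ i * (if (p %| i)%N then th (fcoef (fcst Lz (ma_d m 1)) (i %/ p)) else 0)) /= !coefC.
  case: i => [|i]; first by rewrite dvdn0 div0n expr0 mul1r ethm.
  rewrite [RHS]/=; case: ifP => [/dvdnP[[//|l] ->]|_]; last by rewrite mulr0.
  by rewrite mulnK // rmorph0 mulr0.
have Z2 : hcomp Z (pser_map Lz) = hcomp sigK (ramify k p0).
  apply: hom_ext => a; apply: fps_ext => i.
  rewrite -[LHS]/(x ^+ i * (if (p %| i)%N then th (ma_c M (fcoef a (i %/ p))) else 0)).
  rewrite -[RHS]/(x ^+ i * nz_str KX (if (p %| i)%N then fcoef a (i %/ p) else 0)).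
  case: ifP => _; last by rewrite !rmorph0.
  by congr (_ * _); exact: (homE th).
have R1 : kmap gK (kmap (hcomp (genA PX) (hcomp u2 ph)) uV) =
    aH _ (lam (hcomp (genA KX) (hcomp (fcst KX) yx))) (kmap (hcomp (genA KX) (hcomp sigK (ramify k p0))) f).
  rewrite -kmap_comp hcompA egK.
  have -> : hcomp (hcomp (genA KX) (fpsA_map io)) (hcomp u2 ph) = hcomp (hcomp (genA KX) Z) (hcomp (Winc hA kz) ph).
    by rewrite -[in LHS]hcompA [X in hcomp _ X]hcompA eu2 !hcompA.
  by rewrite kmap_comp eph /orb act_nat lnat -kmap_comp -[in LHS]hcompA Z1 -hcompA Z2.
have e1 : sig (generic_point k (fps_t k) ^+ q) = lz_t KX ^+ q * genA KX (fcst KX x) ^+ q.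
  have e : sig (generic_point k (fps_t k)) = genA KX (sigK (fps_t k)) := congr1 (fun w : hom (pser k) (lauA KX) => w (fps_t k)) esig.
  by rewrite rmorphXn e sigK_t rmorphM mulrC exprMn.
have e2 : lz_t KX ^+ q * genA KX (fcst KX x) ^+ q * (lz_i KX ^+ q * genA KX (fcst KX xi) ^+ q) = 1.
  by rewrite mulrACA lz_pow mul1r -exprMn -!rmorphM exi !rmorph1 expr1n.
have e3 : gK (lz_t PX ^+ q) = lz_t KX ^+ q.
  rewrite rmorphXn; congr (_ ^+ _).
  apply: etrans (congr1 (fun w : hom (fpsA PX) (lauA KX) => w (fz_t PX)) egK) _.
  by rewrite hcompE fpsA_map_t.
rewrite /fnew !act_nat !lnat (tpow_map bD (lt_pow k q) e2 e1) (tpow_map bD (lz_pow PX q) (lz_pow KX q) e3).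
have epts : tpow bD e2 = gmul (tpow bD (lz_pow KX q)) (hcomp (genA KX) (hcomp (fcst KX) yx)).
  apply: tv_ext => m; rewrite tvM !tv_nat !tpowE zpM; congr (_ * _).
  by rewrite !zp_map !rmorphXn.
have ef : kmap sig (kmap (generic_point k) (kmap (ramify k p0) f)) =
    kmap (hcomp (genA KX) (hcomp sigK (ramify k p0))) f.
  by rewrite -(kmap_comp (generic_point k)) -(kmap_comp sig) [hcomp sig _]hcompA esig -hcompA.
by rewrite R1 -actM -lM epts ef.
Qed.

(** The substitution t -> Xt followed by X = 0 computes the limit of [fnew]. The translate [w] of
    [u2] is defined over k[X]((t)), which excludes a pole. Its fibre at X = 0 is the constant f2(0)
    on the one hand and, on the other, a translate of the series of surviving terms; if f2(0) is in
    the stratum, so is that series and, by [jet_factor], its lowest nonconstant part. *)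
Lemma new_map : exists f2 : H (pser k), kmap (generic_point k) f2 = fnew /\
  (zplus S (kmap (closed_point k) f2) -> zplus S (kmap (tz ph j0 edge_ext (gone _ (nza kz))) uV)).
Proof.
have [th [u2 [eth eu2 u2E]]] := u2_ex; have [sig esig] := sig_ex.
have [gK egK] := lauA_map_ex io; have [g0 eg0] := lauA_map_ex at_zero.
pose w := aH _ (lam (tpow (k := k) bD (lz_pow PX q))) (kmap (hcomp (genA PX) (hcomp u2 ph)) uV).
have ecmp : kmap sig fnew = kmap gK w by exact: fnew_compare eth eu2 esig egK.
have gKinj : injective gK := lauA_map_inj egK io_inj.
have fld0 : is_field (lauA kz) by exact: (lau_field k).
have [_ [nn [B [uu [hB cov]]]]] := H_ft.
(* A chart at the fibre of w over X = 0. It contains w wherever some e, nonzero on this fibre, is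
   invertible; in particular it contains the generic fibre, hence [fnew]. *)
have [i [c0 ec0]] := cov _ (kmap g0 w) fld0.
set V := B i in c0 ec0 *; set uv := uu i in ec0; have hV : open_immersion uv := (hB i).2.
have [e [ne [d ed]]] := in_chart_loc hV fld0.1 (ex_intro _ c0 ec0).
have neK : gK e != 0.
  by apply: contraNneq ne => eK; rewrite (gKinj e 0) ?rmorph0.
have [ei eei] := fldK.2 _ neK; have [e0i ee0i] := fld0.2 _ ne.
pose gKe := loc_lift eei; have egKe : hcomp gKe (loc_map e) = gK := loc_liftE eei.
pose g0e := loc_lift ee0i; have eg0e : hcomp g0e (loc_map e) = g0 := loc_liftE ee0i.
have esd : kmap sig fnew = kmap (hcomp gKe d) uv by rewrite ecmp (kmap_comp gKe) ed -kmap_comp egKe.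
have [c ec] : in_chart uv fnew.
  by apply: (in_chart_inj hV (f := sig) (lau_field k) fldK.1); exists (hcomp gKe d).
have ecd : hcomp sig c = hcomp gKe d by apply: (chart_inj hV); rewrite (kmap_comp sig c) ec.
have gKl r : gKe (loc_map e r) = gK r := congr1 (fun h : hom (lauA PX) (lauA KX) => h r) egKe.
have ti : generic_point k (fps_t k) * lt_inv k = 1 := loc_invP (fps_t k).
(* A leading term a(0) t^(-n-1) would become a(0) (Xt)^(-n-1), with a pole at X = 0, while the
   coordinates of w only have powers of e as denominators. Clearing denominators and setting X = 0
   yields a(0) = 0, and the pole order drops. *)
have reg n : forall y s, sig y = gKe s -> (exists a, y = generic_point k a * lt_inv k ^+ n) -> exists a, generic_point k a = y.
  elim: n => [|n IH] y s es [a ea]; first by exists a; rewrite ea expr0 mulr1.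
  suff a0 : fcoef a 0 = 0.
    pose a' : pser k := Fps (fun i => fcoef a i.+1).
    have ea' : a = fps_t k * a'.
      apply: fps_ext => -[|l]; rewrite -[fps_t k]expr1 fps_coefXnM //=.
      by rewrite subn1.
    by apply: (IH y s es); exists a'; rewrite ea {1}ea' rmorphM exprS mulrACA ti mul1r.
  have [r [N er]] := loc_ind_eq s.
  have es2 : sig y * gK e ^+ N = gK r.
    rewrite es er rmorphM rmorphXn gKl (loc_lift_inv eei) -mulrA -exprMn [ei * _]mulrC eei expr1n mulr1.
    by [].
  have es3 : sig y * (genA KX (sigK (fps_t k))) ^+ n.+1 = genA KX (sigK a).
    have e1 b0 : genA KX (sigK b0) = sig (generic_point k b0) by exact: esym (congr1 (fun h : hom (pser k) (lauA KX) => h b0) esig).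
    rewrite !e1 -rmorphXn -rmorphM ea -mulrA -exprMn [lt_inv k * _]mulrC ti expr1n mulr1.
    by [].
  have gPK b0 : gK (genA PX (sigP b0)) = genA KX (sigK b0).
    apply: etrans (congr1 (fun h : hom (fpsA PX) (lauA KX) => h (sigP b0)) egK) _.
    by rewrite hcompE -[fpsA_map io _]/(hcomp (fpsA_map io) sigP b0) sigPK.
  have es4 : genA PX (sigP a) * e ^+ N = r * (genA PX (sigP (fps_t k))) ^+ n.+1.
    by apply: gKinj; rewrite !rmorphM !rmorphXn !gPK -es3 -es2 mulrAC.
  have g0P b0 : g0 (genA PX (sigP b0)) = genA kz (fps_const (fcoef b0 0)).
    apply: etrans (congr1 (fun h : hom (fpsA PX) (lauA kz) => h (sigP b0)) eg0) _.
    rewrite hcompE -[fpsA_map at_zero _]/(hcomp (fpsA_map at_zero) sigP b0) sigP0.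
    by [].
  have := congr1 g0 es4; rewrite !rmorphM !rmorphXn !g0P [fcoef (fps_t k) 0]coefX /= !rmorph0 exprS mul0r mulr0.
  have [eNi eeNi] : exists y', g0 e ^+ N * y' = 1 by exists (e0i ^+ N); rewrite -exprMn ee0i expr1n.
  move=> /(congr1 (fun y' => y' * eNi)); rewrite -mulrA eeNi mulr1 mul0r -(rmorph0 (genA kz)) => /(@lz_inj k kz).
  by move=> /(congr1 (fun h : fps k => fcoef h 0)); rewrite fps_coefC.
have [c' ec'] : exists c' : hom V (pser k), hcomp (generic_point k) c' = c.
  apply: hom_factor; first exact: generic_inj.
  move=> v; have [a [n ea]] := lau_rep (c v).
  apply: (reg n (c v) (d v)); last by exists a.
  exact: (congr1 (fun h : hom V (lauA KX) => h v) ecd).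
exists (kmap c' uv); split; first by rewrite -kmap_comp ec'.
have ed2 : d = hcomp (loc_map e) (hcomp (genA PX) (hcomp sigP c')).
  have gKe_inj : injective gKe.
    have k0' y : gKe y = 0 -> y = 0.
      have [r [N ->]] := loc_ind_eq y; rewrite rmorphM rmorphXn gKl (loc_lift_inv eei) => h.
      have : gK r = 0.
        by rewrite -[gK r]mulr1 -(expr1n _ N) -eei exprMn [gK e ^+ N * _]mulrC mulrA h mul0r.
      by rewrite -(rmorph0 gK) => /gKinj ->; rewrite rmorph0 mul0r.
    by move=> y1 y2 h; apply/eqP; rewrite -subr_eq0; apply/eqP; apply: k0'; rewrite rmorphB h subrr.
  have e1 : hcomp gKe (hcomp (loc_map e) (hcomp (genA PX) (hcomp sigP c'))) = hcomp sig (hcomp (generic_point k) c').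
    rewrite hcompA egKe [hcomp gK _]hcompA egK -hcompA [hcomp (fpsA_map io) _]hcompA sigPK [RHS]hcompA esig -[RHS]hcompA.
    by [].
  apply: hom_ext => v; apply: gKe_inj; rewrite -[LHS]/(hcomp gKe d v) -ecd -ec' -e1.
  by [].
have e2 : hcomp g0e (hcomp (loc_map e) (hcomp (genA PX) (hcomp sigP c'))) =
    hcomp (hcomp (kin (lauA kz)) (closed_point k)) c'.
  rewrite hcompA eg0e (hcompA g0) eg0 -(hcompA (genA kz)) (hcompA (fpsA_map at_zero)) sigP0.
  have ek : kin (lauA kz) = hcomp (genA kz) (kin (fpsA kz)) by exact: kin_uniq.
  by rewrite ek -!hcompA.
have ew0 : kmap g0 w = kmap (kin (lauA kz)) (kmap (closed_point k) (kmap c' uv)).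
  have -> : kmap g0 w = kmap g0e (kmap (loc_map e) w) by rewrite -(kmap_comp g0e) eg0e.
  by rewrite -ed ed2 -(kmap_comp g0e) e2 !kmap_comp.
move=> zf; have := zplus_map cE (kin (lauA kz)) zf; rewrite -ew0 /w act_nat zplus_act -kmap_comp.
have -> : hcomp g0 (hcomp (genA PX) (hcomp u2 ph)) = hcomp (genA kz) (hcomp (hcomp (fpsA_map at_zero) u2) ph).
  by rewrite !hcompA eg0.
rewrite kmap_comp => /(zplus_inj cE (@lz_inj k kz)); set v := hcomp _ ph.
have vE u n : fcoef (v u) n = if (p %| n)%N then
    pr (fun m (a : kz) => if n%:Z + q%:Z * b m == 0 then a else 0 : k) (fcoef (Winc hA kz (ph u)) (n %/ p)) else 0.
  rewrite -[LHS]/((fcoef (u2 (ph u)) n : {poly k}).[0]) u2E /Bc.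
  case: (boolP (p %| n)%N) => pn; last by rewrite horner0.
  have := @Bc_at0 n (fcoef (Winc hA kz (ph u)) (n %/ p)); rewrite /Bc pn; apply.
  move=> m h; have := slope (svalP (ph u) _ _ h).
  by rewrite mulnC divnK.
apply: (jet_factor (J := (p * j)%N)); first by rewrite muln_gt0 p0.
  move=> u n n0 nj; rewrite vE; case: ifP => // /dvdnP[l el].
  rewrite /pr big1 // => m _; case: eqP => // em.
  apply/eqP; apply: contraT => h; have Am : AA (n %/ p) m by exact: (svalP (ph u) _ _ h).
  move: n0 nj em Am; rewrite el mulnK // [(l * p)%N]mulnC muln_gt0 p0 ltn_pmul2l //= => l0 lj em Am.
  by have := slope_lt l0 lj Am; rewrite em.
move=> u; rewrite (tzE lnat lfix hu ezh f0 eph j0 edge_ext); congr Sqz.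
  rewrite vE dvdn0 div0n WW0 pr_d => [|m]; last by rewrite if_same.
  have b0 : b 0 = 0 by apply: (addrI (b 0)); rewrite -bD !addr0.
  have eW : Wr hA kz (ph u) = zh u :> k := congr1 (fun g : hom U (nza kz) => g u) (Wr_ph lnat lfix hu ezh f0 eph).
  rewrite WrE in eW; rewrite b0 mulr0 eqxx.
  exact: esym eW.
rewrite vE dvdn_mulr // mulKn // /dsumT /pr; apply: eq_bigr => m _.
by case: asboolP => [/eqP ->|/eqP/negbTE ->]; rewrite ?tv1 ?mulr1.
Qed.

End NewMap.

(** * Descent on the slopes *)

Lemma lauA_field (k : comNzRingType) (F : fieldType) (s : {rmorphism k -> F}) : is_field (lauA (@NzAlg k F s)).
Proof. exact: (lau_field F). Qed.

Section Core.
Variables (k : closedFieldType) (M : zmodType) (P : set M).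
Hypothesis char0 : [pchar k] =i pred0.
Variables (r : nat) (bl : 'I_r -> M -> int).
Hypothesis blD : forall l m n, bl l (m + n) = bl l m + bl l n.
Hypothesis PE : forall m, P m <-> forall l, 0 <= bl l m.
Variables (G : grp k) (H : kfun k) (aH : gaction G H).
Hypothesis H_ft : scheme_of_finite_type H.
Local Notation TT := (gring (torus k M)).
Local Notation GG := (gring G).
Local Notation k0 := (self_alg k).
Local Notation kz := (kz k).
Local Notation Lz := (mnz M kz).
Local Notation L := (nza (mnz M kz)).
Variable S : stack_space (Map_stack (quot_stack (torus_act k P)) (quot_stack aH)) -> Prop.
Hypothesis cE : closed_embedding (str_ev S).
Variables (F0 : ob (Map_stack (quot_stack (torus_act k P)) (quot_stack aH)) k0).
Variables (z : H k0) (lam : forall C : alg k, hom TT C -> hom GG C).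
Hypothesis dg : degenerate F0 z lam.
Hypothesis hF0 : forall p : fpoint (Map_stack (quot_stack (torus_act k P)) (quot_stack aH)),
  mor (fp_ob p) F0 -> S (pt_class p).
Let lnat := deg_nat dg.
Let lM := degM dg.
Let lfix := deg_fix dg.
Variables (U : alg k) (uV : H U) (hu : open_immersion uV) (zh : hom U k0).
Hypothesis ezh : kmap zh uV = z.
Variables (nu : nat) (bu : 'I_nu -> U).
Hypothesis bU : forall y, exists t, teval bu t = y.
Variable f : H (pser k).
Hypothesis f0 : kmap (closed_point k) f = z.
Local Notation gen := (generic_point k).
Local Notation cl := (closed_point k).

(** Only representatives of the same curve in the stack are compared: [ga] is integral and the
    closed point stays z. Bounds on their weights are what improves during the descent. *)
Definition attains (AA : nat -> set M) (hA : admissible AA) (ga : hom GG (pser k)) (ph : hom U (WW hA kz)) :=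
  kmap cl (aH _ ga f) = z /\ kmap (hcomp (Winc hA kz) ph) uV = orb aH lam (aH _ ga f).
Definition attainable (AA : nat -> set M) (hA : admissible AA) := exists ga ph, @attains AA hA ga ph.

Section Refine.
Variable F : seq M.
Hypothesis hF : forall (psi : hom U (dual k0)) (m : M) (a b : hom U (dual L)),
  (forall u, sq0 (psi u) = zh u) ->
  (forall u, a u = @Sqz k L (self_alg L) (ma_c M (zh u)) (ma_c M (sq1 (psi u)))) ->
  (forall u, b u = @Sqz k L (self_alg L) (ma_c M (zh u)) (ma_d m (sq1 (psi u) : k))) ->
  aH _ (lam (hcomp (din L) (xpt M kz))) (kmap a uV) = kmap b uV ->
  (exists u, sq1 (psi u) != 0) -> m \in F.

Lemma dsumT1 (R : nzalg k) (y : hom TT (nza R)) m' (g : monalg kz M) :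
  dsumT [set m'] y g = nz_str R (g m') * tv y m'.
Proof.
rewrite /dsumT /pr; case: (eqVneq (g m') 0) => [e|ne].
  by rewrite e rmorph0 mul0r big1 // => i _; case: asboolP => // ->; rewrite e rmorph0 mul0r.
rewrite (bigD1_seq m') ?(suppP ne) ?supp_uniq //= big1 ?addr0 => [|i /eqP ni]; by case: asboolP.
Qed.

(** An extremal coefficient is a nonzero tangent vector at z on which the torus acts by x^m
    ([tz_act]). *)
Lemma extremal_weight AA (hA : admissible AA) ga (ph : hom U (WW hA kz)) j (j0 : (0 < j)%N) m u :
  attains ga ph -> extremal j AA m -> (cf ph j u : monalg kz M) m != 0 -> m \in F.
Proof.
move=> [g0 eph] xm nz; pose De_ext := extD xm.
have tzE' R (w : hom TT (nza R)) v := tzE lnat lfix hu ezh g0 eph j0 De_ext w v.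
apply: (hF (psi := tz ph j0 De_ext (gone _ (nza kz))) (a := tz ph j0 De_ext (gone _ L)) (b := tz ph j0 De_ext (xpt M kz))).
- by move=> v; rewrite tzE'.
- by move=> v; rewrite !tzE' !dsumT1 !tv1 !mulr1.
- move=> v; rewrite !tzE' !dsumT1 tv1 mulr1 xptE; congr Sqz.
  by rewrite -[LHS]/(ma_c M _ * ma_d m 1) ma_dM add0r mulr1.
- exact: (tz_act lnat lM lfix hu ezh g0 eph j0 De_ext).
by exists u; rewrite tzE' dsumT1 tv1 mulr1.
Qed.

Variables (AA BB : nat -> set M) (hA : admissible AA) (hB : admissible BB).
Hypothesis BA : forall i m, BB i m -> AA i m.
Hypothesis FB : forall i m, (0 < i)%N -> AA i m -> m \in F -> BB i m.

(** The bound available once [BB] is known below order c. *)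
Definition cut (c : nat) (i : nat) : set M := if (i < c)%N then BB i else AA i.

Lemma cut_adm c : admissible (cut c).
Proof.
split=> [|i j m n]; first by rewrite /cut; case: ifP => _; [exact: adm0 hB | exact: adm0 hA].
rewrite /cut; case: (ltnP (i + j) c) => h.
  by rewrite (leq_ltn_trans (leq_addr _ _) h) (leq_ltn_trans (leq_addl _ _) h); exact: (admD hB).
have BA' i' m' c' : (if (i' < c')%N then BB i' else AA i') m' -> AA i' m' by case: ifP => // _; exact: BA.
by move=> /BA' h1 /BA' h2; exact: (admD hA).
Qed.

(** The representative is kept. At the first order where a weight outside [BB] occurs, all earlier
    weights lie in [BB], which is closed under sums; so this weight is extremal, hence one of the
    tangent weights [F], which are allowed by [BB]. *)
Lemma refine_attainable : attainable hA -> attainable hB.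
Proof.
move=> [ga [ph [g0 eph]]].
have cph l i m : (fcoef (Winc hA kz (ph (bu l))) i : monalg kz M) m != 0 -> AA i m by exact: (svalP (ph (bu l)) i m).
have step c : forall i l m, (i < c)%N -> (fcoef (Winc hA kz (ph (bu l))) i : monalg kz M) m != 0 -> BB i m.
  elim: c => // c IH i l m; rewrite ltnS leq_eqVlt => /orP[/eqP ->|]; last exact: IH.
  move=> nz; case: (posnP c) => [c0|c0].
    by move: nz; rewrite c0 => /cph; rewrite (adm0 hA) (adm0 hB).
  have [ph' eph'] : exists ph' : hom U (WW (cut_adm c) kz), hcomp (Winc (cut_adm c) kz) ph' = hcomp (Winc hA kz) ph.
    apply: (orb_inW bU) => l' i' m' h; rewrite /cut; case: ifP => ic; last exact: cph h.
    exact: IH h.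
  have at' : attains ga ph' by split=> //; rewrite eph'.
  apply: contrapT => nB; apply: (nB); apply: FB => //; first exact: cph nz.
  apply: (extremal_weight (u := bu l) c0 at').
    move=> i' m1 m2 i0 ic; rewrite /cut ic ltn_subrL i0 c0 => h1 h2 e.
    by apply: nB; rewrite -e -(subnKC (ltnW ic)); exact: (admD hB).
  rewrite /cf; suff -> : Winc (cut_adm c) kz (ph' (bu l)) = Winc hA kz (ph (bu l)) by [].
  exact: (congr1 (fun h : hom U (fpsA Lz) => h (bu l)) eph').
have [ph' eph'] : exists ph' : hom U (WW hB kz), hcomp (Winc hB kz) ph' = hcomp (Winc hA kz) ph.
  by apply: (orb_inW bU) => l i m h; exact: (step i.+1 i l m (ltnSn i) h).
by exists ga, ph'; split=> //; rewrite eph'.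
Qed.
End Refine.

(* [T] acts on the order [i] part of [f] with weights in [slopes p q j i] *)
Definition slopes (p q j i : nat) : set M := [set m | if i == 0%N then m = 0 else
  forall l, if (i < j)%N then 0 < (p * i)%N%:Z + q%:Z * bl l m else 0 <= (p * i)%N%:Z + q%:Z * bl l m].

Lemma bl0 l : bl l 0 = 0. Proof. by apply: (addrI (bl l 0)); rewrite -blD !addr0. Qed.

Lemma slopes_adm p q j : admissible (slopes p q j).
Proof.
split=> [|i i' m n]; first by apply/funext => m; rewrite /slopes /=; apply/propext.
rewrite /slopes /= addn_eq0; case: (posnP i) => [->|i0]; first by move=> ->; rewrite !add0n add0r.
case: (posnP i') => [->|i0']; first by move=> h ->; rewrite addn0 addr0.
rewrite /= => h h' l; have := h l; have := h' l; rewrite blD mulnDr.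
case: (ltnP (i + i') j) => c.
  rewrite (leq_ltn_trans (leq_addr _ _) c) (leq_ltn_trans (leq_addl _ _) c); lia.
by case: ifP => _; case: ifP => _; lia.
Qed.

Lemma slopes_ge p q j i m l : slopes p q j i m -> 0 <= (p * i)%N%:Z + q%:Z * bl l m.
Proof.
rewrite /slopes /=; case: (posnP i) => [-> ->|i0]; first by rewrite muln0 bl0 mulr0.
by move=> /= /(_ l); case: ifP => // _; lia.
Qed.

Lemma slopes_gt p q j i m l : (0 < i)%N -> (i < j)%N -> slopes p q j i m -> 0 < (p * i)%N%:Z + q%:Z * bl l m.
Proof. by move=> i0 ij; rewrite /slopes /= (gtn_eqF i0) => /(_ l); rewrite ij. Qed.

Hypothesis no_escape : forall (d : nat) (d0 : (0 < d)%N) (Ga : hom GG (laurent k)) (f2 : H (pser k)),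
  kmap gen f2 = aH _ Ga (kmap gen (kmap (ramify k d0) f)) -> zplus S (kmap cl f2).

Section Kill.
Variables (p q j : nat) (p0 : (0 < p)%N) (j0 : (0 < j)%N).
Local Notation hA := (slopes_adm p q j).

(** [no_escape] places the new limit in the stratum, with k(X) as generic fibre in [new_map]. On the
    edge q is nonzero, so the pairing with b_l is a single constant -Q, as [tangent_orbit] requires.
    Edge weights for any ray are extremal, so [gauge] leaves the others unchanged. *)
Lemma kill_weight ga (ph : hom U (WW hA kz)) m l : attains ga ph -> slopes p q j j m ->
  edge (bl l) p q j m -> exists ga' (ph' : hom U (WW hA kz)), [/\ attains ga' ph',
    forall u, (cf ph' j u : monalg kz M) m = 0 &
    forall m' l' u, edge (bl l') p q j m' -> m' <> m -> (cf ph' j u : monalg kz M) m' = (cf ph j u : monalg kz M) m'].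
Proof.
move=> [g0 eph] Am em.
have sl l' i n : slopes p q j i n -> 0 <= (p * i)%N%:Z + q%:Z * bl l' n by exact: slopes_ge.
have slt l' i n : (0 < i)%N -> (i < j)%N -> slopes p q j i n -> 0 < (p * i)%N%:Z + q%:Z * bl l' n by exact: slopes_gt.
have xe l' n : edge (bl l') p q j n -> extremal j (slopes p q j) n.
  move=> en i m1 m2 i0 ij h1 h2 e.
  by apply: (edge_ext (blD l') p0 j0 (sl l') (slt l') i0 ij h1 h2); rewrite e.
pose KX : nzalg k := @NzAlg k {fraction {poly k}} (@tofrac {poly k} \o polyC).
pose PX : nzalg k := @NzAlg k {poly k} polyC.
pose io : hom (nza PX) (nza KX) := @Hom k (nza PX) (nza KX) (@tofrac {poly k}) (fun=> erefl).
have io_inj : injective io by move=> x y /eqP; rewrite tofrac_eq => /eqP.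
have exi : io 'X * (io 'X)^-1 = 1 :> {fraction {poly k}} by rewrite divff // tofrac_eq0 polyX_eq0.
have fK : is_field (lauA KX) by exact: lauA_field.
have [f2 [ef2 zf2]] := new_map H_ft cE lnat lM lfix hu ezh g0 eph (blD l) p0 j0 (sl l) (slt l) io_inj exi fK.
have {}zf2 : zplus S (kmap (tz ph j0 (edge_ext (blD l) p0 j0 (sl l) (slt l)) (gone _ (nza kz))) uV).
  apply: zf2; apply: (no_escape (d0 := p0)); rewrite ef2 /fnew !act_nat -actM.
  by [].
have bPl n : P n -> 0 <= bl l n by move=> /PE.
have Qex : exists Q : nat, (0 < Q)%N /\ forall n, edge (bl l) p q j n -> bl l n = - (Q%:Z).
  have pj : (0 < p * j)%N by rewrite muln_gt0 p0.
  move: em; rewrite /edge /= => em; exists (absz (bl l m)); split; first by nia.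
  have qn : q%:Z != 0 by apply/eqP => q0; rewrite q0 mul0r in em; lia.
  move=> n en; have qe : q%:Z * bl l n = q%:Z * bl l m by move: en; rewrite /edge /=; lia.
  have bneg : bl l m < 0.
    have [//|h] : bl l m < 0 \/ 0 <= bl l m by lia.
    by have := mulr_ge0 (isT : 0 <= q%:Z) h; lia.
  by rewrite (mulfI qn qe); lia.
have [Q [Q0 hQ]] := Qex.
have [g [T [g1 eT eg]]] := tangent_orbit cE dg hF0 hu ezh g0 eph (blD l) bPl Q0 hQ zf2.
have [gm [Tm [gm1 wgm egm eTm]]] := weight_projection lnat lM lfix hu ezh g0 eph j0 (edge_ext (blD l) p0 j0 (sl l) (slt l)) em g1 eT eg.
have [ga' [ph' [h1 h2 h3 h4]]] := gauge lnat lfix hu ezh gm1 char0 wgm j0 Am g0 eph eTm egm (xe l m em).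
exists (gmul ga' ga), ph'; split=> //; first by rewrite /attains actM.
by move=> m' l' u e' ne; apply: h4 => //; exact: xe e'.
Qed.

Definition on_edge m := exists l, edge (bl l) p q j m.

(** Induction on a finite list containing the edge weights that occur: each application of
    [kill_weight] removes one and creates none. *)
Lemma kill_all : attainable hA -> exists ga (ph : hom U (WW hA kz)), attains ga ph /\
  forall i m, on_edge m -> (cf ph j (bu i) : monalg kz M) m = 0.
Proof.
suff h (s : seq M) : forall ga (ph : hom U (WW hA kz)), attains ga ph ->
  (forall i m, on_edge m -> (cf ph j (bu i) : monalg kz M) m != 0 -> m \in s) ->
  exists ga (ph : hom U (WW hA kz)), attains ga ph /\
    forall i m, on_edge m -> (cf ph j (bu i) : monalg kz M) m = 0.
  move=> [ga [ph at0]].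
  apply: (h (flatten [seq supp (cf ph j (bu i)) | i <- enum 'I_nu]) ga ph at0) => i m _ nz.
  apply/flattenP; exists (supp (cf ph j (bu i))); last exact: suppP.
  by apply/mapP; exists i => //; rewrite mem_enum.
elim: s => [|m s IH] ga ph at0 hs.
  exists ga, ph; split=> // i m om; apply/eqP; apply: contraT => nz.
  by have := hs i m om nz.
have [[i [om nz]]|no] := pselect (exists i, on_edge m /\ (cf ph j (bu i) : monalg kz M) m != 0); last first.
  apply: (IH ga ph at0) => i m' om nz; have := hs i m' om nz; rewrite inE => /orP[/eqP em|//].
  by case: no; exists i; rewrite -em.
have [l el] := om; have Am : slopes p q j j m by exact: (svalP (ph (bu i)) j m nz).
have [ga' [ph' [at' z' o']]] := kill_weight at0 Am el.
apply: (IH ga' ph' at') => i' m' om' nz'.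
have ne : m' <> m by move=> e; move: nz'; rewrite e z' eqxx.
have [l' el'] := om'; move: nz'; rewrite (o' m' l' _ el' ne) => nz'.
by have := hs i' m' om' nz'; rewrite inE => /orP[/eqP//|].
Qed.

Lemma slope_step : attainable hA -> attainable (slopes_adm p q j.+1).
Proof.
move=> /kill_all [ga [ph [[g0 eph] hk]]].
have [ph' eph'] : exists ph' : hom U (WW (slopes_adm p q j.+1) kz),
    hcomp (Winc (slopes_adm p q j.+1) kz) ph' = hcomp (Winc hA kz) ph.
  apply: (orb_inW bU) => l i m nz; have := svalP (ph (bu l)) i m nz.
  rewrite /slopes /=; case: (posnP i) => [//|i0] h l'; have := h l'.
  rewrite [(i < j.+1)%N]ltnS [(i <= j)%N]leq_eqVlt; case: (eqVneq i j) => [e|ne] //=.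
  rewrite e ltnn => h2; suff : (p * j)%N%:Z + q%:Z * bl l' m != 0 by lia.
  by apply/eqP => ee; move: nz; rewrite e (hk l m) ?eqxx //; exists l'.
by exists ga, ph'; split=> //; rewrite eph'.
Qed.
End Kill.

Lemma slope_steps p q j : (0 < p)%N -> attainable (slopes_adm p q 1) -> attainable (slopes_adm p q j.+1).
Proof. by move=> p0 h; elim: j => // j IH; apply: slope_step. Qed.

Hypothesis gen_out : ~ zplus S (kmap gen f).

(** Some element of the ideal of the stratum on Spec k[[t]] has a nonzero coefficient, at t^n say;
    so f modulo t^(n+1) is outside the stratum. The stratum is G-invariant, hence n serves all
    representatives at once. *)
Lemma not_regular : exists n, forall AA (hA : admissible AA),
  (forall i m, (i <= n)%N -> AA i m -> P m) -> ~ attainable hA.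
Proof.
have [I HI] := zplus_ideal cE f.
have [a [Ia na]] : exists a, I a /\ gen a <> 0.
  apply: contrapT => h; apply: gen_out; apply/HI => a Ia.
  by apply: contrapT => na; apply: h; exists a.
have [n nn] : exists n, fcoef a n <> 0.
  apply: contrapT => h; apply: na; have -> : a = 0; last exact: rmorph0.
  by apply: fps_ext => n; apply: contrapT => nn; apply: h; exists n.
exists n => AA hA AP [ga [ph [g0 eph]]].
have P0 : P 0 by apply/PE => l; rewrite bl0.
have PD m m' : P m -> P m' -> P (m + m').
  by move=> /PE h /PE h'; apply/PE => l; rewrite blD addr_ge0.
have AP' i m : (i < n.+1)%N -> AA i m -> P m by rewrite ltnS; exact: AP.
have [Q [p' [zp kp]]] := regular_zplus P0 PD H_ft dg hF0 hu ezh g0 eph (ltn0Sn n) AP'.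
move: zp; rewrite act_nat zplus_act => /HI /(_ a Ia) /kp [y ey].
by apply: nn; rewrite ey fps_coefXnM ltnn.
Qed.

(** Slopes are of the form p/q with q fixed, and p is lowered by one. A round at p + 1 makes the
    inequalities strict up to order n'; each such order i divides q, so dividing by i turns
    strictness into a gain of one unit, which gives the bound for p. Beyond n' only tangent weights
    matter, and their pairings are at least -E, which suffices while p n is at least q. Once p n <
    q, the bound for p forces the integral pairings to be nonnegative up to order n, against
    [not_regular]. *)
Lemma core_contradiction : False.
Proof.
have [n hn] := not_regular.
have [F hF] := weights_finite lnat lfix hu ezh bU.
have [E hE] : exists E : nat, forall m l, m \in F -> - (E%:Z) <= bl l m.
  exists (\sum_(m <- F) \sum_l absz (bl l m))%N => m l mF.
  suff : (absz (bl l m) <= \sum_(m <- F) \sum_l absz (bl l m))%N by lia.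
  by rewrite (big_rem m) //= (bigD1 l) //= -addnA leq_addr.
(* The summand n E is what orders beyond n' need when p n is at least q; the summand n ensures that
   n' is at least n even if E = 0. The factorial is divisible by every order up to n'. *)
pose n' := (n * E + n)%N; pose q := n'`!.
have q0 : (0 < q)%N by exact: fact_gt0.
have [c [ec hc]] := orb_exists lnat lfix hu ezh f0.
have att0 : attainable (Atot_adm M).
  have [ph eph] := orb_inW bU (Atot_adm M) (fun i => hc (bu i)).
  exists (gone G (pser k)), ph; split; rewrite act1 //.
  by rewrite eph.
(* The starting slope exceeds E, so that every tangent weight satisfies its bound and
   [refine_attainable] suffices. *)
have att1 : attainable (slopes_adm (q * E).+1 q 1).
  apply: (@refine_attainable F hF _ _ (Atot_adm M) (slopes_adm (q * E).+1 q 1) _ _ att0).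
    by move=> i m; rewrite /slopes /Atot /=; case: eqP.
  move=> i m i0 _ mF; rewrite /slopes /= (gtn_eqF i0) => l; have := hE m l mF.
  have qE : (q * E <= (q * E).+1 * i)%N by apply: leq_trans (leq_pmulr _ i0); exact: leqnSn.
  have : - (q%:Z * E%:Z) <= q%:Z * bl l m by have := hE m l mF; nia.
  by case: ifP => ij; [move: i0; rewrite ltnS in ij; lia | lia].
suff desc p : (0 < p)%N -> attainable (slopes_adm p q 1) -> False by apply: (desc _ _ att1).
elim: p => // p IH _ /(slope_steps n' (ltn0Sn p)) att.
have small i m l : (0 < i)%N -> (i <= n')%N -> slopes p.+1 q n'.+1 i m -> 0 <= (p * i)%N%:Z + q%:Z * bl l m.
  move=> i0 il /(slopes_gt l i0) => /(_ il).
  have [d ed] : exists d, q = (d * i)%N by apply/dvdnP; rewrite /q dvdn_fact // i0.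
  rewrite ed => h; have : 0 < (p.+1)%:Z + d%:Z * bl l m by nia.
  by move=> h'; nia.
case: (ltnP (p * n) q) => pn.
  apply: (hn _ _ _ att) => i m il; case: (posnP i) => [->|i0].
    by rewrite /slopes /= => ->; apply/PE => l; rewrite bl0.
  have il' : (i <= n')%N by rewrite /n'; lia.
  move=> Am; apply/PE => l; have := small i m l i0 il' Am.
  have : (p * i < q)%N by apply: leq_ltn_trans pn; rewrite leq_mul2l il orbT.
  by move=> h1 h2; nia.
case: (posnP p) => [p0|p0]; first by move: pn; rewrite p0; lia.
apply: IH => //; apply: (@refine_attainable F hF _ _ (slopes_adm p.+1 q n'.+1) (slopes_adm p q 1) _ _ att).
  move=> i m; rewrite /slopes /=; case: (posnP i) => // i0 h l; have := h l.
  have -> : (i < 1)%N = false by lia.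
  by rewrite mulSn; case: ifP => _; lia.
move=> i m i0 Am mF; rewrite /slopes /= (gtn_eqF i0) => l; have -> : (i < 1)%N = false by lia.
case: (leqP i n') => il; first exact: small Am.
have h1 := hE m l mF.
have h2 : (q * E <= p * i)%N.
  apply: leq_trans (_ : p * n * E <= _)%N; first by rewrite leq_mul2r pn orbT.
  by rewrite -mulnA leq_mul2l; apply/orP; right; rewrite /n' in il; lia.
have : - (q%:Z * E%:Z) <= q%:Z * bl l m by nia.
by move=> h3; lia.
Qed.
End Core.

(** * The rays of a regular cone, ramification, and the conclusion *)

Lemma regular_cone_pairings (R : realType) (r : nat) (tau : set 'rV[R]_r) : regular_cone tau ->
  exists bl : 'I_r -> 'cV[int]_r -> int,
  [/\ forall l m n, bl l (m + n) = bl l m + bl l n,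
      forall m, dual_lattice tau m <-> forall l, 0 <= bl l m &
      forall m, (forall l, bl l m = 0) -> m = 0].
Proof.
move=> [b [bZ ->]]; exists (fun l m => (b l *m m) 0 0); split.
- by move=> l m n; rewrite mulmxDr mxE.
- move=> m; split=> [h l|h v [c [c0 ->]]].
    have := h (map_mx intr (b l)); rewrite -map_mxM mxE ler0z; apply.
    exists (delta_mx 0 l); split=> [i|]; first by rewrite mxE ler0n.
    rewrite (bigD1 l) //= mxE !eqxx scale1r big1 ?addr0 // => i ne.
    by rewrite mxE (negbTE ne) andbF scale0r.
  rewrite mulmx_suml summxE; apply: sumr_ge0 => i _; rewrite -scalemxAl mxE mulr_ge0 //.
  by rewrite -map_mxM mxE ler0z; exact: h.
- move=> m h; apply/matrixP => i j; rewrite (ord1 j) mxE.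
  have [c [ec _]] := bZ (delta_mx 0 i).
  have : ((delta_mx 0 i : 'rV[int]_r) *m m) 0 0 = 0.
    by rewrite ec mulmx_suml summxE big1 // => l _; rewrite -scalemxAl mxE h mulr0.
  by rewrite -rowE mxE.
Qed.

Lemma field_hom_inj (k : comPzRingType) (A B : alg k) (h : hom A B) :
  is_field A -> 1 != 0 :> B -> injective h.
Proof.
move=> [_ inv] B1 x y e; apply/eqP; rewrite -subr_eq0; apply: contraT => /inv [w ew].
by case/eqP: B1; rewrite -(rmorph1 h) -ew rmorphM rmorphB e subrr mul0r.
Qed.

Lemma ramify_comp (k : comNzRingType) (p q : nat) (p0 : (0 < p)%N) (q0 : (0 < q)%N) (pq0 : (0 < q * p)%N) :
  hcomp (ramify k p0) (ramify k q0) = ramify k pq0.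
Proof.
apply: hom_ext => a; apply: fps_ext => n /=.
case: (boolP (p %| n)%N) => [/dvdnP[l ->]|np].
  by rewrite mulnK // dvdn_pmul2r // divnMr.
by case: ifP => // /(dvdn_trans (dvdn_mull q (dvdnn p))); rewrite (negbTE np).
Qed.

Lemma generic_ramify (k : comNzRingType) (d : nat) (d0 : (0 < d)%N) :
  hcomp (generic_point k) (ramify k d0) = hcomp (laurent_ramify k d0) (generic_point k).
Proof. by apply: esym; exact: loc_liftE. Qed.

Theorem theorem1p1 (k : closedFieldType) (char0 : [pchar k] =i pred0)
    (R : realType) (r : nat) (tau : set 'rV[R]_r) (tau_reg : regular_cone tau)
    (G : grp k) (G_lin : linear_algebraic G)
    (H : kfun k) (H_ft : scheme_of_finite_type H) (aH : gaction G H)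
    (S : stack_space (Map_stack (Theta tau k) (quot_stack aH)) -> Prop)
    (S_stratum : higher_Theta_stratum S)
    (f : ob (quot_stack aH) (pser k))
    (f_closed : factors_through (stratum_ev S) (closed_point k) f)
    (f_generic : ~ factors_through (stratum_ev S) (generic_point k) f)
    (fo : ob (quot_stack aH) (laurent k)) (fo_f : mor fo f)
    (fo_restr : mor_base fo_f = generic_point k) :
  exists (d : nat) (d_gt0 : (0 < d)%N) (fnew : ob (quot_stack aH) (pser k))
      (g : ob (quot_stack aH) (laurent k)) (g_fo : mor g fo) (g_fnew : mor g fnew),
    [/\ mor_base g_fo = laurent_ramify k d_gt0,
        mor_base g_fnew = generic_point k
      & ~ factors_through (stratum_ev S) (closed_point k) fnew].
Proof.
have [bl [blD PE bl0]] := regular_cone_pairings tau_reg; pose P := dual_lattice tau.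
(* The sum of the rays is interior to the cone: it is positive on the nonzero elements of the dual
   monoid, so its limit in U_tau is the fixed point. It serves to degenerate F; the slopes are
   measured by the single rays. *)
pose be (m : 'cV[int]_r) : int := \sum_l bl l m.
have beD m n : be (m + n) = be m + be n by rewrite /be -big_split; apply: eq_bigr.
have beP m : P m -> 0 <= be m by move=> /PE h; apply: sumr_ge0 => l _; exact: h.
have be_pointed m : P m -> be m = 0 -> m = 0.
  move=> /PE h e; apply: bl0 => l.
  by have /(_ l isT) := psumr_eq0P (fun l _ => h l) e.
have [US cE0] := S_stratum.
have cE : @closed_embedding k (substack S) (quot_stack aH) (@str_ev k _ P G H aH S) := cE0.
have [fh [mh emh]] := henselian_triv f (@henselian_pser k).
have fac (A' : alg k) (h : hom (pser k) A') : factors_through (@str_ev k _ P G H aH S) h f <-> zplus S (kmap h fh).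
  by rewrite -zplus_factors (factors_comp _ mh) emh hcompf1.
have fh_cl : zplus S (kmap (closed_point k) fh) by apply/fac; exact: f_closed.
have fh_gen : ~ zplus S (kmap (generic_point k) fh) by move=> h; apply: f_generic; exact: (proj2 (fac _ _) h).
have [F [z [q [q0 [f1 [Gam [hF0 [m0 em0] ef1 egen]]]]]]] := closed_limit beD beP H_ft char0 US fh_cl.
have [lam [dg]] := degenerate_ex be_pointed em0.
have [U [uV [[nu [bu bU]] hu [zh ezh]]]] := field_chart H_ft z.
(* The negation is the hypothesis [no_escape]. That [f1] is generically outside the stratum is
   inherited from [fh] through a translation by G and an injective map of fields. *)
have [d [d0 [Ga [f2 [ef2 nf2]]]]] : exists (d : nat) (d0 : (0 < d)%N) (Ga : hom (gring G) (laurent k)) (f2 : H (pser k)),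
    kmap (generic_point k) f2 = aH _ Ga (kmap (generic_point k) (kmap (ramify k d0) f1)) /\
    ~ zplus S (kmap (closed_point k) f2).
  apply: contrapT => no; apply: (core_contradiction char0 blD PE H_ft cE dg hF0 hu ezh bU ef1).
    move=> d d0 Ga f2 e; apply: contrapT => nz; apply: no.
    by exists d, d0, Ga, f2.
  rewrite egen zplus_act -kmap_comp generic_ramify kmap_comp => zg; apply: fh_gen.
  apply: (zplus_inj cE _ zg); apply: field_hom_inj; first exact: lau_field.
  exact: (lau_field k).1.
have D0 : (0 < q * d)%N by rewrite muln_gt0 q0.
(* The translation [Gam] of the first limit has to be ramified by d before being composed with [Ga];
   the ramification indices multiply to q d. *)
pose Ga' := gmul Ga (hcomp (laurent_ramify k d0) Gam).
have ef2' : kmap (generic_point k) f2 = aH _ Ga' (kmap (hcomp (generic_point k) (ramify k D0)) fh).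
  rewrite ef2 -(kmap_comp _ (ramify k d0)) generic_ramify kmap_comp egen act_nat -actM; congr (aH _ _ _).
  have er : hcomp (generic_point k) (ramify k D0) = hcomp (laurent_ramify k d0) (hcomp (generic_point k) (ramify k q0)).
    by rewrite -(ramify_comp k d0 q0 D0) (hcompA (generic_point k)) generic_ramify -(hcompA (laurent_ramify k d0)).
  by rewrite er !kmap_comp.
have [m em] : exists m : @mor _ (quot_stack aH) _ _ (triv_ob aH (kmap (generic_point k) f2)) f,
    mor_base m = hcomp (laurent_ramify k D0) (mor_base fo_f).
  rewrite ef2'; have [m1 [em1 _]] := triv_act_mor aH (kmap (hcomp (generic_point k) (ramify k D0)) fh) Ga'.
  have [m2 [em2 _]] := triv_base aH fh (hcomp (generic_point k) (ramify k D0)).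
  exists (mcomp mh (mcomp m2 m1)).
  by rewrite !mor_base_comp em1 em2 emh hcomp1f hcompf1 fo_restr generic_ramify.
have [g_fo [eg _]] := quot_cart em.
have [g_fnew [egn _]] := triv_base aH f2 (generic_point k).
exists (q * d)%N, D0, (triv_ob aH f2), (triv_ob aH (kmap (generic_point k) f2)), g_fo, g_fnew.
by split=> // h; apply: nf2; exact: (proj1 (zplus_factors S (closed_point k) f2) h).
Qed.
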